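(* Suppose the following. (1) There exist a constant $\kappa>0$ and a nondecreasing, continuously differentiable function $\zeta:[0,\infty)\to[1,\infty)$ with $\int_0^\infty \frac{dr}{r\zeta(r)+1}=\infty$ such that for all $x\in\mathbb R^d$ $$2\langle x,b(x)\rangle+|\sigma(x)|^2+\int_U|c(x,u)|^2\,\nu(du)\le \kappa\,[\,|x|^2\zeta(|x|^2)+1\,].$$ (2) At least one of the following holds: (2a) there exist $\delta_0>0$ and a nondecreasing concave function $\rho:[0,\infty)\to[0,\infty)$ with $\rho(r)>0$ for $r>0$ and $\int_{0+}\frac{dr}{\rho(r)}=\infty$ such that for every $R>0$ there is $\kappa_R>0$ such that for all $x,z\in\mathbb R^d$ with $|x|\vee|z|\le R$ and $|x-z|\le\delta_0$, $2\langle z-x,b(z)-b(x)\rangle+|\sigma(z)-\sigma(x)|^2\le\kappa_R|z-x|\rho(|z-x|)$ and $\int_U|c(z,u)-c(x,u)|\nu(du)\le\kappa_R\rho(|z-x|)$; in addition $\int_U|c(0,u)|\nu(du)<\infty$; (2b) there exist $\delta_0>0$ and a nondecreasing concave function $\varrho:[0,\infty)\to[0,\infty)$ with $0<\varrho(r)\le(1+r)^2\varrho(\tfrac r{1+r})$ for all $r>0$ and $\int_{0+}\frac{dr}{\varrho(r)}=\infty$ such that for every $R>0$ there is $\kappa_R>0$ such that for all $x,z\in\mathbb R^d$ with $|x|\vee|z|\le R$ and $|x-z|\le\delta_0$, $2\langle x-z,b(x)-b(z)\rangle+|\sigma(x)-\sigma(z)|^2+\int_U|c(x,u)-c(z,u)|^2\nu(du)\le\kappa_R\varrho(|x-z|^2)$.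 (3) For $\nu$-almost all $u$, the function $x\mapsto x+c(x,u)$ is one-to-one. (4) There exist a nondecreasing and concave function $\psi:[0,\infty)\to[0,\infty)$ that vanishes only at $r=0$, and a $C^2$ function $V:(0,\infty)\to(0,\infty)$ such that (i) $V$ is nonincreasing in a neighborhood of $0$ and $\lim_{r\downarrow0}V(r)=\infty$; and (ii) for all $x,z\in\mathbb R^d$ with $|x-z|>0$, $$\begin{aligned}\psi(V(|x-z|))\ge{}&\frac12\Big(V''(|x-z|)-\frac{V'(|x-z|)}{|x-z|}\Big)\frac{|\langle x-z,\sigma(x)-\sigma(z)\rangle|^2}{|x-z|^2}\\&+\frac{V'(|x-z|)}{2|x-z|}\big(2\langle x-z,b(x)-b(z)\rangle+|\sigma(x)-\sigma(z)|^2\big)\\&+\int_U\Big[V(|x-z+c(x,u)-c(z,u)|)-V(|x-z|)\\&\qquad-\frac{V'(|x-z|)}{|x-z|}\langle x-z,c(x,u)-c(z,u)\rangle\Big]\nu(du).\end{aligned}$$ Then the non confluence property holds: if $\widetilde x\ne x$, then $\mathbb P\{X^{\widetilde x}(t)\ne X^x(t)\text{ for all }t\ge0\}=1$, where $X^{\widetilde x}$ and $X^x$ denote the solutions of $$dX(t)=b(X(t))\,dt+\sigma(X(t))\,dW(t)+\int_U c(X(t-),u)\,\widetilde N(dt,du)$$ with initial conditions $\widetilde x$ and $x$, respectively.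
   Context: Let $d\ge2$, $(U,\mathfrak U)$ a measurable space, $\nu$ a $\sigma$-finite measure on $U$. The functions $b:\mathbb R^d\to\mathbb R^d$, $\sigma:\mathbb R^d\to\mathbb R^{d\times d}$, $c:\mathbb R^d\times U\to\mathbb R^d$ are Borel measurable; $b$, $\sigma$ and $c(\cdot,u)$ (for each $u\in U$) are continuous, and $x\mapsto\int_U|c(x,u)|^2\nu(du)$ is continuous. For a matrix or vector $A$, $|A|=\sqrt{\mathrm{tr}(AA^T)}$; for $y\in\mathbb R^d$ and a $d\times d$ matrix $S$, $\langle y,S\rangle$ denotes the vector $S^Ty$. $W$ is a standard $d$-dimensional Brownian motion, $N$ a Poisson random measure on $[0,\infty)\times U$ with intensity $dt\,\nu(du)$ independent of $W$, and $\widetilde N$ its compensated measure, on a filtered probability space satisfying the usual hypotheses. Under (1) and (2) the equation has, for each deterministic initial condition, a unique non-explosive strong solution (adapted to the augmented natural filtration of $W$ and $N$); $X^{\widetilde x}$ and $X^x$ are driven by the same $W$ and $N$. *)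

(* Defs.v *)
From HB Require Import structures.
From mathcomp Require Import all_boot all_order all_algebra.
From mathcomp Require Import all_classical all_reals all_analysis.
From mathcomp Require Import measurable_realfun.

Set Implicit Arguments.
Unset Strict Implicit.
Unset Printing Implicit Defensive.

Import Order.TTheory GRing.Theory Num.Theory.
Import numFieldNormedType.Exports.

Local Open Scope ring_scope.
Local Open Scope classical_set_scope.

(* [S] with its Borel sigma-algebra. *)
Notation Borel S := (g_sigma_algebraType (@open S%type)).

(* The norm that the library puts on matrices is the sup norm, hence the
   following. *)
Definition frob (R : realType) (m n : nat) (A : 'M[R]_(m, n)) : R :=
  Num.sqrt (\tr (A *m A^T)).

Definition dotv (R : realType) (d : nat) (x y : 'cV[R]_d) : R :=
  \sum_(i < d) x i 0 * y i 0.

Section HalfLine.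
Variable R : realType.
Implicit Type f : R -> R.

(* Functions on [0, +oo[ or ]0, +oo[ are represented by total functions; only
   their values on the half-line are ever used. *)

Definition nondecreasing0 f := forall r s : R, 0 <= r -> r <= s -> f r <= f s.

Definition concave0 f :=
  @convex_function R R^o `[0, +oo[%classic (fun r => - f r).

(* Continuously differentiable on [0, +oo[, one-sided at 0. *)
Definition C1_halfline f := exists f' : R -> R,
  (forall r : R, 0 <= r ->
    (f s - f r) / (s - r) @[s --> within [set s | 0 <= s /\ s != r] (nbhs r)]
      --> f' r) /\
  {within `[0, +oo[, continuous f'}.

Definition C2_open_halfline f := forall r : R, 0 < r ->
  [/\ derivable f r 1, derivable f^`() r 1 & {for r, continuous f^`()^`()}].

Definition inv_integral0_infty f := forall e : R, 0 < e ->
  (\int[lebesgue_measure]_(r in `]0%R, e[) ((f r)^-1)%:E = +oo)%E.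

End HalfLine.

Section Paths.
Variables (R : realType) (S : ptopologicalType).

Definition left_lim (f : R -> S) (t : R) : S := lim (f s @[s --> t^'-]).

Definition cadlag (f : R -> S) :=
  (forall t : R, 0 <= t -> f s @[s --> t^'+] --> f t) /\
  (forall t : R, 0 < t -> cvg (f s @[s --> t^'-])).

End Paths.

Section StochasticBasis.
Context (R : realType) (dT : measure_display) (T : measurableType dT).
Variable P : probability T R.

Definition filtration (F : R -> set (set T)) :=
  (forall t : R, 0 <= t -> sigma_algebra setT (F t) /\ F t `<=` measurable) /\
  (forall s t : R, 0 <= s -> s <= t -> F s `<=` F t).

Definition usual_hypotheses (F : R -> set (set T)) :=
  [/\ measure_is_complete P, P.-negligible `<=` F 0 &
      forall t : R, 0 <= t -> F t = \bigcap_(s in `]t, +oo[) F s].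

(* The events that depend on a single [Y i] with [i] in [D]. *)
Definition events (I : Type) (dS : measure_display) (S : measurableType dS)
    (D : set I) (Y : I -> T -> S) : set (set T) :=
  \bigcup_(i in D) preimage_set_system setT (Y i) measurable.

Definition adapted (F : R -> set (set T)) (dS : measure_display)
    (S : measurableType dS) (Y : R -> T -> S) :=
  forall t : R, 0 <= t -> events [set t] Y `<=` F t.

Definition independent (A B : set (set T)) :=
  forall E E', A E -> B E' -> P (E `&` E') = (P E * P E')%E.

Definition cvg_in_prob0 (Z : nat -> T -> \bar R) :=
  (forall n, measurable_fun setT (Z n)) /\
  (forall e : R, 0 < e ->
    P [set w | (e%:E <= `|Z n w|)%E] @[n --> \oo] --> 0%E).

End StochasticBasis.

Section BrownianMotion.
Context (R : realType) (dT : measure_display) (T : measurableType dT).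
Variables (P : probability T R) (F : R -> set (set T)) (d : nat).

(* Standard [d]-dimensional Brownian motion relative to the filtration [F]. *)
Definition brownian_motion (W : R -> T -> Borel 'cV[R]_d) :=
  [/\ adapted F W,
      {ae P, forall w, W 0 w = 0 /\
        {within `[0, +oo[, continuous (fun t => W t w : 'cV[R]_d)}},
      forall s t : R, 0 <= s -> s < t ->
        independent P (F s)
          <<s events setT (fun _ : unit => (fun w => W t w - W s w)
                             : T -> Borel 'cV[R]_d) >> &
      forall s t : R, 0 <= s -> s < t -> forall B : 'I_d -> set R,
        (forall i, measurable (B i)) ->
        P [set w | forall i, B i (W t w i 0 - W s w i 0)] =
        (\prod_(i < d) normal_prob 0 (Num.sqrt (t - s)) (B i))%E].

End BrownianMotion.

Section PoissonRandomMeasure.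
Context (R : realType) (dT : measure_display) (T : measurableType dT).
Variables (P : probability T R) (F : R -> set (set T)).
Context (dU : measure_display) (U : measurableType dU).
Variable nu : {sigma_finite_measure set U -> \bar R}.

Definition intensity : set (R * U) -> \bar R :=
  (@lebesgue_measure R \x nu)%E.

Definition time_sets (D : set R) : set (set (R * U)) :=
  [set B | measurable B /\ B `<=` D `*` setT].

(* Poisson random measure on [0, +oo[ x U relative to the filtration [F]. The
   law is written out because [poisson_pmf] is constantly 1 at rate 0. *)
Definition poisson_random_measure
    (N : T -> {measure set (R * U) -> \bar R}) :=
  let NB B w := N w B in
  [/\ forall B, time_sets `[0, +oo[ B -> measurable_fun setT (NB B),
      forall B, time_sets `[0, +oo[ B ->
        (intensity B = +oo%E -> P [set w | N w B = +oo%E] = 1%E) /\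
        (forall l : R, intensity B = l%:E -> forall k : nat,
          P [set w | N w B = k%:R%:E] = (l ^+ k / k`!%:R * expR (- l))%:E),
      forall (n : nat) (B : 'I_n -> set (R * U)) (C : 'I_n -> set (\bar R)),
        (forall i, time_sets `[0, +oo[ (B i)) -> trivIset setT B ->
        (forall i, measurable (C i)) ->
        P [set w | forall i, C i (N w (B i))] =
        (\prod_(i < n) P [set w | C i (N w (B i))])%E,
      forall t : R, 0 <= t -> events (time_sets `[0, t]) NB `<=` F t &
      forall s : R, 0 <= s ->
        independent P (F s) <<s events (time_sets `]s, +oo[) NB >>].

Definition compensated (N : T -> {measure set (R * U) -> \bar R})
    (B : set (R * U)) (w : T) : R := fine (N w B) - fine (intensity B).

End PoissonRandomMeasure.

Section StochasticIntegrals.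
Context (R : realType) (dT : measure_display) (T : measurableType dT).
Variables (P : probability T R) (F : R -> set (set T)).
Context (dU : measure_display) (U : measurableType dU).
Variable nu : {sigma_finite_measure set U -> \bar R}.

(* Bounded simple predictable processes:
   sum_k coef_k 1_{]left_k, right_k]}. *)
Record simple_process := SimpleProcess {
  sp_size : nat;
  sp_left : 'I_sp_size -> R;
  sp_right : 'I_sp_size -> R;
  sp_coef : 'I_sp_size -> T -> R;
  sp_order : forall k, 0 <= sp_left k /\ sp_left k <= sp_right k;
  sp_bounded : forall k, exists C : R, forall w, `|sp_coef k w| <= C;
  sp_measurable : forall k,
    preimage_set_system setT (sp_coef k) measurable `<=` F (sp_left k) }.

Definition sp_val (H : simple_process) (s : R) (w : T) : R :=
  \sum_(k < sp_size H) sp_coef k w * \1_(`]sp_left k, sp_right k]%classic) s.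

Definition sp_integral (H : simple_process) (W : R -> T -> R)
    (t : R) (w : T) : R :=
  \sum_(k < sp_size H) sp_coef k w *
    (W (Num.min (sp_right k) t) w - W (Num.min (sp_left k) t) w).

(* [I] is a continuous version of the Ito integral
   I(t) = int_0^t H(s) dW(s), [W] being a one-dimensional Brownian motion
   and [H] being locally square integrable in time: limit in probability along
   simple processes that approximate [H]. *)
Definition is_ito_integral (W H I : R -> T -> R) :=
  [/\ adapted F I,
      {ae P, forall w, {within `[0, +oo[, continuous (I^~ w)}} &
      exists Hn : nat -> simple_process, forall t : R, 0 <= t ->
        cvg_in_prob0 P (fun n w => \int[lebesgue_measure]_(s in `[0%R, t])
          ((sp_val (Hn n) s w - H s w) ^+ 2)%:E)%E /\
        cvg_in_prob0 P
          (fun n w => (sp_integral (Hn n) W t w - I t w)%:E)].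

(* Simple predictable integrands on [0, +oo[ x U:
   sum_k coef_k 1_{]left_k, right_k]} 1_{mark_k}. *)
Record simple_field := SimpleField {
  sf_process :> simple_process;
  sf_mark : 'I_(sp_size sf_process) -> set U;
  sf_mark_measurable : forall k, measurable (sf_mark k);
  sf_mark_finite : forall k, (nu (sf_mark k) < +oo)%E }.

Definition sf_val (H : simple_field) (s : R) (w : T) (u : U) : R :=
  \sum_(k < sp_size H) sp_coef k w *
    \1_(`]sp_left k, sp_right k]%classic) s * \1_(sf_mark k) u.

Definition sf_integral (H : simple_field)
    (N : T -> {measure set (R * U) -> \bar R}) (t : R) (w : T) : R :=
  \sum_(k < sp_size H) sp_coef k w *
    compensated nu N
      (`]Num.min (sp_left k) t, Num.min (sp_right k) t] `*` sf_mark k) w.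

(* [J] is a cadlag version of
   J(t) = int_0^t int_U H(s, u) (N(ds, du) - ds nu(du)),
   [H] being predictable and locally square integrable. *)
Definition is_compensated_integral (N : T -> {measure set (R * U) -> \bar R})
    (H : R -> T -> U -> R) (J : R -> T -> R) :=
  [/\ adapted F J,
      {ae P, forall w, cadlag (J^~ w)} &
      exists Hn : nat -> simple_field, forall t : R, 0 <= t ->
        cvg_in_prob0 P (fun n w => \int[lebesgue_measure]_(s in `[0%R, t])
          \int[nu]_u ((sf_val (Hn n) s w u - H s w u) ^+ 2)%:E)%E /\
        cvg_in_prob0 P
          (fun n w => (sf_integral (Hn n) N t w - J t w)%:E)].

End StochasticIntegrals.

Section SDE.
Context (R : realType) (dT : measure_display) (T : measurableType dT).
Variables (P : probability T R) (F : R -> set (set T)).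
Context (dU : measure_display) (U : measurableType dU).
Variables (nu : {sigma_finite_measure set U -> \bar R}) (d : nat).
Variables (W : R -> T -> Borel 'cV[R]_d)
          (N : T -> {measure set (R * U) -> \bar R}).

Definition driving_noise :=
  [/\ filtration F, usual_hypotheses P F, brownian_motion P F W,
      poisson_random_measure P F nu N &
      independent P <<s events `[0, +oo[ W >>
                    <<s events (time_sets `[0, +oo[) (fun B w => N w B) >>].

Definition augmented_natural_filtration (t : R) : set (set T) :=
  <<s P.-negligible `|` events `[0, t] W `|`
      events (time_sets `[0, t]) (fun B w => N w B) >>.

(* [X] is a non-explosive strong solution of
   dX = b(X) dt + sigma(X) dW + int_U c(X(t-), u) (N(dt, du) - dt nu(du)),
   X(0) = x. *)
Definition strong_solution (b : 'cV[R]_d -> 'cV[R]_d)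
    (sigma : 'cV[R]_d -> 'M[R]_d) (c : 'cV[R]_d -> U -> 'cV[R]_d)
    (x : 'cV[R]_d) (X : R -> T -> Borel 'cV[R]_d) :=
  [/\ adapted augmented_natural_filtration X,
      {ae P, forall w, @cadlag R 'cV[R]_d (X^~ w)} &
      exists (I : 'I_d -> 'I_d -> R -> T -> R) (J : 'I_d -> R -> T -> R),
      [/\ forall i j, is_ito_integral P F (fun t w => W t w j 0)
            (fun s w => sigma (X s w) i j) (I i j),
          forall i, is_compensated_integral P F nu N
            (fun s w u => c (@left_lim R 'cV[R]_d (X^~ w) s) u i 0) (J i) &
          {ae P, forall w, forall t : R, 0 <= t -> forall i,
            X t w i 0 = x i 0
              + \int[lebesgue_measure]_(s in `[0%R, t]) (b (X s w) i 0)
              + \sum_(j < d) I i j t w + J i t w}]].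

End SDE.

(* Main.v *)
Require Import Defs.
From HB Require Import structures.
From mathcomp Require Import all_boot all_order all_algebra.
From mathcomp Require Import all_classical all_reals all_analysis.
From mathcomp Require Import measurable_realfun.
From mathcomp Require Import ring lra.

Set Implicit Arguments.
Unset Strict Implicit.
Unset Printing Implicit Defensive.

Import Order.TTheory GRing.Theory Num.Theory.
Import numFieldNormedType.Exports.

Local Open Scope ring_scope.
Local Open Scope classical_set_scope.

(** Let D = X' - X, let v = V(|D|), and let L be the generator of the pair
    (X', X) acting on functions of D. Condition (4) gives L v <= psi(v), psi
    concave, so psi(v) <= psi(1) (1 + v). A concave truncation of V at height of
    order m, cut off for |D| large and made constant near 0, is a bounded C^2
    function f_m of D with f_m(D(0)) <= 1 + V(|D(0)|), whose values near 0 tend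
    to infinity with m, and L f_m <= Q' f_m for a rate Q' that is locally
    integrable along paths and does not depend on m as long as |D| stays bounded.
    So exp(-Q) f_m(D) is a supermartingale; stopping it when D comes near 0
    shows that D reaches 0 before leaving a ball, before a given time, with
    probability 0. Condition (3) is what keeps the generator meaningful at the
    jumps: they cannot take D from a nonzero value to 0.

    Instead of Ito's formula, the supermartingale inequality is proved for the
    simple processes that approximate the coefficients, on a grid that contains
    their breakpoints: one step of length h changes E[Y f(D)] by
    h E[Y L f(D)] + o(h), for Y determined by the past. This needs only the
    independence of the past, of the Brownian increment and of the Poisson
    increments, and the moments of the latter. The mesh and the approximation
    error then tend to 0, almost surely along a subsequence. *)

(** No stopping time and no localization occur: stopping is encoded by a running weight, multiplied
    at finitely many chosen times by 1 - E, with E the indicator that the gap is near 0. The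
    obstacle is the limit passage. The simple approximants satisfy the supermartingale inequality
    only up to a defect, and nothing bounds its negative part a priori. The remedy is to add to the
    rate the quantity [coq], which dominates the generator up to the constant C0 of the test
    function: the discounted sum of the defects is then at least - C0, the loss is at most min(C0,
    total negative defect), and dominated convergence applies. A further multiple C0 of [coq] pays
    for the cut-off. It depends on m, so a ramp switches it on only where |D|^2 > R0; on paths that
    stay in the ball the discount is the same for all m. Level m then yields a probability of order
    1 / m. Right-continuity lets finitely many rational times, growing in number, see every visit to
    0 before the horizon. *)

Notation sigT_of A := (g_sigma_algebraType A).

(** * Independence and moments of the noise *)

Section Independence.
Context (R : realType) (dT : measure_display) (T : measurableType dT).
Variable P : probability T R.
Implicit Types A B : set (set T).

Lemma measurable_fun_sub A d' (S : measurableType d') (f : T -> S) :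
  sigma_algebra setT A -> A `<=` measurable ->
  measurable_fun setT (f : sigT_of A -> S) -> measurable_fun setT f.
Proof.
move=> sA Am mf _ Y mY; apply: Am; have := mf measurableT Y mY.
by rewrite /measurable/= sigma_algebra_id.
Qed.

(** The law of w |-> (w, w), as a map into T with [A] times T with [B], gives the rectangle of E and
    E' the mass of their intersection. Independence and uniqueness of the product measure make it
    the product of the two restrictions of [P], and Fubini factors the integral. *)
Lemma indep_integral A B (f g : T -> R) :
  sigma_algebra setT A -> A `<=` measurable ->
  sigma_algebra setT B -> B `<=` measurable -> independent P A B ->
  measurable_fun setT (f : sigT_of A -> R) ->
  measurable_fun setT (g : sigT_of B -> R) ->
  P.-integrable setT (EFin \o f) -> P.-integrable setT (EFin \o g) ->
  P.-integrable setT (EFin \o (f \* g)) /\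
  \int[P]_w (f w * g w) = \int[P]_w f w * \int[P]_w g w.
Proof.
move=> sA Am sB Bm indep mf mg fi gi.
have mA : measurable_fun setT (id : T -> sigT_of A).
  move=> _ Y; rewrite setTI preimage_id => mY; apply: Am.
  by move: mY; rewrite /measurable/= sigma_algebra_id.
have mB : measurable_fun setT (id : T -> sigT_of B).
  move=> _ Y; rewrite setTI preimage_id => mY; apply: Bm.
  by move: mY; rewrite /measurable/= sigma_algebra_id.
have mAB : measurable_fun setT ((fun w => (w, w)) : T -> sigT_of A * sigT_of B).
  exact/measurable_fun_pair.
pose mixA := isMeasurableFun.Build _ _ _ _ _ mA.
pose XA : {mfun T >-> sigT_of A} := HB.pack (id : T -> sigT_of A) mixA.
pose mixB := isMeasurableFun.Build _ _ _ _ _ mB.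
pose XB : {mfun T >-> sigT_of B} := HB.pack (id : T -> sigT_of B) mixB.
pose mixAB := isMeasurableFun.Build _ _ _ _ _ mAB.
pose XAB : {mfun T >-> (sigT_of A * sigT_of B)%type} :=
  HB.pack ((fun w => (w, w)) : T -> sigT_of A * sigT_of B) mixAB.
pose PA := distribution P XA; pose PB := distribution P XB.
have prodE : forall X, measurable X -> (PA \x PB)%E X = distribution P XAB X.
  apply: product_measure_unique => E E' mE mE'.
  have [AE BE] : A E /\ B E'.
    by split; [move: mE|move: mE']; rewrite /measurable/= sigma_algebra_id.
  by rewrite -[RHS]/(P E * P E')%E -(indep E E').
have fA : PA.-integrable setT (EFin \o f).
  apply: (@integrable_pushforward _ _ _ _ _ XA mA P setT (EFin \o f)) => //.
  exact/measurable_EFinP.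
have gB : PB.-integrable setT (EFin \o g).
  apply: (@integrable_pushforward _ _ _ _ _ XB mB P setT (EFin \o g)) => //.
  exact/measurable_EFinP.
have fE : (\int[PA]_x (f x)%:E = \int[P]_w (f w)%:E)%E.
  rewrite (@integral_pushforward _ _ _ _ _ XA mA P setT (EFin \o f)) //.
  exact/measurable_EFinP.
have gE : (\int[PB]_x (g x)%:E = \int[P]_w (g w)%:E)%E.
  rewrite (@integral_pushforward _ _ _ _ _ XB mB P setT (EFin \o g)) //.
  exact/measurable_EFinP.
pose F (z : (sigT_of A * sigT_of B)%type) := ((f z.1 * g z.2)%:E).
have mF : measurable_fun setT F.
  apply/measurable_EFinP/measurable_funM; exact: measurableT_comp.
have Fint : (PA \x PB)%E.-integrable setT F.
  apply/integrable12ltyP => //=.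
  under eq_integral => x _.
    under eq_integral do rewrite /F/= normrM EFinM.
    rewrite ge0_integralZl//; last first.
      by apply/measurable_EFinP; exact: measurableT_comp.
    over.
  have gfin : (\int[PB]_y `|g y|%:E)%E \is a fin_num.
    rewrite ge0_fin_numE; last exact: integral_ge0.
    by case/integrableP : gB.
  rewrite -(fineK gfin) ge0_integralZr//.
  - apply: lte_mul_pinfty => //; first exact: integral_ge0.
      rewrite ge0_fin_numE; last exact: integral_ge0.
      by case/integrableP : fA.
    by rewrite ltry.
  - by apply/measurable_EFinP; exact: measurableT_comp.
  - by rewrite lee_fin fine_ge0// integral_ge0.
have distE : (\int[distribution P XAB]_z F z = \int[PA \x PB]_z F z)%E.
  by apply: eq_measure_integral => E mE _; exact/esym/prodE.
have mfg : measurable_fun setT (EFin \o (f \* g)).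
  by apply/measurable_EFinP/measurable_funM;
    [exact: (measurable_fun_sub sA)|exact: (measurable_fun_sub sB)].
have fgi : P.-integrable setT (EFin \o (f \* g)).
  apply/integrableP; split => //.
  have := @ge0_integral_pushforward _ _ _ _ R _ mAB P setT (abse \o F).
  move=> /(_ measurableT (measurableT_comp (@abse_measurable R setT) mF)).
  rewrite preimage_setT => /= <-; last by move=> y _ /=.
  rewrite (@eq_measure_integral _ _ _ setT (PA \x PB)%E).
    by case/integrableP : Fint.
  move=> E mE _; have := prodE E mE; rewrite /distribution /pushforward/= => H; first [exact: (esym H) | exact: H].
split=> //; rewrite /Rintegral -fineM; last 2 first.
- exact: (integrable_fin_num _ fi).
- exact: (integrable_fin_num _ gi).
congr fine.
have := @integral_pushforward _ _ _ _ R _ mAB P setT F mF.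
rewrite preimage_setT => /(_ fgi measurableT)/= <-.
rewrite -[LHS]/(\int[distribution P XAB]_z F z)%E distE.
rewrite -integral12_prod_meas1// /fubini_F/=.
under eq_integral => x _.
  rewrite /F/=; under eq_integral do rewrite EFinM.
  rewrite integralZl//= gE.
  over.
have gfin : (\int[P]_y (g y)%:E)%E \is a fin_num by exact: integrable_fin_num.
by rewrite -(fineK gfin) integralZr//= fE.
Qed.

End Independence.

(** * Densities and moments of the centred normal law *)

Section Density.
Context d (T : measurableType d) (R : realType).
Variables (mu m : {measure set T -> \bar R}) (g : T -> R).
Hypothesis mg : measurable_fun setT g.
Hypothesis g0 : forall x, 0 <= g x.
Hypothesis mE : forall A, measurable A -> (m A = \int[mu]_(x in A) (g x)%:E)%E.

Import HBNNSimple.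

Let density_nnsfun (f : {nnsfun T >-> R}) :
  (\int[m]_x (f x)%:E = \int[mu]_x ((f x)%:E * (g x)%:E))%E.
Proof.
under [LHS]eq_integral do rewrite fimfunE -fsumEFin//.
rewrite [LHS]ge0_integral_fsum//; last 2 first.
  - by move=> r; exact/measurable_EFinP/measurableT_comp.
  - by move=> n x _; rewrite EFinM nnfun_muleindic_ge0.
under [RHS]eq_integral.
  move=> x xD; rewrite fimfunE -fsumEFin// muleC ge0_mule_fsumr; last first.
    by move=> r; rewrite EFinM nnfun_muleindic_ge0.
  over.
rewrite [RHS]ge0_integral_fsum//; last 2 first.
  - move=> r; apply: emeasurable_funM; first exact/measurable_EFinP.
    by apply/measurable_EFinP; do 2 apply/measurableT_comp => //.
  - by move=> n x _; rewrite mule_ge0 ?lee_fin// -lee_fin EFinM nnfun_muleindic_ge0.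
apply: eq_fsbigr => r; rewrite inE => -[t _ ftr].
have r0 : 0 <= r by rewrite -ftr.
under [LHS]eq_integral do rewrite EFinM.
rewrite ge0_integralZl//; last exact/measurable_EFinP.
rewrite integral_indic// setIT mE//.
under [RHS]eq_integral do rewrite EFinM muleCA.
rewrite ge0_integralZl//; last 2 first.
- by apply: emeasurable_funM => //; exact/measurable_EFinP.
- by move=> x _; rewrite mule_ge0 ?lee_fin.
congr *%E; rewrite integral_mkcond; apply: eq_integral => x _.
by rewrite patchE indicE; case: ifPn => xA; rewrite ?mule1 ?mule0.
Qed.

(** By simple functions and monotone convergence. It turns integrals against [normal_prob] into
    Lebesgue integrals against the Gaussian density. *)
Lemma ge0_integral_density (f : T -> \bar R) : measurable_fun setT f ->
  (forall x, 0 <= f x)%E -> (\int[m]_x f x = \int[mu]_x (f x * (g x)%:E))%E.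
Proof.
move=> mf f0; pose f_ := nnsfun_approx measurableT mf.
transitivity (lim (\int[m]_x (f_ n x)%:E @[n --> \oo])%E).
  rewrite -monotone_convergence//=.
  - apply: eq_integral => ? /[!inE] xD; apply/esym/cvg_lim => //=.
    exact: cvg_nnsfun_approx.
  - by move=> n; exact/measurable_EFinP/measurable_funTS.
  - by move=> n ? _; rewrite lee_fin.
  - by move=> ? _ ? ? mn; rewrite lee_fin; exact/lefP/nd_nnsfun_approx.
transitivity (lim (\int[mu]_x ((f_ n x)%:E * (g x)%:E) @[n --> \oo])%E).
  by apply: congr_lim; apply/funext => n /=; exact: density_nnsfun.
rewrite -monotone_convergence//=.
- apply: eq_integral => x /[!inE] xD; apply/cvg_lim => //=.
  move: (@cvg_nnsfun_approx _ _ _ _ measurableT _ mf (fun t _ => f0 t) x I) => h.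
  exact: cvgeZr.
- by move=> n; apply: emeasurable_funM => //; exact/measurable_EFinP.
- by move=> n x _; rewrite mule_ge0 ?lee_fin.
- move=> x _ a b ab; apply: lee_wpmul2r; first by rewrite lee_fin.
  by rewrite lee_fin; exact/lefP/nd_nnsfun_approx.
Qed.

End Density.

Section NormalMoments.
Variable R : realType.
Local Notation mu := (@lebesgue_measure R).
Variable s : R.
Hypothesis s0 : 0 < s.

Let e (x : R) : R := normal_fun 0 s x.

Let eE x : e x = expR (- x ^+ 2 / (s ^+ 2 * 2)).
Proof. by rewrite /e /normal_fun subr0 mulr_natr. Qed.

Let s20 : s ^+ 2 != 0. Proof. by rewrite expf_neq0 ?gt_eqF. Qed.

Let e_der (x : R) : is_derive x 1 e (- (x / s ^+ 2) * e x).
Proof.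
have -> : e = expR \o (fun y : R => - y ^+ 2 * (s ^+ 2 * 2)^-1).
  by apply/funext => y /=; rewrite eE.
apply: is_derive_eq; rewrite /= /GRing.scale/=.
by field; rewrite gt_eqF.
Qed.

(** The source of the variance: [- (y * e y)] vanishes at 0 and at infinity, so x^2 / s^2 and 1 have
    the same integral against [e]. *)
Let F_der (x : R) :
  is_derive x 1 (fun y => - (y * e y)) ((x ^+ 2 / s ^+ 2 - 1) * e x).
Proof.
have H := e_der x.
by apply: is_derive_eq; rewrite /GRing.scale/=; field; rewrite gt_eqF.
Qed.

Let continuous_e : continuous e.
Proof.
move=> x; apply/differentiable_continuous/derivable1_diffP.
by case: (e_der x).
Qed.

Let f (x : R) := (x ^+ 2 / s ^+ 2 - 1) * e x.

Let continuous_f : continuous f.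
Proof.
move=> x; rewrite /f; apply: cvgM; last exact: continuous_e.
apply: cvgB; last exact: cvg_cst.
by apply: cvgM; [exact: exprn_continuous|exact: cvg_cst].
Qed.

(** From exp(a) >= 1 + a with a = x^2 / (2 s^2), which gives x e(x) <= 2 s^2 / x. *)
Let F_cvgy : (fun y => - (y * e y)) x @[x --> +oo] --> (0 : R).
Proof.
rewrite -oppr0; apply: cvgN.
apply: (@squeeze_cvgr _ _ _ _ (fun=> 0) (fun x => (s ^+ 2 * 2) / x)).
- near=> x; have x0 : 0 < x by near: x; exact: nbhs_pinfty_gt.
  rewrite mulr_ge0 ?(ltW x0)//=; last by rewrite eE expR_ge0.
  rewrite ler_pdivlMr// eE.
  have y0 : 0 < x ^+ 2 / (s ^+ 2 * 2).
    by rewrite divr_gt0// ?mulr_gt0// exprn_gt0.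
  rewrite mulNr expRN mulrAC -expr2 -ler_pdivlMr ?invr_gt0 ?expR_gt0// invrK.
  rewrite -ler_pdivrMl ?mulr_gt0 ?exprn_gt0// mulrC.
  by apply: le_trans (expR_ge1Dx _); rewrite lerDr.
- exact: cvg_cst.
- rewrite -(mulr0 (s ^+ 2 * 2)); apply: cvgM; first exact: cvg_cst.
  apply/gtr0_cvgV0; last exact: cvg_id.
  exact: nbhs_pinfty_gt.
Unshelve. all: by end_near. Qed.

Let nf_int (q : R) : q != 0 -> mu.-integrable setT (EFin \o normal_fun 0 q).
Proof.
move=> q0; have := integrable_normal_pdf 0 q.
move=> /(integrableZl measurableT (normal_peak q)^-1).
apply: eq_integrable => // x _; rewrite normal_pdfE// -EFinM.
by rewrite /= mulKf// gt_eqF// normal_peak_gt0.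
Qed.

Let e_int : mu.-integrable setT (EFin \o e).
Proof. by apply: nf_int; rewrite gt_eqF. Qed.

Let e_tot : (\int[mu]_x (e x)%:E = (normal_peak s)^-1%:E)%E.
Proof.
have := integral_normal_pdf 0 s.
under eq_integral do rewrite normal_pdfE ?gt_eqF// EFinM.
rewrite integralZl//=.
have p0 : normal_peak s != 0 by rewrite gt_eqF// normal_peak_gt0// gt_eqF.
have ef : (\int[mu]_x (e x)%:E)%E \is a fin_num by exact: integrable_fin_num.
move/(congr1 fine); rewrite fineM//= => h; rewrite -[LHS]fineK//; congr EFin.
by apply: (mulfI p0); rewrite mulfV.
Qed.

(** Half of the exponent absorbs the fourth power, by exp(y) >= (y / 2)^2 for y = x^2 / (4 s^2); the
    other half is the Gaussian of standard deviation sqrt 2 times s, whose total mass is known. *)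
Let four_le (x : R) : x ^+ 4 * e x <= 64 * s ^+ 4 * normal_fun 0 (Num.sqrt 2 * s) x.
Proof.
rewrite eE /normal_fun subr0 exprMn sqr_sqrtr//.
set y := x ^+ 2 / (s ^+ 2 * 4).
have -> : - x ^+ 2 / (s ^+ 2 * 2) = - y + - y by rewrite /y; field; rewrite gt_eqF.
have -> : - x ^+ 2 / (2 * s ^+ 2 *+ 2) = - y by rewrite /y -mulr_natr; field; rewrite gt_eqF.
rewrite expRD mulrA ler_pM2r ?expR_gt0//.
have -> : x ^+ 4 = 64 * s ^+ 4 * (y / 2) ^+ 2 by rewrite /y; field; rewrite gt_eqF.
rewrite -mulrA; apply: ler_piMr; first by rewrite mulr_ge0 ?exprn_ge0// ltW.
rewrite expRN ler_pdivrMr ?expR_gt0// mul1r.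
rewrite [in leRHS](splitr y).
have y0 : 0 <= y / 2.
  have x2 := sqr_ge0 x; have s2 := sqr_ge0 s.
  apply: divr_ge0 => //; apply: divr_ge0 => //; exact: mulr_ge0.
rewrite expRD -expr2; apply: lerXn2r; [by rewrite nnegrE|by rewrite nnegrE expR_ge0|].
by apply: le_trans (expR_ge1Dx _); rewrite lerDr.
Qed.

Let mnf : measurable_fun setT e. Proof. exact: measurable_normal_fun. Qed.

Let pdfE x : normal_pdf 0 s x = normal_peak s * e x.
Proof. by rewrite normal_pdfE ?gt_eqF. Qed.

Lemma ge0_integral_normal_prob (g : R -> \bar R) : measurable_fun setT g ->
  (forall x, 0 <= g x)%E ->
  (\int[normal_prob 0 s]_x g x = \int[mu]_x (g x * (normal_pdf 0 s x)%:E))%E.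
Proof.
move=> mg g0; apply: ge0_integral_density => //.
- exact: measurable_normal_pdf.
- exact: normal_pdf_ge0.
Qed.

(** What counts later is the order s^4, that is h^2 for an increment over time h. The constant is
    the 64 of [four_le] times the ratio sqrt 2 of the two peaks, rounded up to 2. *)
Lemma normal_prob_fourth :
  (\int[normal_prob 0 s]_x (x ^+ 4)%:E <= (128 * s ^+ 4)%:E)%E.
Proof.
have m4 : measurable_fun setT (fun x : R => x ^+ 4) by exact: exprn_measurable.
rewrite ge0_integral_normal_prob//; last 2 first.
- exact/measurable_EFinP.
- by move=> x; rewrite lee_fin exprn_even_ge0.
have q0 : Num.sqrt 2 * s != 0 :> R.
  by rewrite mulf_neq0 ?gt_eqF// sqrtr_gt0.
have qn : 0 < normal_peak s by rewrite normal_peak_gt0// gt_eqF.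
have qq : 0 < normal_peak (Num.sqrt 2 * s) by rewrite normal_peak_gt0.
apply: (@le_trans _ _ (\int[mu]_x ((normal_peak s * (64 * s ^+ 4) /
     normal_peak (Num.sqrt 2 * s))%:E * (normal_pdf 0 (Num.sqrt 2 * s) x)%:E))%E).
  apply: ge0_le_integral => //.
  - by move=> x _; rewrite mule_ge0// lee_fin ?exprn_even_ge0// normal_pdf_ge0.
  - apply: emeasurable_funM; first exact/measurable_EFinP.
    by apply/measurable_EFinP; exact: measurable_normal_pdf.
  - apply: emeasurable_funM; first exact/measurable_EFinP.
    by apply/measurable_EFinP; exact: measurable_normal_pdf.
  - move=> x _; rewrite -!EFinM lee_fin pdfE normal_pdfE//.
    rewrite [leLHS](_ : _ = normal_peak s * (x ^+ 4 * e x)); last by ring.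
    rewrite [leRHS](_ : _ = normal_peak s *
      (64 * s ^+ 4 * normal_fun 0 (Num.sqrt 2 * s) x)); last by field; rewrite gt_eqF.
    by rewrite ler_pM2l.
rewrite ge0_integralZl//; last 3 first.
- by apply/measurable_EFinP; exact: measurable_normal_pdf.
- by move=> x _; rewrite lee_fin normal_pdf_ge0.
- by rewrite lee_fin ltW// divr_gt0// !mulr_gt0// exprn_gt0.
rewrite integral_normal_pdf mule1 lee_fin.
have -> : normal_peak s = Num.sqrt 2 * normal_peak (Num.sqrt 2 * s) :> R.
  rewrite /normal_peak exprMn sqr_sqrtr//.
  have -> : 2 * s ^+ 2 * pi *+ 2 = 2 * (s ^+ 2 * pi *+ 2) :> R by ring.
  by rewrite sqrtrM// invfM mulVKf// gt_eqF// sqrtr_gt0.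
rewrite mulrAC mulfK ?gt_eqF// mulrA ler_pM2r ?exprn_gt0//.
have : Num.sqrt 2 <= 2 :> R.
  by rewrite -[leRHS]ger0_norm// -sqrtr_sqr ler_sqrt//; lra.
by move: (Num.sqrt 2) => r; lra.
Qed.

(** Integrability follows from |x| <= x^4 + 1. The density is even, so the positive and the negative
    part have the same integral. *)
Lemma normal_prob_mean :
  (normal_prob 0 s).-integrable setT (EFin \o @id R) /\
  \int[normal_prob 0 s]_x x = 0.
Proof.
have m1 : measurable_fun setT (@id R) by [].
have i4 : (normal_prob 0 s).-integrable setT (EFin \o (fun x : R => x ^+ 4)).
  apply/integrableP; split; first by apply/measurable_EFinP; exact: exprn_measurable.
  under eq_integral do rewrite /= ger0_norm ?exprn_even_ge0//.
  by apply: le_lt_trans normal_prob_fourth _; rewrite ltry.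
have i1 : (normal_prob 0 s).-integrable setT (EFin \o @id R).
  have := integrableD measurableT i4 (finite_measure_integrable_cst (normal_prob 0 s) 1 measurableT).
  apply: le_integrable => //; first exact/measurable_EFinP.
  move=> x _ /=; rewrite lee_fin [leRHS]ger0_norm; last first.
    by rewrite addr_ge0// exprn_even_ge0.
  have -> : x ^+ 4 = `|x| ^+ 4 by rewrite -normrX ger0_norm ?exprn_even_ge0.
  move: `|x| (normr_ge0 x) => y y0; have y4 := exprn_ge0 4 y0.
  have [y1|y1] := leP y 1; first lra.
  by apply: (@le_trans _ _ (y ^+ 4)); [rewrite ler_eXnr// ltW|lra].
split=> //.
have neg (g : R -> R) : measurable_fun setT g -> (forall x, 0 <= g x) ->
  (\int[normal_prob 0 s]_x (g (- x))%:E = \int[normal_prob 0 s]_x (g x)%:E)%E.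
  move=> mg g0.
  have mgN : measurable_fun setT (fun x : R => g (- x)).
    by apply: measurableT_comp => //; exact: oppr_measurable.
  rewrite !ge0_integral_normal_prob;
    do ?[by apply/measurable_EFinP | by move=> ?; rewrite lee_fin].
  have mopp : measurable_fun setT (-%R : measurableTypeR R -> measurableTypeR R).
    exact: oppr_measurable.
  pose h (x : measurableTypeR R) := ((g x)%:E * (normal_pdf 0 s x)%:E)%E.
  transitivity (\int[pushforward mu (-%R : measurableTypeR R -> measurableTypeR R)]_x h x)%E.
    rewrite (@ge0_integral_pushforward _ _ _ _ _ _ mopp mu setT h measurableT).
    - rewrite preimage_setT; apply: eq_integral => x _; rewrite /h/= !pdfE !eE.
      by rewrite sqrrN.
    - apply: emeasurable_funM; first exact/measurable_EFinP.
      by apply/measurable_EFinP; exact: measurable_normal_pdf.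
    - by move=> x _; rewrite mule_ge0// lee_fin// normal_pdf_ge0.
  by apply: eq_measure_integral => A mA _; exact: lebesgue_measureN.
rewrite /Rintegral integralE.
have -> : (\int[normal_prob 0 s]_x ((fun x : R => x%:E)^\- x) =
    \int[normal_prob 0 s]_x ((fun x : R => x%:E)^\+ x))%E.
  have := neg (fun x => Num.max x 0).
  have mm : measurable_fun setT (fun x : R => Num.max x 0) by exact: measurable_maxr.
  have m0 x : 0 <= Num.max x 0 :> R by rewrite le_max lexx orbT.
  move=> /(_ mm m0) E; rewrite (_ : integral _ _ _ = \int[normal_prob 0 s]_x (Num.max (- x) 0)%:E)%E.
    by rewrite E; apply: eq_integral => x _; rewrite funeposE EFin_max.
  by apply: eq_integral => x _; rewrite funenegE EFin_max.
by rewrite subee//; exact: integrable_pos_fin_num.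
Qed.

Lemma normal_prob_var :
  (\int[normal_prob 0 s]_x (x ^+ 2)%:E = (s ^+ 2)%:E)%E.
Proof.
have m2 : measurable_fun setT (fun x : R => x ^+ 2) by exact: exprn_measurable.
rewrite ge0_integral_normal_prob//; last 2 first.
- exact/measurable_EFinP.
- by move=> x; rewrite lee_fin sqr_ge0.
have f_int : mu.-integrable setT (EFin \o f).
  have q0 : Num.sqrt 2 * s != 0 :> R.
    by rewrite mulf_neq0 ?gt_eqF// sqrtr_gt0.
  have i1 := integrableZl measurableT 64 (nf_int q0).
  have i2 := integrableZl measurableT 2 e_int.
  have := integrableD measurableT i1 i2.
  apply: le_integrable => //.
    by apply/measurable_EFinP; exact: continuous_measurable_fun.
  move=> x _ /=; rewrite lee_fin [leRHS]ger0_norm; last first.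
    by rewrite addr_ge0// mulr_ge0// /e /normal_fun expR_ge0.
  have s4 : 0 < s ^+ 4 by rewrite exprn_gt0.
  have h4 := four_le x; rewrite -mulrA mulrCA -ler_pdivrMl// in h4.
  apply: le_trans (lerD h4 (lexx _)).
  have ex : 0 <= e x by rewrite eE expR_ge0.
  rewrite /f normrM (ger0_norm ex) mulrA -mulrDl ler_wpM2r//.
  have -> : (s ^+ 4)^-1 * x ^+ 4 = (x ^+ 2 / s ^+ 2) ^+ 2.
    by field; rewrite gt_eqF.
  have : 0 <= x ^+ 2 / s ^+ 2 by rewrite divr_ge0 ?sqr_ge0.
  move: (x ^+ 2 / s ^+ 2) => y y0; rewrite ler_norml; nra.
have fD D : measurable D -> mu.-integrable D (EFin \o f).
  by move=> mD; apply: integrableS f_int.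
have FE : (fun y => - (y * e y)) 0 = 0 by rewrite /= mul0r oppr0.
pose F y := - (y * e y).
have cF : continuous F.
  move=> x; apply/differentiable_continuous/derivable1_diffP.
  by case: (F_der x).
have dF x : derivable F x 1 by case: (F_der x).
have F'E x : F^`() x = f x by rewrite derive1E; case: (F_der x).
(* The half-line is cut at [s], where [f] changes sign: the improper form of the fundamental theorem
   used on [s, +oo[ is for nonnegative integrands. *)
have I1 : (\int[mu]_(x in `[0%R, s]) (f x)%:E = (F s)%:E - (F 0)%:E)%E.
  apply: continuous_FTC2 => //.
  - exact: continuous_subspaceT.
  - split => //.
    + by apply: cvg_at_right_filter; exact: cF.
    + by apply: cvg_at_left_filter; exact: cF.
have I2 : (\int[mu]_(x in `[s, +oo[) (f x)%:E = 0%:E - (F s)%:E)%E.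
  apply: ge0_continuous_FTC2y => //.
  - move=> x sx; rewrite /f mulr_ge0//; last by rewrite eE expR_ge0.
    rewrite subr_ge0 ler_pdivlMr ?exprn_gt0// mul1r.
    by rewrite lerXn2r// nnegrE ltW// (lt_le_trans s0).
  - exact: continuous_subspaceT.
  - by apply: cvg_at_right_filter; exact: cF.
have I0 : \int[mu]_(x in `[0%R, +oo[) f x = 0.
  have := @Rintegral_itvB R f (BLeft 0) (BInfty _ false) s (fD _ (measurable_itv _)).
  rewrite bnd_simp (ltW s0) => /(_ isT isT)/eqP; rewrite subr_eq => /eqP ->.
  rewrite Rintegral_itv_obnd_cbnd; last exact: fD.
  by rewrite /Rintegral I1 I2/= /F mul0r; lra.
have e_D D : measurable D -> mu.-integrable D (EFin \o e).
  by move=> mD; apply: integrableS e_int.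
pose g x := x ^+ 2 / s ^+ 2 * e x.
have cg : continuous g.
  move=> x; apply: cvgM; last exact: continuous_e.
  by apply: cvgM; [exact: exprn_continuous|exact: cvg_cst].
have gfe : g = (fun x => f x + e x) by apply/funext => x; rewrite /g /f; ring.
have g0 x : 0 <= g x by rewrite mulr_ge0 ?divr_ge0 ?sqr_ge0// eE expR_ge0.
have e0 x : 0 <= e x by rewrite eE expR_ge0.
have half : (\int[mu]_(x in `[0%R, +oo[) (g x)%:E = \int[mu]_(x in `[0%R, +oo[) (e x)%:E)%E.
  rewrite gfe; under eq_integral do rewrite EFinD.
  rewrite integralD//; last 2 first.
  - exact: fD.
  - exact: e_D.
  have fi : (\int[mu]_(x in `[0%R, +oo[) (f x)%:E)%E \is a fin_num.
    by apply: integrable_fin_num => //; exact: fD.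
  by rewrite -(fineK fi) -/(Rintegral _ _ _) I0 add0e.
have tot : (\int[mu]_x (g x)%:E = \int[mu]_x (e x)%:E)%E.
  rewrite (@ge0_symfun_integralT _ g)//; last by move=> x; rewrite /g /= !eE sqrrN.
  rewrite (@ge0_symfun_integralT _ e)//; last by move=> x; rewrite /= !eE sqrrN.
  have -> : [set x : R | 0 <= x] = `[0%R, +oo[%classic.
    by apply/seteqP; split => x /=; rewrite in_itv/= andbT.
  by rewrite half.
transitivity (\int[mu]_x ((s ^+ 2 * normal_peak s)%:E * (g x)%:E))%E.
  apply: eq_integral => x _; rewrite pdfE -!EFinM; congr EFin.
  by rewrite /g; field; rewrite gt_eqF.
have pp : 0 < normal_peak s by rewrite normal_peak_gt0// gt_eqF.
rewrite ge0_integralZl//; last 3 first.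
- by apply/measurable_EFinP; exact: continuous_measurable_fun.
- by move=> x _; rewrite lee_fin.
- by rewrite lee_fin mulr_ge0 ?sqr_ge0 ?ltW.
by rewrite tot e_tot -EFinM mulfK// gt_eqF.
Qed.

End NormalMoments.

(** * Moments of a Poisson variable given by its point masses *)

Section PoissonMoments.
Context (R : realType) d (T : measurableType d) (P : probability T R).
Variables (N : T -> \bar R) (l : R).
Hypothesis l0 : 0 <= l.
Hypothesis mN : measurable_fun setT N.
Hypothesis lawN : forall k : nat,
  P [set w | N w = k%:R%:E] = (l ^+ k / k`!%:R * expR (- l))%:E.

Let nneseries_shift (f : nat -> \bar R) : (forall k, 0 <= f k)%E ->
  (\sum_(1 <= k <oo) f k = \sum_(0 <= k <oo) f k.+1)%E.
Proof.
move=> f0; apply/esym/cvg_lim => //.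
have : (fun n => \sum_(1 <= k < n) f k)%E @ \oo --> (\sum_(1 <= k <oo) f k)%E.
  by apply: is_cvg_nneseries => n _ _; exact: f0.
rewrite -cvg_shiftS; apply: cvg_trans; apply: near_eq_cvg.
by apply: nearW => n; rewrite /= big_add1.
Qed.

Let p k : \bar R := (l ^+ k / k`!%:R * expR (- l))%:E.

Let p0 k : (0 <= p k)%E.
Proof. by rewrite lee_fin mulr_ge0 ?expR_ge0// divr_ge0// exprn_ge0. Qed.

Let sum_p : (\sum_(0 <= k <oo) p k = 1)%E.
Proof.
rewrite [RHS](_ : _ = (expR (- l))%:E * (expR l)%:E)%E; last first.
  by rewrite -EFinM expRN mulVf ?gt_eqF ?expR_gt0.
under eq_eseriesr.
  move=> n _; rewrite /p EFinM muleC; over.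
rewrite /= nneseriesZl/=; last first.
  by move=> n _; rewrite lee_fin divr_ge0// exprn_ge0.
congr *%E; rewrite expRE -EFin_lim; last first.
  rewrite /pseries/=; under eq_fun do rewrite mulrC.
  exact: is_cvg_series_exp_coeff.
apply/congr_lim/funext => n/=; rewrite /pseries/= /series/= -sumEFin//.
by under eq_bigr do rewrite mulrC.
Qed.

Let A k := [set w | N w = k%:R%:E].

Let mA k : measurable (A k).
Proof.
have -> : A k = N @^-1` [set k%:R%:E] by apply/seteqP; split.
by rewrite -[X in measurable X]setTI; apply: mN.
Qed.

Let tA : trivIset setT A.
Proof.
apply/trivIsetP => i j _ _ ij; apply/seteqP; split => // w [].
by rewrite /A /= => -> [] /eqP; rewrite eqr_nat (negbTE ij).
Qed.

Let PA : P (\bigcup_k A k) = 1%E.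
Proof.
rewrite measure_bigcup//.
under eq_eseriesl do rewrite in_setT.
by rewrite -[RHS]sum_p; apply: eq_eseriesr => k _; exact: lawN.
Qed.

(** The law is known only through the masses of the natural numbers; they add up to 1, which leaves
    no mass elsewhere, in particular none at infinity. *)
Lemma poisson_ae : {ae P, forall w, exists k : nat, N w = k%:R%:E}.
Proof.
exists (~` \bigcup_k A k); split.
- by apply: measurableC; exact: bigcupT_measurable.
- by rewrite probability_setC ?PA ?subee//; exact: bigcupT_measurable.
- by move=> w /= H [k _ Ak]; apply: H; exists k.
Qed.

Let integralN (g : nat -> R) (G : T -> R) : (forall k, 0 <= g k) ->
  measurable_fun setT G -> (forall w, 0 <= G w) ->
  (forall w k, N w = k%:R%:E -> G w = g k) ->
  (\int[P]_w (G w)%:E = \sum_(0 <= k <oo) (g k)%:E * p k)%E.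
Proof.
move=> g0 mG G0 Gg.
have mU : measurable (\bigcup_k A k) by exact: bigcupT_measurable.
rewrite (ae_eq_integral ((EFin \o G) \_ (\bigcup_k A k)))//=; last 3 first.
- exact/measurable_EFinP.
- apply/(measurable_restrictT _ mU)/measurable_funTS.
  exact/measurable_EFinP.
- apply: filterS poisson_ae => w [k Nk] _; rewrite patchE mem_set//.
  by exists k.
rewrite -integral_mkcond ge0_integral_bigcup//=;
  do ?[by apply/measurable_funTS; apply/measurable_EFinP |
       by move=> w _; rewrite lee_fin].
apply: eq_eseriesr => k _.
rewrite (eq_integral (fun=> (g k)%:E)); last first.
  by move=> w /set_mem /= Nk; rewrite (Gg _ _ Nk).
by rewrite integral_cst//= lawN.
Qed.

Let n w : R := fine (N w).

Let mn : measurable_fun setT (fun w => `|n w|).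
Proof. by do 2 apply: measurableT_comp => //. Qed.

Let n_ae : {ae P, forall w, 0 <= n w}.
Proof. by apply: filterS poisson_ae => w [k]; rewrite /n => ->. Qed.

(** Recursion of the Poisson weights; combined with a shift of the series it lowers the degree of a
    moment by one. *)
Let step k : (k.+1%:R%:E * p k.+1 = l%:E * p k)%E.
Proof.
rewrite -!EFinM; congr EFin; rewrite exprS factS natrM.
have kf : k`!%:R != 0 :> R by rewrite pnatr_eq0 -lt0n fact_gt0.
have k1 : k.+1%:R != 0 :> R by rewrite pnatr_eq0.
move: kf k1; move: (k`!%:R) (k.+1%:R) => x y x0 y0.
by field; rewrite x0 y0.
Qed.

Lemma poisson_mean : P.-integrable setT (EFin \o n) /\ \int[P]_w n w = l.
Proof.
have E1 : (\int[P]_w `|n w|%:E = l%:E)%E.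
  rewrite (integralN (g := fun k => k%:R))//; last first.
    by move=> w k Nk; rewrite /n Nk ger0_norm.
  rewrite nneseries_recl//; last by move=> k; rewrite mule_ge0// lee_fin.
  rewrite mul0e add0e.
  rewrite nneseries_shift; last by move=> k; rewrite mule_ge0// lee_fin.
  under eq_eseriesr do rewrite step.
  by rewrite nneseriesZl// sum_p mule1.
have ni : P.-integrable setT (EFin \o n).
  apply/integrableP; split; first by apply/measurable_EFinP; exact: measurableT_comp.
  by rewrite [ltLHS]E1 ltry.
split=> //; rewrite -[RHS]/(fine l%:E) -E1; congr fine.
apply: ae_eq_integral => //.
- by case/integrableP : ni.
- exact/measurable_EFinP.
- by apply: filterS n_ae => w nw _; rewrite ger0_norm.
Qed.

(** To be combined with [poisson_mean]: n^2 - n has mean l^2, so two or more jumps in a short step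
    are an effect of second order. *)
Lemma poisson_fact2 : P.-integrable setT (fun w => (n w ^+ 2)%:E) /\
  \int[P]_w (n w ^+ 2) = l ^+ 2 + l.
Proof.
have E2 : (\int[P]_w (n w ^+ 2)%:E = (l ^+ 2 + l)%:E)%E.
  rewrite (integralN (g := fun k => k%:R ^+ 2))//;
    do ?[by apply: measurable_funX; exact: measurableT_comp |
         by move=> w; rewrite sqr_ge0 | by move=> w k Nk; rewrite /n Nk].
  have pos k : (0 <= (k%:R ^+ 2)%:E * p k)%E by rewrite mule_ge0// lee_fin sqr_ge0.
  rewrite nneseries_recl// expr0n mul0e add0e nneseries_shift//.
  under eq_eseriesr => k _.
    rewrite expr2 EFinM -muleA step muleCA -natr1 EFinD muleDl//.
    over.
  have pos1 k : (0 <= k%:R%:E * p k)%E by rewrite mule_ge0// lee_fin.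
  rewrite nneseriesZl; last by move=> k _; rewrite adde_ge0// mule_ge0.
  rewrite nneseriesD//; last by move=> k _; rewrite mule_ge0.
  have -> : (\sum_(0 <= k <oo) k%:R%:E * p k = l%:E)%E.
    rewrite nneseries_recl// mul0e add0e nneseries_shift//.
    under eq_eseriesr do rewrite step.
    by rewrite nneseriesZl// sum_p mule1.
  under eq_eseriesr do rewrite mul1e.
  by rewrite sum_p -EFinD -EFinM; congr EFin; ring.
split; last by rewrite /Rintegral E2.
apply/integrableP; split.
  by apply/measurable_EFinP; apply: measurable_funX; exact: measurableT_comp.
by under eq_integral do rewrite gee0_abs ?lee_fin ?sqr_ge0//; rewrite E2 ltry.
Qed.

End PoissonMoments.

(** * Radial test functions *)

Section Vectors.
Variables (R : realType) (d : nat).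
Implicit Types x y z : 'cV[R]_d.

Lemma frob_sqr (m n : nat) (A : 'M[R]_(m, n)) :
  frob A ^+ 2 = \sum_i \sum_j A i j ^+ 2.
Proof.
have trE : \tr (A *m A^T) = \sum_i \sum_j A i j ^+ 2.
  apply: eq_bigr => i _; rewrite mxE; apply: eq_bigr => j _.
  by rewrite mxE expr2.
rewrite /frob sqr_sqrtr trE//.
by apply: sumr_ge0 => i _; apply: sumr_ge0 => j _; rewrite sqr_ge0.
Qed.

Lemma frob_ge0 (m n : nat) (A : 'M[R]_(m, n)) : 0 <= frob A.
Proof. exact: sqrtr_ge0. Qed.

Lemma frob_dotv x : frob x ^+ 2 = dotv x x.
Proof.
rewrite frob_sqr; apply: eq_bigr => i _; rewrite big_ord1 expr2.
by rewrite /GRing.mul/=.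
Qed.

Lemma dotvC x y : dotv x y = dotv y x.
Proof. by apply: eq_bigr => i _; rewrite mulrC. Qed.

Lemma dotvDl x y z : dotv (x + y) z = dotv x z + dotv y z.
Proof. by rewrite -big_split; apply: eq_bigr => i _; rewrite mxE mulrDl. Qed.

Lemma dotvDr x y z : dotv z (x + y) = dotv z x + dotv z y.
Proof. by rewrite dotvC dotvDl !(dotvC z). Qed.

Lemma dotvZl a x z : dotv (a *: x) z = a * dotv x z.
Proof. by rewrite mulr_sumr; apply: eq_bigr => i _; rewrite mxE mulrA. Qed.

Lemma dotvZr a x z : dotv z (a *: x) = a * dotv z x.
Proof. by rewrite dotvC dotvZl dotvC. Qed.

Lemma dotvNl x z : dotv (- x) z = - dotv x z.
Proof. by rewrite -scaleN1r dotvZl mulN1r. Qed.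

Lemma dotvNr x z : dotv z (- x) = - dotv z x.
Proof. by rewrite dotvC dotvNl dotvC. Qed.

Lemma dotv0l z : dotv 0 z = 0.
Proof. by rewrite -(scale0r 0) dotvZl mul0r. Qed.

Lemma dotv0r z : dotv z 0 = 0.
Proof. by rewrite dotvC dotv0l. Qed.

Lemma dotv_ge0 x : 0 <= dotv x x.
Proof. by rewrite -frob_dotv sqr_ge0. Qed.

Lemma dotv_sqr_eq0 x : dotv x x = 0 -> x = 0.
Proof.
move=> /eqP; rewrite psumr_eq0 => [/allP h|i _]; last by rewrite -expr2 sqr_ge0.
apply/matrixP => i j; rewrite ord1 mxE.
by have := h i (mem_index_enum _); rewrite mulf_eq0 orbb => /eqP.
Qed.

Lemma frob_eq0 x : frob x = 0 -> x = 0.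
Proof. by move=> h; apply: dotv_sqr_eq0; rewrite -frob_dotv h expr0n. Qed.

Lemma frob0 : frob (0 : 'cV[R]_d) = 0.
Proof. by apply/eqP; rewrite -sqrf_eq0 frob_dotv dotv0l. Qed.

Lemma frobZ a x : frob (a *: x) = `|a| * frob x.
Proof.
apply/eqP; rewrite -(@eqrXn2 _ 2) ?mulr_ge0 ?frob_ge0// exprMn !frob_dotv.
by rewrite dotvZl dotvZr mulrA -expr2 -normrX ger0_norm ?sqr_ge0.
Qed.

Lemma frobN x : frob (- x) = frob x.
Proof. by rewrite -scaleN1r frobZ normrN1 mul1r. Qed.

Lemma dotv_le x y : `|dotv x y| <= frob x * frob y.
Proof.
rewrite -(@ler_pXn2r _ 2) ?nnegrE ?mulr_ge0 ?frob_ge0//.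
rewrite exprMn !frob_dotv -normrX ger0_norm ?sqr_ge0//.
have [y0|y0] := eqVneq (dotv y y) 0.
  by rewrite y0 mulr0 (dotv_sqr_eq0 y0) dotv0r expr0n.
have yp : 0 < dotv y y by rewrite lt0r y0 dotv_ge0.
have := dotv_ge0 (dotv y y *: x - dotv x y *: y).
rewrite !(dotvDl, dotvDr, dotvNl, dotvNr, dotvZl, dotvZr) (dotvC y x).
move: (dotv x x) (dotv y y) (dotv x y) yp => a b c b0 H.
rewrite -subr_ge0 -(pmulr_rge0 _ b0).
by apply: le_trans H _; rewrite le_eqVlt; apply/orP; left; apply/eqP; ring.
Qed.

Lemma frobD x y : frob (x + y) <= frob x + frob y.
Proof.
rewrite -(@ler_pXn2r _ 2) ?nnegrE ?addr_ge0 ?frob_ge0//.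
rewrite sqrrD !frob_dotv dotvDl !dotvDr (dotvC y x).
have := le_trans (ler_norm _) (dotv_le x y); lra.
Qed.

Lemma coord_le_frob x i : `|x i 0| <= frob x.
Proof.
rewrite -(@ler_pXn2r _ 2) ?nnegrE ?frob_ge0//.
rewrite frob_dotv -normrX ger0_norm ?sqr_ge0// /dotv (bigD1 i)//= expr2 lerDl.
by apply: sumr_ge0 => j _; rewrite -expr2 sqr_ge0.
Qed.

End Vectors.

Section Compactness.
Variable R : realType.

(** Only [s] is confined to the segment while [t] is any point near it, so one of the two arguments
    never has to be located. *)
Lemma segment_unif_continuous (f : R -> R) (a b e : R) : continuous f -> 0 < e ->
  exists2 dl, 0 < dl & forall s t, a <= s <= b -> `|s - t| < dl -> `|f s - f t| < e.
Proof.
move=> cf e0; have /compact_near_coveringP := @segment_compact R a b.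
move=> /(_ R (0^'+) (fun dl s => forall t, `|s - t| < dl -> `|f s - f t| < e)).
case.
- move=> x _; have /cvgrPdist_lt /(_ (e / 2)) := cf x.
  rewrite divr_gt0// => /(_ isT) [r /= r0 Hr].
  exists (ball x (r / 2), [set dl | dl < r / 2]) => /=.
    split; first by apply: nbhsx_ballx; rewrite divr_gt0.
    by apply: nbhs_right_lt; rewrite divr_gt0.
  move=> [s dl] /= [xs dls] t st.
  have xs' : `|x - s| < r / 2 by [].
  have H1 : `|f x - f s| < e / 2 by apply: Hr => /=; lra.
  have H2 : `|f x - f t| < e / 2.
    apply: Hr => /=; rewrite (_ : x - t = (x - s) + (s - t)); last by ring.
    by apply: le_lt_trans (ler_normD _ _) _; lra.
  rewrite (_ : f s - f t = - (f x - f s) + (f x - f t)); last by ring.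
  by apply: le_lt_trans (ler_normD _ _) _; rewrite normrN; lra.
- move=> /= dl dl0 H.
  exists (dl / 2); first by rewrite divr_gt0.
  move=> s t sab; apply: (H (dl / 2)) => //=.
    by rewrite sub0r normrN gtr0_norm ?divr_gt0//; lra.
  by rewrite divr_gt0.
Qed.

Lemma segment_bounded (f : R -> R) (a b : R) : continuous f ->
  exists2 C, 0 <= C & forall s, a <= s <= b -> `|f s| <= C.
Proof.
move=> cf; have [ab|ab] := leP a b; last first.
  by exists 0 => // s /andP[h1 h2]; have := le_trans h1 h2; rewrite leNgt ab.
have cn : {within `[a, b], continuous (fun s => `|f s|)}.
  apply: continuous_subspaceT => s; apply: (cvg_comp _ _ (cf s)).
  exact: norm_continuous.
have [c _ H] := EVT_max ab cn.
by exists `|f c| => // s sab; apply: H; rewrite in_itv.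
Qed.

Lemma MVT01 (k k1 : R -> R) : (forall t : R, is_derive t 1 k (k1 t)) ->
  exists2 c : R, 0 <= c <= 1 & k 1 - k 0 = k1 c.
Proof.
move=> kd; have [|c] := @MVT_segment R k k1 0 1 ler01 (fun t _ => kd t).
- apply: continuous_subspaceT => t; apply/differentiable_continuous.
  by apply/derivable1_diffP; case: (kd t).
by rewrite in_itv /= subr0 mulr1; exists c.
Qed.

Lemma MVT0t (k k1 : R -> R) (t : R) : 0 <= t -> (forall t : R, is_derive t 1 k (k1 t)) ->
  exists2 c : R, 0 <= c <= t & k t - k 0 = k1 c * t.
Proof.
move=> t0 kd; have [|c] := @MVT_segment R k k1 0 t t0 (fun t _ => kd t).
- apply: continuous_subspaceT => u; apply/differentiable_continuous.
  by apply/derivable1_diffP; case: (kd u).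
by rewrite in_itv /= subr0; exists c.
Qed.

(** The mean value theorem, applied to [k] minus its expected quadratic part and then to [k1]. The
    loss of a factor 2 in the bound is harmless. *)
Lemma taylor01 (k k1 k2 : R -> R) (c e : R) : (forall t : R, is_derive t 1 k (k1 t)) ->
  (forall t : R, is_derive t 1 k1 (k2 t)) ->
  (forall t : R, 0 <= t <= 1 -> `|k2 t - c| <= e) ->
  `|k 1 - k 0 - k1 0 - c / 2| <= e.
Proof.
move=> kd k1d H.
pose q (t : R) := k t - k1 0 * t - c / 2 * t ^+ 2.
have qd (t : R) : is_derive t 1 q (k1 t - k1 0 - c * t).
  by have := kd t => ?; apply: is_derive_eq; rewrite /GRing.scale/=; field.
have [x /andP[x0 x1]] := MVT01 qd.
have -> : q 1 - q 0 = k 1 - k 0 - k1 0 - c / 2 by rewrite /q; field.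
move=> ->; have [y /andP[y0 yx] ->] := MVT0t x0 k1d.
rewrite -mulrBl normrM (ger0_norm x0).
apply: le_trans (_ : `|k2 y - c| * 1 <= _); first exact: ler_wpM2l.
by rewrite mulr1; apply: H; rewrite y0 (le_trans yx x1).
Qed.

End Compactness.

Section RadialTest.
Variables (R : realType) (d : nat) (h h1 h2 : R -> R) (B : R).
Hypothesis h_d : forall s : R, is_derive s 1 h (h1 s).
Hypothesis h1_d : forall s : R, is_derive s 1 h1 (h2 s).
Hypothesis h2_c : continuous h2.
Hypothesis B0 : 0 < B.
Hypothesis hB : forall s : R, B <= s -> [/\ h s = 1, h1 s = 0 & h2 s = 0].
Implicit Types y z : 'cV[R]_d.

(** The squared norm is a polynomial in y, so smoothness at the origin costs nothing; the factors 2
    and 4 in the derivatives [tg] and [tD] are those of the chain rule. *)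
Definition tf y : R := h (dotv y y).
Definition tg y z : R := 2 * h1 (dotv y y) * dotv y z.
Definition tD y z z' : R :=
  2 * h1 (dotv y y) * dotv z z' + 4 * h2 (dotv y y) * dotv y z * dotv y z'.
Definition tT y z : R := tf (y + z) - tf y - tg y z.

Let cont (f f1 : R -> R) : (forall s : R, is_derive s 1 f (f1 s)) -> continuous f.
Proof.
move=> fd s; apply/differentiable_continuous/derivable1_diffP.
by case: (fd s).
Qed.

Lemma continuous_h : continuous h. Proof. exact: cont h_d. Qed.
Lemma continuous_h1 : continuous h1. Proof. exact: cont h1_d. Qed.

Lemma h_bounded : exists2 C, 1 <= C & forall s, 0 <= s ->
  [/\ `|h s| <= C, `|h1 s| <= C & `|h2 s| <= C].
Proof.
have [C0 C00 H0] := @segment_bounded R h 0 B continuous_h.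
have [C1 C10 H1] := @segment_bounded R h1 0 B continuous_h1.
have [C2 C20 H2] := @segment_bounded R h2 0 B h2_c.
exists (1 + C0 + C1 + C2); first by lra.
move=> s s0; have [sB|Bs] := leP s B.
  have sB' : 0 <= s <= B by rewrite s0.
  by split; [have := H0 _ sB'|have := H1 _ sB'|have := H2 _ sB']; lra.
have [-> -> ->] := hB (ltW Bs).
by split; rewrite ?normr0 ?normr1; lra.
Qed.

Lemma line_sqr y z (t : R) :
  dotv (y + t *: z) (y + t *: z) = dotv y y + 2 * t * dotv y z + t ^+ 2 * dotv z z.
Proof. by rewrite !(dotvDl, dotvDr, dotvZl, dotvZr) (dotvC z y); ring. Qed.

Lemma line_dot y z z' (t : R) : dotv (y + t *: z) z' = dotv y z' + t * dotv z z'.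
Proof. by rewrite dotvDl dotvZl. Qed.

Lemma line_tf y z (t : R) :
  is_derive t 1 (fun t => tf (y + t *: z)) (tg (y + t *: z) z).
Proof.
rewrite (_ : (fun t => _) = h \o (fun t : R => dotv y y + 2 * t * dotv y z + t ^+ 2 * dotv z z)).
  have := h_d (dotv y y + 2 * t * dotv y z + t ^+ 2 * dotv z z) => ?.
  apply: is_derive_eq; rewrite /GRing.scale/= /tg line_sqr line_dot.
  by move: (h1 _) => u; ring.
by apply/funext => u; rewrite /= /tf line_sqr.
Qed.

Lemma line_tg y z z' (t : R) :
  is_derive t 1 (fun t => tg (y + t *: z) z') (tD (y + t *: z) z z').
Proof.
rewrite (_ : (fun t => _) = (fun t : R =>
    2 * (h1 \o (fun t : R => dotv y y + 2 * t * dotv y z + t ^+ 2 * dotv z z)) t *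
    (dotv y z' + t * dotv z z'))).
  have := h1_d (dotv y y + 2 * t * dotv y z + t ^+ 2 * dotv z z) => ?.
  apply: is_derive_eq; rewrite /GRing.scale/= /tD line_sqr !line_dot.
  by move: (h1 _) (h2 _) => u v; ring.
by apply/funext => u; rewrite /= /tg line_sqr line_dot.
Qed.

Lemma line0 y z : y + 0 *: z = y. Proof. by rewrite scale0r addr0. Qed.
Lemma line1 y z : y + 1 *: z = y + z. Proof. by rewrite scale1r. Qed.

Let K := Num.sqrt B.

Let K0 : 0 <= K. Proof. exact: sqrtr_ge0. Qed.

Let far y : K <= frob y -> [/\ tf y = 1, h1 (dotv y y) = 0 & h2 (dotv y y) = 0].
Proof.
move=> Ky; apply: hB; rewrite -frob_dotv -(sqr_sqrtr (ltW B0)).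
by rewrite lerXn2r// nnegrE frob_ge0.
Qed.

(** Where |y| >= [K] the derivatives of [h] vanish, and elsewhere |<y, z>| <= K |z|; hence the
    factors y produced by the chain rule do not spoil the bounds. *)
Lemma test_bounds : exists2 C, 1 <= C & [/\
  forall y, `|tf y| <= C,
  forall y z, `|tg y z| <= C * frob z &
  forall y z z', `|tD y z z'| <= C * (frob z * frob z')].
Proof.
have [C C1 HC] := h_bounded.
have C0 : 0 <= C by lra.
exists (C + 2 * C * K + (2 * C + 4 * C * K ^+ 2)).
  by have := mulr_ge0 C0 K0; have := mulr_ge0 C0 (sqr_ge0 K); lra.
split.
- move=> y; have [H _ _] := HC _ (dotv_ge0 y).
  apply: le_trans H _.
  by have := mulr_ge0 C0 K0; have := mulr_ge0 C0 (sqr_ge0 K); lra.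
- move=> y z; apply: (@le_trans _ _ (2 * C * K * frob z)); last first.
    apply: ler_wpM2r; first exact: frob_ge0.
    by have := mulr_ge0 C0 K0; have := mulr_ge0 C0 (sqr_ge0 K); lra.
  have [yK|Ky] := leP (frob y) K; last first.
    have [_ h10 _] := far (ltW Ky).
    by rewrite /tg h10 mulr0 mul0r normr0 !mulr_ge0 ?frob_ge0.
  have [_ H _] := HC _ (dotv_ge0 y).
  rewrite /tg !normrM ger0_norm// -!mulrA ler_pM2l//.
  apply: ler_pM => //; apply: le_trans (dotv_le _ _) _.
  by rewrite ler_wpM2r ?frob_ge0.
- move=> y z z'; apply: (@le_trans _ _ ((2 * C + 4 * C * K ^+ 2) * (frob z * frob z'))); last first.
    apply: ler_wpM2r; first by rewrite mulr_ge0 ?frob_ge0.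
    by have := mulr_ge0 C0 K0; have := mulr_ge0 C0 (sqr_ge0 K); lra.
  have zz : 0 <= frob z * frob z' by rewrite mulr_ge0 ?frob_ge0.
  have [yK|Ky] := leP (frob y) K; last first.
    have [_ h10 h20] := far (ltW Ky).
    rewrite /tD h10 h20 !mulr0 !mul0r addr0 normr0 mulr_ge0// addr_ge0//.
      by rewrite mulr_ge0.
    by rewrite !mulr_ge0// sqr_ge0.
  have [_ H1 H2] := HC _ (dotv_ge0 y).
  rewrite /tD [leRHS]mulrDl; apply: le_trans (ler_normD _ _) _; apply: lerD.
    rewrite !normrM ger0_norm// -!mulrA ler_pM2l//.
    by apply: ler_pM => //; exact: dotv_le.
  rewrite !normrM ger0_norm// -!mulrA ler_pM2l//.
  apply: ler_pM; rewrite ?mulr_ge0//.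
  rewrite [leRHS](_ : _ = (K * frob z) * (K * frob z')); last by ring.
  have hz w : `|dotv y w| <= K * frob w.
    by apply: le_trans (dotv_le _ _) _; rewrite ler_wpM2r ?frob_ge0.
  exact: ler_pM.
Qed.

(** The third estimate serves to compare jump integrals: it is of order two in z and z' together, so
    square integrable integrands suffice. The difference splits into a remainder at y + z' and a
    variation of the gradient between y and y + z'. *)
Lemma test_lip : exists2 C, 1 <= C & [/\
  forall y z, `|tf (y + z) - tf y| <= C * frob z,
  forall y z, `|tT y z| <= C * frob z ^+ 2 &
  forall y z z', `|tT y z - tT y z'| <= C * (frob (z - z') * (frob z + frob z'))].
Proof.
have [C C1 [_ Hg HD]] := test_bounds; have C0 : 0 <= C by lra.
have T2 y z : `|tT y z| <= C * frob z ^+ 2.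
  have := @taylor01 R _ _ _ 0 (C * frob z ^+ 2) (line_tf y z) (line_tg y z z).
  rewrite mul0r subr0 !line0 !line1; apply.
  by move=> t _; rewrite subr0 expr2.
exists (3 * C); first lra.
split.
- move=> y z; have [t _] := MVT01 (line_tf y z).
  rewrite line0 line1 => ->; apply: le_trans (Hg _ _) _.
  by rewrite -mulrA ler_peMl ?mulr_ge0 ?frob_ge0//; lra.
- move=> y z; apply: le_trans (T2 _ _) _.
  by have := mulr_ge0 C0 (sqr_ge0 (frob z)); lra.
- move=> y z z'; set w := z - z'.
  have -> : tT y z - tT y z' = tT (y + z') w + (tg (y + z') w - tg y w).
    rewrite /tT (_ : y + z' + w = y + z); last by rewrite /w -addrA [z' + _]addrC subrK.
    rewrite /tg /w !(dotvDr, dotvNr); ring.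
  have [t _] := MVT01 (line_tg y z' w).
  rewrite line0 line1 => ->.
  have wz : frob w <= frob z + frob z' by rewrite -(frobN z') frobD.
  have w0 := frob_ge0 w; have z0 := frob_ge0 z; have z'0 := frob_ge0 z'.
  apply: le_trans (ler_normD _ _) _.
  apply: le_trans (lerD (T2 _ _) (HD _ _ _)) _.
  rewrite -mulrDr [leRHS](_ : _ = C * (3 * (frob w * (frob z + frob z')))); last by ring.
  apply: ler_wpM2l => //; move: w0 z0 z'0 wz.
  by move: (frob w) (frob z) (frob z') => a b c; nra.
Qed.

(** The point is uniformity over all y. For |y| >= K + 1 and |z| <= 1 the whole segment lies where
    [h1] and [h2] vanish; the other y have bounded norm, and uniform continuity on a compact
    interval of squared norms applies. *)
Lemma test_taylor (e : R) : 0 < e -> exists2 dl, 0 < dl & forall y z,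
  frob z <= dl -> `|tT y z - tD y z z / 2| <= e * frob z ^+ 2.
Proof.
move=> e0; have [C C1 HC] := h_bounded; have C0 : 0 <= C by lra.
pose L := K + 2.
have L2 : 2 <= L by rewrite /L; move: K0; lra.
have L0 : 0 < L by lra.
(* The denominator is fitted to the three error terms: the variation of [h1] (4), of [h2] (4 L^2),
   and of <y, z>^2 (4 C L^2); the last one uses L >= 2. *)
pose e' := e / (4 * L ^+ 2 + 4 * C * L ^+ 2 + 4).
have Den : 0 < 4 * L ^+ 2 + 4 * C * L ^+ 2 + 4.
  by have := exprn_gt0 2 L0; have := mulr_ge0 C0 (sqr_ge0 L); lra.
have e'0 : 0 < e' by rewrite divr_gt0.
have [d1 d10 H1] := @segment_unif_continuous R h1 0 (L ^+ 2) e' continuous_h1 e'0.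
have [d2 d20 H2] := @segment_unif_continuous R h2 0 (L ^+ 2) e' h2_c e'0.
pose dl := Num.min (Num.min 1 e') (Num.min (d1 / (4 * L)) (d2 / (4 * L))).
have dl0 : 0 < dl by rewrite !lt_min ltr01 e'0 !divr_gt0 ?mulr_gt0.
exists dl => // y z.
rewrite !le_min => /andP[/andP[z1 ze] /andP[zd1 zd2]].
have z0 := frob_ge0 z.
have key (t : R) : 0 <= t <= 1 ->
    `|tD (y + t *: z) z z - tD y z z| <= e * frob z ^+ 2.
  move=> /andP[t0 t1].
  have tz : frob (t *: z) <= frob z by rewrite frobZ ger0_norm// ler_piMl.
  set y' := y + t *: z.
  have [yL|Ly] := leP (K + 1) (frob y).
    have Ky : K <= frob y by lra.
    have Ky' : K <= frob y'.
      have := frobD y' (- (t *: z)); rewrite /y' addrK frobN; lra.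
    have [_ a b] := far Ky; have [_ a' b'] := far Ky'.
    rewrite /tD a b a' b' !mulr0 !mul0r subrr normr0.
    by rewrite mulr_ge0 ?sqr_ge0 ?ltW.
  have yL : frob y <= L by rewrite /L; lra.
  have y0 := frob_ge0 y.
  have y'L : frob y' <= L.
    by apply: le_trans (frobD _ _) _; rewrite /L; lra.
  have sL : 0 <= dotv y y <= L ^+ 2.
    apply/andP; split; first exact: dotv_ge0.
    by rewrite -frob_dotv lerXn2r// nnegrE (ltW L0).
  have yz := dotv_le y z; have y'z := dotv_le y' z.
  have ds : `|dotv y y - dotv y' y'| <= (2 * L + 1) * frob z.
    rewrite line_sqr (_ : _ - _ = - (2 * t * dotv y z + t ^+ 2 * dotv z z)); last by ring.
    rewrite normrN; apply: le_trans (ler_normD _ _) _; rewrite [leRHS]mulrDl; apply: lerD.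
      rewrite normrM ger0_norm ?mulr_ge0// -!mulrA ler_pM2l//.
      apply: le_trans (_ : 1 * `|dotv y z| <= _); first exact: ler_wpM2r.
      by rewrite mul1r; apply: le_trans yz _; exact: ler_wpM2r.
    rewrite -frob_dotv ger0_norm ?mulr_ge0 ?sqr_ge0// mul1r.
    apply: le_trans (_ : 1 * frob z ^+ 2 <= _).
      by apply: ler_wpM2r; rewrite ?sqr_ge0// expr_le1.
    by rewrite mul1r expr2 ler_piMr.
  have small (dd : R) : 0 < dd -> frob z <= dd / (4 * L) -> `|dotv y y - dotv y' y'| < dd.
    move=> dd0 zdd; apply: le_lt_trans ds _.
    rewrite ler_pdivlMr ?mulr_gt0// in zdd.
    have := mulr_ge0 z0 (ltW L0); nra.
  have G1 := H1 _ _ sL (small _ d10 zd1).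
  have G2 := H2 _ _ sL (small _ d20 zd2).
  have [_ B1 B2] := HC _ (dotv_ge0 y).
  rewrite /tD -!(frob_dotv z).
  rewrite [X in `|X|](_ : _ = - (2 * (h1 (dotv y y) - h1 (dotv y' y')) * frob z ^+ 2)
    - 4 * (h2 (dotv y y) - h2 (dotv y' y')) * dotv y' z ^+ 2
    + 4 * h2 (dotv y y) * (dotv y' z - dotv y z) * (dotv y' z + dotv y z)); last by ring.
  have dz : dotv y' z - dotv y z = t * frob z ^+ 2.
    by rewrite line_dot frob_dotv; ring.
  have q0 := sqr_ge0 (frob z).
  apply: le_trans (ler_normD _ _) _.
  apply: le_trans (lerD (ler_normB _ _) (lexx _)) _; rewrite normrN.
  have E : e = 4 * e' + 4 * L ^+ 2 * e' + 4 * C * L ^+ 2 * e'.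
    by rewrite /e'; field; rewrite gt_eqF.
  rewrite [leRHS](_ : _ = 4 * e' * frob z ^+ 2 + 4 * L ^+ 2 * e' * frob z ^+ 2
    + 4 * C * L ^+ 2 * e' * frob z ^+ 2); last by rewrite [X in X * _ = _]E; ring.
  apply: lerD; first apply: lerD.
  - rewrite normrM (ger0_norm q0) ler_wpM2r// normrM ger0_norm//.
    by move: (ltW G1) (ltW e'0); lra.
  - rewrite normrM normrM ger0_norm// [leRHS](_ : _ = 4 * e' * (L * frob z) ^+ 2); last by ring.
    apply: ler_pM; rewrite ?mulr_ge0//; first by rewrite ler_pM2l// ltW.
    rewrite normrX lerXn2r ?nnegrE ?mulr_ge0 ?(ltW L0)//.
    by apply: le_trans y'z _; rewrite ler_wpM2r.
  - rewrite dz normrM normrM (ger0_norm (mulr_ge0 t0 q0)) normrM ger0_norm//.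
    have sm : `|dotv y' z + dotv y z| <= 2 * L * e'.
      apply: le_trans (ler_normD _ _) _.
      have a1 : frob y * frob z <= L * e' by apply: ler_pM.
      have a2 : frob y' * frob z <= L * e' by apply: ler_pM => //; exact: frob_ge0.
      move: yz y'z; lra.
    rewrite [leLHS](_ : _ = (4 * `|h2 (dotv y y)| * (t * `|dotv y' z + dotv y z|)) * frob z ^+ 2); last by ring.
    rewrite ler_wpM2r// [leRHS](_ : _ = 4 * C * (L ^+ 2 * e')); last by ring.
    apply: ler_pM; rewrite ?mulr_ge0//; first by rewrite ler_pM2l.
    apply: le_trans (_ : 1 * `|dotv y' z + dotv y z| <= _); first exact: ler_wpM2r.
    rewrite mul1r; apply: le_trans sm _.
    by rewrite ler_wpM2r ?(ltW e'0)// expr2 ler_wpM2r ?(ltW L0).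
have := @taylor01 R _ _ _ (tD y z z) (e * frob z ^+ 2) (line_tf y z) (line_tg y z z) key.
by rewrite !line0 !line1.
Qed.

End RadialTest.

(** * Increments of the noise *)

Section BorelMaps.
Variable R : realType.

Lemma continuous_Borel (S : ptopologicalType) (f : S -> R) : continuous f ->
  measurable_fun setT (f : Borel S -> R).
Proof.
move=> cf; apply: (measurability _ (RGenOpens.measurableE R)).
move=> _ [_ [a [b ->]] <-]; rewrite setTI; apply: sub_sigma_algebra.
by apply: open_comp => [? _|]; [exact: cf|exact: interval_open].
Qed.

Lemma coord_Borel (m n : nat) (i : 'I_m) (j : 'I_n) :
  measurable_fun setT ((fun A : 'M[R]_(m, n) => A i j) : Borel 'M[R]_(m, n) -> R).
Proof. by apply: continuous_Borel; exact: coord_continuous. Qed.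

End BorelMaps.

Section SubSigma.
Context (R : realType) (dT : measure_display) (T : measurableType dT).
Variable P : probability T R.

Lemma sub_gen (G H : set (set T)) : sigma_algebra setT H -> G `<=` H -> <<s G >> `<=` H.
Proof. by move=> sH GH; apply: smallest_sub. Qed.

Lemma bounded_integrable (f : T -> R) (C : R) : measurable_fun setT f ->
  (forall w, `|f w| <= C) -> P.-integrable setT (EFin \o f).
Proof.
move=> mf fC; have := finite_measure_integrable_cst P C measurableT.
apply: le_integrable => //; first exact/measurable_EFinP.
move=> w _ /=; rewrite lee_fin; apply: le_trans (fC w) _; exact: ler_norm.
Qed.

Lemma Rintegral_prob_cst (r : R) : \int[P]_w r = r.
Proof.
by rewrite /Rintegral integral_cst// -[X in (_ * X)%E]/(P setT) probability_setT mule1.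
Qed.

End SubSigma.

Section Noise.
Context (R : realType) (dT : measure_display) (T : measurableType dT).
Variables (P : probability T R) (F : R -> set (set T)).
Context (dU : measure_display) (U : measurableType dU).
Variables (nu : {sigma_finite_measure set U -> \bar R}) (d : nat).
Variables (W : R -> T -> Borel 'cV[R]_d)
          (N : T -> {measure set (R * U) -> \bar R}).
Hypothesis noise : driving_noise P F nu W N.

(** Measurability with respect to [F a], phrased through the space generated by it so that the usual
    closure rules for measurable functions also prove adaptedness. For a >= 0 the generation adds
    nothing, since [F a] is a sigma-algebra. *)
Definition Fm (a : R) (dS : measure_display) (S : measurableType dS) (Y : T -> S) :=
  measurable_fun setT (Y : sigT_of (F a) -> S).

Let filt : filtration F. Proof. by case: noise. Qed.
Let bm : brownian_motion P F W. Proof. by case: noise. Qed.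
Let prm : poisson_random_measure P F nu N. Proof. by case: noise. Qed.

Lemma F_sigma a : 0 <= a -> sigma_algebra setT (F a).
Proof. by move=> a0; have [/(_ a a0)[]] := filt. Qed.

Lemma F_meas a : 0 <= a -> F a `<=` measurable.
Proof. by move=> a0; have [/(_ a a0)[]] := filt. Qed.

Lemma FmP a dS (S : measurableType dS) (Y : T -> S) : 0 <= a ->
  Fm a Y <-> (forall B, measurable B -> F a (Y @^-1` B)).
Proof.
move=> a0; split=> H; last first.
  move=> _ B mB; rewrite setTI.
  by rewrite /measurable/= sigma_algebra_id; [exact: H|exact: F_sigma].
move=> B mB; have := H measurableT B mB; rewrite setTI.
by rewrite /measurable/= sigma_algebra_id//; exact: F_sigma.
Qed.

Lemma Fm_measurable a dS (S : measurableType dS) (Y : T -> S) : 0 <= a -> Fm a Y ->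
  measurable_fun setT Y.
Proof. by move=> a0; apply: measurable_fun_sub; [exact: F_sigma|exact: F_meas]. Qed.

Lemma Fm_mono a b dS (S : measurableType dS) (Y : T -> S) : 0 <= a -> a <= b ->
  Fm a Y -> Fm b Y.
Proof.
move=> a0 ab /(FmP _ a0) H; apply/FmP; first exact: le_trans ab.
by move=> B mB; have [_ /(_ a b a0 ab)] := filt; apply; exact: H.
Qed.

Lemma W_Fm t (j : 'I_d) : 0 <= t -> Fm t (fun w => (W t w : 'cV[R]_d) j 0).
Proof.
move=> t0; apply/FmP => // B mB; have [ad _ _ _] := bm.
apply: (ad t t0); exists t => //.
exists ((fun A : 'cV[R]_d => A j 0) @^-1` B); last by rewrite setTI.
by rewrite -[X in measurable X]setTI; exact: coord_Borel.
Qed.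

Lemma N_Fm t B : 0 <= t -> time_sets `[0, t] B -> Fm t (fun w => N w B).
Proof.
move=> t0 tB; apply/FmP => // C mC; have [_ _ _ ad _] := prm.
by apply: (ad t t0); exists B => //; exists C => //; rewrite setTI.
Qed.

Definition sig_N (a : R) : set (set T) :=
  <<s events (time_sets `]a, +oo[) (fun B w => N w B) >>.

Definition dW (a b : R) (j : 'I_d) (w : T) : R :=
  (W b w : 'cV[R]_d) j 0 - (W a w : 'cV[R]_d) j 0.

Definition sig_dW (a b : R) : set (set T) := <<s events setT (dW a b) >>.

Definition dN (a b : R) (B : set U) (w : T) : R := fine (N w (`]a, b] `*` B)).

Section Increment.
Variables (a b : R).
Hypotheses (a0 : 0 <= a) (ab : a < b).
Let h := b - a.
Let h0 : 0 < h. Proof. by rewrite subr_gt0. Qed.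
Let b0 : 0 <= b. Proof. exact: le_trans (ltW ab). Qed.

Lemma dW_Fm j : Fm b (dW a b j).
Proof.
apply: measurable_funB; first exact: W_Fm.
by apply: (@Fm_mono a) => //; [exact: ltW|exact: W_Fm].
Qed.

Lemma dW_measurable j : measurable_fun setT (dW a b j).
Proof. exact: Fm_measurable (dW_Fm j). Qed.

Lemma sigma_sig_dW : sigma_algebra setT (sig_dW a b).
Proof. exact: smallest_sigma_algebra. Qed.

Lemma dW_sig j : measurable_fun setT (dW a b j : sigT_of (sig_dW a b) -> R).
Proof.
move=> _ B mB; rewrite setTI /measurable/= sigma_algebra_id; last exact: sigma_sig_dW.
by apply: sub_sigma_algebra; exists j => //; exists B; rewrite ?setTI.
Qed.

Lemma sig_dW_meas : sig_dW a b `<=` measurable.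
Proof.
apply: sub_gen; first exact: sigma_algebra_measurable.
by move=> _ [j _ [B mB <-]]; exact: dW_measurable.
Qed.

Lemma dW_law j B : measurable B -> P (dW a b j @^-1` B) = normal_prob 0 (Num.sqrt h) B.
Proof.
move=> mB; have [_ _ _ law] := bm.
have := law a b a0 ab (fun i => if i == j then B else setT).
rewrite (_ : [set w | _] = dW a b j @^-1` B); last first.
  apply/seteqP; split => w /= H.
    by have := H j; rewrite eqxx.
  by move=> i; case: eqP => // ->.
move=> ->; last by move=> i; case: ifP.
rewrite (bigD1 j)//= eqxx big1 ?mule1// => i /negbTE ->.
exact: probability_setT.
Qed.

Let dW_mT j : measurable_fun setT (dW a b j : T -> measurableTypeR R).
Proof. exact: dW_measurable. Qed.

Let dW_mix j := isMeasurableFun.Build _ _ _ _ _ (dW_mT j).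
Let dW_RV j : {mfun T >-> measurableTypeR R} :=
  HB.pack (dW a b j : T -> measurableTypeR R) (dW_mix j).

Let dW_dist j B : measurable B -> B `<=` setT ->
  distribution P (dW_RV j) B = normal_prob 0 (Num.sqrt h) B.
Proof. by move=> mB _; rewrite -(dW_law j). Qed.

Lemma dW_ge0_integral j (g : R -> R) : measurable_fun setT g -> (forall x, 0 <= g x) ->
  (\int[P]_w (g (dW a b j w))%:E = \int[normal_prob 0 (Num.sqrt h)]_x (g x)%:E)%E.
Proof.
move=> mg g0.
rewrite -(eq_measure_integral _ (@dW_dist j)).
by rewrite ge0_integral_distribution//;
  do ?[by apply/measurable_EFinP | by move=> x; rewrite lee_fin].
Qed.

Let sh0 : 0 < Num.sqrt h. Proof. by rewrite sqrtr_gt0. Qed.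

Lemma dW_sqr j : P.-integrable setT (fun w => (dW a b j w ^+ 2)%:E) /\
  \int[P]_w (dW a b j w ^+ 2) = h.
Proof.
have E : (\int[P]_w (dW a b j w ^+ 2)%:E = h%:E)%E.
  rewrite (dW_ge0_integral j (exprn_measurable 2)); last by move=> x; rewrite sqr_ge0.
  by rewrite normal_prob_var// sqr_sqrtr// ltW.
split; last by rewrite /Rintegral E.
apply/integrableP; split.
  by apply/measurable_EFinP; apply: measurable_funX; exact: dW_measurable.
by under eq_integral do rewrite gee0_abs ?lee_fin ?sqr_ge0//; rewrite E ltry.
Qed.

Lemma dW_four j : P.-integrable setT (fun w => (dW a b j w ^+ 4)%:E) /\
  \int[P]_w (dW a b j w ^+ 4) <= 128 * h ^+ 2.
Proof.
have E : (\int[P]_w (dW a b j w ^+ 4)%:E <= (128 * h ^+ 2)%:E)%E.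
  rewrite (dW_ge0_integral j (exprn_measurable 4)); last by move=> x; rewrite exprn_even_ge0.
  apply: le_trans (normal_prob_fourth sh0) _; rewrite lee_fin.
  by rewrite (_ : 4%N = (2 * 2)%N)// exprM sqr_sqrtr// ltW.
have I : P.-integrable setT (fun w => (dW a b j w ^+ 4)%:E).
  apply/integrableP; split.
    by apply/measurable_EFinP; apply: measurable_funX; exact: dW_measurable.
  under eq_integral do rewrite gee0_abs ?lee_fin ?exprn_even_ge0//.
  by apply: le_lt_trans E _; rewrite ltry.
split=> //; rewrite /Rintegral -lee_fin fineK//.
exact: integrable_fin_num.
Qed.

Lemma dW_mean j : P.-integrable setT (EFin \o dW a b j) /\ \int[P]_w (dW a b j w) = 0.
Proof.
have [i1 e1] := normal_prob_mean sh0.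
have m1 : measurable_fun setT (EFin \o @id R) by exact/measurable_EFinP.
have I : P.-integrable setT (EFin \o dW a b j).
  apply/integrableP; split; first by apply/measurable_EFinP; exact: dW_measurable.
  rewrite (dW_ge0_integral j (@normr_measurable R setT))//.
  by case/integrableP : i1.
split=> //; rewrite -[RHS]e1 /Rintegral; congr fine.
rewrite -(eq_measure_integral _ (@dW_dist j)).
by rewrite (@integral_pushforward _ _ _ _ _ _ (dW_mT j) P setT (EFin \o @id R)).
Qed.

(** The past is independent of the vector increment, and the coordinates generate a smaller
    sigma-algebra than the vector does. *)
Lemma indep_F_dW : independent P (F a) (sig_dW a b).
Proof.
move=> E E' FE sE'; have [_ _ ind _] := bm.
apply: (ind a b a0 ab) => //; apply: sub_gen sE'; first exact: smallest_sigma_algebra.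
move=> _ [j _ [B mB <-]]; apply: sub_sigma_algebra; exists tt => //.
exists ((fun A : 'cV[R]_d => A j 0) @^-1` B).
  by rewrite -[X in measurable X]setTI; exact: coord_Borel.
by rewrite !setTI; apply/seteqP; split => w /=; rewrite /dW !mxE.
Qed.

Lemma E_sig_dW (Y xi : T -> R) (C : R) : Fm a Y -> (forall w, `|Y w| <= C) ->
  measurable_fun setT (xi : sigT_of (sig_dW a b) -> R) ->
  P.-integrable setT (EFin \o xi) ->
  P.-integrable setT (fun w => (Y w * xi w)%:E) /\
  \int[P]_w (Y w * xi w) = \int[P]_w Y w * \int[P]_w xi w.
Proof.
move=> mY YC mxi ixi; apply: indep_integral (indep_F_dW) _ _ _ _ => //.
- exact: F_sigma.
- exact: F_meas.
- exact: sigma_sig_dW.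
- exact: sig_dW_meas.
- by apply: bounded_integrable YC; exact: Fm_measurable mY.
Qed.

Lemma E_dW (Y : T -> R) (C : R) j : Fm a Y -> (forall w, `|Y w| <= C) ->
  P.-integrable setT (fun w => (Y w * dW a b j w)%:E) /\
  \int[P]_w (Y w * dW a b j w) = 0.
Proof.
move=> mY YC; have [i e] := dW_mean j.
by have [? ->] := E_sig_dW mY YC (dW_sig j) i; rewrite e mulr0.
Qed.

(** For distinct coordinates the product form of the law of the increment gives independence of the
    two preimage sigma-algebras, hence the product of two zero means. *)
Lemma dW_cross j k : P.-integrable setT (fun w => (dW a b j w * dW a b k w)%:E) /\
  \int[P]_w (dW a b j w * dW a b k w) = h *+ (j == k).
Proof.
have [<-|jk] := eqVneq j k.
  have [i e] := dW_sqr j.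
  by split; [apply: eq_integrable i => // w _; rewrite expr2|rewrite -e; apply: eq_Rintegral].
have ss l : sigma_algebra setT (preimage_set_system setT (dW a b l) measurable).
  by apply: sigma_algebra_preimage; exact: sigma_algebra_measurable.
have sm l : preimage_set_system setT (dW a b l) measurable `<=` measurable.
  by move=> _ [B mB <-]; exact: dW_measurable.
have mm l : measurable_fun setT
    (dW a b l : sigT_of (preimage_set_system setT (dW a b l) measurable) -> R).
  move=> _ B mB; rewrite setTI /measurable/= sigma_algebra_id; last exact: ss.
  by exists B => //; rewrite setTI.
have ind : independent P (preimage_set_system setT (dW a b j) measurable)
    (preimage_set_system setT (dW a b k) measurable).
  move=> _ _ [B mB <-] [B' mB' <-]; rewrite !setTI.
  have [_ _ _ law] := bm.
  have := law a b a0 ab (fun i => if i == j then B else if i == k then B' else setT).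
  rewrite (_ : [set w | _] = dW a b j @^-1` B `&` dW a b k @^-1` B'); last first.
    apply/seteqP; split => w /= H.
      split; first by have := H j; rewrite eqxx.
      by have := H k; rewrite eqxx eq_sym (negbTE jk).
    by move=> i; case: H => H1 H2; case: eqP => [->//|_]; case: eqP => [->|_].
  move=> ->; last by move=> i; do 2 case: ifP => // _.
  rewrite (bigD1 j)//= eqxx (bigD1 k)/=; last by rewrite eq_sym.
  rewrite (eq_sym k j) (negbTE jk) eqxx.
  rewrite big1 ?mule1 ?dW_law// => i /andP[/negbTE -> /negbTE ->].
  exact: probability_setT.
have [ij ej] := dW_mean j; have [ik ek] := dW_mean k.
have [I E] := indep_integral (ss j) (sm j) (ss k) (sm k) ind (mm j) (mm k) ij ik.
by split=> //; rewrite E ej mul0r.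
Qed.

Lemma E_dW_cross (Y : T -> R) (C : R) j k : Fm a Y -> (forall w, `|Y w| <= C) ->
  P.-integrable setT (fun w => (Y w * (dW a b j w * dW a b k w - h *+ (j == k)))%:E) /\
  \int[P]_w (Y w * (dW a b j w * dW a b k w - h *+ (j == k))) = 0.
Proof.
move=> mY YC; have [i e] := dW_cross j k.
have mh : P.-integrable setT (EFin \o (fun=> h *+ (j == k))).
  exact: finite_measure_integrable_cst.
have ms : measurable_fun setT ((fun w => dW a b j w * dW a b k w - h *+ (j == k))
    : sigT_of (sig_dW a b) -> R).
  by apply: measurable_funB => //; apply: measurable_funM; exact: dW_sig.
have is_ : P.-integrable setT (EFin \o (fun w => dW a b j w * dW a b k w - h *+ (j == k))).
  by have := integrableB measurableT i mh; apply: eq_integrable.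
have [? ->] := E_sig_dW mY YC ms is_; split=> //.
rewrite RintegralB// e Rintegral_prob_cst subrr mulr0//.
Qed.

Section Jumps.
Variable B : set U.
Hypotheses (mB : measurable B) (fB : (nu B < +oo)%E).
Let l := fine (nu B).

Let nuB : nu B = l%:E. Proof. by rewrite /l fineK// ge0_fin_numE. Qed.

Let BB : set (R * U) := `]a, b] `*` B.

Let mBB : measurable BB.
Proof. by apply: measurableX => //; exact: measurable_itv. Qed.

Let tpos : time_sets `[0, +oo[ BB.
Proof.
split=> // -[t u] [/=]; rewrite in_itv/= => /andP[at_ _] _.
by split => //=; rewrite in_itv/= andbT ltW// (le_lt_trans a0).
Qed.

Let tfut : time_sets `]a, +oo[ BB.
Proof.
by split=> // -[t u] [/=]; rewrite in_itv/= => /andP[at_ _] _; split => //=; rewrite in_itv/= at_.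
Qed.

Let tpast : time_sets `[0, b] BB.
Proof.
split=> // -[t u] [/=]; rewrite in_itv/= => /andP[at_ tb] _.
by split => //=; rewrite in_itv/= tb andbT ltW// (le_lt_trans a0).
Qed.

Lemma intensity_itv : intensity nu (`]a, b] `*` B) = (h * l)%:E.
Proof.
rewrite /intensity product_measure1E//=.
by rewrite lebesgue_measure_itv/= lte_fin ab nuB.
Qed.

Let l0 : 0 <= h * l. Proof. by rewrite mulr_ge0 ?(ltW h0)// /l fine_ge0. Qed.

Let mN : measurable_fun setT (fun w => N w BB).
Proof. by have [+ _ _ _ _] := prm; apply. Qed.

Let lawN k : P [set w | N w BB = k%:R%:E] = ((h * l) ^+ k / k`!%:R * expR (- (h * l)))%:E.
Proof.
have [_ /(_ _ tpos)[_ H] _ _ _] := prm.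
by rewrite (H _ intensity_itv).
Qed.

Lemma dN_ae : {ae P, forall w, exists k : nat, N w (`]a, b] `*` B) = k%:R%:E}.
Proof. exact: poisson_ae l0 mN lawN. Qed.

Lemma dN_mean : P.-integrable setT (EFin \o dN a b B) /\ \int[P]_w dN a b B w = h * l.
Proof. exact: poisson_mean l0 mN lawN. Qed.

Lemma dN_sqr : P.-integrable setT (fun w => (dN a b B w ^+ 2)%:E) /\
  \int[P]_w (dN a b B w ^+ 2) = (h * l) ^+ 2 + h * l.
Proof. exact: poisson_fact2 l0 mN lawN. Qed.

Lemma dN_Fm : Fm b (dN a b B).
Proof. by apply: measurableT_comp => //; exact: N_Fm. Qed.

Lemma dN_ge0 w : 0 <= dN a b B w. Proof. exact: fine_ge0. Qed.

Let sig_sN : sigma_algebra setT (sig_N a).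
Proof. exact: smallest_sigma_algebra. Qed.

Let sig_N_meas : sig_N a `<=` measurable.
Proof.
apply: sub_gen; first exact: sigma_algebra_measurable.
move=> _ [A [mA tA] [C mC <-]]; have [+ _ _ _ _] := prm.
apply => //; split => //; apply: subset_trans tA _ => -[t u] [/=].
by rewrite /= !in_itv/= !andbT => /ltW at_ _; split => //; exact: le_trans at_.
Qed.

Let dN_sig : measurable_fun setT (dN a b B : sigT_of (sig_N a) -> R).
Proof.
apply: measurableT_comp => // _ C mC; rewrite setTI /measurable/= sigma_algebra_id//.
by apply: sub_sigma_algebra; exists BB => //; exists C; rewrite ?setTI.
Qed.

Lemma E_dN (Y : T -> R) (C : R) : Fm a Y -> (forall w, `|Y w| <= C) ->
  P.-integrable setT (fun w => (Y w * (dN a b B w - h * l))%:E) /\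
  \int[P]_w (Y w * (dN a b B w - h * l)) = 0.
Proof.
move=> mY YC; have [i e] := dN_mean.
have mh : P.-integrable setT (EFin \o (fun=> h * l)).
  exact: finite_measure_integrable_cst.
have is_ : P.-integrable setT (EFin \o (fun w => dN a b B w - h * l)).
  by have := integrableB measurableT i mh; apply: eq_integrable.
have ind : independent P (F a) (sig_N a) by have [_ _ _ _ +] := prm; apply.
have ms : measurable_fun setT ((fun w => dN a b B w - h * l) : sigT_of (sig_N a) -> R).
  exact: measurable_funB.
have iY : P.-integrable setT (EFin \o Y).
  by apply: bounded_integrable YC; exact: Fm_measurable mY.
have [I ->] := indep_integral (F_sigma a0) (@F_meas a a0) sig_sN sig_N_meas ind mY ms iY is_.
split=> //; rewrite RintegralB// e Rintegral_prob_cst subrr mulr0//.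
Qed.

(** The independence of [W] and [N] enters here. The value is of order h^2, which makes the joint
    effect of a Brownian move and a jump negligible within one step. *)
Lemma E_dW_dN j : P.-integrable setT (fun w => (dW a b j w ^+ 2 * dN a b B w)%:E) /\
  \int[P]_w (dW a b j w ^+ 2 * dN a b B w) = h * (h * l).
Proof.
have [_ _ _ _ ind] := noise.
have sW : sigma_algebra setT <<s events `[0, +oo[ W >> by exact: smallest_sigma_algebra.
have sN : sigma_algebra setT <<s events (time_sets `[0, +oo[) (fun B w => N w B) >>.
  exact: smallest_sigma_algebra.
have mW : <<s events `[0, +oo[ W >> `<=` measurable.
  apply: sub_gen; first exact: sigma_algebra_measurable.
  move=> A [t /=]; rewrite in_itv/= andbT => t0 H; have [ad _ _ _] := bm.
  by apply: (F_meas t0); apply: (ad t t0); exists t.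
have mN' : <<s events (time_sets `[0, +oo[) (fun B w => N w B) >> `<=` measurable.
  apply: sub_gen; first exact: sigma_algebra_measurable.
  by move=> _ [A tA [C mC <-]]; have [+ _ _ _ _] := prm; apply.
have fW t : 0 <= t -> measurable_fun setT
    ((fun w => (W t w : 'cV[R]_d) j 0) : sigT_of <<s events `[0, +oo[ W >> -> R).
  move=> t0 _ D mD; rewrite setTI /measurable/= sigma_algebra_id//.
  apply: sub_sigma_algebra; exists t; first by rewrite /= in_itv/= t0.
  exists ((fun A : 'cV[R]_d => A j 0) @^-1` D); last by rewrite setTI.
  by rewrite -[X in measurable X]setTI; exact: coord_Borel.
have f1 : measurable_fun setT
    ((fun w => dW a b j w ^+ 2) : sigT_of <<s events `[0, +oo[ W >> -> R).
  by apply: measurable_funX; apply: measurable_funB; exact: fW.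
have f2 : measurable_fun setT (dN a b B :
    sigT_of <<s events (time_sets `[0, +oo[) (fun B w => N w B) >> -> R).
  apply: measurableT_comp => // _ C mC; rewrite setTI /measurable/= sigma_algebra_id//.
  by apply: sub_sigma_algebra; exists BB => //; exists C; rewrite ?setTI.
have [i1 e1] := dW_sqr j; have [i2 e2] := dN_mean.
have [I E] := indep_integral sW mW sN mN' ind f1 f2 i1 i2.
by split=> //; rewrite E e1 e2.
Qed.

End Jumps.

End Increment.
End Noise.

(** * The one-step estimate *)

Section ExpectationCalculus.
Context (R : realType) d (T : measurableType d) (mu : {measure set T -> \bar R}).
Implicit Types f g : T -> R.

(** Integrability is part of this notion and of the next: the real-valued integral is [fine] of an
    extended one, so a bare inequality would also accept the default value 0 of an infinite
    integral. *)
Definition int_zero f := mu.-integrable setT (EFin \o f) /\ \int[mu]_w f w = 0.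

Definition int_le f (c : R) := mu.-integrable setT (EFin \o f) /\ \int[mu]_w f w <= c.

Lemma eq_int_zero f g : f =1 g -> int_zero f -> int_zero g.
Proof. by move=> /funext ->. Qed.

Lemma int_zeroD f g : int_zero f -> int_zero g -> int_zero (fun w => f w + g w).
Proof.
move=> [fi f0] [gi g0]; split.
  by have := integrableD measurableT fi gi; apply: eq_integrable.
by rewrite RintegralD// f0 g0 addr0.
Qed.

Lemma int_zero_sum (I : Type) (s : seq I) (f : I -> T -> R) :
  (forall i, int_zero (f i)) -> int_zero (fun w => \sum_(i <- s) f i w).
Proof.
move=> H; elim: s => [|i s ih].
  apply: (@eq_int_zero (fun=> 0)) => [w|]; first by rewrite big_nil.
  split; first exact: integrable0.
  by rewrite /Rintegral integral0.
apply: (@eq_int_zero (fun w => f i w + \sum_(i <- s) f i w)) => [w|].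
  by rewrite big_cons.
exact: int_zeroD.
Qed.

Lemma int_leD f g (c c' : R) : int_le f c -> int_le g c' ->
  int_le (fun w => f w + g w) (c + c').
Proof.
move=> [fi f0] [gi g0]; split.
  by have := integrableD measurableT fi gi; apply: eq_integrable.
by rewrite RintegralD// lerD.
Qed.

Lemma int_leZ (k : R) f (c : R) : 0 <= k -> int_le f c ->
  int_le (fun w => k * f w) (k * c).
Proof.
move=> k0 [fi f0]; split.
  by have := integrableZl measurableT k fi; apply: eq_integrable.
by rewrite RintegralZl// ler_wpM2l.
Qed.

Lemma int_le_sum (I : Type) (s : seq I) (f : I -> T -> R) (c : R) :
  (forall i, int_le (f i) c) -> int_le (fun w => \sum_(i <- s) f i w) ((size s)%:R * c).
Proof.
move=> H; elim: s => [|i s ih].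
  under eq_fun do rewrite big_nil.
  split; first exact: integrable0.
  by rewrite /Rintegral integral0 mul0r.
under eq_fun do rewrite big_cons.
by rewrite /= -natr1 mulrDl mul1r addrC; exact: int_leD.
Qed.

Lemma abs_Rintegral_le f g : mu.-integrable setT (EFin \o f) ->
  mu.-integrable setT (EFin \o g) -> {ae mu, forall w, `|f w| <= g w} ->
  `|\int[mu]_w f w| <= \int[mu]_w g w.
Proof.
move=> fi gi fg; apply: le_trans (le_normr_Rintegral measurableT fi) _.
have gf : (\int[mu]_w (g w)%:E)%E \is a fin_num by exact: integrable_fin_num.
have nfi : mu.-integrable setT (fun w => `|f w|%:E) by exact: integrable_norm fi.
have nf : (\int[mu]_w `|f w|%:E)%E \is a fin_num by exact: integrable_fin_num.
have ngi : mu.-integrable setT (fun w => `|g w|%:E) by exact: integrable_norm gi.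
have E : (\int[mu]_w (g w)%:E = \int[mu]_w `|g w|%:E)%E.
  apply: ae_eq_integral => //.
  - by case/integrableP : gi.
  - by case/integrableP : ngi.
  - by apply: filterS fg => w fgw _; rewrite ger0_norm// (le_trans _ fgw).
rewrite /Rintegral fine_le// E.
apply: ae_ge0_le_integral => //.
- by case/integrableP : nfi.
- by case/integrableP : ngi.
- by apply: filterS fg => w fgw _; rewrite lee_fin (le_trans fgw)// ler_norm.
Qed.

End ExpectationCalculus.

Section MeasurableVectors.
Context (R : realType) dS (S : measurableType dS) (d : nat).
Implicit Types x y : S -> 'cV[R]_d.

(** Coordinatewise, so that the rules for real functions apply over any sigma-algebra, in particular
    over [sigT_of (F a)]. *)
Definition mvec y := forall i, measurable_fun setT (fun w => y w i 0).

Lemma mvecD x y : mvec x -> mvec y -> mvec (fun w => x w + y w).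
Proof.
move=> mx my i; under eq_fun do rewrite mxE.
exact: measurable_funD.
Qed.

Lemma mvecB x y : mvec x -> mvec y -> mvec (fun w => x w - y w).
Proof.
move=> mx my i; under eq_fun do rewrite !mxE.
exact: measurable_funB.
Qed.

Lemma mvecZ (a : S -> R) y : measurable_fun setT a -> mvec y ->
  mvec (fun w => a w *: y w).
Proof.
move=> ma my i; under eq_fun do rewrite mxE.
exact: measurable_funM.
Qed.

Lemma mvec_sum (I : Type) (s : seq I) (f : I -> S -> 'cV[R]_d) :
  (forall i, mvec (f i)) -> mvec (fun w => \sum_(i <- s) f i w).
Proof.
move=> mf j; under eq_fun do rewrite summxE.
by apply: measurable_sum => i; exact: mf.
Qed.

Lemma measurable_dotv x y : mvec x -> mvec y ->
  measurable_fun setT (fun w => dotv (x w) (y w)).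
Proof.
by move=> mx my; apply: measurable_sum => i; exact: measurable_funM.
Qed.

Variables (h h1 h2 : R -> R).
Hypothesis hc : continuous h.
Hypothesis h1c : continuous h1.
Hypothesis h2c : continuous h2.

Let mcomp (k : R -> R) y : continuous k -> mvec y ->
  measurable_fun setT (fun w => k (dotv (y w) (y w))).
Proof.
move=> ck my; apply: (measurableT_comp (f := k)); last exact: measurable_dotv.
exact: continuous_measurable_fun.
Qed.

Lemma measurable_tf y : mvec y -> measurable_fun setT (fun w => tf h (y w)).
Proof. exact: mcomp. Qed.

Lemma measurable_tg x y : mvec x -> mvec y ->
  measurable_fun setT (fun w => tg h1 (x w) (y w)).
Proof.
move=> mx my; apply: measurable_funM; last exact: measurable_dotv.
by apply: measurable_funM => //; exact: mcomp.
Qed.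

Lemma measurable_tD x y z : mvec x -> mvec y -> mvec z ->
  measurable_fun setT (fun w => tD h1 h2 (x w) (y w) (z w)).
Proof.
move=> mx my mz; apply: measurable_funD; apply: measurable_funM;
  do ?exact: measurable_dotv.
  by apply: measurable_funM => //; exact: mcomp.
apply: measurable_funM; last exact: measurable_dotv.
by apply: measurable_funM => //; exact: mcomp.
Qed.

Lemma measurable_tT x y : mvec x -> mvec y ->
  measurable_fun setT (fun w => tT h h1 (x w) (y w)).
Proof.
move=> mx my; apply: measurable_funB; last exact: measurable_tg.
by apply: measurable_funB; apply: measurable_tf => //; exact: mvecD.
Qed.

End MeasurableVectors.

Lemma measure_bigU_fin (R : realType) d (T : measurableType d)
    (mu : {measure set T -> \bar R}) (I : choiceType) (s : seq I) (F : I -> set T) :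
  uniq s -> (forall i, measurable (F i)) -> trivIset setT F ->
  mu (\big[setU/set0]_(i <- s) F i) = (\sum_(i <- s) mu (F i))%E.
Proof.
move=> us mF tF; elim: s us => [|i s ih /= /andP[ni us]].
  by rewrite !big_nil measure0.
have mU : measurable (\big[setU/set0]_(j <- s) F j) by elim/big_ind: _ => //; exact: measurableU.
rewrite !big_cons -(ih us); apply: measureU => //.
apply/seteqP; split => // x [Fi].
rewrite -bigcup_seq => -[k /= ks Fk].
have ik : i = k by apply: tF => //; exists x.
by move: ni; rewrite ik ks.
Qed.

Section TestAlgebra.
Variables (R : realType) (d : nat) (h h1 h2 : R -> R).
Implicit Types x y z : 'cV[R]_d.

Lemma tgDr y z z' : tg h1 y (z + z') = tg h1 y z + tg h1 y z'.
Proof. by rewrite /tg dotvDr mulrDr. Qed.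

Lemma tgZr y a z : tg h1 y (a *: z) = a * tg h1 y z.
Proof. by rewrite /tg dotvZr mulrCA. Qed.

Lemma tgNr y z : tg h1 y (- z) = - tg h1 y z.
Proof. by rewrite /tg dotvNr mulrN. Qed.

Lemma tg0r y : tg h1 y 0 = 0.
Proof. by rewrite /tg dotv0r mulr0. Qed.

Lemma tg_sumr (I : Type) (s : seq I) y (z : I -> 'cV[R]_d) :
  tg h1 y (\sum_(i <- s) z i) = \sum_(i <- s) tg h1 y (z i).
Proof. by rewrite (big_morph _ (tgDr y) (tg0r y)). Qed.

Lemma tDC y z z' : tD h1 h2 y z z' = tD h1 h2 y z' z.
Proof. by rewrite /tD (dotvC z); congr +%R; ring. Qed.

Lemma tDDr y x z z' : tD h1 h2 y x (z + z') = tD h1 h2 y x z + tD h1 h2 y x z'.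
Proof. by rewrite /tD !dotvDr; ring. Qed.

Lemma tDZr y x a z : tD h1 h2 y x (a *: z) = a * tD h1 h2 y x z.
Proof. by rewrite /tD !dotvZr; ring. Qed.

Lemma tD0r y x : tD h1 h2 y x 0 = 0.
Proof. by rewrite /tD !dotv0r !mulr0 addr0. Qed.

Lemma tD_sumr (I : Type) (s : seq I) y x (z : I -> 'cV[R]_d) :
  tD h1 h2 y x (\sum_(i <- s) z i) = \sum_(i <- s) tD h1 h2 y x (z i).
Proof. by rewrite (big_morph _ (tDDr y x) (tD0r y x)). Qed.

Lemma tDDl y x x' z : tD h1 h2 y (x + x') z = tD h1 h2 y x z + tD h1 h2 y x' z.
Proof. by rewrite tDC tDDr !(tDC _ z). Qed.

Lemma tDZl y x a z : tD h1 h2 y (a *: x) z = a * tD h1 h2 y x z.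
Proof. by rewrite tDC tDZr tDC. Qed.

Lemma tD_suml (I : Type) (s : seq I) y z (x : I -> 'cV[R]_d) :
  tD h1 h2 y (\sum_(i <- s) x i) z = \sum_(i <- s) tD h1 h2 y (x i) z.
Proof. by rewrite tDC tD_sumr; apply: eq_bigr => i _; rewrite tDC. Qed.

Lemma frob_sumv (I : Type) (s : seq I) (x : I -> 'cV[R]_d) :
  frob (\sum_(i <- s) x i) <= \sum_(i <- s) frob (x i).
Proof.
elim: s => [|i s ih]; first by rewrite !big_nil frob0.
by rewrite !big_cons (le_trans (frobD _ _))// lerD2l.
Qed.

End TestAlgebra.

(* The pathwise expansion behind the one-step estimate: [x j] and [m k] stand
   for the increments of [W] and [N], and [n] is the total number of jumps. *)
Section StepExpansion.
Variables (R : realType) (d : nat) (h h1 h2 : R -> R).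
Variables (C0 : R) (C01 : 1 <= C0).
Hypothesis tf_le : forall y : 'cV[R]_d, `|tf h y| <= C0.
Hypothesis tD_le : forall y z z' : 'cV[R]_d, `|tD h1 h2 y z z'| <= C0 * (frob z * frob z').
Hypothesis tf_lip : forall y z : 'cV[R]_d, `|tf h (y + z) - tf h y| <= C0 * frob z.
Hypothesis tT_le : forall y z : 'cV[R]_d, `|tT h h1 y z| <= C0 * frob z ^+ 2.
Variables (e1 dl : R) (e10 : 0 < e1) (dl0 : 0 < dl).
Hypothesis taylor : forall y z : 'cV[R]_d, frob z <= dl ->
  `|tT h h1 y z - tD h1 h2 y z z / 2| <= e1 * frob z ^+ 2.
Variables (K Lam : R) (K0 : 0 <= K) (Lam0 : 0 <= Lam).
Variables (I : finType) (y b : 'cV[R]_d) (S : 'M[R]_d) (C : I -> 'cV[R]_d) (l : I -> R).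
Hypothesis bK : frob b <= K.
Hypothesis SK : forall j, frob (col j S) <= K.
Hypothesis CK : forall k, frob (C k) <= K.
Hypothesis l0 : forall k, 0 <= l k.
Hypothesis lLam : \sum_k l k <= Lam.
Variables (r : R) (x : 'I_d -> R) (m : I -> nat).
Hypotheses (r0 : 0 < r) (r1 : r <= 1).
Let t := r ^+ 2.
Let n := (\sum_k m k)%N.

(* Generator, increment and martingale part of a step; [tf], [tg], [tD] and [tT] are the
   value of y |-> h(|y|^2), its first and second derivatives, and its first-order Taylor
   remainder. *)
Definition step_gen : R :=
  tg h1 y b + (\sum_j tD h1 h2 y (col j S) (col j S)) / 2 + \sum_k l k * tT h h1 y (C k).

Definition step_incr : 'cV[R]_d :=
  t *: b + \sum_j x j *: col j S + \sum_k ((m k)%:R - t * l k) *: C k.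

Definition step_mart : R :=
  \sum_j tg h1 y (col j S) * x j
  + \sum_i \sum_j tD h1 h2 y (col i S) (col j S) / 2 * (x i * x j - t *+ (i == j))
  + \sum_k (tf h (y + C k) - tf h y) * ((m k)%:R - t * l k).

Let C00 : 0 <= C0. Proof. exact: le_trans ler01 C01. Qed.
(** The compensator of the jumps is moved into the drift. The increment becomes [z + J], a
    continuous part plus a sum over actual jumps, and the expansion has four sources of error:
    Taylor's formula for [z] ([R1]), several jumps ([R2]), a jump together with [z] ([X3]), and the
    drift inside the second-order term ([R4]). *)
Let b' := b - \sum_k l k *: C k.
Let z := t *: b' + \sum_j x j *: col j S.
Let J := \sum_k (m k)%:R *: C k.
Let K1 := K + Lam * K.
Let K10 : 0 <= K1. Proof. by rewrite addr_ge0// mulr_ge0. Qed.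
Let t0 : 0 < t. Proof. by rewrite exprn_gt0. Qed.
Let w2 := \sum_j x j ^+ 2.
Let w20 : 0 <= w2. Proof. by apply: sumr_ge0 => j _; rewrite sqr_ge0. Qed.
Let w4 := \sum_j x j ^+ 4.

Let incrE : step_incr = z + J.
Proof.
rewrite /step_incr /z /b' /J scalerBr scaler_sumr.
have -> : \sum_k ((m k)%:R - t * l k) *: C k =
    \sum_k (m k)%:R *: C k - \sum_k t *: (l k *: C k).
  by rewrite -sumrB; apply: eq_bigr => k _; rewrite scalerBl scalerA.
rewrite -!addrA; congr +%R; rewrite [RHS]addrCA; congr +%R.
by rewrite addrC.
Qed.

Let b'K : frob b' <= K1.
Proof.
apply: le_trans (frobD _ _) _; rewrite frobN; apply: lerD => //.
apply: le_trans (frob_sumv _ _) _.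
apply: (@le_trans _ _ (\sum_k l k * K)).
  by apply: ler_sum => k _; rewrite frobZ ger0_norm// ler_wpM2l.
by rewrite -mulr_suml ler_wpM2r.
Qed.

Let sumx : (\sum_j `|x j|) ^+ 2 <= d%:R * w2.
Proof.
pose u : 'cV[R]_d := \col_j `|x j|; pose o : 'cV[R]_d := \col_j 1.
have := dotv_le u o.
have -> : dotv u o = \sum_j `|x j|.
  by apply: eq_bigr => j _; rewrite !mxE mulr1.
rewrite ger0_norm ?sumr_ge0// => H.
apply: (@le_trans _ _ ((frob u * frob o) ^+ 2)).
  by rewrite lerXn2r// nnegrE ?sumr_ge0// mulr_ge0 ?frob_ge0.
rewrite exprMn !frob_dotv mulrC le_eqVlt; apply/orP; left; apply/eqP; congr (_ * _).
  by rewrite /dotv; under eq_bigr do rewrite !mxE mulr1; rewrite sumr_const card_ord.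
by apply: eq_bigr => j _; rewrite !mxE -expr2 real_normK ?num_real.
Qed.

Let zK : frob z ^+ 2 <= 2 * (1 + d%:R) * K1 ^+ 2 * (t ^+ 2 + w2).
Proof.
have KK1 : K <= K1 by rewrite lerDl mulr_ge0.
have H : frob z <= K1 * t + K1 * \sum_j `|x j|.
  apply: le_trans (frobD _ _) _; apply: lerD.
    by rewrite frobZ gtr0_norm// mulrC ler_wpM2r// ltW.
  apply: le_trans (frob_sumv _ _) _; rewrite mulr_sumr; apply: ler_sum => j _.
  by rewrite frobZ mulrC ler_wpM2r// (le_trans (SK j)).
set s := \sum_j `|x j| in H *.
have s0 : 0 <= s by rewrite sumr_ge0.
apply: (@le_trans _ _ ((K1 * t + K1 * s) ^+ 2)).
  by rewrite lerXn2r// nnegrE ?frob_ge0// addr_ge0// mulr_ge0// ltW.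
apply: (@le_trans _ _ (2 * K1 ^+ 2 * (t ^+ 2 + s ^+ 2))).
  rewrite [leLHS](_ : _ = K1 ^+ 2 * (t + s) ^+ 2); last by ring.
  rewrite [leRHS](_ : _ = K1 ^+ 2 * (2 * (t ^+ 2 + s ^+ 2))); last by ring.
  apply: ler_wpM2l; first exact: sqr_ge0.
  by have := sqr_ge0 (t - s); lra.
rewrite [leRHS](_ : _ = 2 * K1 ^+ 2 * ((1 + d%:R) * (t ^+ 2 + w2))); last by ring.
apply: ler_wpM2l; first by rewrite mulr_ge0 ?sqr_ge0.
have := sumx; rewrite -/s; have d0 : 0 <= d%:R :> R by rewrite ler0n.
have := mulr_ge0 d0 (sqr_ge0 t); have := w20.
by move: (d%:R) (t ^+ 2) (s ^+ 2) (w2) => D u v u'; lra.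
Qed.

Let K2 := 2 * (1 + d%:R) * K1 ^+ 2.
Let K20 : 0 <= K2. Proof. by rewrite !mulr_ge0 ?sqr_ge0. Qed.

Let w24 : w2 ^+ 2 <= d%:R * w4.
Proof.
pose u : 'cV[R]_d := \col_j (x j ^+ 2); pose o : 'cV[R]_d := \col_j 1.
have := dotv_le u o.
have -> : dotv u o = w2.
  by apply: eq_bigr => j _; rewrite !mxE mulr1.
rewrite ger0_norm// => H.
apply: (@le_trans _ _ ((frob u * frob o) ^+ 2)).
  by rewrite lerXn2r// nnegrE ?mulr_ge0 ?frob_ge0.
rewrite exprMn !frob_dotv mulrC le_eqVlt; apply/orP; left; apply/eqP; congr (_ * _).
  by rewrite /dotv; under eq_bigr do rewrite !mxE mulr1; rewrite sumr_const card_ord.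
by apply: eq_bigr => j _; rewrite !mxE -exprD.
Qed.

Let R1 := tT h h1 y z - tD h1 h2 y z z / 2.

(** For |z| > [dl] the quadratic bound on the remainder is traded for |z|^4 / dl^2; this is where
    the fourth moments of the Brownian increment enter. *)
Let R1_le : `|R1| <= e1 * (K2 * (t ^+ 2 + w2)) +
  2 * C0 / dl ^+ 2 * (2 * K2 ^+ 2 * (t ^+ 4 + d%:R * w4)).
Proof.
have w40 : 0 <= w4 by apply: sumr_ge0 => j _; rewrite exprn_even_ge0.
have tw : 0 <= t ^+ 2 + w2 by rewrite addr_ge0 ?sqr_ge0.
have tw4 : 0 <= t ^+ 4 + d%:R * w4 by rewrite addr_ge0 ?exprn_even_ge0// mulr_ge0.
have [zd|dz] := leP (frob z) dl.
  apply: le_trans (taylor _ zd) _.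
  apply: (@le_trans _ _ (e1 * (K2 * (t ^+ 2 + w2)))); first by rewrite ler_wpM2l// ltW.
  by rewrite lerDl !mulr_ge0 ?invr_ge0 ?sqr_ge0.
apply: (@le_trans _ _ (2 * C0 * frob z ^+ 2)).
  apply: le_trans (ler_normB _ _) _.
  have := tT_le y z; have := tD_le y z z; rewrite -expr2 normrM [`|2^-1|]gtr0_norm ?invr_gt0//.
  have := mulr_ge0 C00 (sqr_ge0 (frob z)); move: `|tT _ _ _ _| `|tD _ _ _ _ _| => u v; lra.
apply: (@le_trans _ _ (2 * C0 / dl ^+ 2 * (2 * K2 ^+ 2 * (t ^+ 4 + d%:R * w4)))); last first.
  by rewrite lerDr !mulr_ge0// ltW.
rewrite [leRHS](_ : _ = 2 * C0 * ((dl ^+ 2)^-1 * (2 * K2 ^+ 2 * (t ^+ 4 + d%:R * w4))));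
  last by rewrite !mulrA.
rewrite ler_wpM2l ?mulr_ge0// ler_pdivlMl ?exprn_gt0//.
apply: (@le_trans _ _ ((K2 * (t ^+ 2 + w2)) ^+ 2)).
  apply: (@le_trans _ _ (frob z ^+ 2 * frob z ^+ 2)).
    by rewrite ler_wpM2r ?sqr_ge0// lerXn2r// ?nnegrE ?frob_ge0 ?ltW.
  by rewrite [leRHS]expr2; apply: ler_pM; rewrite ?sqr_ge0.
rewrite [leRHS](_ : _ = K2 ^+ 2 * (2 * (t ^+ 4 + d%:R * w4))); last by ring.
rewrite exprMn ler_wpM2l ?sqr_ge0//.
by have := sqr_ge0 (t ^+ 2 - w2); have := w24; lra.
Qed.

Let R2 := tf h (y + J) - tf h y - \sum_k (m k)%:R * (tf h (y + C k) - tf h y).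

(** The term is zero for at most one jump. For n >= 2 the crude bound 2 C0 (1 + n) is below 4 C0
    (n^2 - n), whose mean is of second order. *)
Let R2_le : `|R2| <= 4 * C0 * (n%:R ^+ 2 - n%:R).
Proof.
have dC (u : 'cV[R]_d) : `|tf h u - tf h y| <= 2 * C0.
  by apply: le_trans (ler_normB _ _) _; have := tf_le u; have := tf_le y; lra.
have [n2|n2] := leqP 2 n.
  have Sm : `|\sum_k (m k)%:R * (tf h (y + C k) - tf h y)| <= n%:R * (2 * C0).
    apply: le_trans (ler_norm_sum _ _ _) _.
    rewrite /n natr_sum mulr_suml; apply: ler_sum => k _.
    by rewrite normrM ger0_norm// ler_wpM2l.
  apply: le_trans (ler_normB _ _) _.
  have H1 := dC (y + J); have n2' : 2 <= n%:R :> R by rewrite ler_nat.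
  apply: le_trans (lerD H1 Sm) _; move: n2'; move: (n%:R) => w w2'.
  rewrite -subr_ge0 (_ : _ - _ = C0 * (2 * (w - 2) * (2 * w + 1) + 2)); last by ring.
  by rewrite mulr_ge0// addr_ge0// !mulr_ge0//; lra.
have -> : R2 = 0.
  case: (posnP n) => [n0|n0].
    have m0 k : m k = 0%N.
      by apply/eqP; rewrite -leqn0 -n0 /n (bigD1 k)//= leq_addr.
    rewrite /R2 /J big1 => [|k _]; last by rewrite m0 scale0r.
    by rewrite addr0 subrr big1 ?subr0// => k _; rewrite m0 mul0r.
  have n1 : n = 1%N by apply/eqP; rewrite eqn_leq n0 andbT -ltnS.
  have [k mk] : exists k, (0 < m k)%N.
    apply/existsP; move: n0; apply: contraTT; rewrite negb_exists => /forallP H.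
    by rewrite /n big1// => k _; apply/eqP; rewrite -leqn0 leqNgt H.
  have mk1 : m k = 1%N.
    by apply/eqP; rewrite eqn_leq mk andbT -n1 /n (bigD1 k)//= leq_addr.
  have mj j : j != k -> m j = 0%N.
    move=> jk; have := n1; rewrite /n (bigD1 k)//= mk1 add1n (bigD1 j)//= => -[] /eqP.
    by rewrite addn_eq0 => /andP[/eqP ->].
  rewrite /R2 /J (bigD1 k)//= big1 => [|j /mj ->]; last by rewrite scale0r.
  rewrite (bigD1 k)//= big1 => [|j /mj ->]; last by rewrite mul0r.
  by rewrite mk1 scale1r mul1r !addr0 subrr.
rewrite normr0; have : n%:R * (n%:R - 1) >= 0 :> R.
  by move: n2; case: (n) => [|[|]]//; rewrite ?mul0r// subrr mulr0.
by have := C00; nra.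
Qed.

Let X3 := tf h (y + J + z) - tf h (y + J) - (tf h (y + z) - tf h y).

(** The term is zero without a jump. Otherwise 2 |z| is split as |z|^2 / r + r, with r the square
    root of the step, and multiplied by n >= 1: in mean the result is of order t r. *)
Let X3_le : `|X3| <= C0 * ((K2 * (t ^+ 2 + w2) / r + r) * n%:R).
Proof.
have rr : r != 0 by rewrite gt_eqF.
case: (posnP n) => [n0|n0].
  have m0 k : m k = 0%N.
    by apply/eqP; rewrite -leqn0 -n0 /n (bigD1 k)//= leq_addr.
  rewrite /X3 /J big1 => [|k _]; last by rewrite m0 scale0r.
  by rewrite addr0 subrr normr0 n0 !mulr0.
have n1 : 1 <= n%:R :> R by rewrite ler1n.
apply: (@le_trans _ _ (2 * C0 * frob z)).
  apply: le_trans (ler_normB _ _) _.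
  have := tf_lip (y + J) z; have := tf_lip y z; lra.
have fz : 2 * frob z <= frob z ^+ 2 / r + r.
  rewrite -subr_ge0 (_ : _ - _ = (frob z - r) ^+ 2 / r); last by field.
  by rewrite divr_ge0 ?sqr_ge0// ltW.
have q0 : 0 <= K2 * (t ^+ 2 + w2) / r + r.
  by rewrite addr_ge0 ?(ltW r0)// divr_ge0 ?(ltW r0)// mulr_ge0// addr_ge0 ?sqr_ge0.
apply: (@le_trans _ _ (C0 * (K2 * (t ^+ 2 + w2) / r + r))).
  rewrite [leLHS](_ : _ = C0 * (2 * frob z)); last by ring.
  apply: ler_wpM2l => //; apply: le_trans fz _.
  by rewrite lerD2r; apply: ler_wpM2r; [rewrite invr_ge0 ltW|exact: zK].
by apply: ler_wpM2l => //; rewrite ler_peMr.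
Qed.

Let R4 := t ^+ 2 * tD h1 h2 y b' b' / 2 + t * \sum_j x j * tD h1 h2 y b' (col j S).

Let R4_le : `|R4| <= C0 * K1 ^+ 2 * (t ^+ 2 + r * (d%:R * t + w2)).
Proof.
have KK1 : K <= K1 by rewrite lerDl mulr_ge0.
apply: le_trans (ler_normD _ _) _.
have B1 : `|tD h1 h2 y b' b'| <= C0 * K1 ^+ 2.
  apply: le_trans (tD_le _ _ _) _; rewrite ler_wpM2l// expr2.
  by apply: ler_pM; rewrite ?frob_ge0.
have B2 j : `|tD h1 h2 y b' (col j S)| <= C0 * K1 ^+ 2.
  apply: le_trans (tD_le _ _ _) _; rewrite ler_wpM2l// expr2.
  by apply: ler_pM; rewrite ?frob_ge0// (le_trans (SK j)).
have CK0 : 0 <= C0 * K1 ^+ 2 by rewrite mulr_ge0 ?sqr_ge0.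
rewrite [leRHS]mulrDr; apply: lerD.
  rewrite normrM normrM [`|2^-1|]gtr0_norm ?invr_gt0// (ger0_norm (sqr_ge0 t)).
  have t2 : 0 <= t ^+ 2 by rewrite sqr_ge0.
  move: (t ^+ 2) t2 B1 CK0 => a a0; move: `|tD _ _ _ _ _| (C0 * _) => u v uv v0.
  have : a * u <= a * v by rewrite ler_wpM2l.
  by have := mulr_ge0 a0 v0; lra.
rewrite normrM (gtr0_norm t0).
apply: (@le_trans _ _ (t * \sum_j `|x j| * (C0 * K1 ^+ 2))).
  rewrite ler_wpM2l ?(ltW t0)//; apply: le_trans (ler_norm_sum _ _ _) _.
  by apply: ler_sum => j _; rewrite normrM ler_wpM2l.
rewrite [leLHS](_ : _ = C0 * K1 ^+ 2 * (t * \sum_j `|x j|)); last by rewrite -mulr_suml; ring.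
rewrite ler_wpM2l//.
have -> : d%:R * t + w2 = \sum_j (t + x j ^+ 2).
  by rewrite big_split/= sumr_const card_ord mulr_natl.
rewrite !mulr_sumr; apply: ler_sum => j _.
rewrite -(real_normK (num_real (x j))) /t expr2 -mulrA ler_wpM2l ?(ltW r0)//.
have := normr_ge0 (x j); move: `|x j| => u u0.
by have := sqr_ge0 (r - u); have := mulr_ge0 (ltW r0) u0; lra.
Qed.

Let decomposition :
  tf h (y + step_incr) - tf h y - t * step_gen - step_mart = R1 + R4 + R2 + X3.
Proof.
have E1 : tf h (y + step_incr) - tf h y = X3 + (tT h h1 y z + tg h1 y z) + (tf h (y + J) - tf h y).
  rewrite incrE /X3 /tT -[y + J + z]addrA [J + z]addrC; ring.
have E2 : tg h1 y z = t * tg h1 y b - t * \sum_k l k * tg h1 y (C k)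
    + \sum_j tg h1 y (col j S) * x j.
  rewrite /z tgDr tgZr /b' tgDr tgNr !tg_sumr mulrBr; congr (_ - _ * _ + _).
    by apply: eq_bigr => k _; rewrite tgZr.
  by apply: eq_bigr => j _; rewrite tgZr mulrC.
have E3 : tD h1 h2 y z z / 2 = R4 +
    \sum_i \sum_j tD h1 h2 y (col i S) (col j S) / 2 * (x i * x j).
  have -> : \sum_i \sum_j tD h1 h2 y (col i S) (col j S) / 2 * (x i * x j) =
      tD h1 h2 y (\sum_j x j *: col j S) (\sum_j x j *: col j S) / 2.
    rewrite tD_suml mulr_suml; apply: eq_bigr => i _.
    rewrite tD_sumr mulr_suml; apply: eq_bigr => j _.
    by rewrite tDZl tDZr; ring.
  rewrite /R4; have -> : \sum_j x j * tD h1 h2 y b' (col j S) = tD h1 h2 y b' (\sum_j x j *: col j S).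
    by rewrite tD_sumr; apply: eq_bigr => j _; rewrite tDZr.
  rewrite /z; set s := \sum_j x j *: col j S.
  move: (b') => b1; rewrite tDDl !tDDr !tDZl !tDZr [tD _ _ _ s b1]tDC.
  by field.
have E4 : \sum_i \sum_j tD h1 h2 y (col i S) (col j S) / 2 * (x i * x j - t *+ (i == j)) =
   \sum_i \sum_j tD h1 h2 y (col i S) (col j S) / 2 * (x i * x j)
   - t * ((\sum_j tD h1 h2 y (col j S) (col j S)) / 2).
  rewrite mulr_suml mulr_sumr -sumrB; apply: eq_bigr => i _.
  under eq_bigr do rewrite mulrBr.
  rewrite sumrB; congr (_ - _); rewrite (bigD1 i)//= eqxx big1 ?addr0.
    by rewrite mulrC.
  by move=> j /negbTE ji; rewrite eq_sym ji mulr0n mulr0.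
have E5 : t * \sum_k l k * tT h h1 y (C k) =
   t * \sum_k l k * (tf h (y + C k) - tf h y) - t * \sum_k l k * tg h1 y (C k).
  rewrite -mulrBr -sumrB; congr (_ * _); apply: eq_bigr => k _.
  by rewrite /tT mulrBr.
have E6 : \sum_k (tf h (y + C k) - tf h y) * ((m k)%:R - t * l k) =
   \sum_k (m k)%:R * (tf h (y + C k) - tf h y) - t * \sum_k l k * (tf h (y + C k) - tf h y).
  rewrite mulr_sumr -sumrB; apply: eq_bigr => k _; ring.
rewrite E1 E2 /step_gen /step_mart E4 E6 !mulrDr E5 /R1 /R2.
by rewrite E3; ring.
Qed.

(** The noise enters only through [w2], [w4], [n], n^2 and the product of [w2] and [n], all of which
    have known mean bounds. *)
Definition step_bound : R :=
  (e1 * (K2 * (t ^+ 2 + w2)) + 2 * C0 / dl ^+ 2 * (2 * K2 ^+ 2 * (t ^+ 4 + d%:R * w4)))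
  + C0 * K1 ^+ 2 * (t ^+ 2 + r * (d%:R * t + w2))
  + 4 * C0 * (n%:R ^+ 2 - n%:R)
  + C0 * ((K2 * (t ^+ 2 + w2) / r + r) * n%:R).

Lemma step_expansion :
  `|tf h (y + step_incr) - tf h y - t * step_gen - step_mart| <= step_bound.
Proof.
rewrite decomposition /step_bound.
apply: le_trans (ler_normD _ _) _; apply: lerD; last exact: X3_le.
apply: le_trans (ler_normD _ _) _; apply: lerD; last exact: R2_le.
by apply: le_trans (ler_normD _ _) _; apply: lerD; [exact: R1_le|exact: R4_le].
Qed.

End StepExpansion.

Lemma size_index_ord n : size (index_enum 'I_n) = n.
Proof. by rewrite -[RHS](card_ord n) cardE /index_enum unlock -enumT. Qed.

(** * Expectation of one step against a weight from the past *)

Section OneStep.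
Context (R : realType) (dT : measure_display) (T : measurableType dT).
Variables (P : probability T R) (F : R -> set (set T)).
Context (dU : measure_display) (U : measurableType dU).
Variables (nu : {sigma_finite_measure set U -> \bar R}) (d : nat).
Variables (W : R -> T -> Borel 'cV[R]_d)
          (N : T -> {measure set (R * U) -> \bar R}).
Hypothesis noise : driving_noise P F nu W N.
Variables (h h1 h2 : R -> R) (C0 : R).
Hypothesis hc : continuous h.
Hypothesis h1c : continuous h1.
Hypothesis h2c : continuous h2.
Hypothesis C01 : 1 <= C0.
Hypothesis tf_le : forall y : 'cV[R]_d, `|tf h y| <= C0.
Hypothesis tg_le : forall y z : 'cV[R]_d, `|tg h1 y z| <= C0 * frob z.
Hypothesis tD_le : forall y z z' : 'cV[R]_d, `|tD h1 h2 y z z'| <= C0 * (frob z * frob z').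
Hypothesis tf_lip : forall y z : 'cV[R]_d, `|tf h (y + z) - tf h y| <= C0 * frob z.
Hypothesis tT_le : forall y z : 'cV[R]_d, `|tT h h1 y z| <= C0 * frob z ^+ 2.
Hypothesis taylor : forall e : R, 0 < e -> exists2 dl, 0 < dl & forall y z : 'cV[R]_d,
  frob z <= dl -> `|tT h h1 y z - tD h1 h2 y z z / 2| <= e * frob z ^+ 2.

Let C00 : 0 <= C0. Proof. exact: le_trans ler01 C01. Qed.

Definition noise_incr (a b : R) (I : finType) (B : I -> set U) (bt : 'cV[R]_d)
    (S : 'M[R]_d) (C : I -> 'cV[R]_d) (w : T) : 'cV[R]_d :=
  (b - a) *: bt + \sum_j dW W a b j w *: col j S
  + \sum_k (dN N a b (B k) w - (b - a) * fine (nu (B k))) *: C k.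

Section Fixed.
Variables (K Lam e1 dl : R) (K0 : 0 <= K) (Lam0 : 0 <= Lam) (e10 : 0 < e1) (dl0 : 0 < dl).
Hypothesis taylor1 : forall y z : 'cV[R]_d,
  frob z <= dl -> `|tT h h1 y z - tD h1 h2 y z z / 2| <= e1 * frob z ^+ 2.
Variables (a b : R) (a0 : 0 <= a) (ab : a < b) (ba1 : b - a <= 1).
Variables (I : finType) (B : I -> set U).
Hypothesis mB : forall k, measurable (B k).
Hypothesis fB : forall k, (nu (B k) < +oo)%E.
Hypothesis tB : trivIset setT B.
Let l k := fine (nu (B k)).
Hypothesis lLam : \sum_k l k <= Lam.
Variables (y bt : T -> 'cV[R]_d) (S : T -> 'M[R]_d) (C : I -> T -> 'cV[R]_d).
Hypothesis my : mvec (y : sigT_of (F a) -> _).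
Hypothesis mbt : mvec (bt : sigT_of (F a) -> _).
Hypothesis mS : forall j, mvec ((fun w => col j (S w)) : sigT_of (F a) -> _).
Hypothesis mC : forall k, mvec (C k : sigT_of (F a) -> _).
Hypothesis btK : forall w, frob (bt w) <= K.
Hypothesis SK : forall j w, frob (col j (S w)) <= K.
Hypothesis CK : forall k w, frob (C k w) <= K.
Variable Y : T -> R.
Hypothesis mY : Fm F a Y.
Hypothesis Y01 : forall w, 0 <= Y w <= 1.

Let t := b - a.
Let r := Num.sqrt t.
Let t0 : 0 < t. Proof. by rewrite subr_gt0. Qed.
Let r0 : 0 < r. Proof. by rewrite sqrtr_gt0. Qed.
Let rr : r ^+ 2 = t. Proof. by rewrite sqr_sqrtr// ltW. Qed.
Let r1 : r <= 1. Proof. by rewrite -sqrtr1 ler_sqrt. Qed.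
Let l0 k : 0 <= l k. Proof. exact: fine_ge0. Qed.
Let Lsum0 : 0 <= \sum_k l k. Proof. by apply: sumr_ge0. Qed.

Let D w := noise_incr a b B (bt w) (S w) (C^~ w) w.
Let G w := step_gen h h1 h2 (y w) (bt w) (S w) (C^~ w) l.

Let M w : R :=
  \sum_j tg h1 (y w) (col j (S w)) * dW W a b j w
  + \sum_i \sum_j tD h1 h2 (y w) (col i (S w)) (col j (S w)) / 2 *
      (dW W a b i w * dW W a b j w - t *+ (i == j))
  + \sum_k (tf h (y w + C k w) - tf h (y w)) * (dN N a b (B k) w - t * l k).

Let Y1 w : `|Y w| <= 1.
Proof. by have /andP[Y0 Yl] := Y01 w; rewrite ger0_norm. Qed.

(** Each summand is a factor known at time [a] times a centred increment. The bound [K] on the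
    coefficients makes these factors bounded, as the independence lemmas require. *)
Let YM_zero : int_zero P (fun w => Y w * M w).
Proof.
have yC (X : T -> R) (c : R) : 0 <= c -> (forall w, `|X w| <= c) ->
    forall w, `|Y w * X w| <= c.
  by move=> c0 H w; rewrite normrM -(mul1r c); exact: ler_pM.
apply: (@eq_int_zero _ _ _ _ (fun w =>
  \sum_j (Y w * tg h1 (y w) (col j (S w))) * dW W a b j w
  + \sum_i \sum_j (Y w * (tD h1 h2 (y w) (col i (S w)) (col j (S w)) / 2)) *
      (dW W a b i w * dW W a b j w - t *+ (i == j))
  + \sum_k (Y w * (tf h (y w + C k w) - tf h (y w))) * (dN N a b (B k) w - t * l k))).
  move=> w; rewrite /M !mulrDr; congr (_ + _ + _).
  - by rewrite [RHS]mulr_sumr; apply: eq_bigr => j _; rewrite mulrA.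
  - rewrite [RHS]mulr_sumr; apply: eq_bigr => i _.
    by rewrite [RHS]mulr_sumr; apply: eq_bigr => j _; rewrite -[LHS]mulrA.
  - by rewrite [RHS]mulr_sumr; apply: eq_bigr => j _; rewrite mulrA.
apply: int_zeroD; first apply: int_zeroD.
- apply: int_zero_sum => j; apply: (E_dW noise a0 ab (C := C0 * K)).
    by apply: measurable_funM => //; exact: measurable_tg.
  apply: yC; first by rewrite mulr_ge0.
  by move=> w; apply: le_trans (tg_le _ _) _; exact: ler_wpM2l.
- apply: int_zero_sum => i; apply: int_zero_sum => j.
  apply: (E_dW_cross noise a0 ab (C := C0 * (K * K) / 2)).
    apply: measurable_funM => //; apply: measurable_funM => //.
    exact: measurable_tD.
  apply: yC; first by rewrite divr_ge0// !mulr_ge0.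
  move=> w; rewrite normrM [`|2^-1|]gtr0_norm ?invr_gt0// ler_wpM2r//.
  by apply: le_trans (tD_le _ _ _) _; rewrite ler_wpM2l// ler_pM ?frob_ge0.
- apply: int_zero_sum => k; apply: (E_dN noise a0 ab (mB k) (fB k) (C := C0 * K)).
    apply: measurable_funM => //; apply: measurable_funB; apply: measurable_tf => //.
    exact: mvecD.
  apply: yC; first by rewrite mulr_ge0.
  by move=> w; apply: le_trans (tf_lip _ _) _; exact: ler_wpM2l.
Qed.

(** The marks are disjoint, so the total number of jumps is the count of their union, again a
    Poisson variable; its second factorial moment also covers pairs of jumps with different
    marks. *)
Let Btot := \big[setU/set0]_k B k.

Let mBtot : measurable Btot.
Proof. by rewrite /Btot; elim/big_ind: _ => //; exact: measurableU. Qed.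

Let nuBtot : nu Btot = (\sum_k l k)%:E.
Proof.
rewrite /Btot measure_bigU_fin ?index_enum_uniq//.
by rewrite -sumEFin; apply: eq_bigr => k _; rewrite /l fineK// ge0_fin_numE.
Qed.

Let fBtot : (nu Btot < +oo)%E. Proof. by rewrite nuBtot ltry. Qed.

Let lBtot : fine (nu Btot) = \sum_k l k. Proof. by rewrite nuBtot. Qed.

Let n w := dN N a b Btot w.

(** The pathwise expansion asks for integer jump counts; they are available almost surely, and
    disjointness makes their sum the count of the union. *)
Let good : {ae P, forall w, exists m : I -> nat,
  (forall k, dN N a b (B k) w = (m k)%:R) /\ n w = (\sum_k m k)%N%:R}.
Proof.
have : {ae P, forall w, forall k, exists m : nat, N w (`]a, b] `*` B k) = m%:R%:E}.
  apply: filter_forall => k; exact: (dN_ae noise a0 ab (mB k) (fB k)).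
apply: filterS => w /choice[m Hm]; exists m; split=> [k|]; first by rewrite /dN Hm.
have E : `]a, b] `*` Btot = \big[setU/set0]_k (`]a, b] `*` B k).
  rewrite /Btot; apply: (big_morph (fun X => `]a, b]%classic `*` X)).
    by move=> X X'; apply/seteqP; split => -[u v] /=; tauto.
  by apply/seteqP; split => -[u v] /= => [[]|].
rewrite /n /dN E measure_bigU_fin ?index_enum_uniq//.
- rewrite (eq_bigr (fun k => (m k)%:R%:E)) => [|k _]; last exact: Hm.
  by rewrite sumEFin /= natr_sum.
- by move=> k; apply: measurableX => //; exact: measurable_itv.
- move=> i j _ _ [[u v] [[_ /= Bi] [_ /= Bj]]].
  by apply: tB => //; exists v.
Qed.

Let w2 w := \sum_j dW W a b j w ^+ 2.
Let w4 w := \sum_j dW W a b j w ^+ 4.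

Let w2_le : int_le P w2 (d%:R * t).
Proof.
have := @int_le_sum R _ T P 'I_d (index_enum 'I_d) (fun j w => dW W a b j w ^+ 2) t.
rewrite size_index_ord.
by apply=> j; have [i e] := dW_sqr noise a0 ab j; split=> //; rewrite e.
Qed.

Let w4_le : int_le P w4 (d%:R * (128 * t ^+ 2)).
Proof.
have := @int_le_sum R _ T P 'I_d (index_enum 'I_d) (fun j w => dW W a b j w ^+ 4) (128 * t ^+ 2).
rewrite size_index_ord.
by apply=> j; have [i e] := dW_four noise a0 ab j; split.
Qed.

Let n_le : int_le P n (t * Lam).
Proof.
have [i e] := dN_mean noise a0 ab mBtot fBtot; split=> //.
by rewrite e lBtot ler_wpM2l// ltW.
Qed.

Let n2_le : int_le P (fun w => n w ^+ 2 - n w) ((t * Lam) ^+ 2).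
Proof.
have [i e] := dN_mean noise a0 ab mBtot fBtot.
have [i2 e2] := dN_sqr noise a0 ab mBtot fBtot; split.
  by have := integrableB measurableT i2 i; apply: eq_integrable.
rewrite RintegralB// e e2 addrK lBtot lerXn2r ?nnegrE ?mulr_ge0 ?(ltW t0)//.
by rewrite ler_wpM2l// ltW.
Qed.

Let w2n_le : int_le P (fun w => w2 w * n w) (d%:R * (t * (t * Lam))).
Proof.
have := @int_le_sum R _ T P 'I_d (index_enum 'I_d) (fun j w => dW W a b j w ^+ 2 * n w) (t * (t * Lam)).
rewrite size_index_ord.
have -> : (fun w => \sum_(i <- index_enum 'I_d) dW W a b i w ^+ 2 * n w) = (fun w => w2 w * n w).
  by apply/funext => w; rewrite /w2 mulr_suml.
apply=> j; have [i e] := E_dW_dN noise a0 ab mBtot fBtot j; split=> //.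
by rewrite e lBtot !ler_wpM2l ?(ltW t0).
Qed.

Let cst_le (c : R) : int_le P (fun=> c) c.
Proof.
by split; [exact: finite_measure_integrable_cst|rewrite Rintegral_prob_cst].
Qed.

Let K1 := K + Lam * K.
Let K2 := 2 * (1 + d%:R) * K1 ^+ 2.
Let K20 : 0 <= K2. Proof. by apply: mulr_ge0; rewrite ?sqr_ge0// mulr_ge0// addr_ge0. Qed.

Let Bd w : R :=
  (e1 * (K2 * (t ^+ 2 + w2 w)) + 2 * C0 / dl ^+ 2 * (2 * K2 ^+ 2 * (t ^+ 4 + d%:R * w4 w)))
  + C0 * K1 ^+ 2 * (t ^+ 2 + r * (d%:R * t + w2 w))
  + 4 * C0 * (n w ^+ 2 - n w)
  + C0 * ((K2 * (t ^+ 2 + w2 w) / r + r) * n w).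

(** Collects the coefficients of r once every higher power of r is bounded by r. It depends on [dl],
    but not on the length of the step. *)
Definition one_step_const : R :=
  4 * C0 / dl ^+ 2 * K2 ^+ 2 * (1 + d%:R * d%:R * 128) + C0 * K1 ^+ 2 * (1 + 2 * d%:R)
  + 4 * C0 * Lam ^+ 2 + C0 * (K2 * Lam + K2 * d%:R * Lam + Lam).

Let Bd_le : int_le P Bd (t * (e1 * (K2 * (1 + d%:R)) + r * one_step_const)).
Proof.
have rn0 : r != 0 by rewrite gt_eqF.
have E : int_le P Bd (
  (e1 * (K2 * (t ^+ 2 + d%:R * t)) +
    2 * C0 / dl ^+ 2 * (2 * K2 ^+ 2 * (t ^+ 4 + d%:R * (d%:R * (128 * t ^+ 2)))))
  + C0 * K1 ^+ 2 * (t ^+ 2 + r * (d%:R * t + d%:R * t))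
  + 4 * C0 * (t * Lam) ^+ 2
  + C0 * (K2 / r * (t ^+ 2 * (t * Lam) + d%:R * (t * (t * Lam))) + r * (t * Lam))).
  apply: int_leD; first apply: int_leD; first apply: int_leD; first apply: int_leD.
  - by apply: int_leZ (ltW e10) _; apply: int_leZ K20 _; apply: int_leD.
  - apply: int_leZ; first by rewrite divr_ge0 ?sqr_ge0// mulr_ge0.
    apply: int_leZ; first by rewrite mulr_ge0 ?sqr_ge0.
    by apply: int_leD => //; apply: int_leZ.
  - apply: int_leZ; first by rewrite mulr_ge0 ?sqr_ge0.
    apply: int_leD => //; apply: int_leZ (ltW r0) _.
    by apply: int_leD.
  - by apply: int_leZ => //; rewrite mulr_ge0.
  - apply: int_leZ => //.
    have -> : (fun w => (K2 * (t ^+ 2 + w2 w) / r + r) * n w) =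
        (fun w => K2 / r * (t ^+ 2 * n w + w2 w * n w) + r * n w).
      by apply/funext => w; ring.
    apply: int_leD; last by apply: int_leZ (ltW r0) _.
    apply: int_leZ; first by rewrite divr_ge0 ?(ltW r0).
    by apply: int_leD => //; apply: int_leZ; rewrite ?sqr_ge0.
case: E => Ei Ee; split=> //; apply: le_trans Ee _.
rewrite -rr.
have d0 : 0 <= d%:R :> R by [].
rewrite [leLHS](_ : _ = r ^+ 2 * (e1 * (K2 * (r ^+ 2 + d%:R))
   + (4 * C0 / dl ^+ 2 * K2 ^+ 2 * (r ^+ 6 + d%:R * d%:R * 128 * r ^+ 2)
   + C0 * K1 ^+ 2 * (r ^+ 2 + 2 * d%:R * r)
   + 4 * C0 * Lam ^+ 2 * r ^+ 2
   + C0 * (K2 * Lam * r ^+ 3 + K2 * d%:R * Lam * r + Lam * r)))); last first.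
  by field; rewrite rn0 gt_eqF.
apply: ler_wpM2l; first exact: sqr_ge0.
have rk k : r ^+ k.+1 <= r by rewrite exprS ler_piMr ?exprn_ile1 ?(ltW r0).
apply: lerD.
  apply: ler_wpM2l; first exact: ltW.
  by apply: ler_wpM2l => //; rewrite lerD2r exprn_ile1// ltW.
rewrite /one_step_const [leRHS](_ : _ =
   4 * C0 / dl ^+ 2 * K2 ^+ 2 * (r + d%:R * d%:R * 128 * r)
   + C0 * K1 ^+ 2 * (r + 2 * d%:R * r)
   + 4 * C0 * Lam ^+ 2 * r
   + C0 * (K2 * Lam * r + K2 * d%:R * Lam * r + Lam * r)); last by field; rewrite gt_eqF.
have c1 : 0 <= 4 * C0 / dl ^+ 2 * K2 ^+ 2.
  by rewrite mulr_ge0 ?sqr_ge0// divr_ge0 ?sqr_ge0// mulr_ge0.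
apply: lerD; first apply: lerD; first apply: lerD.
- apply: ler_wpM2l => //; apply: lerD; first exact: (rk 5%N).
  by apply: ler_wpM2l; [rewrite !mulr_ge0|exact: (rk 1%N)].
- apply: ler_wpM2l; first by rewrite mulr_ge0 ?sqr_ge0.
  by rewrite lerD2r; exact: (rk 1%N).
- by apply: ler_wpM2l; [rewrite !mulr_ge0 ?sqr_ge0|exact: (rk 1%N)].
- apply: ler_wpM2l => //; rewrite !lerD2r.
  by apply: ler_wpM2l; [rewrite mulr_ge0|exact: (rk 2%N)].
Qed.

Let mF (X : T -> R) : Fm F a X -> measurable_fun setT X.
Proof. by move=> H; exact: (Fm_measurable noise a0 H). Qed.

Let mvF (x : T -> 'cV[R]_d) : mvec (x : sigT_of (F a) -> _) -> mvec x.
Proof. by move=> mx i; apply: mF; exact: mx. Qed.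

Let mD : mvec D.
Proof.
apply: mvecD; first apply: mvecD.
- by apply: mvecZ => //; exact: mvF.
- apply: mvec_sum => j; apply: mvecZ; first exact: (dW_measurable noise a0 ab).
  by apply: mvF; exact: mS.
- apply: mvec_sum => k; apply: mvecZ; last by apply: mvF; exact: mC.
  apply: measurable_funB => //.
  apply: (Fm_measurable noise (le_trans a0 (ltW ab))).
  exact: (dN_Fm noise a0 ab (mB k)).
Qed.

Let mG : Fm F a G.
Proof.
apply: measurable_funD; first apply: measurable_funD.
- exact: measurable_tg.
- apply: measurable_funM => //; apply: measurable_sum => j.
  by apply: measurable_tD; [exact: h1c|exact: h2c|exact: my|exact: mS|exact: mS].
- apply: measurable_sum => k; apply: measurable_funM => //.
  exact: measurable_tT.
Qed.

Lemma step_gen_bound w : `|G w| <= C0 * K + d%:R * (C0 * (K * K)) / 2 + Lam * (C0 * K ^+ 2).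
Proof.
apply: le_trans (ler_normD _ _) _; apply: lerD; first apply: le_trans (ler_normD _ _) _; first apply: lerD.
- by apply: le_trans (tg_le _ _) _; exact: ler_wpM2l.
- rewrite normrM [`|2^-1|]gtr0_norm ?invr_gt0// ler_wpM2r//.
  apply: le_trans (ler_norm_sum _ _ _) _.
  rewrite mulr_natl -[X in _ *+ X](card_ord d) -sumr_const; apply: ler_sum => j _.
  by apply: le_trans (tD_le _ _ _) _; rewrite ler_wpM2l// ler_pM ?frob_ge0.
- apply: le_trans (ler_norm_sum _ _ _) _.
  apply: (@le_trans _ _ (\sum_k l k * (C0 * K ^+ 2))).
    apply: ler_sum => k _; rewrite normrM ger0_norm// ler_wpM2l//.
    apply: le_trans (tT_le _ _) _; rewrite ler_wpM2l// lerXn2r ?nnegrE ?frob_ge0//.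
  by rewrite -mulr_suml ler_wpM2r// mulr_ge0 ?sqr_ge0.
Qed.

Lemma one_step_fixed :
  `|\int[P]_w (Y w * (tf h (y w + D w) - tf h (y w))) - t * \int[P]_w (Y w * G w)|
   <= t * (e1 * (K2 * (1 + d%:R)) + r * one_step_const).
Proof.
have [YMi YM0] := YM_zero; have [Bi Be] := Bd_le.
have mY' := mF mY.
pose X w := Y w * (tf h (y w + D w) - tf h (y w)).
have Xi : P.-integrable setT (EFin \o X).
  apply: (@bounded_integrable _ _ _ _ _ (2 * C0)).
    apply: measurable_funM => //; apply: measurable_funB; apply: measurable_tf => //.
      by apply: mvecD => //; exact: mvF.
    exact: mvF.
  move=> w; rewrite normrM -(mul1r (2 * C0)); apply: ler_pM => //.
  apply: le_trans (ler_normB _ _) _.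
  by rewrite (_ : 2 * C0 = C0 + C0); [exact: lerD|ring].
have YGi : P.-integrable setT (fun w => (Y w * G w)%:E).
  apply: (@bounded_integrable _ _ _ _ (fun w => Y w * G w) (C0 * K + d%:R * (C0 * (K * K)) / 2 + Lam * (C0 * K ^+ 2))).
    by apply: measurable_funM => //; exact: mF.
  by move=> w; rewrite normrM -[leRHS]mul1r; apply: ler_pM => //; exact: step_gen_bound.
have tYGi : P.-integrable setT (fun w => (t * (Y w * G w))%:E).
  by have := integrableZl measurableT t YGi; apply: eq_integrable.
have Ri : P.-integrable setT (EFin \o (fun w => X w - t * (Y w * G w) - Y w * M w)).
  have := integrableB measurableT (integrableB measurableT Xi tYGi) YMi.
  exact: eq_integrable.
have XGi : P.-integrable setT (EFin \o (fun w => X w - t * (Y w * G w))).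
  by have := integrableB measurableT Xi tYGi; apply: eq_integrable.
(* The martingale part has mean zero against [Y], so it may be subtracted before the pathwise bound
   is applied. *)
have -> : \int[P]_w X w - t * \int[P]_w (Y w * G w) =
    \int[P]_w (X w - t * (Y w * G w) - Y w * M w).
  by rewrite RintegralB// YM0 subr0 RintegralB// RintegralZl.
apply: le_trans Be; apply: abs_Rintegral_le => //.
apply: filterS good => w [m [mk nw]].
have SE := @step_expansion R d h h1 h2 C0 C01 tf_le tD_le tf_lip tT_le e1 dl e10 dl0
  taylor1 K Lam K0 Lam0 I (y w) (bt w) (S w) (C^~ w) l (btK w) (SK^~ w) (CK^~ w)
  l0 lLam r (dW W a b ^~ w) m r0.
have DE : D w = step_incr (bt w) (S w) (C^~ w) l r (dW W a b ^~ w) m.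
  rewrite /D /noise_incr /step_incr rr; congr (_ + _).
  by apply: eq_bigr => k _; rewrite mk.
have ME : M w = step_mart h h1 h2 (y w) (S w) (C^~ w) l r (dW W a b ^~ w) m.
  rewrite /M /step_mart rr; congr (_ + _).
  by apply: eq_bigr => k _; rewrite mk.
have BE : Bd w = step_bound C0 e1 dl K Lam r (dW W a b ^~ w) m.
  by rewrite /Bd /step_bound rr nw.
rewrite BE /X DE ME.
rewrite [X in `|X|](_ : _ = Y w * (tf h (y w + step_incr (bt w) (S w) (C^~ w) l r (dW W a b ^~ w) m)
   - tf h (y w) - r ^+ 2 * G w - step_mart h h1 h2 (y w) (S w) (C^~ w) l r (dW W a b ^~ w) m)); last first.
  by rewrite rr; ring.
rewrite normrM; apply: le_trans SE.
by rewrite ler_piMl.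
Qed.

End Fixed.

(** The admissible step depends on the coefficients, the marks and the weight only through [K] and
    [Lam]: this is a uniform o(h), which can be summed over all cells of a grid. *)
Lemma one_step (K Lam e : R) : 0 <= K -> 0 <= Lam -> 0 < e ->
  exists2 dl : R, 0 < dl & forall a b : R, 0 <= a -> a < b -> b - a <= dl ->
  forall (I : finType) (B : I -> set U), (forall k, measurable (B k)) ->
  (forall k, (nu (B k) < +oo)%E) -> trivIset setT B -> \sum_k fine (nu (B k)) <= Lam ->
  forall (y bt : T -> 'cV[R]_d) (S : T -> 'M[R]_d) (C : I -> T -> 'cV[R]_d),
  mvec (y : sigT_of (F a) -> _) -> mvec (bt : sigT_of (F a) -> _) ->
  (forall j, mvec ((fun w => col j (S w)) : sigT_of (F a) -> _)) ->
  (forall k, mvec (C k : sigT_of (F a) -> _)) ->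
  (forall w, frob (bt w) <= K) -> (forall j w, frob (col j (S w)) <= K) ->
  (forall k w, frob (C k w) <= K) ->
  forall Y : T -> R, Fm F a Y -> (forall w, 0 <= Y w <= 1) ->
  `|\int[P]_w (Y w * (tf h (y w + noise_incr a b B (bt w) (S w) (C^~ w) w) - tf h (y w)))
    - (b - a) * \int[P]_w (Y w * step_gen h h1 h2 (y w) (bt w) (S w) (C^~ w)
                                   (fun k => fine (nu (B k))))| <= (b - a) * e.
Proof.
move=> K0 Lam0 e0.
pose K2 := 2 * (1 + d%:R) * (K + Lam * K) ^+ 2.
have K20 : 0 <= K2 by apply: mulr_ge0; rewrite ?sqr_ge0// mulr_ge0// addr_ge0.
have q0 : 0 < 2 * (K2 * (1 + d%:R) + 1).
  by rewrite mulr_gt0// ltr_wpDl// mulr_ge0// addr_ge0.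
(* [e1] spends half of [e] on the Taylor term and thereby fixes [dl] and the constant [c]. Only then
   is the mesh chosen: its square root [m] keeps the remaining term below the other half. *)
pose e1 := e / (2 * (K2 * (1 + d%:R) + 1)).
have e10 : 0 < e1 by rewrite divr_gt0.
have [dl dl0 tay] := taylor e10.
pose c := one_step_const K Lam dl.
have c0 : 0 <= c.
  rewrite /c /one_step_const -/K2.
  by do ?[done | exact: sqr_ge0 | rewrite invr_ge0 | apply: addr_ge0 | apply: mulr_ge0].
pose m := Num.min 1 (e / (2 * (c + 1))).
have m0 : 0 < m by rewrite lt_min ltr01 divr_gt0// mulr_gt0// ltr_wpDl.
exists (m ^+ 2); first by rewrite exprn_gt0.
move=> a b a0 ab bam I B mB fB tB lL y bt S C my mbt mS mC btK SK CK Y mY Y01.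
have m1 : m <= 1 by rewrite ge_min lexx.
have ba1 : b - a <= 1 by apply: le_trans bam _; rewrite exprn_ile1// ltW.
apply: le_trans (one_step_fixed K0 Lam0 e10 dl0 tay a0 ab ba1 mB fB tB lL my mbt mS mC
  btK SK CK mY Y01) _.
apply: ler_wpM2l; first by rewrite subr_ge0 ltW.
rewrite [leRHS](_ : _ = e / 2 + e / 2); last by field.
apply: lerD.
  have -> : e1 = e / 2 / (K2 * (1 + d%:R) + 1) by rewrite /e1 invfM mulrA.
  rewrite mulrAC ler_pdivrMr; last by rewrite ltr_wpDl// mulr_ge0// addr_ge0.
  by rewrite ler_wpM2l ?lerDl// divr_ge0// ltW.
have rm : Num.sqrt (b - a) <= m.
  by rewrite -(ler_pXn2r (n := 2)) ?nnegrE ?sqrtr_ge0 ?(ltW m0)// sqr_sqrtr// subr_ge0 ltW.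
apply: (@le_trans _ _ (m * c)); first by rewrite ler_wpM2r.
apply: (@le_trans _ _ (e / (2 * (c + 1)) * c)).
  by rewrite ler_wpM2r// ge_min lexx orbT.
have -> : e / (2 * (c + 1)) = e / 2 / (c + 1) by rewrite invfM mulrA.
rewrite mulrAC ler_pdivrMr; last by rewrite ltr_wpDl.
by rewrite ler_wpM2l ?lerDl// divr_ge0// ltW.
Qed.

End OneStep.

(** * Integrals of simple processes on a grid *)

Section Cells.
Variable R : realType.

Lemma indic_oc (l r x : R) : \1_(`]l, r]%classic) x = (l < x <= r)%R%:R :> R.
Proof. by rewrite indicE mem_setE in_itv. Qed.

Lemma cell_indic (l r a b x : R) : l <= r -> l <= a \/ b <= l -> r <= a \/ b <= r ->
  a < x <= b -> (l < x <= r) = (l <= a) && (b <= r).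
Proof.
move=> lr la ra /andP[ax xb]; apply/idP/idP => /andP[H1 H2]; apply/andP; split.
- by case: la => // bl; lra.
- by case: ra => // ra; lra.
- lra.
- lra.
Qed.

Context (dT : measure_display) (T : measurableType dT) (F : R -> set (set T)).

(** On ]a, b] such an [H] is constant. Its value, read off at [b], involves only coefficients whose
    left endpoint is at most [a], so it is known at time [a]. *)
Definition bfree (H : simple_process F) (a b : R) := forall k : 'I_(sp_size H),
  (sp_left k <= a \/ b <= sp_left k) /\ (sp_right k <= a \/ b <= sp_right k).

Definition in_cell (H : simple_process F) (a b : R) (k : 'I_(sp_size H)) : bool :=
  (sp_left k <= a) && (b <= sp_right k).

Lemma bfree_sub (H : simple_process F) (a b c : R) : c <= b -> bfree H a b -> bfree H a c.
Proof.
move=> cb ab k; have [l r] := ab k; split.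
- by case: l; [left|right; exact: le_trans cb _].
- by case: r; [left|right; exact: le_trans cb _].
Qed.

Lemma sp_val_cell (H : simple_process F) (a b r : R) w : bfree H a b -> a < r <= b ->
  sp_val H r w = \sum_k sp_coef k w * (@in_cell H a b k)%:R.
Proof.
move=> ab rab; apply: eq_bigr => k _; rewrite indic_oc.
have [la ra] := ab k.
by rewrite (cell_indic (proj2 (sp_order k)) la ra rab).
Qed.

Lemma sp_integral_cell (H : simple_process F) (V : R -> T -> R) (a b : R) w :
  a < b -> bfree H a b ->
  sp_integral H V b w - sp_integral H V a w = sp_val H b w * (V b w - V a w).
Proof.
move=> altb ab; rewrite (sp_val_cell _ ab); last by rewrite altb lexx.
rewrite mulr_suml /sp_integral -sumrB; apply: eq_bigr => k _.
have [la ra] := ab k; have lr := proj2 (sp_order k); rewrite /in_cell.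
case: (leP (sp_left k) a) => [la'|al] /=; last first.
  have bl : b <= sp_left k by case: la => // la'; lra.
  have br := le_trans bl lr.
  rewrite !(min_idPr _) ?bl ?br ?(le_trans (ltW altb))//.
  ring.
rewrite (min_idPl (le_trans la' (ltW altb))) ?(min_idPl la').
case: (leP b (sp_right k)) => [br|rb] /=.
  rewrite ?(min_idPr br) ?(min_idPr (le_trans (ltW altb) br)); ring.
have ra' : sp_right k <= a by case: ra => // br; lra.
rewrite ?(min_idPl (ltW rb)) ?(min_idPl ra'); ring.
Qed.

Lemma sp_val_bound (H : simple_process F) : exists2 C : R, 0 <= C &
  forall r w, `|sp_val H r w| <= C.
Proof.
have [C HC] := choice (fun k : 'I_(sp_size H) => sp_bounded k).
exists (\sum_k `|C k|); first by rewrite sumr_ge0.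
move=> r w; apply: le_trans (ler_norm_sum _ _ _) _; apply: ler_sum => k _.
rewrite normrM -[leRHS]mulr1 ler_pM//; first exact: le_trans (HC k w) (ler_norm _).
by rewrite indicE; case: (_ \in _); rewrite ?normr1 ?normr0.
Qed.

End Cells.

Lemma indic_integrable (R : realType) d (T : measurableType d)
    (mu : {measure set T -> \bar R}) (B : set T) : measurable B -> (mu B < +oo)%E ->
  mu.-integrable setT (fun x => (\1_B x)%:E).
Proof.
move=> mB fB; apply/integrableP; split.
  by apply/measurable_EFinP; exact: measurable_indic.
under eq_integral do rewrite gee0_abs ?lee_fin//.
by rewrite integral_indic// setIT.
Qed.

(** * Disjoint pieces of overlapping marks *)

Section Atoms.
Context (R : realType) (dU : measure_display) (U : measurableType dU).
Variables (I : finType) (B : I -> set U).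

(** Marks may overlap, while the one-step estimate asks for disjoint ones; these are the cells of
    the finite partition generated by the marks. The empty index set gives the empty set, because
    the region outside all marks may have infinite measure. *)
Definition atom (K : {set I}) : set U :=
  [set u | (exists k, k \in K) /\ forall k, B k u <-> k \in K].

Lemma trivIset_atom : trivIset setT atom.
Proof.
move=> K K' _ _ [u [[_ uK] [_ uK']]]; apply/setP => k; apply/idP/idP => kK.
  by apply/uK'/uK.
by apply/uK/uK'.
Qed.

Lemma atomP u k : B k u -> exists2 K : {set I}, k \in K & atom K u.
Proof.
move=> Bu; exists [set j | `[< B j u >]]%SET.
  by rewrite inE; apply/asboolP.
split; first by exists k; rewrite inE; apply/asboolP.
by move=> j; rewrite inE; split=> [?|/asboolP//]; apply/asboolP.
Qed.

Lemma mark_atoms k : B k = \big[setU/set0]_(K <- [seq K : {set I} <- index_enum _ | k \in K]) atom K.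
Proof.
rewrite -bigcup_seq; apply/seteqP; split=> [u /atomP[K kK Ku]|u [K /=]].
  by exists K => //=; rewrite mem_filter kK mem_index_enum.
by rewrite mem_filter => /andP[kK _] [_ /(_ k)[_]]; apply.
Qed.

Hypothesis mB : forall k, measurable (B k).

Lemma measurable_atom K : measurable (atom K).
Proof.
have [|/set0Pn[k kK]] := eqVneq K finset.set0.
  move=> ->; rewrite (_ : atom _ = set0)//; apply/seteqP; split=> // u [[k]].
  by rewrite inE.
rewrite (_ : atom K = \bigcap_j (if j \in K then B j else ~` B j)).
  apply: fin_bigcap_measurable => // j _; case: ifP => // _.
  exact: measurableC.
apply/seteqP; split=> [u [_ H] j _|u H].
  by case: ifP => [jK|/negP jK]; [apply/H|move=> /H].
split; first by exists k.
move=> j; have := H j Logic.I; case: ifP => // jK Bj; split=> //.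
Qed.

Lemma measure_mark (mu : {measure set U -> \bar R}) k :
  mu (B k) = (\sum_(K : {set I} | k \in K) mu (atom K))%E.
Proof.
rewrite {1}(mark_atoms k) measure_bigU_fin ?filter_uniq ?index_enum_uniq//; last 2 first.
- exact: measurable_atom.
- exact: trivIset_atom.
by rewrite big_filter.
Qed.

Lemma measure_mark_time (mu : {measure set (R * U) -> \bar R}) (J : set R) k :
  measurable J -> mu (J `*` B k) = (\sum_(K : {set I} | k \in K) mu (J `*` atom K))%E.
Proof.
move=> mJ; rewrite {1}(mark_atoms k).
rewrite (_ : J `*` _ = \big[setU/set0]_(K <- [seq K : {set I} <- index_enum _ | k \in K]) (J `*` atom K)).
  rewrite measure_bigU_fin ?filter_uniq ?index_enum_uniq//; last 2 first.
  - by move=> K; apply: measurableX => //; exact: measurable_atom.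
  - move=> K K' _ _ [[u v] [[_ /= Bi] [_ /= Bj]]].
    by apply: trivIset_atom => //; exists v.
  by rewrite big_filter.
apply: (big_morph (fun X => J `*` X)).
  by move=> X X'; apply/seteqP; split => -[u v] /=; tauto.
by apply/seteqP; split => -[u v] /= => [[]|].
Qed.

Lemma atom_fin (mu : {measure set U -> \bar R}) K : (forall k, (mu (B k) < +oo)%E) ->
  (mu (atom K) < +oo)%E.
Proof.
move=> fB; have [|/set0Pn[k kK]] := eqVneq K finset.set0.
  move=> ->; rewrite (_ : atom _ = set0) ?measure0//; apply/seteqP; split=> // u [[k]].
  by rewrite inE.
apply: le_lt_trans (fB k); apply: le_measure; rewrite ?inE//.
- exact: measurable_atom.
- by move=> u [_ H]; apply/H.
Qed.

Lemma mark_sum (V : lmodType R) (c : {set I} -> R) (v : I -> V) :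
  \sum_k (\sum_(K : {set I} | k \in K) c K) *: v k = \sum_(K : {set I}) c K *: \sum_(k in K) v k.
Proof.
under eq_bigr do rewrite scaler_suml.
rewrite (exchange_big_dep xpredT)//=; apply: eq_bigr => K _.
by rewrite scaler_sumr.
Qed.

Lemma mark_val (V : lmodType R) (v : I -> V) u K : atom K u ->
  \sum_k (\1_(B k) u : R) *: v k = \sum_(k in K) v k.
Proof.
move=> [_ H]; rewrite [RHS]big_mkcond/=; apply: eq_bigr => k _; rewrite indicE.
case: ifP => kK.
  by rewrite mem_set ?scale1r//; apply/H.
by rewrite memNset ?scale0r// => /H; rewrite kK.
Qed.

(** The integrand is constant on each atom, and phi 0 = 0 disposes of the region outside the marks.
    Thus jump integrals of simple fields are finite sums. *)
Lemma integral_marks (V : lmodType R) (mu : {measure set U -> \bar R}) (v : I -> V)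
    (phi : V -> R) : (forall k, (mu (B k) < +oo)%E) -> phi 0 = 0 ->
  (mu.-integrable setT (fun u => (phi (\sum_k (\1_(B k) u : R) *: v k))%:E) /\
  \int[mu]_u (phi (\sum_k (\1_(B k) u : R) *: v k))%:E =
    (\sum_(K : {set I}) fine (mu (atom K)) * phi (\sum_(k in K) v k))%:E)%E.
Proof.
move=> fB phi0.
have E u : (phi (\sum_k (\1_(B k) u : R) *: v k))%:E =
    (\sum_(K : {set I}) (phi (\sum_(k in K) v k))%:E * (\1_(atom K) u)%:E)%E.
  have [[k Bk]|nB] := pselect (exists k, B k u).
    have [K kK Ku] := atomP Bk; rewrite (mark_val _ Ku) (bigD1 K)//= [X in (_ + X)%E]big1 ?adde0.
      by rewrite indicE mem_set// mule1.
    move=> K' /eqP KK'; rewrite indicE memNset ?mule0// => K'u; apply: KK'.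
    by apply: trivIset_atom => //; exists u.
  rewrite [X in phi X]big1 ?phi0 => [|k _]; last first.
    by rewrite indicE memNset ?scale0r// => Bu; apply: nB; exists k.
  rewrite big1// => K _; rewrite indicE memNset ?mule0// => -[[k kK] H].
  by apply: nB; exists k; apply/H.
have mA := measurable_atom; have fA K := @atom_fin mu K fB.
have iA (K : {set I}) : mu.-integrable setT (fun u => ((phi (\sum_(k in K) v k))%:E * (\1_(atom K) u)%:E)%E).
  by apply: integrableZl => //; exact: indic_integrable.
under eq_fun do rewrite E; split; first exact: integrable_sum.
rewrite integral_sum// -sumEFin; apply: eq_bigr => K _.
rewrite integralZl//; last exact: indic_integrable.
by rewrite integral_indic// setIT muleC EFinM fineK// ge0_fin_numE.
Qed.

End Atoms.

Section Generator.
Context (R : realType) (dU : measure_display) (U : measurableType dU).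
Variables (nu : {measure set U -> \bar R}) (d : nat) (h h1 h2 : R -> R).

Definition gen (y b : 'cV[R]_d) (S : 'I_d -> 'cV[R]_d) (C : U -> 'cV[R]_d) : R :=
  tg h1 y b + (\sum_j tD h1 h2 y (S j) (S j)) / 2 + \int[nu]_u tT h h1 y (C u).

(** The size of the coefficients on the scale of the generator: drift to the first power, diffusion
    and jumps squared. It dominates the generator ([gen_le]) and enters the discount rate. *)
Definition coq (b : 'cV[R]_d) (S : 'I_d -> 'cV[R]_d) (C : U -> 'cV[R]_d) : R :=
  frob b + \sum_j frob (S j) ^+ 2 + \int[nu]_u (frob (C u) ^+ 2).

Lemma coq_ge0 b S C : 0 <= coq b S C.
Proof.
rewrite /coq addr_ge0 ?addr_ge0 ?frob_ge0//.
  by apply: sumr_ge0 => j _; exact: sqr_ge0.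
by apply: Rintegral_ge0 => u _; exact: sqr_ge0.
Qed.

End Generator.

Section IntLe.
Context (R : realType) d (T : measurableType d) (mu : {measure set T -> \bar R}).
Implicit Types f g : T -> R.

Lemma int_le_weak f (c c' : R) : c <= c' -> int_le mu f c -> int_le mu f c'.
Proof. by move=> cc [fi fc]; split=> //; exact: le_trans fc cc. Qed.

Lemma int_le_sumv (I : Type) (s : seq I) (f : I -> T -> R) (c : I -> R) :
  (forall i, int_le mu (f i) (c i)) ->
  int_le mu (fun w => \sum_(i <- s) f i w) (\sum_(i <- s) c i).
Proof.
move=> H; elim: s => [|i s ih].
  rewrite big_nil; under eq_fun do rewrite big_nil.
  by split; [exact: integrable0|rewrite /Rintegral integral0].
by rewrite big_cons; under eq_fun do rewrite big_cons; exact: int_leD.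
Qed.

Lemma int_le_mono f g (c : R) : measurable_fun setT f -> (forall w, 0 <= f w) ->
  {ae mu, forall w, f w <= g w} -> int_le mu g c -> int_le mu f c.
Proof.
move=> mf f0 fg [gi gc].
have ng : mu.-integrable setT (EFin \o (fun w => `|g w|)).
  by have := integrable_norm gi; apply: eq_integrable.
have fi : mu.-integrable setT (EFin \o f).
  have /integrableP[mg lg] := ng; apply/integrableP; split; first exact/measurable_EFinP.
  apply: le_lt_trans lg; apply: ae_ge0_le_integral => //.
  - by apply: measurableT_comp => //; exact/measurable_EFinP.
  - by apply: measurableT_comp => //.
  - apply: filterS fg => w fgw _; rewrite /= lee_fin normr_id (ger0_norm (f0 w)).
    exact: le_trans fgw (ler_norm _).
split=> //; apply: le_trans gc; apply: le_trans (ler_norm _) _.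
by apply: abs_Rintegral_le => //; apply: filterS fg => w fgw; rewrite ger0_norm.
Qed.

End IntLe.

(** * Processes driven by simple integrands *)

Section SimpleIto.
Context (R : realType) (dT : measure_display) (T : measurableType dT).
Variables (P : probability T R) (F : R -> set (set T)).
Context (dU : measure_display) (U : measurableType dU).
Variables (nu : {sigma_finite_measure set U -> \bar R}) (d : nat).
Variables (W : R -> T -> Borel 'cV[R]_d)
          (N : T -> {measure set (R * U) -> \bar R}).
Hypothesis noise : driving_noise P F nu W N.
Variables (A : finType) (e : A -> 'cV[R]_d) (z0 : 'cV[R]_d).
Variables (K : A -> simple_process F) (H : A -> 'I_d -> simple_process F)
  (G : A -> simple_field F nu).

Let time (t : R) (w : T) := t.
Let Wj (j : 'I_d) (t : R) (w : T) : R := (W t w : 'cV[R]_d) j 0.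

(** [A] indexes scalar integrals and [e] gives their directions, so that one process can carry both
    solutions. The drift is a simple integral against the clock [time]. *)
Definition Zs t w : 'cV[R]_d := z0 + \sum_i
  (sp_integral (K i) time t w + \sum_j sp_integral (H i j) (Wj j) t w
   + sf_integral (G i) N t w) *: e i.
Definition coB r w : 'cV[R]_d := \sum_i sp_val (K i) r w *: e i.
Definition coSj j r w : 'cV[R]_d := \sum_i sp_val (H i j) r w *: e i.
Definition coS r w : 'M[R]_d := \matrix_(i, j) coSj j r w i 0.
Definition coC r w u : 'cV[R]_d := \sum_i sf_val (G i) r w u *: e i.

Lemma col_coS j r w : col j (coS r w) = coSj j r w.
Proof. by apply/colP => i; rewrite !mxE. Qed.

Definition bfree_all (a b : R) := [/\ forall i, bfree (K i) a b,
  forall i j, bfree (H i j) a b & forall i, bfree (G i) a b].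

Lemma bfree_all_sub a b c : c <= b -> bfree_all a b -> bfree_all a c.
Proof.
move=> cb [h1 h2 h3]; split=> *; [exact: bfree_sub (h1 _)|exact: bfree_sub (h2 _ _)|].
exact: bfree_sub (h3 _).
Qed.

Let I : finType := {i : A & 'I_(sp_size (G i))}.
Let mk (p : I) : set U := sf_mark (tagged p).
Let mmk p : measurable (mk p). Proof. exact: sf_mark_measurable. Qed.
Let fmk p : (nu (mk p) < +oo)%E. Proof. exact: sf_mark_finite. Qed.

Let vC (a b : R) (w : T) (p : I) : 'cV[R]_d :=
  (sp_coef (tagged p) w * (in_cell a b (tagged p))%:R) *: e (tag p).

(** [compensated] goes through [fine], which is additive only on finite values; finite counts on the
    marks are an almost sure property. *)
Definition good_path (T0 : R) (w : T) := forall p : I, (N w (`]0%R, T0] `*` mk p) < +oo)%E.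

Lemma good_path_ae (T0 : R) : 0 < T0 -> {ae P, forall w, good_path T0 w}.
Proof.
move=> T00; apply: filter_forall => p.
have := dN_ae noise (lexx 0) T00 (mmk p) (fmk p).
by apply: filterS => w [k ->]; rewrite ltry.
Qed.

(** Between [a] and [b] a strip ]l, r] grows only if it contains the whole cell; otherwise its two
    truncations are both empty or coincide. *)
Lemma comp_cell (a b l r T0 : R) (m : set U) w : measurable m -> (nu m < +oo)%E ->
  (N w (`]0%R, T0] `*` m) < +oo)%E -> 0 <= a -> a < b -> b <= T0 -> 0 <= l -> l <= r ->
  l <= a \/ b <= l -> r <= a \/ b <= r ->
  compensated nu N (`]Num.min l b, Num.min r b] `*` m) w -
  compensated nu N (`]Num.min l a, Num.min r a] `*` m) w =
  ((l <= a) && (b <= r))%:R * (dN N a b m w - (b - a) * fine (nu m)).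
Proof.
move=> mm fm fN a0 ab bT l0 lr la ra.
have empty x : compensated nu N (`]x, x] `*` m) w = 0.
  have E : (`]x, x]%classic `*` m : set (R * U)) = set0.
    by rewrite set_itvoc0// ?set0X//.
  by rewrite /compensated E /intensity !measure0 subrr.
case: (leP l a) => [la'|al] /=; last first.
  have bl : b <= l by case: la => // la'; lra.
  have br := le_trans bl lr.
  rewrite !(min_idPr _) ?bl ?br ?(le_trans (ltW ab))//.
  by rewrite !empty mul0r subrr.
rewrite (min_idPl (le_trans la' (ltW ab))) ?(min_idPl la').
case: (leP b r) => [br|rb] /=.
  rewrite ?(min_idPr br) ?(min_idPr (le_trans (ltW ab) br)) mul1r.
  have E : (`]l, b]%classic `*` m : set (R * U)) = (`]l, a] `*` m) `|` (`]a, b] `*` m).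
    apply/seteqP; split=> -[x u] /=; rewrite !in_itv/=.
      move=> [/andP[lx xb] mu]; have [xa|ax] := leP x a; [left|right]; split=> //.
      by rewrite lx.
    by move=> [[/andP[lx xa] mu]|[/andP[ax xb] mu]]; split=> //; lra.
  have mX (x y : R) : measurable (`]x, y]%classic `*` m : set (R * U)).
    exact: measurableX.
  have add (mu : {measure set (R * U) -> \bar R}) : (mu (`]l, b] `*` m) < +oo)%E ->
      fine (mu (`]l, b] `*` m)) - fine (mu (`]l, a] `*` m)) = fine (mu (`]a, b] `*` m)).
    move=> fmu; have [f1 f2] : (mu (`]l, a] `*` m) \is a fin_num) /\ (mu (`]a, b] `*` m) \is a fin_num).
      split; rewrite ge0_fin_numE//; apply: le_lt_trans fmu; apply: le_measure; rewrite ?inE// E.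
        exact: subsetUl.
      exact: subsetUr.
    rewrite E measureU//; first by rewrite fineD// addrAC subrr add0r.
    apply/seteqP; split=> // -[x u] /= [[+ _] [+ _]]; rewrite !in_itv/= => /andP[_ xa] /andP[ax _].
    by move: ax; rewrite ltNge xa.
  have lb : l < b by lra.
  have mTb : `]l, b]%classic `*` m `<=` (`]0%R, T0] `*` m : set (R * U)).
    move=> [x u] /= []; rewrite !in_itv/= => /andP[lx xb] mu; split=> //.
    by rewrite (le_lt_trans l0 lx) (le_trans xb bT).
  have i1 := add (N w) (le_lt_trans (le_measure _ (mem_set (mX _ _)) (mem_set (mX _ _)) mTb) fN).
  have iE x y : x <= y -> fine (intensity nu (`]x, y] `*` m)) = (y - x) * fine (nu m).
    rewrite le_eqVlt => /orP[/eqP <-|xy]; last by rewrite (intensity_itv xy mm fm).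
    rewrite subrr mul0r (_ : `]x, x] `*` m = set0); first by rewrite /intensity measure0.
    by rewrite set_itvoc0// set0X.
  by rewrite /compensated /dN -i1 !iE ?(ltW lb)//; ring.
have ra' : r <= a by case: ra => // br; lra.
by rewrite ?(min_idPl (ltW rb)) ?(min_idPl ra') subrr mul0r.
Qed.

Lemma sf_integral_cell (X : simple_field F nu) (a b T0 : R) w :
  (forall k : 'I_(sp_size X), (N w (`]0%R, T0] `*` sf_mark k) < +oo)%E) ->
  0 <= a -> a < b -> b <= T0 -> bfree X a b ->
  sf_integral X N b w - sf_integral X N a w =
  \sum_(k < sp_size X) sp_coef k w * (in_cell a b k)%:R *
     (dN N a b (sf_mark k) w - (b - a) * fine (nu (sf_mark k))).
Proof.
move=> fN a0 ab bT bf; rewrite /sf_integral -sumrB; apply: eq_bigr => k _.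
have [l0 lr] := sp_order k; have [la ra] := bf k.
by rewrite -mulrBr (comp_cell _ _ (fN k))// ?mulrA//; [exact: sf_mark_measurable|exact: sf_mark_finite].
Qed.

Lemma sf_val_cell (X : simple_field F nu) (a b r : R) w u : bfree X a b -> a < r <= b ->
  sf_val X r w u = \sum_(k < sp_size X) sp_coef k w * (in_cell a b k)%:R * \1_(sf_mark k) u.
Proof.
move=> ab rab; apply: eq_bigr => k _; rewrite indic_oc.
have [la ra] := ab k.
by rewrite (cell_indic (proj2 (sp_order k)) la ra rab).
Qed.

(** Coefficients are frozen on the cell and marks are regrouped into atoms, which puts the increment
    into the form required by the one-step estimate. *)
Lemma Zs_incr (T0 a b : R) w : good_path T0 w -> 0 <= a -> a < b -> b <= T0 -> bfree_all a b ->
  Zs b w - Zs a w = noise_incr nu W N a b (atom mk) (coB b w) (coS b w)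
    (fun S : {set I} => \sum_(p in S) vC a b w p) w.
Proof.
move=> gw a0 ab bT [bK bH bG].
have bb : a < b <= b by rewrite ab lexx.
pose c (S : {set I}) := dN N a b (atom mk S) w - (b - a) * fine (nu (atom mk S)).
have fnu (S : {set I}) : nu (atom mk S) \is a fin_num.
  by rewrite ge0_fin_numE//; exact: atom_fin.
have cE p : \sum_(S : {set I} | p \in S) c S = dN N a b (mk p) w - (b - a) * fine (nu (mk p)).
  have mab : measurable (`]a, b]%classic : set R) by [].
  rewrite /c sumrB -mulr_sumr /dN (measure_mark_time mmk (N w) p mab) (measure_mark mmk nu p).
  have fN (S : {set I}) : p \in S -> N w (`]a, b] `*` atom mk S) \is a fin_num.
    move=> pS; rewrite ge0_fin_numE//; apply: le_lt_trans (gw p).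
    apply: le_measure; rewrite ?inE; do ?exact: measurableX.
      by apply: measurableX => //; exact: measurable_atom.
    move=> [x u] /= []; rewrite !in_itv/= => /andP[lx xb] [_ mu]; split; last exact/mu.
    by rewrite (le_lt_trans a0 lx) (le_trans xb bT).
  rewrite (eq_bigr (fun S => (fine (N w (`]a, b] `*` atom mk S)))%:E)); last first.
    by move=> S pS; rewrite fineK// fN.
  rewrite [X in _ - _ * fine X](_ : _ = \sum_(S : {set I} | p \in S) (fine (nu (atom mk S)))%:E)%E; last first.
    by apply: eq_bigr => S _; rewrite fineK.
  by rewrite !sumEFin.
rewrite /Zs opprD addrACA subrr add0r -sumrB /noise_incr.
rewrite [X in _ + X](_ : _ = \sum_i (\sum_(k < sp_size (G i)) sp_coef k w * (in_cell a b k)%:R *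
     (dN N a b (sf_mark k) w - (b - a) * fine (nu (sf_mark k)))) *: e i); last first.
  rewrite -(mark_sum c (vC a b w)).
  under [RHS]eq_bigr do rewrite scaler_suml.
  rewrite sig_big_dep/=; apply: eq_bigr => p _.
  by rewrite cE /vC scalerA mulrC.
rewrite [X in X + _](_ : _ = \sum_i (sp_val (K i) b w * (b - a) +
    \sum_j sp_val (H i j) b w * dW W a b j w) *: e i); last first.
  under [RHS]eq_bigr do rewrite scalerDl.
  rewrite big_split/= /coB scaler_sumr; congr (_ + _).
    by apply: eq_bigr => i _; rewrite scalerA mulrC.
  under [RHS]eq_bigr do rewrite scaler_suml.
  rewrite exchange_big/=; apply: eq_bigr => j _; rewrite col_coS scaler_sumr.
  by apply: eq_bigr => i _; rewrite scalerA mulrC.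
rewrite -big_split/=; apply: eq_bigr => i _; rewrite -scalerBl -scalerDl; congr (_ *: _).
rewrite -(sp_integral_cell time w ab (bK i)) -(sf_integral_cell (fun k => gw (existT _ i k)) a0 ab bT (bG i)).
have -> : \sum_j sp_val (H i j) b w * dW W a b j w =
    \sum_j sp_integral (H i j) (Wj j) b w - \sum_j sp_integral (H i j) (Wj j) a w.
  by rewrite -sumrB; apply: eq_bigr => j _; rewrite (sp_integral_cell (Wj j) w ab (bH i j)).
ring.
Qed.

Lemma co_bound : exists2 C : R, 0 <= C & forall r w,
  [/\ frob (coB r w) <= C, forall j, frob (coSj j r w) <= C &
      forall a b (S : {set I}), frob (\sum_(p in S) vC a b w p) <= C].
Proof.
have lin (J : finType) (X : J -> R -> T -> R) (v : J -> 'cV[R]_d) :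
    (forall i, exists2 C : R, 0 <= C & forall r w, `|X i r w| <= C) ->
    exists2 C : R, 0 <= C & forall r w, frob (\sum_i X i r w *: v i) <= C.
  move=> /(_ _)/cid2-/all_sig2[C C0 HC]; exists (\sum_i C i * frob (v i)).
    by apply: sumr_ge0 => i _; rewrite mulr_ge0 ?frob_ge0.
  move=> r w; apply: le_trans (frob_sumv _ _) _; apply: ler_sum => i _.
  by rewrite frobZ ler_wpM2r ?frob_ge0.
have [C1 C10 H1] := lin A (fun i => sp_val (K i)) e (fun i => sp_val_bound (K i)).
have /(_ _)/cid2-/all_sig2[C2 C20 H2] := fun j =>
  lin A (fun i => sp_val (H i j)) e (fun i => sp_val_bound (H i j)).
have cb (p : I) : exists C : R, forall w, `|sp_coef (tagged p) w| <= C by exact: sp_bounded.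
have [C3 H3] := choice cb.
exists (C1 + \sum_j C2 j + \sum_p `|C3 p| * frob (e (tag p))).
  by do ?apply: addr_ge0; rewrite ?sumr_ge0// => i _; rewrite mulr_ge0 ?frob_ge0.
have s2 : 0 <= \sum_j C2 j by rewrite sumr_ge0.
have s3 : 0 <= \sum_p `|C3 p| * frob (e (tag p)).
  by rewrite sumr_ge0// => i _; rewrite mulr_ge0 ?frob_ge0.
move=> r w; split.
- by apply: le_trans (H1 r w) _; rewrite -addrA lerDl addr_ge0.
- move=> j; apply: le_trans (H2 j r w) _; rewrite (bigD1 j)//=.
  rewrite (_ : _ + _ = C2 j + (C1 + \sum_(i | i != j) C2 i + \sum_p `|C3 p| * frob (e (tag p)))); last by ring.
  by rewrite lerDl !addr_ge0// sumr_ge0.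
- move=> a b S; apply: (@le_trans _ _ (\sum_p `|C3 p| * frob (e (tag p)))); last first.
    by rewrite lerDr addr_ge0.
  rewrite big_mkcond/=; apply: le_trans (frob_sumv _ _) _; apply: ler_sum => p _.
  case: ifP => _; last by rewrite frob0 mulr_ge0 ?frob_ge0.
  rewrite /vC frobZ ler_wpM2r ?frob_ge0// normrM -[leRHS]mulr1 ler_pM//.
    exact: le_trans (H3 p w) (ler_norm _).
  by case: in_cell; rewrite ?normr1 ?normr0.
Qed.

Lemma co_cell a b r w : bfree_all a b -> a < r <= b ->
  [/\ coB r w = coB b w, forall j, coSj j r w = coSj j b w & forall u, coC r w u = coC b w u].
Proof.
move=> [bK bH bG] rab.
have bb : a < b <= b by rewrite lexx andbT; case/andP : rab => /lt_le_trans; apply.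
split.
- by apply: eq_bigr => i _; rewrite !(sp_val_cell _ (bK i)).
- by move=> j; apply: eq_bigr => i _; rewrite !(sp_val_cell _ (bH i j)).
- by move=> u; apply: eq_bigr => i _; rewrite !(sf_val_cell _ _ (bG i)).
Qed.

Lemma coC_cell a b w u : bfree_all a b -> a < b ->
  coC b w u = \sum_p (\1_(mk p) u : R) *: vC a b w p.
Proof.
move=> [_ _ bG] ab; rewrite /coC.
under eq_bigr => i _.
  rewrite (sf_val_cell w u (bG i)) ?ab ?lexx//.
  rewrite scaler_suml; over.
rewrite sig_big_dep/=; apply: eq_bigr => p _.
by rewrite /vC scalerA mulrC.
Qed.

Let coef_Fm (X : simple_process F) k a : sp_left k <= a -> Fm F a (sp_coef (s := X) k).
Proof.
move=> la; have [l0 _] := sp_order k.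
apply: (Fm_mono noise l0 la); apply/(FmP noise _ l0) => B mB.
by apply: sp_measurable; exists B => //; rewrite setTI.
Qed.

Let sp_val_Fm (X : simple_process F) a b : a < b -> bfree X a b -> Fm F a (sp_val X b).
Proof.
move=> ab bX; have -> : sp_val X b = fun w => \sum_k sp_coef k w * (@in_cell _ _ _ _ X a b k)%:R.
  by apply/funext => w; rewrite (sp_val_cell w bX) ?ab ?lexx.
apply: measurable_sum => k; have [/andP[la _]|] := boolP (in_cell a b k).
  by apply: measurable_funM => //; exact: coef_Fm.
by move=> _; under eq_fun do rewrite mulr0; exact: measurable_cst.
Qed.

Let sp_integral_Fm (X : simple_process F) V a : 0 <= a ->
  (forall t, 0 <= t -> Fm F t (V t)) -> Fm F a (sp_integral X V a).
Proof.
move=> a0 FV; apply: measurable_sum => k; have [l0 lr] := sp_order k.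
have [la|al] := leP (sp_left k) a; last first.
  rewrite (min_idPr (le_trans (ltW al) lr)); under eq_fun do rewrite subrr mulr0.
  exact: measurable_cst.
apply: measurable_funM; first exact: coef_Fm.
by apply: measurable_funB; [apply: (Fm_mono noise _ _ (FV _ _))|apply: (Fm_mono noise _ _ (FV _ _))];
  rewrite ?ge_min ?le_min ?lexx ?orbT ?l0 ?a0 ?(le_trans l0 lr).
Qed.

Let sf_integral_Fm (X : simple_field F nu) a : 0 <= a -> Fm F a (sf_integral X N a).
Proof.
move=> a0; apply: measurable_sum => k; have [l0 lr] := sp_order k.
have [la|al] := leP (sp_left k) a; last first.
  rewrite (min_idPr (le_trans (ltW al) lr)).
  rewrite (_ : (fun w => _) = fun=> 0)//; apply/funext => w.
  by rewrite set_itvoc0// set0X /compensated /intensity !measure0 subrr mulr0.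
apply: measurable_funM; first exact: coef_Fm.
apply: measurable_funB => //; apply: measurableT_comp => //.
apply: (N_Fm noise a0); split.
  by apply: measurableX => //; exact: sf_mark_measurable.
move=> [x u] /= []; rewrite !in_itv/= => /andP[lx xa] _; split=> //.
apply/andP; split; last by apply: le_trans xa _; rewrite ge_min lexx orbT.
by rewrite ltW// (le_lt_trans _ lx).
Qed.

Lemma Zs_Fm a : 0 <= a -> mvec (Zs a : sigT_of (F a) -> _).
Proof.
move=> a0; apply: mvecD; first by move=> i; exact: measurable_cst.
apply: mvec_sum => i; apply: mvecZ; last by move=> j; exact: measurable_cst.
apply: measurable_funD; last exact: sf_integral_Fm.
apply: measurable_funD; first by apply: sp_integral_Fm => // t _; exact: measurable_cst.
by apply: measurable_sum => j; apply: sp_integral_Fm => // t t0; exact: (W_Fm noise j t0).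
Qed.

Lemma co_Fm a b : bfree_all a b -> a < b ->
  [/\ mvec (coB b : sigT_of (F a) -> _), forall j, mvec (coSj j b : sigT_of (F a) -> _) &
      forall S : {set I}, mvec ((fun w => \sum_(p in S) vC a b w p) : sigT_of (F a) -> _)].
Proof.
move=> [bK bH bG] ab; split.
- apply: mvec_sum => i; apply: mvecZ; last by move=> j; exact: measurable_cst.
  exact: sp_val_Fm.
- move=> j; apply: mvec_sum => i; apply: mvecZ; last by move=> k; exact: measurable_cst.
  exact: sp_val_Fm.
- move=> S; rewrite (_ : (fun w => _) = fun w => \sum_p (if p \in S then vC a b w p else 0)); last first.
    by apply/funext => w; rewrite big_mkcond.
  apply: mvec_sum => p; case: (p \in S); last by move=> j; exact: measurable_cst.
  apply: mvecZ; last by move=> j; exact: measurable_cst.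
  have [/andP[la _]|] := boolP (in_cell a b (tagged p)).
    by apply: measurable_funM => //; exact: coef_Fm.
  by move=> _; under eq_fun do rewrite mulr0; exact: measurable_cst.
Qed.

Lemma coq_cell a b w : bfree_all a b -> a < b ->
  coq nu (coB b w) (coSj^~ b ^~ w) (coC b w) = frob (coB b w) + \sum_j frob (coSj j b w) ^+ 2 +
    \sum_(S : {set I}) fine (nu (atom mk S)) * frob (\sum_(p in S) vC a b w p) ^+ 2.
Proof.
move=> bf ab; rewrite /coq; congr (_ + _).
under eq_Rintegral do rewrite (coC_cell w _ bf ab).
have phi0 : frob (0 : 'cV[R]_d) ^+ 2 = 0 by rewrite frob0 expr0n.
have [_ E] := integral_marks mmk (vC a b w) (phi := fun v => frob v ^+ 2) fmk phi0.
by rewrite /Rintegral E.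
Qed.

Lemma coq_Fm a b : bfree_all a b -> a < b ->
  Fm F a (fun w => coq nu (coB b w) (coSj^~ b ^~ w) (coC b w)).
Proof.
move=> bf ab; have [mb mS mC] := co_Fm bf ab.
have mf dS (S' : measurableType dS) (y : S' -> 'cV[R]_d) : mvec y -> measurable_fun setT (fun w => frob (y w) ^+ 2).
  move=> my; under eq_fun do rewrite frob_dotv; exact: measurable_dotv.
rewrite (_ : (fun w => _) = fun w => Num.sqrt (frob (coB b w) ^+ 2) + \sum_j frob (coSj j b w) ^+ 2 +
    \sum_(S : {set I}) fine (nu (atom mk S)) * frob (\sum_(p in S) vC a b w p) ^+ 2); last first.
  by apply/funext => w; rewrite (coq_cell w bf ab) sqrtr_sqr ger0_norm ?frob_ge0.
apply: measurable_funD; first apply: measurable_funD.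
- have ms : measurable_fun setT (Num.sqrt : R -> R).
    by apply: continuous_measurable_fun; exact: sqrt_continuous.
  exact: (measurableT_comp ms (mf _ _ _ mb)).
- by apply: measurable_sum => j; exact: mf.
- by apply: measurable_sum => S; apply: measurable_funM => //; exact: mf.
Qed.

Let mv t : 0 <= t -> mvec (Zs t).
Proof. by move=> t0 i; apply: (Fm_measurable noise t0); exact: Zs_Fm. Qed.

Let incr_mvec a b : 0 <= a -> a < b -> bfree_all a b ->
  mvec (fun w => noise_incr nu W N a b (atom mk) (coB b w) (coS b w)
     (fun S : {set I} => \sum_(p in S) vC a b w p) w).
Proof.
move=> a0 ab bf; have [mb mS mC] := co_Fm bf ab.
have mF (y : T -> 'cV[R]_d) : mvec (y : sigT_of (F a) -> _) -> mvec y.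
  by move=> my i; apply: (Fm_measurable noise a0); exact: my.
apply: mvecD; first apply: mvecD.
- by apply: mvecZ => //; exact: mF.
- apply: mvec_sum => j; under eq_fun do rewrite col_coS.
  by apply: mvecZ; [exact: (dW_measurable noise a0 ab)|exact: mF].
- apply: mvec_sum => S; apply: mvecZ; last exact: mF.
  apply: measurable_funB => //.
  apply: (Fm_measurable noise (le_trans a0 (ltW ab))).
  exact: (dN_Fm noise a0 ab (measurable_atom mmk S)).
Qed.

Lemma Zs_L1 (T0 : R) : 0 < T0 -> exists2 C : R, 0 <= C & forall a b : R,
  0 <= a -> a < b -> b <= T0 -> b - a <= 1 -> bfree_all a b ->
  int_le P (fun w => frob (Zs b w - Zs a w)) (C * Num.sqrt (b - a)).
Proof.
move=> T00; have [C C1 HC] := co_bound.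
pose Lam := \sum_(S : {set I}) fine (nu (atom mk S)).
have Lam0 : 0 <= Lam by apply: sumr_ge0 => S _; exact: fine_ge0.
exists (C * (1 + d%:R + 2 * Lam)); first by rewrite mulr_ge0// addr_ge0 ?addr_ge0 ?mulr_ge0.
move=> a b a0 ab bT ba1 bf.
set r := Num.sqrt (b - a).
have t0 : 0 < b - a by rewrite subr_gt0.
have r0 : 0 < r by rewrite sqrtr_gt0.
have rr : r ^+ 2 = b - a by rewrite sqr_sqrtr// ltW.
have r1 : r <= 1 by rewrite -sqrtr1 ler_sqrt.
pose B w : R := C * ((b - a) + \sum_j (2^-1 * (r^-1 * dW W a b j w ^+ 2 + r)) +
   \sum_(S : {set I}) (dN N a b (atom mk S) w + (b - a) * fine (nu (atom mk S)))).
have cst_le (c : R) : int_le P (fun=> c) c.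
  by split; [exact: finite_measure_integrable_cst|rewrite Rintegral_prob_cst].
have HB : int_le P B (C * (1 + d%:R + 2 * Lam) * r).
  have : int_le P B (C * ((b - a) + d%:R * (2^-1 * (r^-1 * (b - a) + r)) + 
      \sum_(S : {set I}) ((b - a) * fine (nu (atom mk S)) + (b - a) * fine (nu (atom mk S))))).
    apply: int_leZ => //; apply: int_leD; first apply: int_leD => //.
      rewrite -[in X in X%:R * _](size_index_ord d); apply: int_le_sum => j; apply: int_leZ => //.
      apply: int_leD => //; apply: int_leZ; first by rewrite invr_ge0 ltW.
      by have [i ee] := dW_sqr noise a0 ab j; split=> //; rewrite ee.
    apply: int_le_sumv => S; apply: int_leD => //.
    have [i ee] := dN_mean noise a0 ab (measurable_atom mmk S) (atom_fin mmk S fmk).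
    by split=> //; rewrite ee.
  apply: int_le_weak; rewrite -mulrA; apply: ler_wpM2l => //.
  under eq_bigr do rewrite -mulrDr -mulr2n -mulr_natl mulrCA.
  rewrite -!mulr_sumr -/Lam -rr expr2 (mulrA r^-1) mulVf ?gt_eqF// mul1r.
  rewrite (_ : 2^-1 * (r + r) = r); last by field.
  rewrite [leRHS](_ : _ = r + d%:R * r + 2 * (r * Lam)); last by ring.
  apply: lerD; first by rewrite lerD2r ler_piMl// ltW.
  by rewrite ler_wpM2l// -mulrA ler_piMl// mulr_ge0// ltW.
apply: int_le_mono HB.
- rewrite (_ : (fun w => _) = fun w => Num.sqrt (dotv (Zs b w - Zs a w) (Zs b w - Zs a w))); last first.
    by apply/funext => w; rewrite -frob_dotv sqrtr_sqr ger0_norm ?frob_ge0.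
  have ms : measurable_fun setT (Num.sqrt : R -> R).
    by apply: continuous_measurable_fun; exact: sqrt_continuous.
  have mB : mvec (fun w => Zs b w - Zs a w).
    by apply: mvecB; apply: mv => //; exact: le_trans a0 (ltW ab).
  exact: (measurableT_comp ms (measurable_dotv mB mB)).
- by move=> w; exact: frob_ge0.
apply: filterS (good_path_ae T00) => w gw; rewrite (Zs_incr gw a0 ab bT bf) /B.
have [cb cS cC] := HC b w.
rewrite [leRHS]mulrDr [X in _ <= X + _]mulrDr; apply: le_trans (frobD _ _) _; apply: lerD.
  apply: le_trans (frobD _ _) _; apply: lerD.
    by rewrite frobZ gtr0_norm// mulrC ler_wpM2r// ltW.
  apply: le_trans (frob_sumv _ _) _; rewrite mulr_sumr; apply: ler_sum => j _.
  rewrite frobZ mulrC col_coS ler_pM ?frob_ge0//.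
  rewrite -(real_normK (num_real (dW W a b j w))).
  move: `|_| => x; rewrite -subr_ge0.
  rewrite (_ : _ - _ = 2^-1 * r^-1 * (x - r) ^+ 2); last by field; rewrite gt_eqF.
  by rewrite mulr_ge0 ?sqr_ge0// mulr_ge0// invr_ge0 ltW.
apply: le_trans (frob_sumv _ _) _; rewrite mulr_sumr; apply: ler_sum => S _.
rewrite frobZ mulrC ler_pM ?frob_ge0//.
apply: le_trans (ler_normB _ _) _; rewrite ger0_norm ?dN_ge0// ger0_norm//.
by rewrite mulr_ge0 ?fine_ge0// ltW.
Qed.

Section Test.
Variables (h h1 h2 : R -> R) (C0 : R).
Hypothesis hc : continuous h.
Hypothesis h1c : continuous h1.
Hypothesis h2c : continuous h2.

Lemma gen_cell a b w (y : 'cV[R]_d) : bfree_all a b -> a < b ->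
  gen nu h h1 h2 y (coB b w) (coSj^~ b ^~ w) (coC b w) =
  step_gen h h1 h2 y (coB b w) (coS b w) (fun S : {set I} => \sum_(p in S) vC a b w p)
     (fun S => fine (nu (atom mk S))).
Proof.
move=> bf ab; rewrite /gen /step_gen; congr (_ + _ / _ + _).
  by apply: eq_bigr => j _; rewrite col_coS.
under eq_Rintegral do rewrite (coC_cell w _ bf ab).
have phi0 : tT h h1 y (0 : 'cV[R]_d) = 0 by rewrite /tT addr0 subrr tg0r subrr.
have [_ E] := integral_marks mmk (vC a b w) (phi := tT h h1 y) fmk phi0.
by rewrite /Rintegral E.
Qed.

Lemma gen_Fm a b y : bfree_all a b -> a < b -> mvec (y : sigT_of (F a) -> _) ->
  Fm F a (fun w => gen nu h h1 h2 (y w) (coB b w) (coSj^~ b ^~ w) (coC b w)).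
Proof.
move=> bf ab my; have [mb mS mC] := co_Fm bf ab.
rewrite (_ : (fun w => _) = (fun w => step_gen h h1 h2 (y w) (coB b w) (coS b w)
   (fun S : {set I} => \sum_(p in S) vC a b w p) (fun S => fine (nu (atom mk S))))); last first.
  by apply/funext => w; rewrite (gen_cell _ _ bf ab).
apply: measurable_funD; first apply: measurable_funD.
- exact: measurable_tg.
- apply: measurable_funM => //; apply: measurable_sum => j; under eq_fun do rewrite col_coS.
  by apply: measurable_tD; [exact: h1c|exact: h2c|exact: my|exact: mS|exact: mS].
- apply: measurable_sum => S; apply: measurable_funM => //.
  by apply: measurable_tT => //; exact: mC.
Qed.

Hypothesis C01 : 1 <= C0.
Hypothesis tf_le : forall y : 'cV[R]_d, `|tf h y| <= C0.
Hypothesis tg_le : forall y z : 'cV[R]_d, `|tg h1 y z| <= C0 * frob z.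
Hypothesis tD_le : forall y z z' : 'cV[R]_d, `|tD h1 h2 y z z'| <= C0 * (frob z * frob z').
Hypothesis tf_lip : forall y z : 'cV[R]_d, `|tf h (y + z) - tf h y| <= C0 * frob z.
Hypothesis tT_le : forall y z : 'cV[R]_d, `|tT h h1 y z| <= C0 * frob z ^+ 2.
Hypothesis taylor : forall e : R, 0 < e -> exists2 dl, 0 < dl & forall y z : 'cV[R]_d,
  frob z <= dl -> `|tT h h1 y z - tD h1 h2 y z z / 2| <= e * frob z ^+ 2.

(** Simple integrands are bounded ([co_bound]) and their marks have finite total measure; this
    supplies the [K] and [Lam] of [one_step]. *)
Lemma cell_step (T0 eps : R) : 0 < T0 -> 0 < eps -> exists2 dl : R, 0 < dl &
  forall a b : R, 0 <= a -> a < b -> b <= T0 -> b - a <= dl -> bfree_all a b ->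
  forall Y : T -> R, Fm F a Y -> (forall w, 0 <= Y w <= 1) ->
  `|\int[P]_w (Y w * (tf h (Zs b w) - tf h (Zs a w))) -
    (b - a) * \int[P]_w (Y w * gen nu h h1 h2 (Zs a w) (coB b w) (coSj^~ b ^~ w) (coC b w))|
  <= (b - a) * eps.
Proof.
move=> T00 e0; have [C C1 HC] := co_bound.
pose Lam := \sum_(S : {set I}) fine (nu (atom mk S)).
have Lam0 : 0 <= Lam by apply: sumr_ge0 => S _; exact: fine_ge0.
have [dl dl0 H1] := one_step noise hc h1c h2c C01 tf_le tg_le tD_le tf_lip tT_le taylor C1 Lam0 e0.
exists dl => // a b a0 ab bT bal bf Y mY Y01.
have [mb mS mC] := co_Fm bf ab.
have := H1 a b a0 ab bal _ (atom mk) (measurable_atom mmk) (fun S => atom_fin mmk S fmk)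
  (@trivIset_atom _ _ _ mk) (lexx _) (Zs a) (coB b) (coS b) (fun S w => \sum_(p in S) vC a b w p)
  (Zs_Fm a0) mb.
have mS' j : mvec ((fun w => col j (coS b w)) : sigT_of (F a) -> _).
  by under eq_fun do rewrite col_coS; exact: mS.
move=> /(_ mS' mC).
have cb w : frob (coB b w) <= C by case: (HC b w).
have cS j w : frob (col j (coS b w)) <= C by rewrite col_coS; case: (HC b w).
have cC (S : {set I}) w : frob (\sum_(p in S) vC a b w p) <= C by case: (HC b w).
move=> /(_ cb cS cC Y mY Y01).
have b0 := le_trans a0 (ltW ab).
under [X in _ - _ * X]eq_Rintegral do rewrite -(gen_cell _ _ bf ab).
rewrite (_ : \int[P]_w (Y w * (tf h (Zs a w + _) - _)) =
  \int[P]_w (Y w * (tf h (Zs b w) - tf h (Zs a w))))//.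
rewrite /Rintegral; congr fine; apply: ae_eq_integral => //.
- apply/measurable_EFinP; apply: measurable_funM; first exact: (Fm_measurable noise a0 mY).
  apply: measurable_funB; apply: measurable_tf => //; last exact: mv.
  by apply: mvecD; [exact: mv|exact: incr_mvec].
- apply/measurable_EFinP; apply: measurable_funM; first exact: (Fm_measurable noise a0 mY).
  by apply: measurable_funB; apply: measurable_tf => //; exact: mv.
- apply: filterS (good_path_ae T00) => w gw _; congr (_ * (tf h _ - _))%:E.
  by rewrite -(Zs_incr gw a0 ab bT bf) addrC subrK.
Qed.

End Test.

End SimpleIto.

(** * The discrete supermartingale inequality *)

Section Grid.
Variable R : realType.

Definition grid (T0 dl : R) (n : nat) (t : nat -> R) :=
  [/\ t 0%N = 0, t n = T0 & forall i, (i < n)%N -> t i < t i.+1 /\ t i.+1 - t i <= dl].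

Lemma grid_le (T0 dl : R) n t i j : grid T0 dl n t -> (i <= j <= n)%N -> t i <= t j.
Proof.
move=> [_ _ H] /andP[ij jn]; rewrite -(subnKC ij) in jn *.
elim: (j - i)%N jn => [|k ih]; first by rewrite addn0.
rewrite addnS => jn; apply: le_trans (ih (ltnW jn)) _.
by apply: ltW; case: (H _ jn).
Qed.

(** The prescribed points of [0, T0] are merged with a uniform subdivision of step at most [dl] and
    sorted without repetition. *)
Lemma grid_exists (T0 dl : R) (pts : seq R) : 0 < T0 -> 0 < dl -> exists n t,
  grid T0 dl n t /\ forall x, x \in pts -> 0 <= x <= T0 -> exists2 i, (i <= n)%N & x = t i.
Proof.
move=> T00 dl0.
pose N := (Num.truncn (T0 / dl)).+1.
have N0 : 0 < N%:R :> R by rewrite ltr0n.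
have Ndl : T0 / N%:R <= dl.
  rewrite ler_pdivrMr// mulrC -ler_pdivrMr//; apply: ltW; exact: truncnS_gt.
pose u k : R := T0 * k%:R / N%:R.
pose s0 := [seq x <- pts ++ [seq u k | k <- iota 0 N.+1] | 0 <= x <= T0].
pose s := sort <=%R (undup s0).
have ms x : (x \in s) = (x \in s0) by rewrite mem_sort mem_undup.
have srt : sorted <%R s by rewrite sort_lt_sorted undup_uniq.
have us k : (k <= N)%N -> u k \in s.
  move=> kN; rewrite ms mem_filter mem_cat; apply/andP; split; last first.
    by apply/orP; right; apply/mapP; exists k => //; rewrite mem_iota.
  rewrite /u mulr_ge0 ?mulr_ge0 ?(ltW T00)//= ?invr_ge0 ?(ltW N0)// -mulrA ler_piMr ?(ltW T00)//.
  by rewrite ler_pdivrMr// mul1r ler_nat.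
have s_in x : x \in s -> 0 <= x <= T0 by rewrite ms mem_filter => /andP[].
have u0 : u 0%N = 0 by rewrite /u mulr0 mul0r.
have uN : u N = T0 by rewrite /u mulfK ?gt_eqF.
have s_gt0 : (0 < size s)%N by have := us 0%N isT; case: (s) => [|//]; rewrite in_nil.
pose t := nth T0 s.
have tin i : (i < size s)%N -> t i \in s by move=> ?; exact: mem_nth.
have tle i j : (i < size s)%N -> (j < size s)%N -> (t i <= t j) = (i <= j)%N.
  by move=> i1 j1; rewrite /t lt_sorted_leq_nth.
have tlt i j : (i < size s)%N -> (j < size s)%N -> (t i < t j) = (i < j)%N.
  by move=> i1 j1; rewrite /t lt_sorted_ltn_nth.
have tE x : x \in s -> exists2 i, (i < size s)%N & x = t i.
  by move=> xs; exists (index x s); rewrite ?index_mem// /t nth_index.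
have sz : (size s).-1.+1 = size s by rewrite prednK.
exists (size s).-1, t; split; last first.
  move=> x xp x01; have [|i i1 ->] := tE x; first by rewrite ms mem_filter x01 mem_cat xp.
  by exists i => //; rewrite -ltnS sz.
split.
- apply/eqP; rewrite eq_le; have /andP[-> _] := s_in _ (tin 0%N s_gt0); rewrite andbT.
  have [i i1] := tE _ (us 0%N isT); rewrite u0 => ->.
  by rewrite tle.
- apply/eqP; have l1 : ((size s).-1 < size s)%N by rewrite sz.
  rewrite eq_le; have /andP[_ ->] := s_in _ (tin _ l1) => /=.
  have [i i1] := tE _ (us N (leqnn _)); rewrite uN => ->.
  by rewrite tle// -ltnS sz.
move=> i i1; have i2 : (i.+1 < size s)%N by rewrite -sz.
have i3 := ltn_trans (ltnSn _) i2.
split; first by rewrite tlt.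
have /andP[ti0 _] := s_in _ (tin _ i3).
have /andP[_ tiT] := s_in _ (tin _ i2).
have tT : t i < T0 by apply: lt_le_trans tiT; rewrite tlt.
(* [u k.+1] is the first uniform node beyond [t i]; as it belongs to the grid, the next grid point
   is not farther away. *)
pose k := Num.truncn (t i / T0 * N%:R).
have x0 : 0 <= t i / T0 * N%:R by rewrite mulr_ge0 ?divr_ge0 ?(ltW T00) ?(ltW N0).
have kN : (k.+1 <= N)%N.
  rewrite -(ltr_nat R); apply: (@le_lt_trans _ _ (t i / T0 * N%:R)); first by rewrite truncn_le.
  by rewrite -[ltRHS]mul1r ltr_pM2r// ltr_pdivrMr// mul1r.
have tx : t i = T0 * (t i / T0 * N%:R) / N%:R by field; rewrite !gt_eqF.
have tu : t i < u k.+1.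
  by rewrite tx /u ltr_pM2r ?invr_gt0// ltr_pM2l//; exact: truncnS_gt.
have ut : u k.+1 <= t i + T0 / N%:R.
  rewrite /u -natr1 mulrDr mulr1 mulrDl lerD2r [leRHS]tx.
  by rewrite ler_pM2r ?invr_gt0// ler_pM2l// truncn_le.
have [j j1 uj] := tE _ (us _ kN).
have : t i.+1 <= u k.+1 by rewrite uj tle//; rewrite uj tlt in tu.
move=> H; rewrite lerBlDl (le_trans H)// (le_trans ut)// lerD2l//.
Qed.

(** For r in ]0, T0], the index of the cell that contains r. Writing it as a count makes its
    measurability in r immediate. *)
Definition gidx (n : nat) (t : nat -> R) (r : R) : nat := \sum_(i < n) (t i.+1 < r)%R.

Lemma gidxE (T0 dl : R) n t i r : grid T0 dl n t -> (i < n)%N -> t i < r <= t i.+1 ->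
  gidx n t r = i.
Proof.
move=> g ni /andP[ir ri]; rewrite /gidx.
rewrite (eq_bigr (fun j : 'I_n => ((j < i)%N : nat))); last first.
  move=> j _; congr (nat_of_bool _); apply/idP/idP.
    apply: contraTT; rewrite -!leqNgt -leNgt => ij; apply: le_trans ri _.
    by apply: (grid_le g); rewrite ltnS ij ltn_ord.
  by move=> ji; apply: le_lt_trans ir; apply: (grid_le g); rewrite ji ltnW.
have H m : (\sum_(j < m) (j < i)%N = minn i m)%N.
  elim: m => [|m ih]; first by rewrite big_ord0 minn0.
  rewrite big_ord_recr/= ih; case: (ltnP m i) => mi.
    by rewrite ?(minn_idPr (ltnW mi)) (minn_idPr mi) addn1.
  by rewrite ?(minn_idPl mi) (minn_idPl (leqW mi)) addn0.
by rewrite H; apply/minn_idPl; exact: ltnW.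
Qed.

Lemma grid_cell (T0 dl : R) n t r : grid T0 dl n t -> 0 < r <= T0 ->
  (gidx n t r < n)%N /\ t (gidx n t r) < r <= t (gidx n t r).+1.
Proof.
move=> g /andP[r0 rT].
have [i [ni Hi]] : exists i, (i < n)%N /\ t i < r <= t i.+1.
  have [t0 tn _] := g; rewrite -tn in rT.
  have : forall m, (m <= n)%N -> r <= t m -> exists i, (i < m)%N /\ t i < r <= t i.+1.
    elim=> [_|m ih mn rm]; first by rewrite t0 leNgt r0.
    have [rm'|mr] := leP r (t m); last by exists m; rewrite ltnSn mr.
    by have [i [im H]] := ih (ltnW mn) rm'; exists i; rewrite (ltn_trans im).
  by move=> /(_ n (leqnn n) rT).
by rewrite (gidxE g ni Hi).
Qed.

Lemma measurable_gidx n t i : measurable [set r : R | gidx n t r = i].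
Proof.
have mg : measurable_fun setT (fun r : R => (gidx n t r)%:R : R).
  under eq_fun do rewrite natr_sum; apply: measurable_sum => j.
  have -> : (fun r : R => ((t j.+1 < r)%R : nat)%:R : R) = \1_(`]t j.+1, +oo[).
    by apply/funext => r; rewrite indicE mem_setE in_itv/= andbT.
  exact: measurable_indic.
have := mg measurableT [set i%:R] (measurable_set1 _); rewrite setTI.
congr measurable; apply/seteqP; split=> r /=; last by move=> ->.
by move=> /eqP; rewrite eqr_nat => /eqP.
Qed.

Lemma measurable_select dS (S : measurableType dS) dS' (S' : measurableType dS')
    (k : S -> nat) (phi : nat -> S -> S') : (forall i, measurable [set s | k s = i]) ->
  (forall i, measurable_fun setT (phi i)) -> measurable_fun setT (fun s => phi (k s) s).
Proof.
move=> mk mphi _ B mB; rewrite setTI.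
rewrite (_ : _ @^-1` B = \bigcup_i ([set s | k s = i] `&` (phi i @^-1` B))).
  apply: bigcupT_measurable => i; apply: measurableI => //.
  by rewrite -[X in measurable X]setTI; exact: mphi.
apply/seteqP; split=> [s /= Bs|s [i _ [/= -> //]]].
by exists (k s).
Qed.

Lemma step_integral (T0 dl : R) n t (phi : R -> R) : grid T0 dl n t ->
  (forall r, 0 <= phi r) -> 
  (forall i r, (i < n)%N -> t i < r <= t i.+1 -> phi r = phi (t i.+1)) ->
  (\int[lebesgue_measure]_(r in `]0%R, T0]) (phi r)%:E =
  (\sum_(i < n) (t i.+1 - t i) * phi (t i.+1))%:E)%E.
Proof.
move=> g phi0 hcell; have [t0 tn H] := g.
have : forall m, (m <= n)%N -> measurable_fun `]0%R, t m] phi /\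
  (\int[lebesgue_measure]_(r in `]0%R, t m]) (phi r)%:E =
  (\sum_(i < m) (t i.+1 - t i) * phi (t i.+1))%:E)%E.
  elim=> [_|m ih mn].
    rewrite t0 set_itvoc0// integral_set0 big_ord0; split=> //.
    exact: measurable_fun_set0.
  have [mf E] := ih (ltnW mn); have [tm _] := H m mn.
  have t0m : 0 <= t m by rewrite -t0; apply: (grid_le g); rewrite leq0n ltnW.
  have U : `]0%R, t m.+1]%classic = `]0%R, t m] `|` `]t m, t m.+1].
    by rewrite -itv_bndbnd_setU// ?bnd_simp// ltW.
  have mc : measurable_fun `]t m, t m.+1] phi.
    apply: (eq_measurable_fun (cst (phi (t m.+1)))) => //.
    by move=> r; rewrite inE/= in_itv/= => ?; rewrite (hcell m).
  have mU : measurable_fun (`]0%R, t m] `|` `]t m, t m.+1]) phi.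
    by apply/measurable_funU => //.
  rewrite U; split=> //.
  rewrite ge0_integral_setU//=; last 3 first.
  - by apply/measurable_EFinP.
  - by move=> r _; rewrite lee_fin.
  - apply/disj_setPS => r /= []; rewrite !in_itv/= => /andP[_ rm] /andP[mr _].
    by move: mr; rewrite ltNge rm.
  rewrite E big_ord_recr/= EFinD; congr (_ + _)%E.
  under eq_integral.
    move=> r; rewrite inE/= in_itv/= => rm; rewrite (hcell m)//; over.
  rewrite integral_cst//= lebesgue_measure_itv/= lte_fin tm.
  by rewrite muleC -EFinB -EFinM.
by move=> /(_ n (leqnn n)); rewrite tn => -[].
Qed.

End Grid.

(** * Discounted and stopped sums along a grid *)

Section DiscreteInequality.
Variables (R : realType) (f q h e L : nat -> R) (C v : R).
Hypothesis f0 : forall i, 0 <= f i.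
Hypothesis q0 : forall i, 0 <= q i.
Hypothesis h0 : forall i, 0 <= h i.
Hypothesis e01 : forall i, 0 <= e i <= 1.

(** At index i + 1 only the rates up to index i occur, so the discount for the step that starts at i
    is already known when that step starts. *)
Definition wexp i : R := \sum_(j < i) h j * q j.
(** Replaces a stopping time: for indicators [e] it is 1 up to the first index j with e j = 1, that
    index included, and 0 afterwards. *)
Definition alive i : R := \prod_(j < i) (1 - e j).

Lemma wexp_ge0 i : 0 <= wexp i.
Proof. by apply: sumr_ge0 => j _; rewrite mulr_ge0. Qed.

Lemma alive01 i : 0 <= alive i <= 1.
Proof.
apply/andP; split; first by apply: prodr_ge0 => j _; rewrite subr_ge0; case/andP: (e01 j).
apply: prodr_ile1 => j _.
by have /andP[ej0 ej1] := e01 j; rewrite subr_ge0 ej1 gerBl.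
Qed.

Let al0 i : 0 <= alive i. Proof. by case/andP: (alive01 i). Qed.

Let decay i : expR (- wexp i.+1) * (1 + h i * q i) <= expR (- wexp i).
Proof.
have -> : - wexp i = - wexp i.+1 + h i * q i by rewrite /wexp big_ord_recr/= opprD addrNK.
by rewrite expRD ler_wpM2l ?expR_ge0// expR_ge1Dx.
Qed.

(** Summation by parts. On the left stand the discounted value at the stopping index and the value
    when no stop has occurred; the discount loses nothing in the right direction because (1 + h q)
    exp(- h q) <= 1. *)
Lemma stopped_sum n : \sum_(i < n.+1) alive i * e i * (expR (- wexp i) * f i)
  + alive n.+1 * (expR (- wexp n) * f n) <=
  f 0%N + \sum_(i < n) alive i.+1 * expR (- wexp i.+1) * (f i.+1 - f i - h i * q i * f i).
Proof.
elim: n => [|n ih].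
  rewrite big_ord_recr !big_ord0/= /alive big_ord_recr !big_ord0/= /wexp big_ord0 oppr0 expR0.
  by rewrite !mul1r add0r -mulrDl addrC subrK mul1r addr0.
rewrite big_ord_recr/= [X in _ <= _ + X]big_ord_recr/= addrA.
have -> : alive n.+2 = alive n.+1 * (1 - e n.+1) by rewrite /alive big_ord_recr.
have := mulr_ge0 (al0 n.+1) (mulr_ge0 (f0 n) (expR_ge0 (- wexp n))).
have H : alive n.+1 * (expR (- wexp n.+1) * (1 + h n * q n) * f n) <= alive n.+1 * (expR (- wexp n) * f n).
  by rewrite ler_wpM2l// ler_wpM2r.
move: ih H; set s1 := \sum_(i < n.+1) _; set s2 := \sum_(i < n) _; set E1 := expR _; set E2 := expR (- wexp n).
move=> ih H _; lra.
Qed.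

Lemma alive_sum n : \sum_(i < n) alive i * e i = 1 - alive n.
Proof.
elim: n => [|n ih]; first by rewrite big_ord0 /alive big_ord0 subrr.
rewrite big_ord_recr/= ih {3}/alive big_ord_recr/= -/(alive n); ring.
Qed.

(** At the stopping index [f] is meant to equal the level [v], and the last sum accounts for the
    difference. For an approximant the difference is real, since [e] will be computed from the true
    path. *)
Lemma discrete_hitting n : 0 <= v ->
  v * (1 - alive n.+1) * expR (- wexp n) <= f 0%N +
  \sum_(i < n) alive i.+1 * expR (- wexp i.+1) * (f i.+1 - f i - h i * q i * f i)
  + \sum_(i < n.+1) e i * `|f i - v|.
Proof.
move=> v0; have := stopped_sum n.
have H1 : 0 <= alive n.+1 * (expR (- wexp n) * f n) by rewrite !mulr_ge0 ?expR_ge0.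
have mono i : (i <= n)%N -> expR (- wexp n) <= expR (- wexp i).
  move=> i_n; rewrite ler_expR lerN2 -(subnKC i_n); elim: (n - i)%N => [|k ih]; first by rewrite addn0.
  by rewrite addnS; apply: le_trans ih _; rewrite [leRHS]/wexp big_ord_recr/= lerDl mulr_ge0.
have E1 : expR (- wexp n) <= 1 by rewrite -expR0 ler_expR oppr_le0 wexp_ge0.
have H2 : v * (1 - alive n.+1) * expR (- wexp n) - \sum_(i < n.+1) e i * `|f i - v| <=
    \sum_(i < n.+1) alive i * e i * (expR (- wexp i) * f i).
  rewrite -alive_sum mulr_sumr mulr_suml -sumrB; apply: ler_sum => i _.
  have Ei : expR (- wexp n) * f i <= expR (- wexp i) * f i.
    by rewrite ler_wpM2r// mono// -ltnS.
  have /andP[a0 a1] := alive01 i; have /andP[ei0 ei1] := e01 i.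
  apply: (@le_trans _ _ (alive i * e i * (expR (- wexp n) * f i))); last first.
    by rewrite ler_wpM2l// mulr_ge0.
  rewrite lerBlDr -subr_ge0.
  have fv : v <= f i + `|f i - v|.
    by have := ler_norm (v - f i); rewrite distrC; lra.
  have X1 : alive i * e i * expR (- wexp n) * v <= alive i * e i * expR (- wexp n) * (f i + `|f i - v|).
    by rewrite ler_wpM2l// !mulr_ge0// expR_ge0.
  have X2 : alive i * expR (- wexp n) * (e i * `|f i - v|) <= e i * `|f i - v|.
    rewrite ler_piMl ?mulr_ge0//; apply: mulr_ile1 => //; exact: expR_ge0.
  lra.
lra.
Qed.

(** The weights h q exp(- wexp) have sum at most 1 whatever the size of q, by telescoping. The
    discounted sum of defects is therefore at least - C uniformly in the path and in the grid, which
    is the domination needed in the limit. *)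
Lemma discrete_lower n : 0 <= C -> (forall i, L i <= C * q i) ->
  - C <= \sum_(i < n) h i * (alive i.+1 * expR (- wexp i.+1) * (q i * f i - L i)).
Proof.
move=> C0 LC.
have H : \sum_(i < n) h i * q i * expR (- wexp i.+1) <= 1.
  have : \sum_(i < n) h i * q i * expR (- wexp i.+1) <= 1 - expR (- wexp n).
    elim: n => [|n ih]; first by rewrite big_ord0 /wexp big_ord0 oppr0 expR0 subrr.
    rewrite big_ord_recr/=; have := decay n; lra.
  by move=> H; apply: le_trans H _; rewrite gerBl expR_ge0.
apply: (@le_trans _ _ (- C * \sum_(i < n) h i * q i * expR (- wexp i.+1))).
  by rewrite mulNr lerN2 ler_piMr.
rewrite mulr_sumr; apply: ler_sum => i _.
have /andP[a0 a1] := alive01 i.+1.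
have X : - (C * q i) <= alive i.+1 * (q i * f i - L i).
  apply: (@le_trans _ _ (alive i.+1 * (- (C * q i)))).
    by rewrite mulrN lerN2 ler_piMl// mulr_ge0.
  rewrite ler_wpM2l//; have := LC i; have := mulr_ge0 (q0 i) (f0 i); lra.
have Y : 0 <= h i * expR (- wexp i.+1) by rewrite mulr_ge0 ?expR_ge0.
have := ler_wpM2l Y X; lra.
Qed.

End DiscreteInequality.

Section GenBound.
Context (R : realType) (dU : measure_display) (U : measurableType dU).
Variables (nu : {measure set U -> \bar R}) (d : nat) (h h1 h2 : R -> R) (C0 : R).
Hypothesis hc : continuous h.
Hypothesis h1c : continuous h1.
Hypothesis C01 : 1 <= C0.
Hypothesis tg_le : forall y z : 'cV[R]_d, `|tg h1 y z| <= C0 * frob z.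
Hypothesis tD_le : forall y z z' : 'cV[R]_d, `|tD h1 h2 y z z'| <= C0 * (frob z * frob z').
Hypothesis tT_le : forall y z : 'cV[R]_d, `|tT h h1 y z| <= C0 * frob z ^+ 2.

Lemma gen_le (y b : 'cV[R]_d) (S : 'I_d -> 'cV[R]_d) (C : U -> 'cV[R]_d) : mvec C ->
  nu.-integrable setT (fun u => (frob (C u) ^+ 2)%:E) ->
  nu.-integrable setT (fun u => (tT h h1 y (C u))%:E) /\
  `|gen nu h h1 h2 y b S C| <= C0 * coq nu b S C.
Proof.
move=> mC iC; have C00 : 0 <= C0 by exact: le_trans ler01 C01.
have iC' : nu.-integrable setT (EFin \o (fun u => C0 * frob (C u) ^+ 2)).
  by have := integrableZl measurableT C0 iC; apply: eq_integrable.
have iT : nu.-integrable setT (fun u => (tT h h1 y (C u))%:E).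
  apply: (le_integrable _ _ _ iC') => //.
    apply/measurable_EFinP; apply: measurable_tT => //.
  move=> u _ /=; rewrite lee_fin (ger0_norm (mulr_ge0 C00 (sqr_ge0 _))).
  exact: tT_le.
split=> //; rewrite /gen /coq !mulrDr.
apply: le_trans (ler_normD _ _) _; apply: lerD; first apply: le_trans (ler_normD _ _) _; first apply: lerD => //.
- rewrite normrM [`|2^-1|]gtr0_norm ?invr_gt0// mulr_sumr.
  have H : `|\sum_j tD h1 h2 y (S j) (S j)| <= \sum_j C0 * frob (S j) ^+ 2.
    by apply: le_trans (ler_norm_sum _ _ _) _; apply: ler_sum => j _; rewrite expr2.
  by apply: le_trans _ H; rewrite ler_piMr// invf_le1// ler1n.
- rewrite -RintegralZl//; apply: abs_Rintegral_le => //.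
  by apply: aeW => u; exact: tT_le.
Qed.

End GenBound.

Lemma int_le_le (R : realType) d (T : measurableType d) (mu : {measure set T -> \bar R})
    (f g : T -> R) (c : R) : mu.-integrable setT (EFin \o f) -> (forall w, f w <= g w) ->
  int_le mu g c -> int_le mu f c.
Proof.
move=> fi fg [gi gc]; split=> //; apply: le_trans gc.
by apply: le_Rintegral => // w _; exact: fg.
Qed.

(** Stopping is tested only at the coarse times, which form part of the grid; the other grid indices
    contribute the neutral element. *)
Lemma coarse_big (R : realType) (V : Type) (idx : V) (op : Monoid.com_law idx)
    (T0 dl : R) n t (coarse : seq R) (g : R -> V) : grid T0 dl n t -> uniq coarse ->
  (forall s, s \in coarse -> exists2 i, (i <= n)%N & s = t i) ->
  \big[op/idx]_(i < n.+1) (if t i \in coarse then g (t i) else idx) =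
  \big[op/idx]_(s <- coarse) g s.
Proof.
move=> gr uc cin.
have E : perm_eq [seq s <- [seq t i | i <- iota 0 n.+1] | s \in coarse] coarse.
  apply: uniq_perm => //.
    rewrite filter_uniq// map_inj_in_uniq ?iota_uniq// => i j.
    rewrite !mem_iota !add0n !ltnS /= => i_n jn tij.
    have inj a b : (a < b <= n)%N -> t a < t b.
      move=> /andP[ab bn]; have [_ _ /(_ a (leq_trans ab bn))[+ _]] := gr.
      by move=> /lt_le_trans; apply; apply: (grid_le gr); rewrite ab.
    case: (ltngtP i j) => // ij.
      by have := inj i j; rewrite ij jn tij ltxx => /(_ isT).
    by have := inj j i; rewrite ij i_n tij ltxx => /(_ isT).
  move=> s; rewrite mem_filter; apply/andP/idP => [[]//|sc]; split=> //.
  have [i i_n ->] := cin s sc; apply/mapP; exists i => //.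
  by rewrite mem_iota add0n ltnS.
rewrite -(perm_big _ E) big_filter big_map -[iota 0 n.+1]/(index_iota 0 n.+1).
by rewrite [RHS]big_mkcond/= big_mkord.
Qed.

(** * The hitting inequality for simple integrands *)

Section Approximant.
Context (R : realType) (dT : measure_display) (T : measurableType dT).
Variables (P : probability T R) (F : R -> set (set T)).
Context (dU : measure_display) (U : measurableType dU).
Variables (nu : {sigma_finite_measure set U -> \bar R}) (d : nat).
Variables (W : R -> T -> Borel 'cV[R]_d)
          (N : T -> {measure set (R * U) -> \bar R}).
Hypothesis noise : driving_noise P F nu W N.
Variables (A : finType) (e : A -> 'cV[R]_d) (z0 : 'cV[R]_d).
Variables (K : A -> simple_process F) (H : A -> 'I_d -> simple_process F)
  (G : A -> simple_field F nu).
Variables (h h1 h2 : R -> R) (C0 : R).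
Hypothesis hc : continuous h.
Hypothesis h1c : continuous h1.
Hypothesis h2c : continuous h2.
Hypothesis C01 : 1 <= C0.
Hypothesis tf_le : forall y : 'cV[R]_d, `|tf h y| <= C0.
Hypothesis tg_le : forall y z : 'cV[R]_d, `|tg h1 y z| <= C0 * frob z.
Hypothesis tD_le : forall y z z' : 'cV[R]_d, `|tD h1 h2 y z z'| <= C0 * (frob z * frob z').
Hypothesis tf_lip : forall y z : 'cV[R]_d, `|tf h (y + z) - tf h y| <= C0 * frob z.
Hypothesis tT_le : forall y z : 'cV[R]_d, `|tT h h1 y z| <= C0 * frob z ^+ 2.
Hypothesis taylor : forall e : R, 0 < e -> exists2 dl, 0 < dl & forall y z : 'cV[R]_d,
  frob z <= dl -> `|tT h h1 y z - tD h1 h2 y z z / 2| <= e * frob z ^+ 2.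
Hypothesis h_ge0 : forall s, 0 <= h s.
Variables (Kp kk : R) (eta : R -> R).
Hypotheses (Kp0 : 0 <= Kp) (kk0 : 0 <= kk) (etac : continuous eta).
Hypothesis eta01 : forall s, 0 <= eta s <= 1.

Let C00 : 0 <= C0. Proof. exact: le_trans ler01 C01. Qed.
Let Z := Zs W N e z0 K H G.
Let bf := bfree_all K H G.
Let cob := coB e K.
Let cos (r : R) (w : T) j := coSj e H j r w.
Let coc := coC e G.

(** [Kp] is the Lyapunov constant. The bare summand [q0] bounds the generator of arbitrary
    coefficients up to the factor [C0]; the term with [kk] and [eta] adds that factor far out, where
    the test function is cut off. *)
Definition rate (y : 'cV[R]_d) (q0 : R) : R := Kp + q0 * (1 + kk * eta (dotv y y)).

Lemma rate_ge y q0 : 0 <= q0 -> q0 <= rate y q0.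
Proof.
move=> q00; have /andP[e0 e1] := eta01 (dotv y y); rewrite /rate mulrDr mulr1.
by apply: (@le_trans _ _ (q0 + q0 * (kk * eta (dotv y y)))); rewrite ?lerDr ?lerDl// !mulr_ge0.
Qed.

Let coC_int a b w : bf a b -> a < b ->
  mvec (coc b w) /\ nu.-integrable setT (fun u => (frob (coc b w u) ^+ 2)%:E).
Proof.
move=> bfab ab; split.
  apply: mvec_sum => i; apply: mvecZ; last by move=> j; exact: measurable_cst.
  apply: measurable_sum => k; apply: measurable_funM => //.
  by apply: measurable_indic; exact: sf_mark_measurable.
have phi0 : frob (0 : 'cV[R]_d) ^+ 2 = 0 by rewrite frob0 expr0n.
have mmk (p : {i : A & 'I_(sp_size (G i))}) : measurable (sf_mark (tagged p)).
  exact: sf_mark_measurable.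
have fmk (p : {i : A & 'I_(sp_size (G i))}) : (nu (sf_mark (tagged p)) < +oo)%E.
  exact: sf_mark_finite.
rewrite (_ : (fun u => _) = (fun u => (frob (\sum_(p : {i : A & 'I_(sp_size (G i))})
   \1_(sf_mark (tagged p)) u *: ((sp_coef (tagged p) w * (in_cell a b (tagged p))%:R) *: e (tag p))) ^+ 2)%:E)).
  by have [] := integral_marks mmk (fun p => (sp_coef (tagged p) w * (in_cell a b (tagged p))%:R) *: e (tag p))
     (phi := fun v => frob v ^+ 2) fmk phi0.
by apply/funext => u; rewrite /coc (coC_cell e w u bfab ab).
Qed.

Let cq b w := coq nu (cob b w) (cos b w) (coc b w).
Let gn y b w := gen nu h h1 h2 y (cob b w) (cos b w) (coc b w).

Let coq_bound : exists2 C : R, 0 <= C & forall a b w, bf a b -> a < b -> cq b w <= C.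
Proof.
have [C Cge0 HC] := co_bound e K H G.
pose I := {i : A & 'I_(sp_size (G i))}.
pose mk (p : I) := sf_mark (tagged p).
exists (C + d%:R * C ^+ 2 + \sum_(S : {set I}) fine (nu (atom mk S)) * C ^+ 2).
  rewrite addr_ge0 ?addr_ge0 ?mulr_ge0 ?sqr_ge0// sumr_ge0// => S _.
  by rewrite mulr_ge0 ?fine_ge0 ?sqr_ge0.
move=> a b w bfab ab; rewrite /cq (coq_cell e w bfab ab); have [H1 H2 H3] := HC b w.
have sq x : 0 <= x -> x <= C -> x ^+ 2 <= C ^+ 2 by move=> x0 xC; rewrite lerXn2r.
apply: lerD; first apply: lerD => //.
  rewrite mulr_natl -[X in _ *+ X](card_ord d) -sumr_const; apply: ler_sum => j _.
  by apply: sq; [exact: frob_ge0|exact: H2].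
apply: ler_sum => S _; rewrite ler_wpM2l ?fine_ge0//.
by apply: sq; [exact: frob_ge0|exact: H3].
Qed.

Let mF a (X : T -> R) : 0 <= a -> Fm F a X -> measurable_fun setT X.
Proof. by move=> a0 mX; exact: (Fm_measurable noise a0 mX). Qed.

Variables (T0 eps v : R) (coarse : seq R) (E : R -> T -> R).
Hypotheses (T00 : 0 < T0) (eps0 : 0 < eps) (v0 : 0 <= v).
Hypothesis coarse_in : forall s, s \in coarse -> 0 <= s <= T0.
Hypothesis coarse_uniq : uniq coarse.
Hypothesis E01 : forall s w, 0 <= E s w <= 1.
Hypothesis mE : forall s, s \in coarse -> Fm F s (E s).

(** It is nonnegative for the true coefficients, where the test function is a supersolution. For an
    approximant only its negative part does harm. *)
Definition defect y b w : R := rate y (cq b w) * tf h y - gn y b w.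

Definition total_rate n (t : nat -> R) w : R :=
  \sum_(i < n) (t i.+1 - t i) * rate (Z (t i) w) (cq (t i.+1) w).

Definition total_defect n (t : nat -> R) w : R :=
  \sum_(i < n) (t i.+1 - t i) * Num.max 0 (- defect (Z (t i) w) (t i.+1) w).

(** The loss is the minimum of [C0] and the total negative defect: the second tends to 0, the first
    makes the loss bounded. Coarse times and indicators [E] stay fixed while the integrands and the
    grid vary. *)
Lemma approximant_hitting : exists2 dl : R, 0 < dl & forall n t, grid T0 dl n t ->
  (forall i, (i < n)%N -> bf (t i) (t i.+1)) ->
  (forall s, s \in coarse -> exists2 i, (i <= n)%N & s = t i) ->
  [/\ measurable_fun setT (total_rate n t), measurable_fun setT (total_defect n t) &
  int_le P (fun w => v * (1 - \prod_(s <- coarse) (1 - E s w)) * expR (- total_rate n t w)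
     - Num.min C0 (total_defect n t w) - \sum_(s <- coarse) E s w * `|tf h (Z s w) - v|)
    (tf h z0 + eps * T0)].
Proof.
have [dl dl0 Hstep] := cell_step noise e z0 K H G hc h1c h2c C01 tf_le tg_le tD_le tf_lip
  tT_le taylor T00 eps0.
exists dl => // n t g bfree cin.
have [t0 tn Ht] := g.
have ti0 i : (i <= n)%N -> 0 <= t i by move=> i_n; rewrite -t0; apply: (grid_le g); rewrite i_n.
have tiT i : (i <= n)%N -> t i <= T0 by move=> i_n; rewrite -tn; apply: (grid_le g); rewrite i_n leqnn.
have lt i : (i < n)%N -> t i < t i.+1 by move=> /Ht[].
pose f i w := tf h (Z (t i) w).
pose q i w := rate (Z (t i) w) (cq (t i.+1) w).
pose L i w := gn (Z (t i) w) (t i.+1) w.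
pose hh i := Num.max 0 (t i.+1 - t i).
have hE i : (i < n)%N -> hh i = t i.+1 - t i.
  by move=> i_n; rewrite /hh (max_idPr _)// subr_ge0 ltW// lt.
pose ee i w := if t i \in coarse then E (t i) w else 0.
have mq i : (i < n)%N -> Fm F (t i) (q i).
  move=> i_n; apply: measurable_funD => //; apply: measurable_funM.
    exact: (coq_Fm noise e (bfree _ i_n) (lt _ i_n)).
  apply: measurable_funD => //; apply: measurable_funM => //.
  apply: (measurableT_comp (f := eta)); first exact: continuous_measurable_fun.
  have mz := Zs_Fm noise e z0 K H G (ti0 _ (ltnW i_n)).
  exact: (measurable_dotv mz mz).
have mL i : (i < n)%N -> Fm F (t i) (L i).
  move=> i_n; apply: (gen_Fm noise e hc h1c h2c (bfree _ i_n) (lt _ i_n)).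
  exact: (Zs_Fm noise e z0 K H G (ti0 _ (ltnW i_n))).
have mf i : (i <= n)%N -> Fm F (t i) (f i).
  by move=> i_n; apply: measurable_tf => //; exact: (Zs_Fm noise e z0 K H G (ti0 _ i_n)).
have me i : (i <= n)%N -> Fm F (t i) (ee i).
  move=> i_n; have [tc|tc] := boolP (t i \in coarse).
    by rewrite (_ : ee i = E (t i)); [exact: mE|apply/funext => w; rewrite /ee tc].
  rewrite (_ : ee i = cst 0); first exact: measurable_cst.
  by apply/funext => w; rewrite /ee (negbTE tc).
pose al i w := alive (ee^~ w) i; pose we i w := wexp (q^~ w) hh i.
pose Y i w := al i.+1 w * expR (- we i.+1 w).
have h0 i : 0 <= hh i by rewrite le_max lexx.
have q0 i w : 0 <= q i w.
  by apply: le_trans (rate_ge _ _); exact: coq_ge0.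
have e01 i w : 0 <= ee i w <= 1 by rewrite /ee; case: ifP => // _; rewrite lexx ler01.
have f0 i w : 0 <= f i w by exact: h_ge0.
have al01 i w : 0 <= al i w <= 1 by apply: alive01 => j; exact: e01.
have ex01 i w : 0 <= expR (- we i w) <= 1.
  rewrite expR_ge0/= -expR0 ler_expR oppr_le0; apply: wexp_ge0 => // j; exact: q0.
have Y01 i w : 0 <= Y i w <= 1.
  have /andP[a0 a1] := al01 i.+1 w; have /andP[x0 x1] := ex01 i.+1 w.
  by rewrite mulr_ge0// mulr_ile1.
have mono i j : (i <= j <= n)%N -> forall X : T -> R, Fm F (t i) X -> Fm F (t j) X.
  move=> /andP[ij jn] X; apply: (Fm_mono noise); first by apply: ti0; exact: leq_trans jn.
  by apply: (grid_le g); rewrite ij.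
have mal i : (i <= n)%N -> Fm F (t i) (al i.+1).
  move=> i_n; apply: measurable_prod => j _; apply: measurable_funB => //.
  have jn : (j <= i)%N by rewrite -ltnS.
  by apply: (mono j i); [rewrite jn i_n|apply: me; exact: leq_trans i_n].
have mwe i : (i < n)%N -> Fm F (t i) (we i.+1).
  move=> i_n; apply: measurable_sum => j; apply: measurable_funM => //.
  have jn : (j <= i)%N by rewrite -ltnS.
  by apply: (mono j i); [rewrite jn ltnW|apply: mq; exact: leq_ltn_trans i_n].
have mY i : (i < n)%N -> Fm F (t i) (Y i).
  move=> i_n; apply: measurable_funM; first exact: (mal i (ltnW i_n)).
  by apply: measurableT_comp => //; apply: measurableT_comp => //; exact: mwe.
have [Cq Cq0 HCq] := coq_bound.
have gn_le i w : (i < n)%N -> gn (Z (t i) w) (t i.+1) w <= C0 * q i w /\ `|L i w| <= C0 * Cq.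
  move=> i_n; have [m1 i1] := coC_int w (bfree _ i_n) (lt _ i_n).
  have [_ B] := gen_le hc h1c C01 tg_le tD_le tT_le (Z (t i) w) (cob (t i.+1) w) (cos (t i.+1) w) m1 i1.
  split.
    apply: le_trans (ler_norm _) _; apply: le_trans B _; rewrite ler_wpM2l//.
    by apply: rate_ge; exact: coq_ge0.
  by apply: le_trans B _; rewrite ler_wpM2l//; exact: HCq (bfree _ i_n) (lt _ i_n).
have mT i : (i <= n)%N -> forall X : T -> R, Fm F (t i) X -> measurable_fun setT X.
  by move=> i_n X; apply: mF; exact: ti0.
have mTR : measurable_fun setT (total_rate n t).
  apply: measurable_sum => i; apply: measurable_funM => //.
  by apply: (mT i); [exact: ltnW|exact: mq].
have mTD : measurable_fun setT (total_defect n t).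
  apply: measurable_sum => i; apply: measurable_funM => //.
  apply: measurable_maxr => //; apply: measurableT_comp => //.
  apply: measurable_funB; last by apply: (mT i); [exact: ltnW|exact: mL].
  apply: measurable_funM; apply: (mT i); do ?exact: ltnW.
    exact: mq.
  by apply: mf; exact: ltnW.
split=> //.
(* A step of the test function minus its predicted drift, against the weight [Y i] known at time
   [t i]; by [cell_step] its mean is at most [eps] times the length of the step. *)
pose X i w := Y i w * (f i.+1 w - f i w - (t i.+1 - t i) * L i w).
have iX i : (i < n)%N -> int_le P (X i) ((t i.+1 - t i) * eps).
  move=> i_n.
  have mY' := mT i (ltnW i_n) _ (mY i i_n).
  have i1 : P.-integrable setT (EFin \o (fun w => Y i w * (f i.+1 w - f i w))).
    apply: (@bounded_integrable _ _ _ _ _ (C0 + C0)).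
      apply: measurable_funM => //; apply: measurable_funB.
        by apply: (mT i.+1) => //; exact: mf.
      by apply: (mT i); [exact: ltnW|apply: mf; exact: ltnW].
    move=> w; rewrite normrM -[leRHS]mul1r; have /andP[y0 y1] := Y01 i w.
    apply: ler_pM => //; first by rewrite ger0_norm.
    by apply: le_trans (ler_normB _ _) _; apply: lerD; exact: tf_le.
  have i2 : P.-integrable setT (EFin \o (fun w => Y i w * L i w)).
    apply: (@bounded_integrable _ _ _ _ _ (C0 * Cq)).
      by apply: measurable_funM => //; apply: (mT i); [exact: ltnW|exact: mL].
    move=> w; rewrite normrM -[leRHS]mul1r; have /andP[y0 y1] := Y01 i w.
    by apply: ler_pM => //; [rewrite ger0_norm|have [] := gn_le i w i_n].
  have i3 : P.-integrable setT (EFin \o (fun w => (t i.+1 - t i) * (Y i w * L i w))).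
    by have := integrableZl measurableT (t i.+1 - t i) i2; apply: eq_integrable.
  have -> : X i = fun w => Y i w * (f i.+1 w - f i w) - (t i.+1 - t i) * (Y i w * L i w).
    by apply/funext => w; rewrite /X mulrBr [Y i w * (_ * L i w)]mulrCA.
  split; first by have := integrableB measurableT i1 i3; apply: eq_integrable.
  rewrite RintegralB// RintegralZl//; apply: le_trans (ler_norm _) _.
  by apply: (Hstep _ _ (ti0 _ (ltnW i_n)) (lt _ i_n) (tiT _ i_n) _ (bfree _ i_n) _ (mY i i_n));
    [have [] := Ht i i_n|exact: Y01].
have alE w : al n.+1 w = \prod_(s <- coarse) (1 - E s w).
  rewrite -(coarse_big _ (fun s => 1 - E s w) g coarse_uniq cin) /al /alive.
  by apply: eq_bigr => i _; rewrite /ee; case: ifP => _; rewrite ?subr0.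
have weE w : we n w = total_rate n t w.
  by apply: eq_bigr => i _; rewrite hE.
have ErE w : \sum_(i < n.+1) ee i w * `|f i w - v| = \sum_(s <- coarse) E s w * `|tf h (Z s w) - v|.
  rewrite -(coarse_big _ (fun s => E s w * `|tf h (Z s w) - v|) g coarse_uniq cin).
  by apply: eq_bigr => i _; rewrite /ee; case: ifP => _; rewrite ?mul0r.
have f0E w : f 0%N w = tf h z0.
  rewrite /f /Z t0 /Zs big1 ?addr0// => i _.
  have sp0 (V : simple_process F) X' : sp_integral V X' 0 w = 0.
    rewrite /sp_integral big1// => k _; have [l0 lr] := sp_order k.
    by rewrite !(min_idPr _) ?(le_trans l0 lr)// subrr mulr0.
  have -> : sf_integral (G i) N 0 w = 0.
    rewrite /sf_integral big1// => k _; have [l0 lr] := sp_order k.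
    rewrite !(min_idPr _) ?(le_trans l0 lr)//.
    rewrite (_ : `]0, 0] `*` _ = set0); first by rewrite /compensated /intensity !measure0 subrr mulr0.
    by rewrite set_itvoc0// set0X.
  by rewrite sp0 big1 ?addr0 ?scale0r// => j _; rewrite sp0.
(* Pathwise form: the discrete hitting inequality, in which the sum of defects is bounded below both
   by - C0 and by minus the total negative defect. *)
have path w : v * (1 - \prod_(s <- coarse) (1 - E s w)) * expR (- total_rate n t w)
     - Num.min C0 (total_defect n t w) - \sum_(s <- coarse) E s w * `|tf h (Z s w) - v|
   <= tf h z0 + \sum_(i < n) X i w.
  have D1 := @discrete_hitting R (f^~ w) (q^~ w) hh (ee^~ w) v (f0^~ w) (q0^~ w) h0 (e01^~ w) n v0.
  (* The bound on the generator is known only for indices of actual cells; beyond them the value 0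
     is substituted. *)
  pose LL i : R := if (i < n)%N then L i w else 0.
  have LLC i : LL i <= C0 * q i w.
    by rewrite /LL; case: ifP => [/(gn_le i w)[]//|_]; rewrite mulr_ge0.
  have D2 := @discrete_lower R (f^~ w) (q^~ w) hh (ee^~ w) LL C0 (f0^~ w) (q0^~ w) h0 (e01^~ w) n C00 LLC.
  move: D1; rewrite -/(al n.+1 w) alE -/(we n w) weE ErE f0E => D1.
  pose S := \sum_(i < n) hh i * (Y i w * (q i w * f i w - L i w)).
  have D2' : - C0 <= S.
    apply: le_trans D2 _; rewrite le_eqVlt; apply/orP; left; apply/eqP.
    by apply: eq_bigr => i _; rewrite /LL ltn_ord.
  have D3 : - total_defect n t w <= S.
    rewrite /total_defect -sumrN; apply: ler_sum => i _; rewrite hE// -mulrN ler_wpM2l//.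
      by rewrite subr_ge0 ltW// lt.
    rewrite -/(Z (t i) w) -[defect _ _ _]/(q i w * f i w - L i w).
    have /andP[y0 y1] := Y01 i w; move: (_ - L i w) => a.
    case: (leP 0 (- a)) => a0.
      have := ler_wpM2r a0 y1; rewrite mul1r mulrN; lra.
    by rewrite oppr0 mulr_ge0//; lra.
  have SE : \sum_(i < n) alive (ee^~ w) i.+1 * expR (- wexp (q^~ w) hh i.+1) *
      (f i.+1 w - f i w - hh i * q i w * f i w) = \sum_(i < n) X i w - S.
    rewrite /S -sumrB; apply: eq_bigr => i _; rewrite -/(al i.+1 w) -/(we i.+1 w) -/(Y i w) /X hE//.
    by move: (Y i w) (f i.+1 w) (f i w) (q i w) (L i w) (t i.+1 - t i) => *; ring.
  rewrite SE in D1.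
  clearbody S.
  have D4 : - S <= Num.min C0 (total_defect n t w).
    by rewrite le_min; apply/andP; split; rewrite lerNl.
  move: D1 D4.
  move: (v * _ * _) (Num.min _ _) (\sum_(s <- coarse) _) (\sum_(i < n) X i w) (tf h z0) => a1 a2 a3 a4 a5.
  by move=> D1 D4; lra.
have bX : int_le P (fun w => tf h z0 + \sum_(i < n) X i w) (tf h z0 + eps * T0).
  apply: int_leD.
    by split; [exact: finite_measure_integrable_cst|rewrite Rintegral_prob_cst].
  have := int_le_sumv (index_enum 'I_n) (fun i : 'I_n => iX i (ltn_ord i)).
  rewrite -mulr_suml.
  rewrite (_ : \sum_(i <- index_enum 'I_n) (t i.+1 - t i) = T0) 1?mulrC//.
  rewrite -(big_mkord xpredT (fun i => t i.+1 - t i)) telescope_sumr// tn t0 subr0//.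
apply: int_le_le path bX.
have pr01 w : 0 <= \prod_(s <- coarse) (1 - E s w) <= 1 by rewrite -alE.
have mE' s : s \in coarse -> measurable_fun setT (E s).
  by move=> sc; have /andP[s0 _] := coarse_in sc; exact: (mF s0 (mE sc)).
have mZ s : s \in coarse -> measurable_fun setT (fun w => tf h (Z s w)).
  move=> sc; have /andP[s0 _] := coarse_in sc; apply: measurable_tf => // i.
  by apply: (mF s0); exact: (Zs_Fm noise e z0 K H G s0).
apply: (@bounded_integrable _ _ _ _ _ (v + C0 + \sum_(s <- coarse) (C0 + v))).
  apply: measurable_funB; first apply: measurable_funB.
  - apply: measurable_funM; first apply: measurable_funM => //.
      apply: measurable_funB => //; apply: measurable_prod => s sc.
      by apply: measurable_funB => //; exact: mE'.
    by apply: measurableT_comp => //; exact: measurableT_comp.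
  - exact: measurable_minr.
  - under eq_fun do rewrite (big_nth 0) big_mkord.
    apply: measurable_sum => i; have ic : nth 0 coarse i \in coarse by exact: mem_nth.
    apply: measurable_funM; first exact: mE'.
    by apply: measurableT_comp => //; apply: measurable_funB => //; exact: mZ.
move=> w; apply: le_trans (ler_normB _ _) _; apply: lerD; first apply: le_trans (ler_normB _ _) _; first apply: lerD.
- have /andP[p0 p1] := pr01 w.
  have p2 : 0 <= 1 - \prod_(s <- coarse) (1 - E s w) <= 1 by lra.
  have /andP[p3 p4] := p2; have := ex01 n w; rewrite weE => /andP[x0 x1].
  rewrite ger0_norm ?mulr_ge0// -mulrA ler_piMr// mulr_ile1//.
- rewrite ger0_norm ?ge_min ?lexx// le_min C00/=.
  apply: sumr_ge0 => i _; rewrite mulr_ge0 ?subr_ge0 ?(ltW (lt _ (ltn_ord i)))//.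
  by rewrite le_max lexx.
- apply: le_trans (ler_norm_sum _ _ _) _; apply: ler_sum => s _.
  have /andP[s0 s1] := E01 s w; rewrite normrM (ger0_norm s0) normr_id.
  apply: (@le_trans _ _ `|tf h (Z s w) - v|); first by rewrite ler_piMl.
  by apply: le_trans (ler_normB _ _) _; rewrite (ger0_norm v0) lerD2r.
Qed.

End Approximant.

(** * Right-continuous paths *)

Section Rcll.
Variable R : realType.
Implicit Types f : R -> R.

Definition rcll f := (forall t : R, f s @[s --> t^'+] --> f t) /\
  (forall t : R, cvg (f s @[s --> t^'-])).

Lemma rcll_bounded f (T0 : R) : rcll f -> exists2 M : R, 0 <= M &
  forall r, 0 <= r <= T0 -> `|f r| <= M.
Proof.
move=> [rf lf]; have /compact_near_coveringP := @segment_compact R 0 T0.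
move=> /(_ R (+oo) (fun M s => `|f s| <= M)); case.
- move=> x _.
  have bd (G : set_system R) (PG : ProperFilter G) : cvg (f s @[s --> G]) ->
      exists2 B : R, 0 <= B & \forall s \near G, `|f s| <= B.
    move=> cf; exists (`|lim (f s @[s --> G])| + 1); first by rewrite addr_ge0.
    have /cvgrPdist_le /(_ 1 ltr01) := cf.
    apply: filterS => s H; rewrite -lerBlDl -[leRHS]normr1.
    by apply: le_trans (lerB_dist _ _) _; rewrite distrC normr1.
  have [B1 B10 H1] := bd (x^'-) _ (lf x).
  have [B2 B20 H2] := bd (x^'+) _ (cvgP _ (rf x)).
  pose B := B1 + B2 + `|f x|.
  have nx : \forall s \near x, `|f s| <= B.
    rewrite /at_left /at_right /within/= in H1 H2.
    near=> s; have [sx|xs|->] := ltgtP s x; last by rewrite lerDr addr_ge0.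
      have /le_trans : `|f s| <= B1 by move: sx; near: s; exact: H1.
      by apply; rewrite /B -addrA lerDl addr_ge0.
    have /le_trans : `|f s| <= B2 by move: xs; near: s; exact: H2.
    by apply; rewrite /B addrAC lerDr addr_ge0.
  exists ([set s | `|f s| <= B], [set M | B <= M]) => /=.
    by split=> //; apply: nbhs_pinfty_ge; rewrite num_real.
  by move=> [s M] /= [H3 H4]; exact: le_trans H3 H4.
- move=> M [Mr HM]; exists (`|M| + 1); first by rewrite addr_ge0.
  move=> r r01; apply: (HM (`|M| + 1)); first by rewrite ltr_pwDr// ler_norm.
  by rewrite /= in_itv/=.
Unshelve. all: by end_near. Qed.

(** At a left discontinuity the value lies strictly above or strictly below the left limit. In the
    first case choose a rational between the two and a rational to the left of the time, after which
    the path stays below the first one: a pair of rationals serves at most one time. Downward jumps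
    are treated through - f. *)
Lemma rcll_left_continuous f : rcll f ->
  countable [set t : R | ~ (f s @[s --> t^'-] --> f t)].
Proof.
move=> [_ lf].
pose A (g : R -> R) (pq : rat * rat) := [set t : R | ratr pq.2 < t /\ ratr pq.1 < g t /\
   forall s, ratr pq.2 < s -> s < t -> g s < ratr pq.1].
have cA g : countable (\bigcup_pq A g pq).
  apply: bigcup_countable => [|pq _]; first exact: countableP.
  apply: finite_set_countable.
  have [->|/set0P[t At]] := eqVneq (A g pq) set0; first exact: finite_set0.
  apply: (@sub_finite_set _ _ [set t]); last exact: finite_set1.
  move=> s As /=; case: At => [t1 [t2 t3]]; case: As => [s1 [s2 s3]].
  have [st|ts|//] := ltgtP s t.
    by have := lt_trans s2 (t3 _ s1 st); rewrite ltxx.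
  by have := lt_trans t2 (s3 _ t1 ts); rewrite ltxx.
have pick g t : g t > lim (g s @[s --> t^'-]) -> cvg (g s @[s --> t^'-]) -> (\bigcup_pq A g pq) t.
  move=> /rat_in_itvoo[p /itvP pl] cg.
  have H : \forall s \near t^'-, g s < ratr p.
    by apply: (cvgr_lt _ cg); rewrite pl.
  rewrite /at_left /within/= in H; have [e /= e0 He] := H.
  have /rat_in_itvoo[q /itvP ql] : t - e < t by rewrite gtrBl.
  exists (p, q) => //; rewrite /A/= ql pl; split=> //; split=> // s qs st.
  apply: He => //=; rewrite ger0_norm ?subr_ge0 ?(ltW st)//.
  by rewrite ltrBlDr -ltrBlDl (lt_trans _ qs)// ql.
apply: (@sub_countable _ _ _ (\bigcup_pq A f pq `|` \bigcup_pq A (fun t => - f t) pq)).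
  apply: subset_card_le => t nf.
  have [E|E|E] := ltgtP (lim (f s @[s --> t^'-])) (f t).
  - by left; exact: pick.
  - right; apply: pick.
      have -> : lim (- f s @[s --> t^'-]) = - lim (f s @[s --> t^'-]).
        by apply: cvg_lim => //; exact: cvgN.
      by rewrite ltrN2.
    by apply: is_cvgN.
  - by exfalso; apply: nf; rewrite -E; exact: lf.
by rewrite -bigcup2E; apply: bigcup_countable => // -[|[|?]] _; rewrite /bigcup2/=.
Qed.

End Rcll.

Section JointMeasurability.
Context (R : realType) dS (S : measurableType dS).

Lemma measurable_floor_set (n : nat) (z : int) :
  measurable [set r : R | Num.floor (r * n.+1%:R) = z].
Proof.
have n0 : 0 < n.+1%:R :> R by [].
rewrite (_ : mkset _ = `[z%:~R / n.+1%:R, (z + 1)%:~R / n.+1%:R[%classic)//.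
apply/seteqP; split=> r /=; rewrite in_itv/= ler_pdivrMr// ltr_pdivlMr//.
  by move=> <-; rewrite floor_le lt_succ_floor.
by move=> H; exact: floor_def.
Qed.

(** Each r is replaced by the next multiple of 1 / (n + 1) strictly to its right. The approximants
    are countable gluings along level sets of the floor, and right-continuity gives the pointwise
    limit. *)
Lemma right_continuous_joint (G : R -> S -> R) : (forall r, measurable_fun setT (G r)) ->
  (forall s r, G r' s @[r' --> r^'+] --> G r s) ->
  measurable_fun setT (fun p : R * S => G p.1 p.2).
Proof.
move=> mG rG.
pose g (n : nat) (r : R) : R := (Num.floor (r * n.+1%:R) + 1)%:~R / n.+1%:R.
apply: (measurable_fun_cvg (h := fun n p => G (g n p.1) p.2)).
- move=> n _ B mB; rewrite setTI.
  rewrite (_ : _ @^-1` B = \bigcup_(z in @setT int)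
     ([set r | Num.floor (r * n.+1%:R) = z] `*` (G ((z + 1)%:~R / n.+1%:R) @^-1` B))).
    apply: countable_bigcupT_measurable => [|z]; first exact: countableP.
    apply: measurableX.
      exact: measurable_floor_set.
    by rewrite -[X in measurable X]setTI; exact: mG.
  apply/seteqP; split=> [[r s] /= Bs|[r s] [z _ [/= fz Bz]]]; last by rewrite /g fz.
  by exists (Num.floor (r * n.+1%:R)).
- move=> [r s] _ /=; have /cvg_at_rightP := rG s r; apply; split.
    by move=> n; rewrite /g ltr_pdivlMr// lt_succ_floor.
  apply/cvgrPdist_le => e e0; near=> n.
  have n0 : 0 < n.+1%:R :> R by [].
  have H1 : r < g n r by rewrite /g ltr_pdivlMr// lt_succ_floor.
  have H2 : g n r <= r + n.+1%:R^-1.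
    rewrite /g ler_pdivrMr// mulrDl mulVf ?gt_eqF// intrD lerD2r; exact: floor_le.
  rewrite distrC ger0_norm ?subr_ge0 ?(ltW H1)// lerBlDl (le_trans H2)// lerD2l.
  by apply: ltW; near: n; apply: (near_infty_natSinv_lt (PosNum e0)).
Unshelve. all: by end_near. Qed.

End JointMeasurability.

Section TimeIntegral.
Context (R : realType) dS (S : measurableType dS).
Variables (T0 : R) (f : R * S -> \bar R).
Hypotheses (mf : measurable_fun setT f) (f0 : forall p, (0 <= f p)%E).

Let g (p : R * S) : \bar R := (f p * (\1_(`]0%R, T0]%classic) p.1)%:E)%E.

Let mg : measurable_fun setT g.
Proof.
apply: emeasurable_funM => //; apply/measurable_EFinP.
by apply: measurableT_comp => //; exact: measurable_indic.
Qed.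

Let g0 p : (0 <= g p)%E. Proof. by rewrite mule_ge0// lee_fin. Qed.

Let gE s : (\int[@lebesgue_measure R]_(r in `]0%R, T0]) f (r, s) = \int[@lebesgue_measure R]_r g (r, s))%E.
Proof. by rewrite integral_mkcond epatch_indic. Qed.

Lemma measurable_time_integral :
  measurable_fun setT (fun s => \int[lebesgue_measure]_(r in `]0%R, T0]) f (r, s))%E.
Proof.
rewrite (_ : (fun s => _) = fubini_G (@lebesgue_measure R) g).
  exact: measurable_fun_fubini_tonelli_G.
by apply/funext => s; rewrite /fubini_G gE.
Qed.

Variable mu : {sigma_finite_measure set S -> \bar R}.

Lemma measurable_space_integral : measurable_fun setT (fun r : R => \int[mu]_s f (r, s))%E.
Proof. exact: (@measurable_fun_fubini_tonelli_F _ _ _ _ _ mu). Qed.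

Lemma time_integral_swap :
  (\int[mu]_s \int[lebesgue_measure]_(r in `]0%R, T0]) f (r, s) =
   \int[lebesgue_measure]_(r in `]0%R, T0]) \int[mu]_s f (r, s))%E.
Proof.
under eq_integral do rewrite gE.
rewrite -(fubini_tonelli (m1 := @lebesgue_measure R) (m2 := mu) g mg g0) [RHS]integral_mkcond epatch_indic.
apply: eq_integral => r _ /=; rewrite muleC -ge0_integralZl//.
  by apply: eq_integral => s _; rewrite /g muleC.
exact: measurableT_comp.
Qed.

End TimeIntegral.

(** * Passage to the limit *)

Section SmallTerms.
Context (R : realType) d (S : measurableType d) (mu : {measure set S -> \bar R}).

Lemma summable_ae (D : set S) (g : nat -> S -> \bar R) : measurable D ->
  (forall k, measurable_fun D (g k)) -> (forall k x, D x -> (0 <= g k x)%E) ->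
  (\sum_(0 <= k <oo) \int[mu]_(x in D) g k x < +oo)%E ->
  {ae mu, forall x, D x -> (\sum_(0 <= k <oo) g k x < +oo)%E}.
Proof.
move=> mD mg g0 H.
have s0 x : D x -> (0 <= \sum_(0 <= k <oo) g k x)%E by move=> Dx; apply: nneseries_ge0 => k _ _; exact: g0.
have : mu.-integrable D (fun x => \sum_(0 <= k <oo) g k x)%E.
  apply/integrableP; split; first by apply: ge0_emeasurable_sum => // k x Dx _; exact: g0.
  under eq_integral => x do rewrite inE => Dx.
  rewrite (eq_integral (fun x => \sum_(0 <= k <oo) g k x)%E); last first.
    by move=> x; rewrite inE => Dx; rewrite gee0_abs// s0.
  by rewrite integral_nneseries.
move=> /(integrable_ae mD); apply: filterS => x H' Dx.
by rewrite -ge0_fin_numE ?s0//; exact: H'.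
Qed.

End SmallTerms.

Lemma summable_term0 (R : realType) (g : nat -> \bar R) (e : R) : 0 < e ->
  (forall k, (0 <= g k)%E) -> (\sum_(0 <= k <oo) g k < +oo)%E ->
  \forall k \near \oo, (g k < e%:E)%E.
Proof.
move=> e0 g0 H.
have := nneseries_tail_cvg (P := xpredT) H (fun k _ => g0 k).
have Ne : nbhs (0%E : \bar R) [set y | (y < e%:E)%E].
  by apply: open_nbhs_nbhs; split; [exact: open_ereal_lt_ereal|rewrite /= lte_fin].
move=> cv; have : \forall N \near \oo, (\sum_(N <= k <oo) g k < e%:E)%E by exact: cv _ Ne.
apply: filterS => k /=; apply: le_lt_trans.
rewrite (nneseries_split k 1)// addn1 big_nat1.
by rewrite leeDl// nneseries_ge0.
Qed.

(** * Convergence in probability through capped expectations *)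

Section InProbability.
Context (R : realType) d (T : measurableType d) (P : probability T R).

Definition cap1 (x : \bar R) : \bar R := mine 1%E x.

Lemma cap1_ge0 x : (0 <= x)%E -> (0 <= cap1 x)%E.
Proof. by move=> x0; rewrite /cap1 le_min lee01 x0. Qed.

Lemma cap1_le1 x : (cap1 x <= 1)%E.
Proof. by rewrite /cap1 ge_min lexx. Qed.

Lemma cap1_le x : (cap1 x <= x)%E.
Proof. by rewrite /cap1 ge_min lexx orbT. Qed.

Lemma cap1_mono x y : (x <= y)%E -> (cap1 x <= cap1 y)%E.
Proof.
by move=> xy; rewrite /cap1 le_min cap1_le1 (le_trans (cap1_le x)).
Qed.

Lemma cap1D x y : (0 <= x)%E -> (0 <= y)%E -> (cap1 (x + y) <= cap1 x + cap1 y)%E.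
Proof.
move=> x0 y0; rewrite {2 3}/cap1.
have [x1|x1] := leP 1%E x.
  by apply: le_trans (cap1_le1 _) _; rewrite leeDl// le_min lee01.
have [y1|y1] := leP 1%E y.
  by apply: le_trans (cap1_le1 _) _; rewrite leeDr.
exact: cap1_le.
Qed.

Lemma measurable_cap1 (f : T -> \bar R) : measurable_fun setT f ->
  measurable_fun setT (fun w => cap1 (f w)).
Proof. by move=> mf; exact: measurable_mine. Qed.

(** Convergence to 0 in probability, stated with the mean of min(1, Z): the cap is subadditive and
    tolerates infinite values, so errors can be added without handling events. *)
Definition pr0 (Z : nat -> T -> \bar R) := [/\ forall n, measurable_fun setT (Z n),
  forall n w, (0 <= Z n w)%E &
  forall e : R, 0 < e -> \forall n \near \oo, (\int[P]_w cap1 (Z n w) <= e%:E)%E].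

Lemma pr0_le (Z Z' : nat -> T -> \bar R) : (forall n, measurable_fun setT (Z' n)) ->
  (forall n w, (0 <= Z' n w)%E) -> (forall n, {ae P, forall w, (Z' n w <= Z n w)%E}) ->
  pr0 Z -> pr0 Z'.
Proof.
move=> mZ' Z0 ZZ [mZ Z0' H]; split=> // e e0; apply: filterS (H e e0) => n.
apply: le_trans; apply: ae_ge0_le_integral => //.
- by move=> w _; exact: cap1_ge0.
- exact: measurable_cap1.
- by move=> w _; exact: cap1_ge0.
- exact: measurable_cap1.
- by apply: filterS (ZZ n) => w ? _; exact: cap1_mono.
Qed.

Lemma pr0D (Z Z' : nat -> T -> \bar R) : pr0 Z -> pr0 Z' -> pr0 (fun n w => Z n w + Z' n w)%E.
Proof.
move=> [mZ Z0 H] [mZ' Z0' H']; split.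
- by move=> n; exact: emeasurable_funD.
- by move=> n w; rewrite adde_ge0.
move=> e e0; have e2 : 0 < e / 2 by rewrite divr_gt0.
near=> n.
apply: (@le_trans _ _ (\int[P]_w (cap1 (Z n w) + cap1 (Z' n w)))%E).
  apply: ge0_le_integral => //.
  - by move=> w _; rewrite cap1_ge0 ?adde_ge0.
  - by apply: measurable_cap1; exact: emeasurable_funD.
  - by apply: emeasurable_funD; exact: measurable_cap1.
  - by move=> w _; exact: cap1D.
rewrite ge0_integralD//; do ?[exact: measurable_cap1 | by move=> w _; exact: cap1_ge0].
rewrite [leRHS](_ : _ = ((e / 2)%:E + (e / 2)%:E)%E); last by rewrite -EFinD; congr EFin; field.
apply: leeD.
  by near: n; exact: H.
by near: n; exact: H'.
Unshelve. all: by end_near. Qed.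

Lemma pr00 : pr0 (fun _ _ => 0%E).
Proof.
split=> // e e0; apply: nearW => n; rewrite /cap1 min_r ?lee01//.
by rewrite integral0 lee_fin ltW.
Qed.

Lemma pr0_sum (I : Type) (s : seq I) (Z : I -> nat -> T -> \bar R) : (forall i, pr0 (Z i)) ->
  pr0 (fun n w => \sum_(i <- s) Z i n w)%E.
Proof.
move=> H; elim: s => [|i s ih].
  rewrite (_ : (fun n w => _) = fun _ _ => 0%E); first exact: pr00.
  by apply/funext => n; apply/funext => w; rewrite big_nil.
rewrite (_ : (fun n w => _) = fun n w => (Z i n w + \sum_(i <- s) Z i n w)%E).
  exact: pr0D.
by apply/funext => n; apply/funext => w; rewrite big_cons.
Qed.

(** The cap is not homogeneous; c is bounded by an integer, and Z is added to itself that many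
    times. *)
Lemma pr0Z (c : R) (Z : nat -> T -> \bar R) : 0 <= c -> pr0 Z -> pr0 (fun n w => c%:E * Z n w)%E.
Proof.
move=> c0 HZ; have [mZ Z0 _] := HZ.
pose m := (Num.truncn c).+1.
have := pr0_sum (iota 0 m) (fun _ => HZ); apply: pr0_le.
- by move=> n; exact: measurable_funeM.
- by move=> n w; rewrite mule_ge0// lee_fin.
- move=> n; apply: aeW => w.
  rewrite (_ : \sum_(i <- iota 0 m) Z n w = m%:R%:E * Z n w)%E.
    by apply: lee_wpmul2r => //; rewrite lee_fin ltW// truncnS_gt.
  have sz : size (iota 0 m) = m by rewrite size_iota.
  rewrite -[in RHS]sz; elim: (iota 0 m) => [|i s ih]; first by rewrite big_nil mul0e.
  rewrite big_cons ih/= -nat1r EFinD ge0_muleDl ?mul1e//.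
Qed.

Lemma pr0_prob (Z : nat -> T -> \bar R) : cvg_in_prob0 P Z -> pr0 (fun n w => `|Z n w|)%E.
Proof.
move=> [mZ H]; split=> //; first by move=> n; exact: measurableT_comp.
move=> e e0; have e2 : 0 < e / 2 by rewrite divr_gt0.
have Ne : nbhs (0%E : \bar R) [set y | (y < (e / 2)%:E)%E].
  by apply: open_nbhs_nbhs; split; [exact: open_ereal_lt_ereal|rewrite /= lte_fin].
have cv : \forall n \near \oo, (P [set w | ((e / 2)%:E <= `|Z n w|)%E] < (e / 2)%:E)%E.
  exact: H _ e2 _ Ne.
apply: filterS cv => n Hn.
pose B := [set w | ((e / 2)%:E <= `|Z n w|)%E].
have mB : measurable B.
  rewrite -[B]setTI; apply: emeasurable_fun_c_infty => //; exact: measurableT_comp.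
apply: (@le_trans _ _ (\int[P]_w ((e / 2)%:E + (\1_B w)%:E))%E).
  apply: ge0_le_integral => //.
  - by move=> w _; exact: cap1_ge0.
  - by apply: measurable_cap1; exact: measurableT_comp.
  - by apply/measurable_EFinP; apply: measurable_funD => //; exact: measurable_indic.
  - move=> w _; rewrite indicE; have [wB|wB] := pselect (B w).
      rewrite mem_set//; apply: le_trans (cap1_le1 _) _.
      by rewrite leeDr// lee_fin ltW.
    rewrite memNset// adde0; apply: le_trans (cap1_le _) _.
    by rewrite leNgt; apply/negP => /ltW.
rewrite ge0_integralD//=.
- rewrite integral_indic// setIT integral_cst//= -[X in (_ * X)%E]/(P setT) probability_setT mule1.
  rewrite [leRHS](_ : _ = ((e / 2)%:E + (e / 2)%:E)%E); last by rewrite -EFinD; congr EFin; field.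
  by rewrite leeD2l// ltW.
- by move=> w _; rewrite lee_fin ltW.
- by apply/measurable_EFinP; exact: measurable_indic.
Qed.

Lemma pr0_pointwise (Z : nat -> T -> \bar R) : (forall n, measurable_fun setT (Z n)) ->
  (forall n w, (0 <= Z n w)%E) -> {ae P, forall w, Z n w @[n --> \oo] --> 0%E} -> pr0 Z.
Proof.
move=> mZ Z0 H; split=> // e e0.
have ic : P.-integrable setT (cst 1%E).
  by have := finite_measure_integrable_cst P 1 measurableT.
have cc : {ae P, forall w, setT w -> cap1 (Z n w) @[n --> \oo] --> 0%E}.
  apply: filterS H => w Hw _; apply: (squeeze_cvge _ (cvg_cst _) Hw).
  by apply: nearW => n; rewrite cap1_ge0//= cap1_le.
have [_ _ cv] := dominated_convergence measurableT (fun n => measurable_cap1 (mZ n))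
  (measurable_cst _) cc ic
  (aeW _ (fun w n _ => le_trans (eq_ind_r (fun x => x <= _)%E (cap1_le1 _) (gee0_abs (cap1_ge0 (Z0 n w)))) (lexx _))).
have Ne : nbhs (0%E : \bar R) [set y | (y < e%:E)%E].
  by apply: open_nbhs_nbhs; split; [exact: open_ereal_lt_ereal|rewrite /= lte_fin].
rewrite integral0 in cv.
have cv' : \forall n \near \oo, (\int[P]_w cap1 (Z n w) < e%:E)%E by exact: cv _ Ne.
by apply: filterS cv' => n /ltW.
Qed.

(** Along [n_] the capped means are at most 2^-(k+1), so the capped errors are almost surely
    summable. Summability is recorded, and not mere convergence, because it is exploited once more
    in the time variable. *)
Lemma pr0_subseq (Z : nat -> T -> \bar R) : pr0 Z -> exists n_ : nat -> nat,
  (forall k, (k <= n_ k)%N) /\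
  {ae P, forall w, (\sum_(0 <= k <oo) cap1 (Z (n_ k) w) < +oo)%E}.
Proof.
move=> [mZ Z0 H].
have ch k : exists n : nat, (k <= n)%N /\ (\int[P]_w cap1 (Z n w) <= (1 / (2 ^ k.+1)%:R)%:E)%E.
  have e0 : 0 < 1 / (2 ^ k.+1)%:R :> R by rewrite divr_gt0// ltr0n expn_gt0.
  have [m _ Hm] := H _ e0.
  by exists (maxn k m); rewrite leq_maxl; split=> //; apply: Hm; rewrite /= leq_maxr.
have [n_ Hn] := choice ch; exists n_; split; first by move=> k; case: (Hn k).
have := @summable_ae _ _ _ P setT (fun k w => cap1 (Z (n_ k) w)) measurableT
  (fun k => measurable_cap1 (mZ _)) (fun k w _ => cap1_ge0 (Z0 _ _)).
move=> X; apply: filterS (X _) => [w Hw|]; first exact: Hw.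
apply: (@le_lt_trans _ _ (\sum_(0 <= k <oo) (1 / (2 ^ k.+1)%:R)%:E)%E); last first.
  by apply: le_lt_trans (epsilon_trick0 xpredT ler01) (ltry _).
apply: lee_nneseries => k _; last by case: (Hn k).
by move=> _; apply: integral_ge0 => w _; exact: cap1_ge0.
Qed.

End InProbability.

Lemma rcll_measurable (R : realType) (f : R -> R) : rcll f -> measurable_fun setT f.
Proof.
move=> [rf _].
have mj := @right_continuous_joint R _ _ (fun r (_ : unit) => f r)
  (fun r => measurable_cst (f r)) (fun _ r => rf r).
exact: (measurableT_comp mj (measurable_pair2 tt)).
Qed.

(** * Simple approximation of the drift *)

Section SimpleDrift.
Context (R : realType) (dT : measure_display) (T : measurableType dT).
Variables (F : R -> set (set T)) (phi : R -> T -> R) (T0 : R).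
Hypothesis T00 : 0 < T0.
Hypothesis F_sig : forall t, 0 <= t -> sigma_algebra setT (F t).
Hypothesis mphi : forall t, 0 <= t -> Fm F t (phi t).
Hypothesis rphi : forall w, rcll (phi ^~ w).

Let t n i : R := i%:R / n.+1%:R.
Let len n := (n.+1 * (Num.truncn T0).+1)%N.
Let coef n (i : nat) w : R := Num.max (- n%:R) (Num.min n%:R (phi (t n i) w)).

Let t_ge0 n i : 0 <= t n i. Proof. by rewrite divr_ge0. Qed.

Let coef_Fm n i B : measurable B -> F (t n i) (coef n i @^-1` B).
Proof.
move=> mB; have m1 : Fm F (t n i) (coef n i).
  by apply: measurable_maxr => //; apply: measurable_minr => //; exact: mphi.
have := m1 measurableT B mB; rewrite setTI.
by rewrite /measurable/= sigma_algebra_id//; exact: F_sig.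
Qed.

(** Sampling at the left end of cells of length 1 / (n + 1) makes the coefficient known in time, and
    truncation at level n makes it bounded; enough cells are taken to cover [0, T0]. *)
Definition simple_drift (n : nat) : simple_process F.
Proof.
refine (@SimpleProcess R dT T F (len n) (fun i => t n i) (fun i => t n i.+1)
  (fun i => coef n i) _ _ _).
- by move=> i; rewrite t_ge0 /t ler_pM2r ?invr_gt0// ler_nat leqnSn.
- move=> i; exists n%:R => w; rewrite ler_norml le_max lexx/= ge_max ge_min lexx/= andbT.
  by rewrite (@le_trans _ _ 0)// oppr_le0.
- by move=> i A [B mB <-]; rewrite setTI; exact: coef_Fm.
Defined.

Let gr n : grid (t n (len n)) n.+1%:R^-1 (len n) (t n).
Proof.
split=> // [|i _]; first by rewrite /t mul0r.
rewrite /t ltr_pM2r ?invr_gt0// ltr_nat ltnSn; split=> //.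
by rewrite -mulrBl -natrB// subSnn mul1r.
Qed.

Let T0_len n : T0 <= t n (len n).
Proof.
rewrite /t /len natrM mulrAC mulfV// mul1r; apply: ltW; exact: truncnS_gt.
Qed.

Let val n r w : 0 < r <= T0 -> exists i,
  [/\ (i < len n)%N, t n i < r <= t n i.+1 & sp_val (simple_drift n) r w = coef n i w].
Proof.
move=> /andP[r0 rT]; have r01 : 0 < r <= t n (len n) by rewrite r0 (le_trans rT).
have [il ir] := grid_cell (gr n) r01; exists (gidx (len n) (t n) r); split=> //.
rewrite /sp_val/= (bigD1 (Ordinal il))//= big1 ?addr0.
  by rewrite indic_oc ir mulr1.
move=> i ni; rewrite indic_oc; case: (boolP (_ < _ <= _)) => [H|]; last by rewrite mulr0.
case/eqP: ni; apply: val_inj => /=.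
by rewrite (gidxE (gr n) (ltn_ord i) H).
Qed.

(** The sampling points approach r from the left, so convergence holds at points of left continuity,
    hence almost everywhere; the path is bounded on [0, T0], which provides the domination. *)
Lemma simple_drift_cvg w :
  (\int[lebesgue_measure]_(r in `]0%R, T0]) `|sp_val (simple_drift n) r w - phi r w|%:E)%E
    @[n --> \oo] --> 0%E.
Proof.
have [M M0 HM] := rcll_bounded T0 (rphi w).
have mD : measurable (`]0, T0]%classic : set R) by [].
have mp : measurable_fun setT (phi ^~ w) by exact: rcll_measurable.
have ms n : measurable_fun setT (fun r => sp_val (simple_drift n) r w).
  by apply: measurable_sum => i; apply: measurable_funM => //; exact: measurable_indic.
have cb n i : `|coef n i w| <= `|phi (t n i) w|.
  rewrite /coef; have n0 : 0 <= n%:R :> R by [].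
  move: (phi _ _) => x; have H1 := ler_norm x.
  have H2 : - `|x| <= x by rewrite lerNl; have := ler_norm (- x); rewrite normrN.
  have H3 : - `|x| <= n%:R by apply: le_trans n0; rewrite oppr_le0.
  have H4 : - n%:R <= `|x| by apply: (@le_trans _ _ 0); rewrite ?oppr_le0.
  by rewrite ler_norml le_max le_min H2 H3 orbT/= ge_max H4 ge_min H1 orbT.
pose f_ n (r : R) : \bar R := `|sp_val (simple_drift n) r w - phi r w|%:E.
have cvg_f : {ae lebesgue_measure, forall r, (`]0, T0]%classic : set R) r -> f_ n r @[n --> \oo] --> 0%E}.
  have cN := rcll_left_continuous (rphi w).
  exists [set r | ~ (phi s w @[s --> r^'-] --> phi r w)]; split.
  - exact: countable_measurable.
  - exact: countable_lebesgue_measure0.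
  move=> r /= H lc; apply: H; rewrite /= in_itv/= => r0.
  have ch n := val n w r0.
  have /choice[i Hi] : forall n, exists i,
    [/\ (i < len n)%N, t n i < r <= t n i.+1 & sp_val (simple_drift n) r w = coef n i w] by move=> n; exact: ch.
  have lim1 : phi (t n (i n)) w @[n --> \oo] --> phi r w.
    have /cvg_at_leftP := lc; apply; split.
      by move=> n; have [_ /andP[]] := Hi n.
    apply/cvgrPdist_le => e e0; near=> n.
    have [_ /andP[H1 H2] _] := Hi n.
    rewrite ger0_norm ?subr_ge0 ?(ltW H1)// lerBlDl (le_trans H2)//.
    rewrite /t -addn1 natrD mulrDl mul1r lerD2l.
    by apply: ltW; near: n; apply: (near_infty_natSinv_lt (PosNum e0)).
  apply: cvg_EFin; first exact: nearW.
  rewrite -(normr0 R); apply: cvg_norm; rewrite -(subrr (phi r w)).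
  apply: cvgB; last exact: cvg_cst.
  apply: cvg_trans lim1; apply: near_eq_cvg; near=> n => /=.
  have [il /andP[H1 H2] ->] := Hi n.
  have tT : t n (i n) <= T0 by rewrite (le_trans (ltW H1))//; case/andP: r0.
  have := HM (t n (i n)); rewrite t_ge0 tT => /(_ isT).
  rewrite /coef; move: (phi _ w) => x xM.
  have nM : M <= n%:R by near: n; exact: nbhs_infty_ger.
  have := le_trans xM nM; rewrite ler_norml => /andP[H3 H4].
  by rewrite (min_idPr H4) (max_idPr H3).
have iC : lebesgue_measure.-integrable (`]0, T0]%classic : set R) (EFin \o cst (M + M)).
  apply/integrableP; split; first by apply/measurable_EFinP; exact: measurable_cst.
  under eq_integral do rewrite /= ger0_norm ?addr_ge0//.
  by rewrite integral_cst//= lebesgue_measure_itv/= lte_fin T00 -EFinB -EFinM ltry.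
have dom : {ae lebesgue_measure, forall (r : R) n, (`]0, T0]%classic : set R) r -> (`|f_ n r| <= (EFin \o cst (M + M)%R) r)%E}.
  apply: aeW => r n /=; rewrite in_itv/= => r0; rewrite lee_fin normr_id.
  have [i [il /andP[H1 H2] ->]] := val n w r0.
  apply: le_trans (ler_normB _ _) _; apply: lerD.
    apply: le_trans (cb _ _) _; apply: HM; rewrite t_ge0 (le_trans (ltW H1))//.
    by case/andP: r0.
  by apply: HM; case/andP: r0 => /ltW -> ->.
have mf n : measurable_fun (`]0, T0]%classic : set R) (f_ n).
  apply/measurable_EFinP; apply: measurable_funTS; apply: measurableT_comp => //.
  exact: measurable_funB.
have [_ _] := @dominated_convergence _ _ R (@lebesgue_measure R) _ mD _ _ _ mf (measurable_cst 0%E) cvg_f iC dom.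
by rewrite integral0.
Unshelve. all: by end_near. Qed.

End SimpleDrift.

Section PathLimit.
Context (R : realType) d (S : measurableType d) (mu : {measure set S -> \bar R}) (D : set S).
Variables (q0 G : S -> R) (F Gk : nat -> S -> R) (dl : nat -> S -> \bar R) (C : R).
Hypotheses (mD : measurable D) (fD : (mu D < +oo)%E) (C0 : 0 <= C).
Hypothesis mG : measurable_fun D G.
Hypothesis mF : forall k, measurable_fun D (F k).
Hypothesis mGk : forall k, measurable_fun D (Gk k).
Hypothesis mdl : forall k, measurable_fun D (dl k).
Hypothesis dl0 : forall k r, (0 <= dl k r)%E.
Hypothesis q00 : forall r, 0 <= q0 r.
Hypothesis iq0 : mu.-integrable D (EFin \o q0).
Hypothesis F_Gk : forall e k, 0 < e -> {ae mu, forall r : S, D r ->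
  (`|F k r - Gk k r|%:E <= C%:E * ((1 + e^-1)%:E * dl k r + (e * q0 r)%:E))%E}.
Hypothesis dl_cvg : forall e : R, 0 < e ->
  \forall k \near \oo, (\int[mu]_(r in D) dl k r <= e%:E)%E.
Hypothesis Gk_cvg : {ae mu, forall r : S, D r -> Gk k r @[k --> \oo] --> G r}.
Hypothesis Gk_le : forall k, {ae mu, forall r : S, D r -> `|Gk k r| <= C * (1 + q0 r)}.
Hypothesis G_le : {ae mu, forall r : S, D r -> `|G r| <= C * (1 + q0 r)}.

Let i1 : mu.-integrable D (EFin \o (fun r => C * (1 + q0 r) + C * (1 + q0 r))).
Proof.
have ic : mu.-integrable D (EFin \o cst 1).
  apply/integrableP; split; first by apply/measurable_EFinP; exact: measurable_cst.
  by under eq_integral do rewrite /= normr1; rewrite integral_cst// mul1e.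
have i2 : mu.-integrable D (EFin \o (fun r => C * (1 + q0 r))).
  by have := integrableZl mD C (integrableD mD ic iq0); apply: eq_integrable.
by have := integrableD mD i2 i2; apply: eq_integrable.
Qed.

Let Gk_lim : (\int[mu]_(r in D) `|Gk k r - G r|%:E)%E @[k --> \oo] --> 0%E.
Proof.
pose f_ k (r : S) : \bar R := `|Gk k r - G r|%:E.
have mf k : measurable_fun D (f_ k).
  by apply/measurable_EFinP; apply: measurableT_comp => //; exact: measurable_funB.
have cf : {ae mu, forall r, D r -> f_ k r @[k --> \oo] --> 0%E}.
  apply: filterS Gk_cvg => r H Dr; apply: cvg_EFin; first exact: nearW.
  rewrite -(normr0 R); apply: cvg_norm; rewrite -(subrr (G r)).
  by apply: cvgB; [exact: H|exact: cvg_cst].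
have df : {ae mu, forall r k, D r -> (`|f_ k r| <= (C * (1 + q0 r) + C * (1 + q0 r))%:E)%E}.
  have /ae_foralln H := Gk_le; apply: filterS2 H G_le => r H1 H2 k Dr.
  rewrite lee_fin normr_id; apply: le_trans (ler_normB _ _) _.
  by apply: lerD; [exact: H1|exact: H2].
have [_ _] := dominated_convergence mD mf (measurable_cst _) cf i1 df.
by rewrite integral0.
Qed.

(** In the applications [F k] uses approximate coefficients at the approximate position, [Gk k] true
    coefficients at the approximate position, and [G] the true ones throughout. The first gap is
    small in integral by hypothesis [F_Gk], the second by dominated convergence. *)
Lemma path_limit (e : R) : 0 < e ->
  \forall k \near \oo, (\int[mu]_(r in D) `|F k r - G r|%:E <= e%:E)%E.
Proof.
have Q : (\int[mu]_(r in D) (q0 r)%:E)%E \is a fin_num by exact: integrable_fin_num.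
pose Q0 := fine (\int[mu]_(r in D) (q0 r)%:E)%E.
have QE : (\int[mu]_(r in D) (q0 r)%:E = Q0%:E)%E by rewrite fineK.
have Q00 : 0 <= Q0 by apply: fine_ge0; apply: integral_ge0 => r _; rewrite lee_fin.
have small (u : nat -> \bar R) (e' : R) : 0 < e' -> u k @[k --> \oo] --> 0%E ->
    \forall k \near \oo, (u k < e'%:E)%E.
  move=> e0 cu; have Ne : nbhs (0%E : \bar R) [set y | (y < e'%:E)%E].
    by apply: open_nbhs_nbhs; split; [exact: open_ereal_lt_ereal|rewrite /= lte_fin].
  exact: cu _ Ne.
(* [e1] makes the term with [q0] small; [e2] is then the tolerance on the coefficient error, which
   gets multiplied by 1 + 1 / e1. *)
move=> e0; pose e1 := e / (3 * (C * Q0 + 1)).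
have CQ : 0 < C * Q0 + 1 by rewrite ltr_wpDl// mulr_ge0.
have e10 : 0 < e1 by rewrite divr_gt0// mulr_gt0.
pose e2 := e / (3 * (C * (1 + e1^-1) + 1)).
have CE : 0 < C * (1 + e1^-1) + 1 by rewrite ltr_wpDl// mulr_ge0// addr_ge0// invr_ge0 ltW.
have e20 : 0 < e2 by rewrite divr_gt0// mulr_gt0.
near=> k.
have frac (x y : R) : 0 <= x -> 0 <= y -> x * (y / (x + 1)) <= y.
  move=> x0 y0; rewrite mulrCA ler_piMr// ler_pdivrMr ?ltr_wpDl//.
  by rewrite mul1r lerDl.
have mabs (f g : S -> R) : measurable_fun D f -> measurable_fun D g -> measurable_fun D (fun r : S => `|f r - g r|%:E).
  by move=> mf mg; apply/measurable_EFinP; apply: measurableT_comp => //; exact: measurable_funB.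
have mR : measurable_fun D (fun r => C%:E * ((1 + e1^-1)%:E * dl k r + (e1 * q0 r)%:E))%E.
  apply: measurable_funeM; apply: emeasurable_funD; first exact: measurable_funeM.
  have /integrableP[mq _] := iq0; have /measurable_EFinP mq' := mq.
  by apply/measurable_EFinP; exact: measurable_funM.
have R0 r : (0 <= C%:E * ((1 + e1^-1)%:E * dl k r + (e1 * q0 r)%:E))%E.
  rewrite mule_ge0 ?lee_fin// adde_ge0 ?mule_ge0 ?lee_fin//.
    by rewrite addr_ge0// invr_ge0 ltW.
  by rewrite mulr_ge0// ltW.
apply: (@le_trans _ _ (\int[mu]_(r in D)
   (C%:E * ((1 + e1^-1)%:E * dl k r + (e1 * q0 r)%:E) + `|Gk k r - G r|%:E))%E).
  apply: ae_ge0_le_integral => //.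
  - exact: mabs.
  - by move=> r _; rewrite adde_ge0// lee_fin.
  - by apply: emeasurable_funD => //; exact: mabs.
  apply: filterS (F_Gk k e10) => r H Dr; apply: (@le_trans _ _ (`|F k r - Gk k r|%:E + `|Gk k r - G r|%:E)%E).
    rewrite -EFinD lee_fin (_ : F k r - G r = (F k r - Gk k r) + (Gk k r - G r)); last by ring.
    exact: ler_normD.
  by apply: leeD => //; exact: H.
rewrite ge0_integralD//; last exact: mabs.
rewrite [leRHS](_ : _ = ((e / 3 + e / 3) + e / 3)%:E); last by congr EFin; field.
rewrite [leRHS]EFinD; apply: leeD; last first.
  apply: ltW; near: k; apply: small => //; by rewrite divr_gt0.
have mq' : measurable_fun D q0.
  by have /integrableP[mq _] := iq0; have /measurable_EFinP := mq.
rewrite ge0_integralZl//; last 2 first.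
- apply: emeasurable_funD; first exact: measurable_funeM.
  by apply/measurable_EFinP; exact: measurable_funM.
- move=> r _; rewrite adde_ge0 ?mule_ge0 ?lee_fin//.
    by rewrite addr_ge0// invr_ge0 ltW.
  by rewrite mulr_ge0// ltW.
have c10 : (0 <= (1 + e1^-1)%:E)%E by rewrite lee_fin addr_ge0// invr_ge0 ltW.
rewrite ge0_integralD//; last 4 first.
- by move=> r _; rewrite mule_ge0.
- exact: measurable_funeM.
- by move=> r _; rewrite lee_fin mulr_ge0// ltW.
- by apply/measurable_EFinP; exact: measurable_funM.
rewrite ge0_integralZl//.
under [X in (_ + X)%E]eq_integral do rewrite EFinM.
rewrite ge0_integralZl//; last 3 first.
- by apply/measurable_EFinP.
- by move=> r _; rewrite lee_fin.
- by rewrite lee_fin ltW.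
rewrite QE -EFinM.
apply: (@le_trans _ _ (C%:E * ((1 + e1^-1)%:E * e2%:E + (e1 * Q0)%:E))%E).
  apply: lee_wpmul2l => //; apply: leeD => //; apply: lee_wpmul2l => //.
  by near: k; exact: dl_cvg.
rewrite (_ : (C%:E * _)%E = (C * ((1 + e1^-1) * e2 + e1 * Q0))%:E)// lee_fin mulrDr; apply: lerD.
  have -> : e2 = e / 3 / (C * (1 + e1^-1) + 1) by rewrite /e2 invfM mulrA.
  rewrite mulrA; apply: frac; last by rewrite divr_ge0// ltW.
  by rewrite mulr_ge0// addr_ge0// invr_ge0 ltW.
have -> : e1 = e / 3 / (C * Q0 + 1) by rewrite /e1 invfM mulrA.
rewrite [_ * Q0]mulrC mulrA; apply: frac; first exact: mulr_ge0.
by rewrite divr_ge0// ltW.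
Unshelve. all: by end_near. Qed.

End PathLimit.

Lemma cvg_seq_sum (R : realType) (I : Type) (s : seq I) (f : I -> nat -> R) (l : I -> R) :
  (forall i, f i k @[k --> \oo] --> l i) ->
  \sum_(i <- s) f i k @[k --> \oo] --> \sum_(i <- s) l i.
Proof.
move=> H; elim: s => [|i s ih].
  by under eq_fun do rewrite big_nil; rewrite big_nil; exact: cvg_cst.
by under eq_fun do rewrite big_cons; rewrite big_cons; exact: cvgD.
Qed.

Lemma tri3 (R : realType) (x1 x2 x3 y1 y2 y3 c1 c2 c3 : R) : `|x1 - y1| <= c1 ->
  `|x2 - y2| <= c2 -> `|x3 - y3| <= c3 -> `|x1 + x2 + x3 - (y1 + y2 + y3)| <= c1 + c2 + c3.
Proof.
move=> H1 H2 H3; rewrite (_ : _ - _ = (x1 - y1) + (x2 - y2) + (x3 - y3)); last by ring.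
by apply: le_trans (ler_normD _ _) _; apply: lerD => //; apply: le_trans (ler_normD _ _) _; exact: lerD.
Qed.

(** * Stability of the generator in its coefficients and its base point *)

Section Close.
Context (R : realType) (dU : measure_display) (U : measurableType dU).
Variables (nu : {measure set U -> \bar R}) (d : nat).
Implicit Types (y z : 'cV[R]_d) (C : U -> 'cV[R]_d) (S : 'I_d -> 'cV[R]_d).

Definition cvgv (u : nat -> 'cV[R]_d) y := forall i, u k i 0 @[k --> \oo] --> y i 0.

Lemma cvgv_dotv u v y z : cvgv u y -> cvgv v z -> dotv (u k) (v k) @[k --> \oo] --> dotv y z.
Proof.
by move=> cu cv; apply: cvg_seq_sum => i; apply: cvgM; [exact: cu|exact: cv].
Qed.

Lemma cvgvD u v y z : cvgv u y -> cvgv v z -> cvgv (fun k => u k + v k) (y + z).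
Proof.
move=> cu cv i; rewrite mxE; under eq_fun do rewrite mxE.
by apply: cvgD; [exact: cu|exact: cv].
Qed.

Lemma cvgv_cst y : cvgv (fun=> y) y. Proof. by move=> i; exact: cvg_cst. Qed.

(** Young's inequality with a free parameter: only the error z' - z carries the large factor 1 / e,
    and the fixed z carries the small one. *)
Lemma prod_close z' z (e : R) : 0 < e ->
  frob (z' - z) * (frob z' + frob z) <= (1 + e^-1) * frob (z' - z) ^+ 2 + e * frob z ^+ 2.
Proof.
move=> e0; have x0 := frob_ge0 (z' - z); have y0 := frob_ge0 z.
have : frob z' <= frob (z' - z) + frob z by rewrite -[X in frob X](subrK z) frobD.
move: (frob (z' - z)) (frob z) (frob z') x0 y0 => x y t x0 y0 H.
apply: (@le_trans _ _ (x * (x + y + y))); first by rewrite ler_wpM2l// lerD2r.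
rewrite -subr_ge0 (_ : _ - _ = e^-1 * (x - e * y) ^+ 2); last by field; rewrite gt_eqF.
by rewrite mulr_ge0 ?sqr_ge0// invr_ge0 ltW.
Qed.

Lemma sqr_close z' z (e : R) : 0 < e ->
  `|frob z' ^+ 2 - frob z ^+ 2| <= (1 + e^-1) * frob (z' - z) ^+ 2 + e * frob z ^+ 2.
Proof.
move=> e0; apply: le_trans (prod_close z' z e0).
rewrite subr_sqr normrM [X in _ * X]ger0_norm ?addr_ge0 ?frob_ge0//.
rewrite ler_wpM2r ?addr_ge0 ?frob_ge0// ler_norml; apply/andP; split.
  rewrite lerNl opprB lerBlDr -(frobN (z' - z)) opprB.
  by rewrite -[X in frob X <= _](subrK z') frobD.
by rewrite lerBlDr -[X in frob X <= _](subrK z) frobD.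
Qed.

Definition sq_integrable C := mvec C /\ nu.-integrable setT (fun u => (frob (C u) ^+ 2)%:E).

Lemma sq_integrableB C' C : sq_integrable C' -> sq_integrable C ->
  sq_integrable (fun u => C' u - C u).
Proof.
move=> [mC' iC'] [mC iC]; split; first exact: mvecB.
have i2 : nu.-integrable setT (EFin \o (fun u => 2 * frob (C' u) ^+ 2 + 2 * frob (C u) ^+ 2)).
  have := integrableD measurableT (integrableZl measurableT 2 iC') (integrableZl measurableT 2 iC).
  exact: eq_integrable.
apply: (le_integrable _ _ _ i2) => //.
  apply/measurable_EFinP; under eq_fun do rewrite frob_dotv.
  by apply: measurable_dotv; exact: mvecB.
move=> u _ /=; have p2 : 0 <= 2 * frob (C' u) ^+ 2 + 2 * frob (C u) ^+ 2.
  by apply: addr_ge0; apply: mulr_ge0 => //; exact: sqr_ge0.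
rewrite lee_fin (ger0_norm p2) ger0_norm ?sqr_ge0//.
have : frob (C' u - C u) <= frob (C' u) + frob (C u) by rewrite -(frobN (C u)) frobD.
have := frob_ge0 (C' u - C u); move: (frob _) (frob (C' u)) (frob (C u)) => x a b x0 xab.
apply: (@le_trans _ _ ((a + b) ^+ 2)); first by rewrite lerXn2r// nnegrE (le_trans x0).
rewrite -subr_ge0 (_ : _ - _ = (a - b) ^+ 2); first exact: sqr_ge0.
by ring.
Qed.

Let Rint_close (phi' phi : U -> R) C' C (e c : R) : 0 < e -> 0 <= c ->
  sq_integrable C' -> sq_integrable C ->
  nu.-integrable setT (EFin \o phi') -> nu.-integrable setT (EFin \o phi) ->
  (forall u, `|phi' u - phi u| <= c * ((1 + e^-1) * frob (C' u - C u) ^+ 2 + e * frob (C u) ^+ 2)) ->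
  `|\int[nu]_u phi' u - \int[nu]_u phi u| <=
  c * ((1 + e^-1) * \int[nu]_u (frob (C' u - C u) ^+ 2) + e * \int[nu]_u (frob (C u) ^+ 2)).
Proof.
move=> e0 c0 sC' sC i' i H; have [_ iB] := sq_integrableB sC' sC; have [_ iC] := sC.
rewrite -RintegralB//.
have j1 : nu.-integrable setT (EFin \o (fun u => (1 + e^-1) * frob (C' u - C u) ^+ 2)).
  by have := integrableZl measurableT (1 + e^-1) iB; apply: eq_integrable.
have j2 : nu.-integrable setT (EFin \o (fun u => e * frob (C u) ^+ 2)).
  by have := integrableZl measurableT e iC; apply: eq_integrable.
have j3 : nu.-integrable setT (EFin \o (fun u => (1 + e^-1) * frob (C' u - C u) ^+ 2 + e * frob (C u) ^+ 2)).
  by have := integrableD measurableT j1 j2; apply: eq_integrable.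
rewrite -!RintegralZl// -RintegralD// -RintegralZl//.
apply: abs_Rintegral_le.
- by have := integrableB measurableT i' i; apply: eq_integrable.
- by have := integrableZl measurableT c j3; apply: eq_integrable.
- by apply: aeW.
Qed.

Let sum_close (I : finType) (p' p : I -> R) (s' s : I -> 'cV[R]_d) (e c : R) : 0 < e ->
  (forall j, `|p' j - p j| <= c * ((1 + e^-1) * frob (s' j - s j) ^+ 2 + e * frob (s j) ^+ 2)) ->
  `|\sum_j p' j - \sum_j p j| <=
  c * ((1 + e^-1) * \sum_j frob (s' j - s j) ^+ 2 + e * \sum_j frob (s j) ^+ 2).
Proof.
move=> e0 H; rewrite -sumrB; apply: le_trans (ler_norm_sum _ _ _) _.
by rewrite !mulr_sumr -big_split/= mulr_sumr; apply: ler_sum => j _; exact: H.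
Qed.

Lemma coq_close b' S' C' b S C (e : R) : 0 < e -> sq_integrable C' -> sq_integrable C ->
  `|coq nu b' S' C' - coq nu b S C| <=
  (1 + e^-1) * coq nu (b' - b) (fun j => S' j - S j) (fun u => C' u - C u) + e * coq nu b S C.
Proof.
move=> e0 sC' sC; rewrite /coq.
have H1 : `|frob b' - frob b| <= (1 + e^-1) * frob (b' - b) + e * frob b.
  apply: (@le_trans _ _ (frob (b' - b))).
    rewrite ler_norml; apply/andP; split.
      rewrite lerNl opprB lerBlDr -(frobN (b' - b)) opprB.
      by rewrite -[X in frob X <= _](subrK b') frobD.
    by rewrite lerBlDr -[X in frob X <= _](subrK b) frobD.
  rewrite mulrDl mul1r -addrA lerDl addr_ge0// mulr_ge0 ?frob_ge0 ?invr_ge0// ltW//.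
have H2 := @sum_close _ (fun j => frob (S' j) ^+ 2) (fun j => frob (S j) ^+ 2) S' S e 1 e0.
have {}H2 : `|\sum_j frob (S' j) ^+ 2 - \sum_j frob (S j) ^+ 2| <=
   (1 + e^-1) * \sum_j frob (S' j - S j) ^+ 2 + e * \sum_j frob (S j) ^+ 2.
  by rewrite -[leRHS]mul1r; apply: H2 => j; rewrite mul1r; exact: sqr_close.
have H3 : `|\int[nu]_u (frob (C' u) ^+ 2) - \int[nu]_u (frob (C u) ^+ 2)| <=
   (1 + e^-1) * \int[nu]_u (frob (C' u - C u) ^+ 2) + e * \int[nu]_u (frob (C u) ^+ 2).
  rewrite -[leRHS]mul1r; have [_ i'] := sC'; have [_ i] := sC.
  by apply: Rint_close => // u; rewrite mul1r; exact: sqr_close.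
apply: le_trans (tri3 H1 H2 H3) _.
by rewrite le_eqVlt; apply/orP; left; apply/eqP; ring.
Qed.

Variables (h h1 h2 : R -> R) (C0 : R).
Hypothesis hc : continuous h.
Hypothesis h1c : continuous h1.
Hypothesis h2c : continuous h2.
Hypothesis C01 : 1 <= C0.
Hypothesis tf_le : forall y : 'cV[R]_d, `|tf h y| <= C0.
Hypothesis tg_le : forall y z : 'cV[R]_d, `|tg h1 y z| <= C0 * frob z.
Hypothesis tD_le : forall y z z' : 'cV[R]_d, `|tD h1 h2 y z z'| <= C0 * (frob z * frob z').
Hypothesis tT_le : forall y z : 'cV[R]_d, `|tT h h1 y z| <= C0 * frob z ^+ 2.
Hypothesis tT_lip : forall y z z', `|tT h h1 y z - tT h h1 y z'| <= C0 * (frob (z - z') * (frob z + frob z')).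

Let C00 : 0 <= C0. Proof. exact: le_trans ler01 C01. Qed.

Lemma gen_close y b' S' C' b S C (e : R) : 0 < e -> sq_integrable C' -> sq_integrable C ->
  `|gen nu h h1 h2 y b' S' C' - gen nu h h1 h2 y b S C| <=
  C0 * ((1 + e^-1) * coq nu (b' - b) (fun j => S' j - S j) (fun u => C' u - C u) + e * coq nu b S C).
Proof.
move=> e0 sC' sC; rewrite /coq /gen.
have ei : 0 <= e^-1 by rewrite invr_ge0 ltW.
have H1 : `|tg h1 y b' - tg h1 y b| <= C0 * ((1 + e^-1) * frob (b' - b) + e * frob b).
  rewrite -tgNr -tgDr; apply: le_trans (tg_le _ _) _; rewrite ler_wpM2l//.
  rewrite mulrDl mul1r -addrA lerDl addr_ge0// mulr_ge0 ?frob_ge0// ltW//.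
have H2 : `|\sum_j tD h1 h2 y (S' j) (S' j) - \sum_j tD h1 h2 y (S j) (S j)| <=
   C0 * ((1 + e^-1) * \sum_j frob (S' j - S j) ^+ 2 + e * \sum_j frob (S j) ^+ 2).
  apply: (@sum_close _ _ _ S' S) => // j.
  apply: (@le_trans _ _ (C0 * (frob (S' j - S j) * (frob (S' j) + frob (S j))))); last first.
    by rewrite ler_wpM2l// prod_close.
  rewrite (_ : tD h1 h2 y (S' j) (S' j) - _ =
     tD h1 h2 y (S' j - S j) (S' j) + tD h1 h2 y (S' j - S j) (S j)); last first.
    have tDNl x z : tD h1 h2 y (- x) z = - tD h1 h2 y x z by rewrite -scaleN1r tDZl mulN1r.
    rewrite !tDDl !tDNl [tD _ _ _ (S j) (S' j)]tDC.
    by move: (tD _ _ _ _ _) (tD _ _ _ _ _) (tD _ _ _ _ _) => a1 a2 a3; ring.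
  apply: le_trans (ler_normD _ _) _; rewrite mulrDr mulrDr.
  by apply: lerD; exact: tD_le.
have [_ i'] := sC'; have [_ i] := sC.
have H3 : `|\int[nu]_u tT h h1 y (C' u) - \int[nu]_u tT h h1 y (C u)| <=
   C0 * ((1 + e^-1) * \int[nu]_u (frob (C' u - C u) ^+ 2) + e * \int[nu]_u (frob (C u) ^+ 2)).
  apply: Rint_close => //.
  - by have [] := gen_le hc h1c C01 tg_le tD_le tT_le y b S sC'.1 i'.
  - by have [] := gen_le hc h1c C01 tg_le tD_le tT_le y b S sC.1 i.
  move=> u; apply: le_trans (tT_lip _ _ _) _; rewrite ler_wpM2l//.
  exact: prod_close.
have H2' : `|(\sum_j tD h1 h2 y (S' j) (S' j)) / 2 - (\sum_j tD h1 h2 y (S j) (S j)) / 2| <=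
   C0 * ((1 + e^-1) * \sum_j frob (S' j - S j) ^+ 2 + e * \sum_j frob (S j) ^+ 2).
  rewrite -mulrBl normrM [`|2^-1|]gtr0_norm ?invr_gt0//; apply: le_trans _ H2.
  by rewrite ler_piMr// invf_le1// ler1n.
apply: le_trans (tri3 H1 H2' H3) _.
by rewrite le_eqVlt; apply/orP; left; apply/eqP; ring.
Qed.

Lemma tf_cvg u y : cvgv u y -> tf h (u k) @[k --> \oo] --> tf h y.
Proof. by move=> cu; exact: (cvg_comp _ _ (cvgv_dotv cu cu) (@hc (dotv y y))). Qed.

Lemma tg_cvg u y z : cvgv u y -> tg h1 (u k) z @[k --> \oo] --> tg h1 y z.
Proof.
move=> cu; apply: cvgM; last first.
  exact: (cvgv_dotv cu (@cvgv_cst z)).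

apply: cvgM; first exact: cvg_cst.
exact: (cvg_comp _ _ (cvgv_dotv cu cu) (@h1c (dotv y y))).
Qed.

Lemma tD_cvg u y z z' : cvgv u y -> tD h1 h2 (u k) z z' @[k --> \oo] --> tD h1 h2 y z z'.
Proof.
move=> cu; apply: cvgD; apply: cvgM.
- apply: cvgM; first exact: cvg_cst.
  exact: (cvg_comp _ _ (cvgv_dotv cu cu) (@h1c (dotv y y))).
- exact: cvg_cst.
- apply: cvgM; last exact: (cvgv_dotv cu (@cvgv_cst z)).
  apply: cvgM; first exact: cvg_cst.
  exact: (cvg_comp _ _ (cvgv_dotv cu cu) (@h2c (dotv y y))).
- exact: (cvgv_dotv cu (@cvgv_cst z')).
Qed.

(** In the jump part the Taylor remainder is dominated by C0 |C(u)|^2 whatever the position, so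
    dominated convergence applies. *)
Lemma gen_cvg u y b S C : cvgv u y -> sq_integrable C ->
  gen nu h h1 h2 (u k) b S C @[k --> \oo] --> gen nu h h1 h2 y b S C.
Proof.
move=> cu [mC iC]; apply: cvgD; first apply: cvgD.
- exact: tg_cvg.
- apply: cvgM; last exact: cvg_cst.
  by apply: cvg_seq_sum => j; exact: tD_cvg.
have iT w : nu.-integrable setT (fun u => (tT h h1 w (C u))%:E).
  by have [] := gen_le hc h1c C01 tg_le tD_le tT_le w b S mC iC.
have iC' : nu.-integrable setT (EFin \o (fun u => C0 * frob (C u) ^+ 2)).
  by have := integrableZl measurableT C0 iC; apply: eq_integrable.
have mT w : measurable_fun setT (fun v => (tT h h1 w (C v))%:E).
  by have /integrableP[] := iT w.
have cv : {ae nu, forall v, setT v -> (tT h h1 (u k) (C v))%:E @[k --> \oo] --> (tT h h1 y (C v))%:E}.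
  apply: aeW => v _; apply: cvg_EFin; first exact: nearW.
  apply: cvgB; last exact: tg_cvg.
  apply: cvgB; last exact: tf_cvg.
  exact: (tf_cvg (cvgvD cu (@cvgv_cst (C v)))).
have dm : {ae nu, forall v k, setT v -> (`|(tT h h1 (u k) (C v))%:E| <= (EFin \o (fun u => C0 * frob (C u) ^+ 2)%R) v)%E}.
  apply: aeW => v k _ /=; rewrite lee_fin; exact: tT_le.
have [_ _ cI] := dominated_convergence measurableT (fun k => mT (u k)) (mT y) cv iC' dm.
apply: fine_cvg; rewrite fineK//.
by apply: integrable_fin_num => //; exact: iT.
Qed.

End Close.

Section TimeIntegralSimple.
Context (R : realType) (dT : measure_display) (T : measurableType dT).
Variables (F : R -> set (set T)).

Lemma indic_time_integral (l r t : R) : 0 <= l -> l <= r -> 0 <= t ->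
  (@lebesgue_measure R).-integrable `]0, t] (EFin \o \1_(`]l, r]%classic)) /\
  \int[lebesgue_measure]_(s in `]0, t]) (\1_(`]l, r]%classic) s) = Num.min r t - Num.min l t.
Proof.
move=> l0 lr t0.
have I : (\int[lebesgue_measure]_(s in `]0%R, t]) (\1_(`]l, r]%classic) s)%:E =
    (Num.min r t - Num.min l t)%:E)%E.
  rewrite integral_indic//.
  rewrite (_ : `]l, r] `&` `]0, t] = `]Num.min l t, Num.min r t]%classic).
    etransitivity; first exact: lebesgue_measure_itv.
    rewrite /= lte_fin; case: ltP => // H.
    have -> : Num.min r t = Num.min l t; last by rewrite subrr.
    apply/eqP; rewrite eq_le H/= le_min; apply/andP; split; last by rewrite ge_min lexx orbT.
    by rewrite ge_min lr.
  apply/seteqP; split=> x /=; rewrite !in_itv/= le_min gt_min.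
    by move=> [/andP[-> ->] /andP[_ ->]].
  move=> /andP[/orP[lx|tx] /andP[xr xt]]; last by move: tx; rewrite ltNge xt.
  by rewrite lx xr xt (le_lt_trans l0 lx).
split; last by rewrite /Rintegral I.
apply/integrableP; split; first by apply/measurable_EFinP; exact: measurable_indic.
by under eq_integral do rewrite /= ger0_norm//; rewrite I ltry.
Qed.

Lemma sp_integral_time (H : simple_process F) (t : R) w : 0 <= t ->
  (@lebesgue_measure R).-integrable `]0, t] (EFin \o (fun s => sp_val H s w)) /\
  sp_integral H (fun t _ => t) t w = \int[lebesgue_measure]_(s in `]0, t]) sp_val H s w.
Proof.
move=> t0; have mD : measurable (`]0, t]%classic : set (measurableTypeR R)) by [].
have ik (k : 'I_(sp_size H)) : (@lebesgue_measure R).-integrable `]0, t]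
    (EFin \o (fun s => sp_coef k w * \1_(`]sp_left k, sp_right k]%classic) s)).
  have [l0 lr] := sp_order k; have [i _] := indic_time_integral l0 lr t0.
  by have := integrableZl mD (sp_coef k w) i; apply: eq_integrable.
have gen (q : seq 'I_(sp_size H)) : (@lebesgue_measure R).-integrable `]0, t]
    (EFin \o (fun s => \sum_(k <- q) sp_coef k w * \1_(`]sp_left k, sp_right k]%classic) s)) /\
    \int[lebesgue_measure]_(s in `]0, t]) (\sum_(k <- q) sp_coef k w * \1_(`]sp_left k, sp_right k]%classic) s) =
    \sum_(k <- q) \int[lebesgue_measure]_(s in `]0, t]) (sp_coef k w * \1_(`]sp_left k, sp_right k]%classic) s).
  elim: q => [|k q [i1 i2]].
    under [X in _.-integrable _ (EFin \o X)]eq_fun do rewrite big_nil.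
    under eq_Rintegral do rewrite big_nil.
    split; first by apply: integrable0.
    by rewrite big_nil /Rintegral integral0.
  under [X in _.-integrable _ (EFin \o X)]eq_fun do rewrite big_cons.
  under eq_Rintegral do rewrite big_cons.
  split; first by have := integrableD mD (ik k) i1; apply: eq_integrable.
  by rewrite big_cons RintegralD// i2.
have [i E0] := gen (index_enum 'I_(sp_size H)); split=> //.
rewrite /sp_val E0; apply: eq_bigr => k _.
have [l0 lr] := sp_order k; have [j E] := indic_time_integral l0 lr t0.
by rewrite RintegralZl// E.
Qed.

End TimeIntegralSimple.

Lemma frob_subC (R : realType) d (x y : 'cV[R]_d) : frob (x - y) = frob (y - x).
Proof. by rewrite -frobN opprB. Qed.

Lemma frob_min_triangle (R : realType) d (x y z : 'cV[R]_d) :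
  Num.min 1 (frob (y - z)) <= frob (x - y) + Num.min 1 (frob (x - z)).
Proof.
have H : frob (y - z) <= frob (x - y) + frob (x - z).
  rewrite (frob_subC x y) -[y in y - z](subrK x) -addrA; exact: frobD.
have := frob_ge0 (x - y); move: H; move: (frob (y - z)) (frob (x - z)) (frob (x - y)) => u v w H w0.
by case: (leP 1 u) => ?; case: (leP 1 v) => ?; lra.
Qed.

Lemma ereal_cvg0 (R : realType) (u : nat -> \bar R) : (forall n, 0 <= u n)%E ->
  (forall e : R, 0 < e -> \forall n \near \oo, (u n <= e%:E)%E) -> u n @[n --> \oo] --> 0%E.
Proof.
move=> u0 H; apply/fine_cvgP; split.
  near=> n; rewrite ge0_fin_numE//; apply: le_lt_trans (ltry 1).
  by near: n; apply: H.
apply/cvgrPdist_le => e e0; near=> n; rewrite sub0r normrN ger0_norm ?fine_ge0//.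
have L : (u n <= e%:E)%E by near: n; exact: H.
by rewrite -lee_fin fineK// ge0_fin_numE// (le_lt_trans L (ltry _)).
Unshelve. all: by end_near.
Qed.

(** * Convergence of the approximating processes *)

Section ApproximantsInProbability.
Context (R : realType) (dT : measure_display) (T : measurableType dT).
Variables (P : probability T R) (F : R -> set (set T)).
Context (dU : measure_display) (U : measurableType dU).
Variables (nu : {sigma_finite_measure set U -> \bar R}) (d : nat).
Variables (W : R -> T -> Borel 'cV[R]_d)
          (N : T -> {measure set (R * U) -> \bar R}).
Hypothesis noise : driving_noise P F nu W N.
Variables (A : finType) (e : A -> 'cV[R]_d) (z0 : 'cV[R]_d).
Variables (D : R -> T -> 'cV[R]_d) (bb : A -> R -> T -> R)
  (II : A -> 'I_d -> R -> T -> R) (JJ : A -> R -> T -> R).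
Variables (K : nat -> A -> simple_process F) (H : nat -> A -> 'I_d -> simple_process F)
  (G : nat -> A -> simple_field F nu).
Variable T0 : R.
Hypothesis T00 : 0 < T0.
Hypothesis mD : forall i, measurable_fun setT (fun p : R * T => D p.1 p.2 i 0).
Hypothesis rbb : forall a w, rcll (bb a ^~ w).
Hypothesis HD : forall t, 0 <= t -> {ae P, forall w, D t w = z0 + \sum_a
  (\int[lebesgue_measure]_(s in `]0, t]) (bb a s w) + \sum_j II a j t w + JJ a t w) *: e a}.

Definition drift_error a n w : \bar R :=
  (\int[lebesgue_measure]_(r in `]0%R, T0]) `|sp_val (K n a) r w - bb a r w|%:E)%E.
Definition ito_error a j t n w : \bar R :=
  `|sp_integral (H n a j) (fun t w => (W t w : 'cV[R]_d) j 0) t w - II a j t w|%:E.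
Definition jump_error a t n w : \bar R := `|sf_integral (G n a) N t w - JJ a t w|%:E.

Hypothesis HK : forall a, pr0 P (drift_error a).
Hypothesis HH : forall a j t, 0 <= t -> pr0 P (ito_error a j t).
Hypothesis HG : forall a t, 0 <= t -> pr0 P (jump_error a t).

Let Z n := Zs W N e z0 (K n) (H n) (G n).

Let mD1 t i : measurable_fun setT (fun w => D t w i 0).
Proof. exact: (measurableT_comp (mD i) (measurable_pair1 t)). Qed.

Let mZ n t : 0 <= t -> mvec (Z n t).
Proof. by move=> t0 i; apply: (Fm_measurable noise t0); exact: (Zs_Fm noise e z0 (K n) (H n) (G n) t0). Qed.

Lemma measurable_frob dS (S : measurableType dS) (y : S -> 'cV[R]_d) : mvec y ->
  measurable_fun setT (fun s => frob (y s)).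
Proof.
move=> my.
rewrite (_ : (fun s => _) = fun s => Num.sqrt (dotv (y s) (y s))); last first.
  by apply/funext => s; rewrite -frob_dotv sqrtr_sqr ger0_norm ?frob_ge0.
have ms : measurable_fun setT (Num.sqrt : R -> R).
  by apply: continuous_measurable_fun; exact: sqrt_continuous.
exact: (measurableT_comp ms (measurable_dotv my my)).
Qed.

(** The process and its approximant are the same linear expression in scalar integrals, so their
    distance is controlled by the separate errors of the drift, Brownian and jump integrals. *)
Lemma approximants_pr0 t : 0 <= t <= T0 -> pr0 P (fun n w => (frob (Z n t w - D t w))%:E).
Proof.
move=> /andP[t0 tT].
have P1 : pr0 P (fun n w => \sum_a ((frob (e a))%:E * (drift_error a n w +
    (\sum_j ito_error a j t n w + jump_error a t n w))))%E.
  apply: pr0_sum => a; apply: pr0Z; first exact: frob_ge0.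
  apply: pr0D => //; apply: pr0D; last exact: HG.
  by apply: pr0_sum => j; exact: HH.
apply: pr0_le P1.
- move=> n; apply/measurable_EFinP; apply: measurable_frob.
  by apply: mvecB; [exact: mZ|move=> i; exact: mD1].
- by move=> n w; rewrite lee_fin frob_ge0.
move=> n; apply: filterS (HD t0) => w ->.
rewrite /Z /Zs opprD addrACA subrr add0r -sumrB.
under eq_bigr do rewrite -scalerBl.
have Hd a : (`|sp_integral (K n a) (fun t _ => t) t w - \int[lebesgue_measure]_(s in `]0, t]) (bb a s w)|%:E
    <= drift_error a n w)%E.
  have [iK ->] := sp_integral_time (K n a) w t0.
  have mDt : measurable (`]0, t]%classic : set (measurableTypeR R)) by [].
  have [M M0 HM] := rcll_bounded t (rbb a w).
  have mb : measurable_fun setT (bb a ^~ w) by exact: rcll_measurable.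
  have ib : (@lebesgue_measure R).-integrable `]0, t] (EFin \o (fun s => bb a s w)).
    apply: (@le_integrable _ _ _ _ _ _ _ (EFin \o cst M)) => //.
    - by apply/measurable_EFinP; exact: measurable_funTS.
    - move=> r /=; rewrite in_itv/= => /andP[r0 rt]; rewrite lee_fin (ger0_norm M0).
      by apply: HM; rewrite rt ltW.
    apply/integrableP; split; first by apply/measurable_EFinP; exact: measurable_cst.
    under eq_integral do rewrite /= ger0_norm//.
    rewrite integral_cst//= lebesgue_measure_itv/= lte_fin.
    by case: ifP => _; rewrite ?mule0 ?ltry// -EFinB -EFinM ltry.
  rewrite -RintegralB//.
  have iB : (@lebesgue_measure R).-integrable `]0, t] (EFin \o (fun s => sp_val (K n a) s w - bb a s w)).
    by have := integrableB mDt iK ib; apply: eq_integrable.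
  have ms : measurable_fun setT (fun s => `|sp_val (K n a) s w - bb a s w|%:E).
    apply/measurable_EFinP; apply: measurableT_comp => //; apply: measurable_funB => //.
    by apply: measurable_sum => k; apply: measurable_funM => //; exact: measurable_indic.
  apply: (@le_trans _ _ (\int[lebesgue_measure]_(s in `]0%R, t]) `|sp_val (K n a) s w - bb a s w|%:E)%E).
    rewrite -[leRHS]fineK.
      by rewrite lee_fin; apply: le_normr_Rintegral.
    by apply: integrable_fin_num => //; have := integrable_norm iB; apply: eq_integrable.
  apply: ge0_subset_integral => //.
  - exact: measurable_funTS.
  - by move=> x /=; rewrite !in_itv/= => /andP[-> xt]; exact: le_trans xt tT.
apply: (@le_trans _ _ (\sum_a (frob (e a) * (`|sp_integral (K n a) (fun t _ => t) t w - \int[lebesgue_measure]_(s in `]0, t]) (bb a s w)| +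
   (\sum_j fine (ito_error a j t n w) + fine (jump_error a t n w))))%:E)%E).
  rewrite sumEFin lee_fin; apply: le_trans (frob_sumv _ _) _; apply: ler_sum => a _.
  rewrite frobZ mulrC ler_wpM2l ?frob_ge0//.
  rewrite (_ : _ - _ = (sp_integral (K n a) (fun t _ => t) t w - \int[lebesgue_measure]_(s in `]0, t]) (bb a s w))
     + ((\sum_j sp_integral (H n a j) (fun t w => (W t w : 'cV[R]_d) j 0) t w - \sum_j II a j t w) +
       (sf_integral (G n a) N t w - JJ a t w))); last first.
    by move: (sp_integral _ _ _ _) (\sum_j _) (sf_integral _ _ _ _) (\int[_]_(_ in _) _) (\sum_j _) (JJ _ _ _) => *; ring.
  apply: le_trans (ler_normD _ _) _; rewrite lerD2l.
  apply: le_trans (ler_normD _ _) _; rewrite lerD2r -sumrB.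
  exact: ler_norm_sum.
apply: lee_sum => a _; rewrite EFinM; apply: lee_wpmul2l; first by rewrite lee_fin frob_ge0.
rewrite EFinD; apply: leeD; first exact: Hd.
by rewrite EFinD -sumEFin.
Qed.

Variables (m : nat -> nat) (t : nat -> nat -> R) (dl : nat -> R).
Hypothesis gr : forall n, grid T0 (dl n) (m n) (t n).
Hypothesis HL : forall n i r, (i < m n)%N -> t n i < r <= t n i.+1 ->
  int_le P (fun w => frob (Z n r w - Z n (t n i) w)) n.+1%:R^-1.

(** The discrete inequality sees the process at the left end of the current cell. The maximum with 0
    matters only for r outside ]0, T0], where it keeps the time nonnegative. *)
Definition on_grid n r w := Z n (Num.max 0 (t n (gidx (m n) (t n) r))) w.

Let gap n (p : R * T) : R := Num.min 1 (frob (on_grid n p.1 p.2 - D p.1 p.2)).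

Lemma measurable_on_grid n i : measurable_fun setT (fun p : R * T => on_grid n p.1 p.2 i 0).
Proof.
have mk k : measurable [set p : R * T | gidx (m n) (t n) p.1 = k].
  rewrite (_ : mkset _ = [set r | gidx (m n) (t n) r = k] `*` setT).
    by apply: measurableX => //; exact: measurable_gidx.
  by apply/seteqP; split=> [[r w] /= ->//|[r w] [] /=].
have mphi k : measurable_fun setT (fun p : R * T => Z n (Num.max 0 (t n k)) p.2 i 0).
  apply: (measurableT_comp (f := fun w => Z n (Num.max 0 (t n k)) w i 0)) => //.
  by apply: mZ; rewrite le_max lexx.
exact: (measurable_select mk mphi).
Qed.

Let mgap n : measurable_fun setT (gap n).
Proof.
apply: measurable_minr => //; apply: measurable_frob => i.
apply: (eq_measurable_fun (fun p : R * T => on_grid n p.1 p.2 i 0 - D p.1 p.2 i 0)).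
  by move=> p _; rewrite !mxE.
by apply: measurable_funB; [exact: measurable_on_grid|exact: mD].
Qed.

Let gap01 n p : 0 <= gap n p <= 1.
Proof. by rewrite ge_min lexx le_min ler01 frob_ge0. Qed.

Definition grid_error n w : \bar R :=
  (\int[lebesgue_measure]_(r in `]0%R, T0]) (Num.min 1 (frob (on_grid n r w - D r w)))%:E)%E.

Lemma on_gridE n r w : 0 < r <= T0 ->
  exists i, [/\ (i < m n)%N, t n i < r <= t n i.+1 & on_grid n r w = Z n (t n i) w].
Proof.
move=> r0; have [il ir] := grid_cell (gr n) r0.
have H0 : 0 <= t n (gidx (m n) (t n) r).
  by have [t0 _ _] := gr n; rewrite -t0; apply: (grid_le (gr n)); rewrite leq0n ltnW.
by exists (gidx (m n) (t n) r); split; [exact: il|exact: ir|rewrite /on_grid (max_idPr H0)].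
Qed.

Let gap_cvg r : 0 < r <= T0 ->
  (\int[P]_w (gap n (r, w))%:E)%E @[n --> \oo] --> 0%E.
Proof.
move=> r0; have [_ _ Hr] : pr0 P (fun n w => (frob (Z n r w - D r w))%:E).
  by apply: approximants_pr0; case/andP: r0 => /ltW -> ->.
have r00 : 0 <= r by case/andP: r0 => /ltW.
have mf n s s' : 0 <= s -> 0 <= s' -> measurable_fun setT (fun w => frob (Z n s w - Z n s' w)).
  by move=> s0 s'0; apply: measurable_frob; apply: mvecB; exact: mZ.
have mfD n : measurable_fun setT (fun w => (frob (Z n r w - D r w))%:E).
  apply/measurable_EFinP; apply: measurable_frob.
  by apply: mvecB; [exact: mZ|move=> i; exact: mD1].
have mg n : measurable_fun setT (fun w => (gap n (r, w))%:E).
  by apply/measurable_EFinP; exact: (measurableT_comp (mgap n) (measurable_pair1 r)).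
have B n : (\int[P]_w (gap n (r, w))%:E <=
    n.+1%:R^-1%:E + \int[P]_w cap1 (frob (Z n r w - D r w))%:E)%E.
  have [i [im ir _]] := on_gridE n point r0.
  have ti0 : 0 <= t n i.
    by have [t0 _ _] := gr n; rewrite -t0; apply: (grid_le (gr n)); rewrite leq0n ltnW.
  have [iL eL] := HL im ir.
  apply: (@le_trans _ _ (\int[P]_w ((frob (Z n r w - Z n (t n i) w))%:E + cap1 (frob (Z n r w - D r w))%:E))%E).
    apply: ge0_le_integral => //.
    - by move=> w _; rewrite lee_fin; case/andP: (gap01 n (r, w)).
    - by apply: emeasurable_funD; [apply/measurable_EFinP; exact: mf|exact: measurable_cap1].
    move=> w _; rewrite /gap/=.
    have -> : on_grid n r w = Z n (t n i) w.
      have [i' [im' ir' ->]] := on_gridE n w r0.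
      by rewrite -(gidxE (gr n) im' ir') (gidxE (gr n) im ir).
    rewrite /cap1 -EFin_min -EFinD lee_fin.
    exact: frob_min_triangle.
  rewrite ge0_integralD//; last 4 first.
  - by move=> w _; rewrite lee_fin frob_ge0.
  - by apply/measurable_EFinP; exact: mf.
  - by move=> w _; apply: cap1_ge0; rewrite lee_fin frob_ge0.
  - exact: measurable_cap1.
  rewrite leeD2r//.
  have fi : (\int[P]_w (frob (Z n r w - Z n (t n i) w))%:E)%E \is a fin_num.
    by exact: integrable_fin_num.
  by rewrite -(fineK fi) lee_fin.
apply: ereal_cvg0.
  by move=> n; apply: integral_ge0 => w _; rewrite lee_fin; case/andP: (gap01 n (r, w)).
move=> e1 e10; have e2 : 0 < e1 / 2 by lra.
near=> n; apply: le_trans (B n) _; rewrite [e1]splitr EFinD; apply: leeD.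
  by rewrite lee_fin; apply: ltW; near: n; exact: (near_infty_natSinv_lt (PosNum e2)).
by near: n; exact: Hr.
Unshelve. all: by end_near.
Qed.

(** For fixed r the position at the left grid point is within 1 / (n + 1) in mean of the position at
    r, which converges in probability. Dominated convergence in r and Tonelli pass to the time
    integral. *)
Lemma grid_error_pr0 : pr0 P grid_error.
Proof.
have mgE n : measurable_fun setT (fun p => (gap n p)%:E) by exact/measurable_EFinP.
have gE0 n p : (0 <= (gap n p)%:E)%E by rewrite lee_fin; case/andP: (gap01 n p).
split.
- by move=> n; exact: (measurable_time_integral T0 (mgE n) (gE0 n)).
- by move=> n w; apply: integral_ge0 => r _; rewrite lee_fin; case/andP: (gap01 n (r, w)).
move=> eps eps0.
have mD' : measurable (`]0, T0]%classic : set (measurableTypeR R)) by [].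
pose f_ n (r : R) := (\int[P]_w (gap n (r, w))%:E)%E.
have mf n : measurable_fun (`]0, T0]%classic : set (measurableTypeR R)) (f_ n).
  by apply: measurable_funTS; exact: (measurable_space_integral (mgE n) (gE0 n) P).
have cf : {ae (@lebesgue_measure R), forall r : R, (`]0, T0]%classic : set R) r -> f_ n r @[n --> \oo] --> 0%E}.
  by apply: aeW => r /=; rewrite in_itv/=; exact: gap_cvg.
have i1 : (@lebesgue_measure R).-integrable `]0, T0] (cst 1%E).
  apply/integrableP; split; first exact: measurable_cst.
  under eq_integral do rewrite /cst gee0_abs ?lee01//.
  by rewrite integral_cst//= lebesgue_measure_itv/= lte_fin T00 -EFinB mul1e ltry.
have df : {ae (@lebesgue_measure R), forall (r : R) n, (`]0, T0]%classic : set R) r -> (`|f_ n r| <= cst 1%E r)%E}.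
  apply: aeW => r n _; rewrite gee0_abs; last first.
    by apply: integral_ge0 => w _; rewrite lee_fin; case/andP: (gap01 n (r, w)).
  rewrite /cst -(probability_setT P) -[leRHS]mul1e -integral_cst//.
  apply: ge0_le_integral => //.
  - by apply/measurable_EFinP; exact: (measurableT_comp (mgap n) (measurable_pair1 r)).
  - by move=> w _; rewrite lee_fin; case/andP: (gap01 n (r, w)).
have [_ _] := @dominated_convergence _ _ R (@lebesgue_measure R) _ mD' _ _ _ mf (measurable_cst 0%E) cf i1 df.
rewrite integral0 => cv.
have Ne : nbhs (0%E : \bar R) [set y | (y < eps%:E)%E].
  by apply: open_nbhs_nbhs; split; [exact: open_ereal_lt_ereal|rewrite /= lte_fin].
have cv' : \forall n \near \oo, (\int[lebesgue_measure]_(r in `]0%R, T0]) f_ n r < eps%:E)%E by exact: cv _ Ne.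
apply: filterS cv' => n /ltW; apply: le_trans.
rewrite -(time_integral_swap T0 (mgE n) (gE0 n) P).
apply: ge0_le_integral => //.
- move=> w _; apply: cap1_ge0; apply: integral_ge0 => r _; rewrite lee_fin.
  by case/andP: (gap01 n (r, w)).
- by apply: measurable_cap1; exact: (measurable_time_integral T0 (mgE n) (gE0 n)).
- exact: (measurable_time_integral T0 (mgE n) (gE0 n)).
- by move=> w _; exact: cap1_le.
Qed.

End ApproximantsInProbability.

Section ParametricIntegral.
Context (R : realType) (dU : measure_display) (U : measurableType dU)
  (nu : {sigma_finite_measure set U -> \bar R}) (dS : measure_display) (S : measurableType dS).

Lemma measurable_ge0_param (f : S * U -> \bar R) : measurable_fun setT f ->
  (forall p, (0 <= f p)%E) -> measurable_fun setT (fun s => \int[nu]_u f (s, u))%E.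
Proof. by move=> mf f0; exact: (@measurable_fun_fubini_tonelli_F _ _ _ _ _ nu). Qed.

Lemma measurable_Rintegral_param (f : S * U -> R) : measurable_fun setT f ->
  measurable_fun setT (fun s => \int[nu]_u f (s, u)).
Proof.
move=> mf; have mE : measurable_fun setT (fun p => (f p)%:E) by exact/measurable_EFinP.
apply: (measurableT_comp (f := fine)); first exact: fine_measurable.
under eq_fun do rewrite integralE.
apply: emeasurable_funB.
  rewrite (_ : (fun s => _) = fun s => (\int[nu]_u (fun p : S * U => (f p)%:E)^\+ (s, u))%E).
    by apply: measurable_ge0_param => //; exact: measurable_funepos.
  by apply/funext => s; apply: eq_integral => u _; rewrite !funeposE.
rewrite (_ : (fun s => _) = fun s => (\int[nu]_u (fun p : S * U => (f p)%:E)^\- (s, u))%E).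
  by apply: measurable_ge0_param => //; exact: measurable_funeneg.
by apply/funext => s; apply: eq_integral => u _; rewrite !funenegE.
Qed.

Context (d : nat).
Variables (y b : S -> 'cV[R]_d) (Sj : 'I_d -> S -> 'cV[R]_d) (C : S -> U -> 'cV[R]_d).
Hypotheses (my : mvec y) (mb : mvec b) (mS : forall j, mvec (Sj j))
  (mC : mvec (fun p : S * U => C p.1 p.2)).

Lemma measurable_coq : measurable_fun setT (fun s => coq nu (b s) (Sj^~ s) (C s)).
Proof.
apply: measurable_funD; first apply: measurable_funD.
- exact: measurable_frob.
- apply: measurable_sum => j; apply: (measurableT_comp (f := fun x : R => x ^+ 2)) => //.
  exact: measurable_frob.
apply: (measurable_Rintegral_param (f := fun p => frob (C p.1 p.2) ^+ 2)).
apply: (measurableT_comp (f := fun x : R => x ^+ 2)) => //.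
exact: measurable_frob.
Qed.

Variables (h h1 h2 : R -> R).
Hypotheses (hc : continuous h) (h1c : continuous h1) (h2c : continuous h2).

Lemma measurable_gen : measurable_fun setT (fun s => gen nu h h1 h2 (y s) (b s) (Sj^~ s) (C s)).
Proof.
apply: measurable_funD; first apply: measurable_funD.
- exact: measurable_tg.
- apply: measurable_funM => //; apply: measurable_sum => j; exact: measurable_tD.
apply: (measurable_Rintegral_param (f := fun p => tT h h1 (y p.1) (C p.1 p.2))).
apply: measurable_tT => // i; exact: (measurableT_comp (my i)).
Qed.

End ParametricIntegral.

(** Packages the analytic facts about a radial test function, so that the limit passage is
    independent of how the function is built. *)
Record test_function (R : realType) (d : nat) (h h1 h2 : R -> R) (C0 : R) : Prop := TestFunction {
  test_hc : continuous h;
  test_h1c : continuous h1;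
  test_h2c : continuous h2;
  test_C01 : 1 <= C0;
  test_tf_le : forall y : 'cV[R]_d, `|tf h y| <= C0;
  test_tg_le : forall y z : 'cV[R]_d, `|tg h1 y z| <= C0 * frob z;
  test_tD_le : forall y z z' : 'cV[R]_d, `|tD h1 h2 y z z'| <= C0 * (frob z * frob z');
  test_tf_lip : forall y z : 'cV[R]_d, `|tf h (y + z) - tf h y| <= C0 * frob z;
  test_tT_le : forall y z : 'cV[R]_d, `|tT h h1 y z| <= C0 * frob z ^+ 2;
  test_tT_lip : forall y z z' : 'cV[R]_d,
    `|tT h h1 y z - tT h h1 y z'| <= C0 * (frob (z - z') * (frob z + frob z'));
  test_tT_taylor : forall e : R, 0 < e -> exists2 dl, 0 < dl & forall y z : 'cV[R]_d,
    frob z <= dl -> `|tT h h1 y z - tD h1 h2 y z z / 2| <= e * frob z ^+ 2;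
  test_h_ge0 : forall s, 0 <= h s }.

(** * Limits of rate and defect along one path *)

Section PathwiseLimit.
Context (R : realType) (dU : measure_display) (U : measurableType dU).
Variables (nu : {sigma_finite_measure set U -> \bar R}) (d : nat) (h h1 h2 : R -> R) (C0 : R).
Hypothesis test : test_function d h h1 h2 C0.
Variables (Kp kk : R) (eta : R -> R).
Hypotheses (Kp0 : 0 <= Kp) (kk0 : 0 <= kk) (etac : continuous eta).
Hypothesis eta01 : forall s, 0 <= eta s <= 1.
Variables (T0 M Ce : R).
Hypotheses (T00 : 0 < T0) (M0 : 0 <= M) (Ce0 : 0 <= Ce).
Variables (y b : R -> 'cV[R]_d) (S : 'I_d -> R -> 'cV[R]_d) (C : R -> U -> 'cV[R]_d).
Variables (yk bk : nat -> R -> 'cV[R]_d) (Sk : nat -> 'I_d -> R -> 'cV[R]_d)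
  (Ck : nat -> R -> U -> 'cV[R]_d) (dl : nat -> R -> \bar R).
Hypotheses (my : mvec y) (mb : mvec b) (mS : forall j, mvec (S j))
  (mC : mvec (fun p : R * U => C p.1 p.2)).
Hypotheses (myk : forall k, mvec (yk k)) (mbk : forall k, mvec (bk k))
  (mSk : forall k j, mvec (Sk k j)) (mCk : forall k, mvec (fun p : R * U => Ck k p.1 p.2)).
Hypothesis mdl : forall k, measurable_fun setT (dl k).
Hypothesis dl0 : forall k r, (0 <= dl k r)%E.
Hypothesis sqC : forall r, sq_integrable nu (C r).
Hypothesis sqCk : forall k r, sq_integrable nu (Ck k r).
Hypothesis coq_dl : forall k r, ((coq nu (bk k r - b r) (fun j => Sk k j r - S j r)
   (fun u => Ck k r u - C r u))%:E <= Ce%:E * dl k r)%E.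
Hypothesis dl_cvg : forall e : R, 0 < e ->
  \forall k \near \oo, (\int[lebesgue_measure]_(r in `]0%R, T0]) dl k r <= e%:E)%E.
Hypothesis coq_M : forall r, 0 < r <= T0 -> coq nu (b r) (S^~ r) (C r) <= M.
Hypothesis yk_cvg : {ae (@lebesgue_measure R), forall r : R,
  (`]0, T0]%classic : set R) r -> cvgv (yk^~ r) (y r)}.

Let C00 : 0 <= C0. Proof. by apply: le_trans ler01 _; exact: test_C01 test. Qed.
Let q r := coq nu (b r) (S^~ r) (C r).
Let qk k r := coq nu (bk k r) (Sk k ^~ r) (Ck k r).
Let g x r := gen nu h h1 h2 x (b r) (S^~ r) (C r).
Let gk k r := gen nu h h1 h2 (yk k r) (bk k r) (Sk k ^~ r) (Ck k r).
Let mD : measurable (`]0, T0]%classic : set (measurableTypeR R)). Proof. by []. Qed.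
Let fD : (@lebesgue_measure R (`]0%R, T0]%classic : set (measurableTypeR R)) < +oo)%E.
Proof.
rewrite (_ : lebesgue_measure _ = T0%:E) ?ltry//.
by etransitivity; [exact: lebesgue_measure_itv|rewrite /= lte_fin T00 sube0].
Qed.

Let mq : measurable_fun setT q. Proof. exact: measurable_coq. Qed.
Let mqk k : measurable_fun setT (qk k).
Proof. by apply: measurable_coq. Qed.
Let q0 r : 0 <= q r. Proof. exact: coq_ge0. Qed.

Let iq : (@lebesgue_measure R).-integrable `]0, T0] (EFin \o q).
Proof.
have ic : (@lebesgue_measure R).-integrable `]0, T0] (EFin \o cst M).
  apply/integrableP; split; first by apply/measurable_EFinP; exact: measurable_cst.
  under eq_integral do rewrite /= ger0_norm//.
  by rewrite integral_cst//=; exact: lte_mul_pinfty.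
apply: (le_integrable mD _ _ ic).
  by apply/measurable_EFinP; exact: measurable_funTS.
move=> r /=; rewrite in_itv/= => r0; rewrite lee_fin !ger0_norm//.
exact: coq_M.
Qed.

Let mrate (x : R -> 'cV[R]_d) (p : R -> R) : mvec x -> measurable_fun setT p ->
  measurable_fun setT (fun r => rate Kp kk eta (x r) (p r)).
Proof.
move=> mx mp; apply: measurable_funD => //; apply: measurable_funM => //.
apply: measurable_funD => //; apply: measurable_funM => //.
apply: (measurableT_comp (f := eta)); first exact: continuous_measurable_fun.
exact: measurable_dotv.
Qed.

Let fac x : 0 <= 1 + kk * eta x <= 1 + kk.
Proof.
have /andP[e0 e1] := eta01 x; rewrite lerD2l ler_piMr// andbT.
by rewrite addr_ge0// mulr_ge0.
Qed.

Let qclose (e : R) k r : 0 < e ->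
  (`|qk k r - q r|%:E <= (1 + e^-1)%:E * (Ce%:E * dl k r) + (e * q r)%:E)%E.
Proof.
move=> e0; have H := coq_close (bk k r) (Sk k ^~ r) (b r) (S^~ r) e0 (sqCk k r) (sqC r).
move: H; rewrite -lee_fin EFinD EFinM => H; apply: le_trans H _.
apply: leeD => //; apply: lee_wpmul2l; last exact: coq_dl.
by rewrite lee_fin addr_ge0// invr_ge0 ltW.
Qed.

Let gclose (e : R) k r : 0 < e ->
  (`|gk k r - g (yk k r) r|%:E <= C0%:E * ((1 + e^-1)%:E * (Ce%:E * dl k r) + (e * q r)%:E))%E.
Proof.
move=> e0; have H := gen_close (test_hc test) (test_h1c test) (test_C01 test) (test_tg_le test)
  (test_tD_le test) (test_tT_le test) (test_tT_lip test)
  (yk k r) (bk k r) (Sk k ^~ r) (b r) (S^~ r) e0 (sqCk k r) (sqC r).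
move: H; rewrite -lee_fin EFinM EFinD EFinM => H; apply: le_trans H _.
apply: lee_wpmul2l; first by rewrite lee_fin.
apply: leeD => //; apply: lee_wpmul2l; last exact: coq_dl.
by rewrite lee_fin addr_ge0// invr_ge0 ltW.
Qed.

Let Cmul_ge0 (e : R) k r (c : R) : 0 < e -> 0 <= c ->
  (0 <= c%:E * ((1 + e^-1)%:E * (Ce%:E * dl k r) + (e * q r)%:E))%E.
Proof.
move=> e0 c0; rewrite mule_ge0 ?lee_fin// adde_ge0 ?mule_ge0 ?lee_fin// ?mulr_ge0 ?(ltW e0)//.
by rewrite addr_ge0// invr_ge0 ltW.
Qed.

Let dl' k r := (Ce%:E * dl k r)%E.
Let mdl' k : measurable_fun (`]0, T0]%classic : set (measurableTypeR R)) (dl' k).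
Proof. by apply: measurable_funTS; exact: (measurable_funeM Ce%:E (mdl k)). Qed.
Let dl'0 k r : (0 <= dl' k r)%E. Proof. by rewrite mule_ge0// lee_fin. Qed.
Let dl'_cvg (e : R) : 0 < e ->
  \forall k \near \oo, (\int[lebesgue_measure]_(r in `]0%R, T0]) dl' k r <= e%:E)%E.
Proof.
move=> e0; have CC : 0 < Ce + 1 by rewrite ltr_wpDl.
have e1 : 0 < e / (Ce + 1) by rewrite divr_gt0.
apply: filterS (dl_cvg e1) => k H; rewrite ge0_integralZl//; last by apply: measurable_funTS; exact: mdl.
apply: (@le_trans _ _ (Ce%:E * (e / (Ce + 1))%:E)%E); first by apply: lee_wpmul2l => //; rewrite lee_fin.
by rewrite -EFinM lee_fin mulrCA ler_piMr ?(ltW e0)// ler_pdivrMr// mul1r lerDl.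
Qed.

Let yq_cvg r : cvgv (yk^~ r) (y r) ->
  rate Kp kk eta (yk k r) (q r) @[k --> \oo] --> rate Kp kk eta (y r) (q r).
Proof.
move=> cy; apply: cvgD; first exact: cvg_cst.
apply: cvgM; first exact: cvg_cst.
apply: cvgD; first exact: cvg_cst.
apply: cvgM; first exact: cvg_cst.
exact: (cvg_comp _ _ (cvgv_dotv cy cy) (@etac (dotv (y r) (y r)))).
Qed.

Let rate_le (x : 'cV[R]_d) r : 0 <= rate Kp kk eta x (q r) <= (Kp + (1 + kk)) * (1 + q r).
Proof.
have /andP[f0 f1] := fac (dotv x x); rewrite /rate addr_ge0 ?mulr_ge0//=.
have := ler_wpM2l (q0 r) f1; have := mulr_ge0 Kp0 (q0 r); have := q0 r.
move: (q r) (1 + kk * _) => a c a0 H1 H2; have := mulr_ge0 a0 kk0; lra.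
Qed.

Lemma path_rate (e : R) : 0 < e -> \forall k \near \oo, (\int[lebesgue_measure]_(r in `]0%R, T0])
  `|rate Kp kk eta (yk k r) (qk k r) - rate Kp kk eta (y r) (q r)|%:E <= e%:E)%E.
Proof.
have CC : 0 <= Kp + (1 + kk) by rewrite !addr_ge0.
apply: (@path_limit R _ _ (@lebesgue_measure R) _ q _ _
  (fun k r => rate Kp kk eta (yk k r) (q r)) dl' (Kp + (1 + kk)) mD fD CC) => //.
- by apply: measurable_funTS; exact: mrate.
- by move=> k; apply: measurable_funTS; exact: mrate.
- by move=> k; apply: measurable_funTS; exact: mrate.
- move=> e' k e0; apply: aeW => r _.
  apply: (@le_trans _ _ ((1 + kk)%:E * `|qk k r - q r|%:E)%E).
    rewrite -EFinM lee_fin /rate opprD addrACA subrr add0r -mulrBl normrM mulrC.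
    by have /andP[f0 f1] := fac (dotv (yk k r) (yk k r)); rewrite ler_wpM2r// ger0_norm.
  apply: (@le_trans _ _ ((1 + kk)%:E * ((1 + e'^-1)%:E * (Ce%:E * dl k r) + (e' * q r)%:E))%E).
    by apply: lee_wpmul2l; [rewrite lee_fin addr_ge0|exact: qclose].
  by apply: lee_wpmul2r; [have := Cmul_ge0 k r e0 (ler01); rewrite mul1e|rewrite lee_fin lerDr].
- have [X [mX X0 HX]] := yk_cvg; exists X; split=> // r /= H; apply: HX => /= cy.
  by apply: H => Dr; apply: yq_cvg; exact: cy.
- by move=> k; apply: aeW => r _; have /andP[a0 a1] := rate_le (yk k r) r; rewrite ger0_norm.
- by apply: aeW => r _; have /andP[a0 a1] := rate_le (y r) r; rewrite ger0_norm.
Qed.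

Let g_le x r : `|g x r| <= C0 * q r.
Proof.
have [mCr iC] := sqC r.
by have [_] := gen_le (test_hc test) (test_h1c test) (test_C01 test) (test_tg_le test) (test_tD_le test)
  (test_tT_le test) x (b r) (S^~ r) mCr iC.
Qed.

(** The rate is affine in [coq] and the test function is bounded, so the errors of [coq] and of the
    generator have the same form and fit one application of [path_limit]. *)
Lemma path_defect (e : R) : 0 < e -> \forall k \near \oo, (\int[lebesgue_measure]_(r in `]0%R, T0])
  `|(rate Kp kk eta (yk k r) (qk k r) * tf h (yk k r) - gk k r) -
    (rate Kp kk eta (y r) (q r) * tf h (y r) - g (y r) r)|%:E <= e%:E)%E.
Proof.
have CC : 0 <= C0 * (Kp + (1 + kk)) + C0 by rewrite addr_ge0// mulr_ge0// !addr_ge0.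
have bound x r : `|rate Kp kk eta x (q r) * tf h x - g x r| <= (C0 * (Kp + (1 + kk)) + C0) * (1 + q r).
  apply: le_trans (ler_normB _ _) _; rewrite [leRHS]mulrDl; apply: lerD.
    rewrite normrM mulrC -mulrA; apply: ler_pM => //; first exact: (test_tf_le test).
    by have /andP[a0 a1] := rate_le x r; rewrite ger0_norm.
  by apply: le_trans (g_le x r) _; rewrite ler_wpM2l// lerDr.
have mtf (x : R -> 'cV[R]_d) : mvec x -> measurable_fun setT (fun r => tf h (x r)).
  by move=> mx; apply: measurable_tf => //; exact: test_hc test.
have mg (x : R -> 'cV[R]_d) : mvec x -> measurable_fun setT (fun r => g (x r) r).
  by move=> mx; apply: measurable_gen => //; [exact: test_hc test|exact: test_h1c test|exact: test_h2c test].
have mgk k : measurable_fun setT (gk k).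
  by apply: measurable_gen => //; [exact: test_hc test|exact: test_h1c test|exact: test_h2c test].
apply: (@path_limit R _ _ (@lebesgue_measure R) _ q _ _
  (fun k r => rate Kp kk eta (yk k r) (q r) * tf h (yk k r) - g (yk k r) r) dl' _ mD fD CC) => //.
- apply: measurable_funTS; apply: measurable_funB; last exact: mg.
  by apply: measurable_funM; [exact: mrate|exact: mtf].
- move=> k; apply: measurable_funTS; apply: measurable_funB; last exact: mgk.
  by apply: measurable_funM; [exact: mrate|exact: mtf].
- move=> k; apply: measurable_funTS; apply: measurable_funB; last exact: mg.
  by apply: measurable_funM; [exact: mrate|exact: mtf].
- move=> e' k e0; apply: aeW => r _.
  apply: (@le_trans _ _ ((C0 * (1 + kk))%:E * `|qk k r - q r|%:E + `|gk k r - g (yk k r) r|%:E)%E).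
    rewrite -EFinM -EFinD lee_fin.
    rewrite (_ : _ - _ = (qk k r - q r) * (1 + kk * eta (dotv (yk k r) (yk k r))) * tf h (yk k r)
        - (gk k r - g (yk k r) r)); last first.
      by rewrite /rate; move: (eta _) (tf _ _) (gk _ _) (g _ _) (qk _ _) (q _) => *; ring.
    apply: le_trans (ler_normB _ _) _; rewrite lerD2r !normrM mulrC -mulrA.
    apply: ler_pM; [done|by rewrite mulr_ge0|exact: (test_tf_le test)|].
    rewrite mulrC; have /andP[f0 f1] := fac (dotv (yk k r) (yk k r)).
    by rewrite ler_wpM2r// ger0_norm.
  have A0 : (0 <= (1 + e'^-1)%:E * (Ce%:E * dl k r) + (e' * q r)%:E)%E.
    by have := Cmul_ge0 k r e0 (ler01); rewrite mul1e.
  apply: (@le_trans _ _ ((C0 * (1 + kk))%:E * ((1 + e'^-1)%:E * (Ce%:E * dl k r) + (e' * q r)%:E)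
     + C0%:E * ((1 + e'^-1)%:E * (Ce%:E * dl k r) + (e' * q r)%:E))%E).
    apply: leeD; last exact: gclose.
    by apply: lee_wpmul2l; [rewrite lee_fin mulr_ge0// addr_ge0|exact: qclose].
  rewrite -ge0_muleDl ?lee_fin ?mulr_ge0 ?addr_ge0//.
  apply: lee_wpmul2r => //; rewrite -EFinD lee_fin lerD2r ler_wpM2l// lerDr//.
- have [X [mX X0 HX]] := yk_cvg; exists X; split=> // r /= H; apply: HX => /= cy'.
  apply: H => Dr; have cy := cy' Dr; apply: cvgB.
    by apply: cvgM; [exact: yq_cvg|apply: tf_cvg => //; exact: test_hc test].
  exact: (gen_cvg (test_hc test) (test_h1c test) (test_h2c test) (test_C01 test)
    (test_tg_le test) (test_tD_le test) (test_tT_le test) cy (sqC r)).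
- by move=> k; apply: aeW => r _; exact: bound.
- by apply: aeW => r _; exact: bound.
Qed.

End PathwiseLimit.

Lemma sqr_sum_le (R : realType) (I : Type) (s : seq I) (x : I -> R) :
  (\sum_(i <- s) x i) ^+ 2 <= (size s)%:R * \sum_(i <- s) x i ^+ 2.
Proof.
elim: s => [|i s ih]; first by rewrite !big_nil expr0n/= mul0r.
rewrite !big_cons [size (i :: s)]/= -[(size s).+1]addn1 natrD.
case: s ih => [|j s]; first by rewrite !big_nil !addr0 add0r mul1r.
set S := \sum_(i <- _) _; set Q := \sum_(i <- _) _; set n := (size _)%:R => ih.
have n0 : 0 < n by rewrite ltr0n.
have Q0 : 0 <= n * (n * x i ^+ 2 + Q - 2 * x i * S).
  apply: (@le_trans _ _ ((n * x i - S) ^+ 2)); first exact: sqr_ge0.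
  move: ih; move: (x i) S Q => a S Q ih; rewrite -subr_ge0.
  by rewrite (_ : _ - _ = n * Q - S ^+ 2); [rewrite subr_ge0|ring].
rewrite pmulr_rge0// in Q0; move: ih Q0; move: (x i) S Q => a S Q ih Q0.
rewrite -subr_ge0 (_ : _ - _ = (n * Q - S ^+ 2) + (n * a ^+ 2 + Q - 2 * a * S)); last by ring.
by rewrite addr_ge0// subr_ge0.
Qed.

Lemma Rintegral_dist (R : realType) dS (S : measurableType dS) (mu : {measure set S -> \bar R})
    (D : set S) (f g : S -> R) : measurable D ->
  mu.-integrable D (EFin \o f) -> mu.-integrable D (EFin \o g) ->
  (`|\int[mu]_(x in D) f x - \int[mu]_(x in D) g x|%:E <= \int[mu]_(x in D) `|f x - g x|%:E)%E.
Proof.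
move=> mD fi gi; rewrite -RintegralB//.
have iB : mu.-integrable D (EFin \o (fun x => f x - g x)).
  by have := integrableB mD fi gi; apply: eq_integrable.
rewrite -[leRHS]fineK; first by rewrite lee_fin; exact: le_normr_Rintegral.
by apply: integrable_fin_num => //; have := integrable_norm iB; apply: eq_integrable.
Qed.

Section LinearCombination.
Context (R : realType) (d : nat) (A : finType) (e : A -> 'cV[R]_d).

Definition sum_frob := \sum_a frob (e a).
(** Drift errors are measured linearly and cost [sum_frob]; diffusion and jump errors are measured
    in squares and cost the second summand. One constant serves both. *)
Definition comb_cst := sum_frob + #|A|%:R * sum_frob ^+ 2.

Lemma sum_frob_ge0 : 0 <= sum_frob.
Proof. by apply: sumr_ge0 => a _; exact: frob_ge0. Qed.

Lemma comb_cst_ge0 : 0 <= comb_cst.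
Proof. by rewrite addr_ge0 ?sum_frob_ge0// mulr_ge0// sqr_ge0. Qed.

Lemma frob_comb (x : A -> R) : frob (\sum_a x a *: e a) <= sum_frob * \sum_a `|x a|.
Proof.
apply: le_trans (frob_sumv _ _) _; rewrite mulr_sumr; apply: ler_sum => a _.
rewrite frobZ mulrC ler_wpM2r// /sum_frob (bigD1 a)//= lerDl.
by apply: sumr_ge0 => i _; exact: frob_ge0.
Qed.

Lemma sqr_frob_comb (x : A -> R) :
  frob (\sum_a x a *: e a) ^+ 2 <= #|A|%:R * sum_frob ^+ 2 * \sum_a x a ^+ 2.
Proof.
apply: (@le_trans _ _ ((sum_frob * \sum_a `|x a|) ^+ 2)).
  by rewrite lerXn2r ?nnegrE ?frob_ge0 ?mulr_ge0 ?sum_frob_ge0 ?sumr_ge0//; exact: frob_comb.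
rewrite exprMn [leRHS](_ : _ = sum_frob ^+ 2 * (#|A|%:R * \sum_a x a ^+ 2)); last first.
  by move: (\sum_a _) sum_frob => s t; ring.
rewrite ler_wpM2l ?sqr_ge0//.
rewrite [leRHS](_ : _ = (size (index_enum A))%:R * \sum_a `|x a| ^+ 2); last first.
  have -> : size (index_enum A) = #|A| by rewrite -sum1_size sum1_card.
  by congr (_ * _); apply: eq_bigr => a _; rewrite real_normK ?num_real.
exact: sqr_sum_le.
Qed.

Context (dU : measure_display) (U : measurableType dU) (nu : {sigma_finite_measure set U -> \bar R}).

Lemma coq_comb (x : A -> R) (y : 'I_d -> A -> R) (z : A -> U -> R) :
  (forall a, measurable_fun setT (z a)) ->
  sq_integrable nu (fun u => \sum_a z a u *: e a) ->
  ((coq nu (\sum_a x a *: e a) (fun j => \sum_a y j a *: e a) (fun u => \sum_a z a u *: e a))%:E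
  <= comb_cst%:E * \sum_a (`|x a|%:E + (\sum_j (y j a ^+ 2)%:E + \int[nu]_u (z a u ^+ 2)%:E)))%E.
Proof.
move=> mz [_ iz]; set c := #|A|%:R * sum_frob ^+ 2.
have c0 : 0 <= c by rewrite mulr_ge0// sqr_ge0.
have mz2 a : measurable_fun setT (fun u => (z a u ^+ 2)%:E).
  by apply/measurable_EFinP; apply: (measurableT_comp (f := fun x : R => x ^+ 2)).
have I0 a : (0 <= \int[nu]_u (z a u ^+ 2)%:E)%E by apply: integral_ge0 => u _; rewrite lee_fin sqr_ge0.
rewrite /coq !EFinD.
have H3 : ((\int[nu]_u (frob (\sum_a z a u *: e a) ^+ 2))%:E <= c%:E * \sum_a \int[nu]_u (z a u ^+ 2)%:E)%E.
  rewrite /Rintegral fineK; last exact: integrable_fin_num.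
  rewrite -ge0_integral_sum//; last by move=> a u _; rewrite lee_fin sqr_ge0.
  rewrite -ge0_integralZl//; last 2 first.
  - exact: emeasurable_sum.
  - by move=> u _; apply: sume_ge0 => a _; rewrite lee_fin sqr_ge0.
  apply: ge0_le_integral => //.
  - by move=> u _; rewrite lee_fin sqr_ge0.
  - by have /integrableP[] := iz.
  - by apply: measurable_funeM; exact: emeasurable_sum.
  by move=> u _; rewrite sumEFin -EFinM lee_fin; exact: sqr_frob_comb.
have H2 : \sum_j frob (\sum_a y j a *: e a) ^+ 2 <= c * \sum_a \sum_j y j a ^+ 2.
  rewrite exchange_big mulr_sumr; apply: ler_sum => j _; exact: sqr_frob_comb.
have H1 := frob_comb x.
have S0 : (0 <= \sum_a \int[nu]_u (z a u ^+ 2)%:E)%E by apply: sume_ge0.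
rewrite big_split big_split/= (_ : (\sum_a _%:E)%E = (\sum_a `|x a|)%:E); last by rewrite sumEFin.
rewrite (_ : (\sum_a \sum_j _)%E = (\sum_a \sum_j y j a ^+ 2)%:E); last first.
  by rewrite -sumEFin; apply: eq_bigr => a _; rewrite sumEFin.
have A0 : 0 <= \sum_a `|x a| by apply: sumr_ge0.
have B0 : 0 <= \sum_a \sum_j y j a ^+ 2 by apply: sumr_ge0 => a _; apply: sumr_ge0 => j _; exact: sqr_ge0.
have f0 := sum_frob_ge0.
rewrite ge0_muleDr ?lee_fin ?adde_ge0 ?lee_fin// ge0_muleDr ?lee_fin//.
rewrite addeA -EFinM -EFinM; apply: leeD; first apply: leeD; rewrite ?lee_fin.
- by apply: le_trans H1 _; rewrite ler_wpM2r// lerDl.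
- by apply: le_trans H2 _; rewrite ler_wpM2r// lerDr.
by apply: le_trans H3 _; apply: lee_wpmul2r => //; rewrite lee_fin lerDr.
Qed.

End LinearCombination.

Section SquareIntegrable.
Context (R : realType) (dU : measure_display) (U : measurableType dU)
  (nu : {measure set U -> \bar R}) (d : nat).

Lemma sq_integrable0 : sq_integrable nu (fun=> 0 : 'cV[R]_d).
Proof.
split; first by move=> i; exact: measurable_cst.
by under eq_fun do rewrite frob0 expr0n/=; exact: integrable0.
Qed.

Lemma sq_integrable_sum (I : Type) (s : seq I) (f : I -> U -> 'cV[R]_d) :
  (forall i, sq_integrable nu (f i)) -> sq_integrable nu (fun u => \sum_(i <- s) f i u).
Proof.
move=> H; elim: s => [|i s ih].
  by under eq_fun do rewrite big_nil; exact: sq_integrable0.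
rewrite (_ : (fun u => _) = fun u => f i u - (0 - \sum_(i <- s) f i u)); last first.
  by apply/funext => u; rewrite big_cons sub0r opprK.
by apply: sq_integrableB => //; apply: sq_integrableB => //; exact: sq_integrable0.
Qed.

Lemma sq_integrable_indic (A : set U) (v : 'cV[R]_d) : measurable A -> (nu A < +oo)%E ->
  sq_integrable nu (fun u => \1_A u *: v).
Proof.
move=> mA fA; split.
  by apply: mvecZ => [|i]; [exact: measurable_indic|exact: measurable_cst].
rewrite (_ : (fun u => _) = fun u => ((frob v ^+ 2)%:E * (\1_A u)%:E)%E).
  by apply: integrableZl => //; exact: indic_integrable.
apply/funext => u; rewrite -EFinM frobZ ger0_norm// exprMn mulrC; congr (_ * _)%:E.
by rewrite indicE; case: (_ \in _); rewrite ?expr1n ?expr0n.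
Qed.

End SquareIntegrable.

Section SimpleMeasurability.
Context (R : realType) (dT : measure_display) (T : measurableType dT).
Variables (P : probability T R) (F : R -> set (set T)).
Context (dU : measure_display) (U : measurableType dU).
Variables (nu : {sigma_finite_measure set U -> \bar R}) (d : nat).
Variables (W : R -> T -> Borel 'cV[R]_d)
          (N : T -> {measure set (R * U) -> \bar R}).
Hypothesis noise : driving_noise P F nu W N.

Lemma measurable_sp_coef (H : simple_process F) (k : 'I_(sp_size H)) :
  measurable_fun setT (sp_coef k).
Proof.
have [l0 _] := sp_order k; move=> _ B mB; rewrite setTI.
by apply: (F_meas noise l0); apply: sp_measurable; exists B => //; rewrite setTI.
Qed.

Lemma measurable_sp_val (H : simple_process F) :
  measurable_fun setT (fun p : R * T => sp_val H p.1 p.2).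
Proof.
apply: measurable_sum => k; apply: measurable_funM.
  exact: (measurableT_comp (@measurable_sp_coef _ k)).
by apply: measurableT_comp => //; exact: measurable_indic.
Qed.

Lemma measurable_sf_val (H : simple_field F nu) :
  measurable_fun setT (fun p : (R * T) * U => sf_val H p.1.1 p.1.2 p.2).
Proof.
apply: measurable_sum => k; apply: measurable_funM; first apply: measurable_funM.
- exact: (measurableT_comp (@measurable_sp_coef _ k) (measurableT_comp measurable_snd measurable_fst)).
- apply: (measurableT_comp (f := \1_(`]sp_left k, sp_right k]%classic) : R -> R)).
    exact: measurable_indic.
  exact: (measurableT_comp measurable_fst measurable_fst).
- by apply: measurableT_comp => //; apply: measurable_indic; exact: sf_mark_measurable.
Qed.

Variables (A : finType) (e : A -> 'cV[R]_d) (G : A -> simple_field F nu).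

Lemma sq_integrable_coC r w : sq_integrable nu (coC e G r w).
Proof.
rewrite (_ : coC e G r w = fun u => \sum_a \sum_(k < sp_size (G a))
   \1_(sf_mark k) u *: ((sp_coef k w * \1_(`]sp_left k, sp_right k]%classic) r) *: e a)).
  apply: sq_integrable_sum => a; apply: sq_integrable_sum => k.
  by apply: sq_integrable_indic; [exact: sf_mark_measurable|exact: sf_mark_finite].
apply/funext => u; apply: eq_bigr => a _; rewrite scaler_suml; apply: eq_bigr => k _.
by rewrite scalerA mulrC.
Qed.

End SimpleMeasurability.

(** * The hitting inequality for the true path *)

Section SequenceBound.
Context (R : realType) (dT : measure_display) (T : measurableType dT).
Variables (P : probability T R) (F : R -> set (set T)).
Context (dU : measure_display) (U : measurableType dU).
Variables (nu : {sigma_finite_measure set U -> \bar R}) (d : nat).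
Variables (W : R -> T -> Borel 'cV[R]_d)
          (N : T -> {measure set (R * U) -> \bar R}).
Hypothesis noise : driving_noise P F nu W N.
Variables (A : finType) (e : A -> 'cV[R]_d) (z0 : 'cV[R]_d).
Variables (D : R -> T -> 'cV[R]_d) (bb : A -> R -> T -> R)
  (ss : A -> 'I_d -> R -> T -> R) (cc : A -> R -> T -> U -> R)
  (II : A -> 'I_d -> R -> T -> R) (JJ : A -> R -> T -> R).
Variable T0 : R.
Hypothesis T00 : 0 < T0.
Hypothesis mD : forall i, measurable_fun setT (fun p : R * T => D p.1 p.2 i 0).
Hypothesis mbb : forall a, measurable_fun setT (fun p : R * T => bb a p.1 p.2).
Hypothesis rbb : forall a w, rcll (bb a ^~ w).
Hypothesis mss : forall a j, measurable_fun setT (fun p : R * T => ss a j p.1 p.2).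
Hypothesis mcc : forall a, measurable_fun setT (fun p : (R * T) * U => cc a p.1.1 p.1.2 p.2).
Hypothesis HD : forall t, 0 <= t -> {ae P, forall w, D t w = z0 + \sum_a
  (\int[lebesgue_measure]_(s in `]0, t]) (bb a s w) + \sum_j II a j t w + JJ a t w) *: e a}.

Definition lin_drift r w := \sum_a bb a r w *: e a.
Definition lin_diff j r w := \sum_a ss a j r w *: e a.
Definition lin_jump r w u := \sum_a cc a r w u *: e a.
Definition lin_coq r w := coq nu (lin_drift r w) (lin_diff ^~ r ^~ w) (lin_jump r w).

Hypothesis sqG : forall r w, sq_integrable nu (lin_jump r w).
Hypothesis coq_bounded : forall w, exists2 M, 0 <= M & forall r, 0 < r <= T0 -> lin_coq r w <= M.

Variables (h h1 h2 : R -> R) (C0 : R).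
Hypothesis test : test_function d h h1 h2 C0.
Variables (Kp kk : R) (eta : R -> R).
Hypotheses (Kp0 : 0 <= Kp) (kk0 : 0 <= kk) (etac : continuous eta).
Hypothesis eta01 : forall s, 0 <= eta s <= 1.
Hypothesis supersolution : forall r w, 0 < r <= T0 ->
  gen nu h h1 h2 (D r w) (lin_drift r w) (lin_diff ^~ r ^~ w) (lin_jump r w)
  <= rate Kp kk eta (D r w) (lin_coq r w) * tf h (D r w).

Variables (v : R) (coarse : seq R) (E : R -> T -> R).
Hypothesis v0 : 0 <= v.
Hypothesis coarse_in : forall s, s \in coarse -> 0 <= s <= T0.
Hypothesis coarse_uniq : uniq coarse.
Hypothesis E01 : forall s w, 0 <= E s w <= 1.
Hypothesis mE : forall s, s \in coarse -> Fm F s (E s).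
Hypothesis Ev : forall s w, s \in coarse -> E s w != 0 -> tf h (D s w) = v.

Definition rate_integral w :=
  \int[lebesgue_measure]_(r in `]0, T0]) rate Kp kk eta (D r w) (lin_coq r w).

Let C00 : 0 <= C0. Proof. by apply: le_trans ler01 _; exact: test_C01 test. Qed.

Let mdr : mvec (fun p : R * T => lin_drift p.1 p.2).
Proof. by apply: mvec_sum => a; apply: mvecZ => // i; exact: measurable_cst. Qed.
Let mdf j : mvec (fun p : R * T => lin_diff j p.1 p.2).
Proof. by apply: mvec_sum => a; apply: mvecZ => // i; exact: measurable_cst. Qed.
Let mjp : mvec (fun p : (R * T) * U => lin_jump p.1.1 p.1.2 p.2).
Proof. by apply: mvec_sum => a; apply: mvecZ => // i; exact: measurable_cst. Qed.

Let mrate : measurable_fun setT (fun p : R * T => rate Kp kk eta (D p.1 p.2) (lin_coq p.1 p.2)).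
Proof.
apply: measurable_funD => //; apply: measurable_funM.
  exact: (@measurable_coq R dU U nu _ (R * T)%type d (fun p => lin_drift p.1 p.2)
    (fun j p => lin_diff j p.1 p.2) (fun p => lin_jump p.1 p.2) mdr mdf mjp).
apply: measurable_funD => //; apply: measurable_funM => //.
apply: (measurableT_comp (f := eta)); first exact: continuous_measurable_fun.
exact: measurable_dotv.
Qed.

Let rate0 r w : 0 <= rate Kp kk eta (D r w) (lin_coq r w).
Proof.
apply: le_trans (rate_ge Kp0 kk0 eta01 _ _); exact: coq_ge0.
Qed.

Lemma measurable_rate_integral : measurable_fun setT rate_integral.
Proof.
have mr : measurable_fun setT (fun p : R * T => (rate Kp kk eta (D p.1 p.2) (lin_coq p.1 p.2))%:E).
  exact/measurable_EFinP.
apply: (measurableT_comp (f := fine)); first exact: fine_measurable.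
by apply: (measurable_time_integral T0 mr) => p; rewrite lee_fin.
Qed.

Let integrand w := v * (1 - \prod_(s <- coarse) (1 - E s w)) * expR (- rate_integral w).

Let pi w := \prod_(s <- coarse) (1 - E s w).
Let pi01 w : 0 <= pi w <= 1.
Proof.
rewrite /pi; elim: coarse => [|s l /andP[ih0 ih1]]; first by rewrite big_nil ler01 lexx.
have /andP[e0 e1] := E01 s w; rewrite big_cons mulr_ge0 ?subr_ge0//= mulr_ile1 ?subr_ge0//.
by rewrite gerBl.
Qed.

Let mEs s : s \in coarse -> measurable_fun setT (E s).
Proof. by move=> sc; have /andP[s0 _] := coarse_in sc; apply: (Fm_measurable noise s0); exact: mE. Qed.

Let mpi : measurable_fun setT pi.
Proof. by apply: measurable_prod => s sc; apply: measurable_funB => //; exact: mEs. Qed.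

Let ex01 (x : R) : 0 <= x -> 0 <= expR (- x) <= 1.
Proof. by move=> x0; rewrite expR_ge0/= -expR0 ler_expR oppr_le0. Qed.

Let Q0 w : 0 <= rate_integral w.
Proof. by apply: Rintegral_ge0 => r _; exact: rate0. Qed.

Let iintegrand : P.-integrable setT (EFin \o integrand).
Proof.
apply: (@bounded_integrable _ _ _ _ _ v).
  apply: measurable_funM.
    by apply: measurable_funM => //; apply: measurable_funB => //; exact: mpi.
  by apply: measurableT_comp => //; apply: measurableT_comp => //; exact: measurable_rate_integral.
move=> w; have /andP[p0 p1] := pi01 w; have /andP[x0 x1] := ex01 (Q0 w).
rewrite ger0_norm ?mulr_ge0 ?subr_ge0//.
apply: (@le_trans _ _ (v * 1 * 1)); last by rewrite !mulr1.
by apply: ler_pM; rewrite ?mulr_ge0 ?subr_ge0// ler_wpM2l// gerBl.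
Qed.

Section FixedSequences.
Variables (K : nat -> A -> simple_process F) (H : nat -> A -> 'I_d -> simple_process F)
  (G : nat -> A -> simple_field F nu).
Hypothesis HK : forall a, pr0 P (drift_error bb K T0 a).
Hypothesis HH : forall a j t, 0 <= t -> pr0 P (ito_error W II H a j t).
Hypothesis HG : forall a t, 0 <= t -> pr0 P (jump_error N JJ G a t).
Hypothesis HH2 : forall a j, pr0 P (fun n w => \int[lebesgue_measure]_(r in `]0%R, T0])
  ((sp_val (H n a j) r w - ss a j r w) ^+ 2)%:E)%E.
Hypothesis HG2 : forall a, pr0 P (fun n w => \int[lebesgue_measure]_(r in `]0%R, T0])
  \int[nu]_u ((sf_val (G n a) r w u - cc a r w u) ^+ 2)%:E)%E.
Let Z n := Zs W N e z0 (K n) (H n) (G n).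
Variables (m : nat -> nat) (t : nat -> nat -> R) (dl : nat -> R).
Hypothesis gr : forall n, grid T0 (dl n) (m n) (t n).
Hypothesis HL : forall n i r, (i < m n)%N -> t n i < r <= t n i.+1 ->
  int_le P (fun w => frob (Z n r w - Z n (t n i) w)) n.+1%:R^-1.
Hypothesis cells : forall n i, (i < m n)%N -> bfree_all (K n) (H n) (G n) (t n i) (t n i.+1).
Let TR n := total_rate W N e z0 (K n) (H n) (G n) Kp kk eta (m n) (t n).
Let TD n := total_defect W N e z0 (K n) (H n) (G n) h h1 h2 Kp kk eta (m n) (t n).
Hypothesis approx : forall n, [/\ measurable_fun setT (TR n), measurable_fun setT (TD n) &
  int_le P (fun w => v * (1 - \prod_(s <- coarse) (1 - E s w)) * expR (- TR n w)
     - Num.min C0 (TD n w) - \sum_(s <- coarse) E s w * `|tf h (Z n s w) - v|)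
    (tf h z0 + n.+1%:R^-1 * T0)].

Let yk n r w := on_grid W N e z0 K H G m t n r w.
Let ck n r w := coq nu (coB e (K n) r w) (coSj e (H n) ^~ r ^~ w) (coC e (G n) r w).
Let gk n r w := gen nu h h1 h2 (yk n r w) (coB e (K n) r w) (coSj e (H n) ^~ r ^~ w) (coC e (G n) r w).

(** On a cell the position is frozen at the left end and the coefficients are constant, so the grid
    sum of any nonnegative functional of them is a time integral. *)
Let step (phi : 'cV[R]_d -> 'cV[R]_d -> ('I_d -> 'cV[R]_d) -> (U -> 'cV[R]_d) -> R) n w :
  (forall y b S C, 0 <= phi y b S C) ->
  (\int[lebesgue_measure]_(r in `]0%R, T0])
    (phi (yk n r w) (coB e (K n) r w) (coSj e (H n) ^~ r ^~ w) (coC e (G n) r w))%:E =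
  (\sum_(i < m n) (t n i.+1 - t n i) * phi (Z n (t n i) w) (coB e (K n) (t n i.+1) w)
    (coSj e (H n) ^~ (t n i.+1) ^~ w) (coC e (G n) (t n i.+1) w))%:E)%E.
Proof.
move=> phi0.
have gi i r : (i < m n)%N -> t n i < r <= t n i.+1 -> yk n r w = Z n (t n i) w.
  move=> im ir; have [g0 gT gH] := gr n.
  have ti0 : 0 <= t n i by rewrite -g0; apply: (grid_le (gr n)); rewrite leq0n ltnW.
  have tT : t n i.+1 <= T0 by rewrite -gT; apply: (grid_le (gr n)); rewrite im leqnn.
  have r0 : 0 < r <= T0.
    by case/andP: ir => ir1 ir2; rewrite (le_lt_trans ti0 ir1) (le_trans ir2 tT).
  have [i' [im' ir' E']] := on_gridE W N e z0 K H G gr n w r0.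
  have ii : i' = i by rewrite -(gidxE (gr n) im ir) (gidxE (gr n) im' ir').
  by rewrite ii in E'; exact: E'.
have self i : (i < m n)%N -> t n i < t n i.+1 <= t n i.+1.
  by move=> im; have [_ _ gH] := gr n; have [-> _] := gH i im; rewrite lexx.
rewrite (step_integral (phi := fun r => phi (yk n r w) (coB e (K n) r w) (coSj e (H n) ^~ r ^~ w) (coC e (G n) r w)) (gr n)).
- apply: (congr1 EFin); apply: eq_bigr => i _.
  by rewrite (gi i _ (ltn_ord i) (self i (ltn_ord i))).
- by move=> r; exact: phi0.
- move=> i r im ir; rewrite (gi i _ im ir) (gi i _ im (self i im)).
  have [-> E1 E2] := co_cell e w (cells im) ir.
  congr (phi _ _ _ _); first by apply/funext => j; exact: E1.
  by apply/funext => u; exact: E2.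
Qed.

Lemma total_rateE n w :
  (\int[lebesgue_measure]_(r in `]0%R, T0]) (rate Kp kk eta (yk n r w) (ck n r w))%:E = (TR n w)%:E)%E.
Proof.
rewrite (step (phi := fun y b S C => rate Kp kk eta y (coq nu b S C)))// => y b S C.
by apply: le_trans (rate_ge Kp0 kk0 eta01 _ _); exact: coq_ge0.
Qed.

Lemma total_defectE n w :
  (\int[lebesgue_measure]_(r in `]0%R, T0])
    (Num.max 0 (- (rate Kp kk eta (yk n r w) (ck n r w) * tf h (yk n r w) - gk n r w)))%:E = (TD n w)%:E)%E.
Proof.
rewrite (step (phi := fun y b S C =>
  Num.max 0 (- (rate Kp kk eta y (coq nu b S C) * tf h y - gen nu h h1 h2 y b S C))))// => y b S C.
by rewrite le_max lexx.
Qed.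

Let ito_L2 a j n w := (\int[lebesgue_measure]_(r in `]0%R, T0])
  ((sp_val (H n a j) r w - ss a j r w) ^+ 2)%:E)%E.
Let jump_L2 a n w := (\int[lebesgue_measure]_(r in `]0%R, T0])
  \int[nu]_u ((sf_val (G n a) r w u - cc a r w u) ^+ 2)%:E)%E.
Let coef_error n w := (\sum_a (drift_error bb K T0 a n w + (\sum_j ito_L2 a j n w + jump_L2 a n w)))%E.
Let dlk n w r : \bar R := (\sum_a (`|sp_val (K n a) r w - bb a r w|%:E +
  (\sum_j ((sp_val (H n a j) r w - ss a j r w) ^+ 2)%:E +
   \int[nu]_u ((sf_val (G n a) r w u - cc a r w u) ^+ 2)%:E)))%E.

Let at_path dX (X : measurableType dX) (f : R * T -> X) w :
  measurable_fun setT f -> measurable_fun setT (fun r => f (r, w)).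
Proof. by move=> mf; exact: (measurableT_comp mf (measurable_pair2 w)). Qed.

Let at_path2 dX (X : measurableType dX) (f : (R * T) * U -> X) w :
  measurable_fun setT f -> measurable_fun setT (fun p : R * U => f ((p.1, w), p.2)).
Proof.
move=> mf; apply: (measurableT_comp mf); apply/measurable_fun_pairP; split => /=.
  by apply/measurable_fun_pairP; split => /=; [exact: measurable_fst|exact: measurable_cst].
exact: measurable_snd.
Qed.

Let mdK n a w : measurable_fun setT (fun r => `|sp_val (K n a) r w - bb a r w|%:E).
Proof.
apply/measurable_EFinP; apply: measurableT_comp => //; apply: measurable_funB.
  exact: (at_path w (measurable_sp_val noise (K n a))).
exact: (at_path w (mbb a)).
Qed.

Let mdH n a j w : measurable_fun setT (fun r => ((sp_val (H n a j) r w - ss a j r w) ^+ 2)%:E).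
Proof.
apply/measurable_EFinP; apply: (measurableT_comp (f := fun x : R => x ^+ 2)) => //; apply: measurable_funB.
  exact: (at_path w (measurable_sp_val noise (H n a j))).
exact: (at_path w (mss a j)).
Qed.

Let mdG n a w : measurable_fun setT
  (fun r => \int[nu]_u ((sf_val (G n a) r w u - cc a r w u) ^+ 2)%:E)%E.
Proof.
apply: (@measurable_ge0_param _ _ _ nu _ R (fun p => ((sf_val (G n a) p.1 w p.2 - cc a p.1 w p.2) ^+ 2)%:E)).
  apply/measurable_EFinP; apply: (measurableT_comp (f := fun x : R => x ^+ 2)) => //; apply: measurable_funB.
    exact: (at_path2 w (measurable_sf_val noise (G n a))).
  exact: (at_path2 w (mcc a)).
by move=> p; rewrite lee_fin sqr_ge0.
Qed.

Let G20 n a r w : (0 <= \int[nu]_u ((sf_val (G n a) r w u - cc a r w u) ^+ 2)%:E)%E.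
Proof. by apply: integral_ge0 => u _; rewrite lee_fin sqr_ge0. Qed.

Let mDT : measurable (`]0, T0]%classic : set (measurableTypeR R)). Proof. by []. Qed.

Let dlk_ge0 n w r : (0 <= dlk n w r)%E.
Proof.
apply: sume_ge0 => a _; apply: adde_ge0; first by rewrite lee_fin.
apply: adde_ge0; last exact: G20.
by apply: sume_ge0 => j _; rewrite lee_fin sqr_ge0.
Qed.

Let coef_errorE n w : (\int[lebesgue_measure]_(r in `]0%R, T0]) dlk n w r = coef_error n w)%E.
Proof.
have s0 a r : (0 <= \sum_j ((sp_val (H n a j) r w - ss a j r w) ^+ 2)%:E)%E.
  by apply: sume_ge0 => j _; rewrite lee_fin sqr_ge0.
have ms a : measurable_fun setT (fun r => \sum_j ((sp_val (H n a j) r w - ss a j r w) ^+ 2)%:E)%E.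
  by apply: emeasurable_sum => j.
have mHG a : measurable_fun setT (fun r => (\sum_j ((sp_val (H n a j) r w - ss a j r w) ^+ 2)%:E +
   \int[nu]_u ((sf_val (G n a) r w u - cc a r w u) ^+ 2)%:E)%E).
  by apply: emeasurable_funD; [exact: ms|exact: mdG].
rewrite /dlk ge0_integral_sum//; last 2 first.
- by move=> a; apply: measurable_funTS; apply: emeasurable_funD; [exact: mdK|exact: mHG].
- by move=> a r _; apply: adde_ge0; [rewrite lee_fin|apply: adde_ge0].
apply: eq_bigr => a _; rewrite ge0_integralD//; last 3 first.
- by apply: measurable_funTS; exact: mdK.
- by move=> r _; rewrite adde_ge0.
- by apply: measurable_funTS; exact: mHG.
congr (_ + _)%E; rewrite ge0_integralD//; last 2 first.
- by apply: measurable_funTS; exact: ms.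
- by apply: measurable_funTS; exact: mdG.
rewrite ge0_integral_sum//; first by move=> j; apply: measurable_funTS; exact: mdH.
by move=> j r _; rewrite lee_fin sqr_ge0.
Qed.

Let coarse_error s n w : \bar R := if 0 <= s <= T0 then (frob (Z n s w - D s w))%:E else 0%E.

(** All errors are gathered in one sequence, so that a single subsequence serves them all. *)
Let total_error n w := (coef_error n w + (\sum_(s <- coarse) coarse_error s n w +
  grid_error W N e z0 D K H G T0 m t n w))%E.

Let total_error_pr0 : pr0 P total_error.
Proof.
apply: pr0D.
  apply: pr0_sum => a; apply: pr0D; first exact: HK.
  by apply: pr0D; [apply: pr0_sum => j; exact: HH2|exact: HG2].
apply: pr0D; last exact: (grid_error_pr0 noise T00 mD rbb HD HK HH HG gr HL).
apply: pr0_sum => s; rewrite /coarse_error.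
case: (boolP (0 <= s <= T0)) => sT; last exact: pr00.
exact: (approximants_pr0 noise mD rbb HD HK HH HG sT).
Qed.

Section AlongSubsequence.
Variables (nk : nat -> nat) (w : T).
Hypothesis summable : (\sum_(0 <= k <oo) cap1 (total_error (nk k) w) < +oo)%E.

Let coef_error0 n : (0 <= coef_error n w)%E.
Proof. by rewrite -coef_errorE; apply: integral_ge0 => r _; exact: dlk_ge0. Qed.

Let coarse_error0 s n : (0 <= coarse_error s n w)%E.
Proof. by rewrite /coarse_error; case: ifP => // _; rewrite lee_fin frob_ge0. Qed.

Let grid_error0 n : (0 <= grid_error W N e z0 D K H G T0 m t n w)%E.
Proof. by apply: integral_ge0 => r _; rewrite lee_fin le_min ler01 frob_ge0. Qed.

Let total_error0 n : (0 <= total_error n w)%E.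
Proof.
apply: adde_ge0 => //; apply: adde_ge0 => //.
by apply: sume_ge0 => s _; exact: coarse_error0.
Qed.

Let small (e' : R) : 0 < e' -> \forall k \near \oo, (total_error (nk k) w <= e'%:E)%E.
Proof.
move=> e0; pose e1 := Num.min e' 2^-1.
have e10 : 0 < e1 by rewrite lt_min e0 invr_gt0 ltr0n.
apply: filterS (summable_term0 e10 (fun k => cap1_ge0 (total_error0 (nk k))) summable) => k.
rewrite /cap1 gt_min => /orP[|/ltW H1].
  by rewrite lte_fin lt_min => /andP[_]; rewrite ltNge invf_le1// ler1n.
by apply: le_trans H1 _; rewrite lee_fin ge_min lexx.
Qed.

Let coef_small (e' : R) : 0 < e' ->
  \forall k \near \oo, (\int[lebesgue_measure]_(r in `]0%R, T0]) dlk (nk k) w r <= e'%:E)%E.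
Proof.
move=> e0; apply: filterS (small e0) => k; apply: le_trans; rewrite coef_errorE /total_error leeDl//.
by rewrite adde_ge0//; apply: sume_ge0.
Qed.

(** Summable capped errors make the time integrals of the capped gap summable. Hence for almost
    every r the gaps themselves form a convergent series, and its terms tend to 0. *)
Let path_grid : {ae (@lebesgue_measure R), forall r : R,
  (`]0, T0]%classic : set R) r -> cvgv (fun k => yk (nk k) r w) (D r w)}.
Proof.
pose g k r : \bar R := (Num.min 1 (frob (yk (nk k) r w - D r w)))%:E.
have g0 k r : (0 <= g k r)%E by rewrite lee_fin le_min ler01 frob_ge0.
have mg k : measurable_fun (`]0, T0]%classic : set (measurableTypeR R)) (g k).
  apply: measurable_funTS; apply/measurable_EFinP; apply: measurable_minr => //.
  apply: measurable_frob; apply: mvecB => i.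
    exact: (at_path w (measurable_on_grid noise e z0 K H G m t (nk k) i)).
  exact: (at_path w (mD i)).
(* The integral is at most [T0] because the gap is capped by 1, and at most the total error; in
   either case it is below 1 + T0 times the capped error. *)
have bound k : (\int[lebesgue_measure]_(r in `]0%R, T0]) g k r <= (1 + T0)%:E * cap1 (total_error (nk k) w))%E.
  have g1 : (\int[lebesgue_measure]_(r in `]0%R, T0]) g k r <= total_error (nk k) w)%E.
    rewrite /total_error addeA; apply: leeDr; apply: adde_ge0 => //.
    by apply: sume_ge0 => s _; exact: coarse_error0.
  have g2 : (\int[lebesgue_measure]_(r in `]0%R, T0]) g k r <= T0%:E)%E.
    have IT : (\int[@lebesgue_measure R]_(r in `]0%R, T0]) (cst 1%E r) = T0%:E)%E.
      by rewrite integral_cst//= lebesgue_measure_itv/= lte_fin T00 sube0 mul1e.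
    rewrite -IT; apply: ge0_le_integral => //.
    by move=> r _; rewrite lee_fin ge_min lexx.
  rewrite /cap1; case: (leP 1%E (total_error (nk k) w)) => _.
    by rewrite mule1; apply: le_trans g2 _; rewrite lee_fin lerDr.
  apply: le_trans g1 _; rewrite -[leLHS]mul1e; apply: lee_wpmul2r => //.
  by rewrite lee_fin lerDl ltW.
have S : (\sum_(0 <= k <oo) \int[lebesgue_measure]_(r in `]0%R, T0]) g k r < +oo)%E.
  apply: (@le_lt_trans _ _ (\sum_(0 <= k <oo) ((1 + T0)%:E * cap1 (total_error (nk k) w)))%E).
    by apply: lee_nneseries => // k _ _; apply: integral_ge0.
  rewrite nneseriesZl; last by move=> k _; exact: cap1_ge0.
  by apply: lte_mul_pinfty => //; rewrite lee_fin addr_ge0// ltW.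
have [X [mX X0 HX]] := summable_ae mDT mg (fun k r _ => g0 k r) S.
exists X; split=> // r /= Hr; apply: HX => /= sm; apply: Hr => Dr i.
have S1 := sm Dr; apply/cvgrPdist_le => e1 e10; pose e2 := Num.min e1 2^-1.
have e20 : 0 < e2 by rewrite lt_min e10 invr_gt0 ltr0n.
apply: filterS (summable_term0 e20 (fun k => g0 k r) S1) => k.
rewrite /g lte_fin gt_min => /orP[|].
  by rewrite lt_min => /andP[_]; rewrite ltNge invf_le1// ler1n.
rewrite lt_min => /andP[/ltW H1 _]; apply: le_trans H1; rewrite frob_subC.
by apply: le_trans (coord_le_frob _ i); rewrite !mxE.
Qed.

Let y r := D r w.
Let my : mvec y. Proof. by move=> i; exact: (at_path w (mD i)). Qed.
Let mb : mvec (fun r => lin_drift r w). Proof. by move=> i; exact: (at_path w (mdr i)). Qed.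
Let mS j : mvec (fun r => lin_diff j r w). Proof. by move=> i; exact: (at_path w (mdf j i)). Qed.
Let mC : mvec (fun p : R * U => lin_jump p.1 w p.2). Proof. by move=> i; exact: (at_path2 w (mjp i)). Qed.
Let myk k : mvec (fun r => yk (nk k) r w).
Proof. by move=> i; exact: (at_path w (measurable_on_grid noise e z0 K H G m t (nk k) i)). Qed.
Let mbk k : mvec (fun r => coB e (K (nk k)) r w).
Proof.
apply: mvec_sum => a; apply: mvecZ; last by move=> i; exact: measurable_cst.
exact: (at_path w (measurable_sp_val noise (K (nk k) a))).
Qed.
Let mSk k j : mvec (fun r => coSj e (H (nk k)) j r w).
Proof.
apply: mvec_sum => a; apply: mvecZ; last by move=> i; exact: measurable_cst.
exact: (at_path w (measurable_sp_val noise (H (nk k) a j))).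
Qed.
Let mCk k : mvec (fun p : R * U => coC e (G (nk k)) p.1 w p.2).
Proof.
apply: mvec_sum => a; apply: mvecZ; last by move=> i; exact: measurable_cst.
exact: (at_path2 w (measurable_sf_val noise (G (nk k) a))).
Qed.

Let mdlk k : measurable_fun setT (dlk (nk k) w).
Proof.
apply: emeasurable_sum => a; apply: emeasurable_funD; first exact: mdK.
by apply: emeasurable_funD; [apply: emeasurable_sum => j; exact: mdH|exact: mdG].
Qed.

Let dlk0 k r : (0 <= dlk (nk k) w r)%E.
Proof. exact: dlk_ge0. Qed.

Let sqk k r : sq_integrable nu (coC e (G (nk k)) r w). Proof. exact: sq_integrable_coC. Qed.

Let coq_dlk k r : ((coq nu (coB e (K (nk k)) r w - lin_drift r w)
   (fun j => coSj e (H (nk k)) j r w - lin_diff j r w)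
   (fun u => coC e (G (nk k)) r w u - lin_jump r w u))%:E <= (comb_cst e)%:E * dlk (nk k) w r)%E.
Proof.
have mz a : measurable_fun setT (fun u => sf_val (G (nk k) a) r w u - cc a r w u).
  apply: measurable_funB.
    exact: (measurableT_comp (at_path2 w (measurable_sf_val noise (G (nk k) a))) (measurable_pair1 r)).
  exact: (measurableT_comp (at_path2 w (mcc a)) (measurable_pair1 r)).
have subE (f g : A -> R) : \sum_a f a *: e a - \sum_a g a *: e a = \sum_a (f a - g a) *: e a.
  by rewrite -sumrB; apply: eq_bigr => a _; rewrite scalerBl.
have E1 : (fun u => coC e (G (nk k)) r w u - lin_jump r w u) =
    fun u => \sum_a (sf_val (G (nk k) a) r w u - cc a r w u) *: e a.
  by apply/funext => u; exact: subE.
have E2 : (fun j => coSj e (H (nk k)) j r w - lin_diff j r w) =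
    fun j => \sum_a (sp_val (H (nk k) a j) r w - ss a j r w) *: e a.
  by apply/funext => j; exact: subE.
have sq : sq_integrable nu (fun u => \sum_a (sf_val (G (nk k) a) r w u - cc a r w u) *: e a).
  by rewrite -E1; apply: sq_integrableB => //; exact: sqk.
rewrite E1 E2 /coB /lin_drift subE.
exact: (coq_comb (fun a => sp_val (K (nk k) a) r w - bb a r w)
  (fun j a => sp_val (H (nk k) a j) r w - ss a j r w) mz sq).
Qed.

Let mck k : measurable_fun setT (fun r => ck (nk k) r w).
Proof. exact: (@measurable_coq R dU U nu _ R d (fun r => coB e (K (nk k)) r w)
  (fun j r => coSj e (H (nk k)) j r w) (fun r => coC e (G (nk k)) r w) (mbk k) (mSk k) (mCk k)). Qed.

Let mratek k : measurable_fun setT (fun r => rate Kp kk eta (yk (nk k) r w) (ck (nk k) r w)).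
Proof.
apply: measurable_funD => //; apply: measurable_funM => //.
apply: measurable_funD => //; apply: measurable_funM => //.
apply: (measurableT_comp (f := eta)); first exact: continuous_measurable_fun.
exact: measurable_dotv.
Qed.

Let fin_int (f : R -> R) (c : R) : measurable_fun setT f -> (forall r, 0 <= f r) ->
  (\int[lebesgue_measure]_(r in `]0%R, T0]) (f r)%:E = c%:E)%E ->
  (@lebesgue_measure R).-integrable `]0, T0] (EFin \o f).
Proof.
move=> mf f0 E'; apply/integrableP; split; first by apply/measurable_EFinP; exact: measurable_funTS.
by under eq_integral do rewrite /= ger0_norm//; rewrite E' ltry.
Qed.

Lemma total_rate_cvg : TR (nk k) w @[k --> \oo] --> rate_integral w.
Proof.
have [M M0 HM] := coq_bounded w.
apply/cvgrPdist_le => e1 e10.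
have := path_rate Kp0 kk0 etac eta01 T00 M0 (comb_cst_ge0 e) my mb mS mC myk mbk mSk mCk
  mdlk dlk0 (sqG^~ w) sqk coq_dlk coef_small HM path_grid e10.
apply: filterS => k; rewrite -lee_fin distrC; apply: le_trans.
have r0 r : 0 <= rate Kp kk eta (yk (nk k) r w) (ck (nk k) r w).
  by apply: le_trans (rate_ge Kp0 kk0 eta01 _ _); exact: coq_ge0.
have TRE := total_rateE (nk k) w.
rewrite (_ : TR (nk k) w = \int[lebesgue_measure]_(r in `]0, T0]) rate Kp kk eta (yk (nk k) r w) (ck (nk k) r w)).
  apply: Rintegral_dist => //; first exact: fin_int TRE.
  have ic : (@lebesgue_measure R).-integrable `]0, T0] (EFin \o cst ((Kp + (1 + kk)) * (1 + M))).
    apply/integrableP; split; first by apply/measurable_EFinP; exact: measurable_cst.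
    under eq_integral do rewrite /=.
    rewrite integral_cst//= lebesgue_measure_itv/= lte_fin T00 sube0 -EFinM; exact: ltry.
  apply: (le_integrable mDT _ _ ic).
    by apply/measurable_EFinP; apply: measurable_funTS; exact: (at_path w mrate).
  move=> r /=; rewrite in_itv/= => Dr; rewrite lee_fin ger0_norm// ger0_norm; last first.
    by rewrite mulr_ge0 ?addr_ge0.
  have q0 : 0 <= lin_coq r w by exact: coq_ge0.
  have := HM r Dr; have /andP[x0 x1] := eta01 (dotv (D r w) (D r w)); rewrite /rate.
  move: (eta _) (lin_coq r w) x0 x1 q0 => x q x0 x1 q0 qM.
  have : q * (1 + kk * x) <= M * (1 + kk) by rewrite ler_pM// ?addr_ge0 ?mulr_ge0// lerD2l ler_piMr.
  by move: kk0 Kp0 (mulr_ge0 Kp0 M0); move: (q * _) => z; move: Kp kk => a1 a2 H1 H2 H3 H4; lra.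
by rewrite /Rintegral TRE.
Qed.

(** The defect of the true path is nonnegative by [supersolution], so the negative part of the
    approximate defect is at most the distance between the two. *)
Lemma total_defect_cvg : TD (nk k) w @[k --> \oo] --> (0 : R).
Proof.
have [M M0 HM] := coq_bounded w.
apply/cvgrPdist_le => e1 e10.
have := path_defect test Kp0 kk0 etac eta01 T00 M0 (comb_cst_ge0 e) my mb mS mC myk mbk mSk mCk
  mdlk dlk0 (sqG^~ w) sqk coq_dlk coef_small HM path_grid e10.
apply: filterS => k; rewrite sub0r normrN -lee_fin.
have TDE := total_defectE (nk k) w.
have T0' : 0 <= TD (nk k) w.
  by rewrite -lee_fin -TDE; apply: integral_ge0 => r _; rewrite lee_fin le_max lexx.
rewrite (ger0_norm T0') -TDE; apply: le_trans.
have mF : measurable_fun setT (fun r => rate Kp kk eta (yk (nk k) r w) (ck (nk k) r w) * tf h (yk (nk k) r w)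
    - gk (nk k) r w).
  apply: measurable_funB.
    by apply: measurable_funM; [exact: mratek|apply: measurable_tf => //; exact: test_hc test].
  exact: (@measurable_gen R dU U nu _ R d (fun r => yk (nk k) r w) (fun r => coB e (K (nk k)) r w)
    (fun j r => coSj e (H (nk k)) j r w) (fun r => coC e (G (nk k)) r w) (myk k) (mbk k) (mSk k) (mCk k)
    h h1 h2 (test_hc test) (test_h1c test) (test_h2c test)).
have mG : measurable_fun setT (fun r => rate Kp kk eta (D r w) (lin_coq r w) * tf h (D r w)
    - gen nu h h1 h2 (D r w) (lin_drift r w) (lin_diff ^~ r ^~ w) (lin_jump r w)).
  apply: measurable_funB.
    by apply: measurable_funM; [exact: (at_path w mrate)|apply: measurable_tf => //; exact: test_hc test].
  exact: (@measurable_gen R dU U nu _ R d (fun r => D r w) (fun r => lin_drift r w)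
    (fun j r => lin_diff j r w) (fun r => lin_jump r w) my mb mS mC
    h h1 h2 (test_hc test) (test_h1c test) (test_h2c test)).
apply: ge0_le_integral => //.
- by move=> r _; rewrite lee_fin le_max lexx.
- apply: measurable_funTS; apply/measurable_EFinP; apply: measurable_maxr => //.
  by apply: measurableT_comp => //.
- apply: measurable_funTS; apply/measurable_EFinP; apply: measurableT_comp => //.
  exact: measurable_funB.
move=> r; rewrite /= in_itv/= => Dr; have := supersolution w Dr; rewrite -subr_ge0 => SS; rewrite lee_fin; move: SS.
rewrite /lin_coq; move: (_ - gen _ _ _ _ (D r w) _ _ _) (_ - gk _ _ _) => x1 x2 x10.
rewrite ge_max normr_ge0/=; have := ler_norm (- (x2 - x1)); rewrite normrN; lra.
Qed.

Lemma coarse_cvg s : s \in coarse -> tf h (Z (nk k) s w) @[k --> \oo] --> tf h (D s w).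
Proof.
move=> sc; apply: tf_cvg; first exact: test_hc test.
move=> i; apply/cvgrPdist_le => e1 e10; apply: filterS (small e10) => k Hk.
rewrite -lee_fin; apply: le_trans Hk.
have H1 : (coarse_error s (nk k) w <= total_error (nk k) w)%E.
  apply: (@le_trans _ _ (\sum_(s <- coarse) coarse_error s (nk k) w)%E).
    by rewrite (bigD1_seq s)//= leeDl//; apply: sume_ge0.
  rewrite /total_error; apply: (@le_trans _ _ (\sum_(s <- coarse) coarse_error s (nk k) w +
    grid_error W N e z0 D K H G T0 m t (nk k) w)%E); first exact: leeDl.
  by apply: leeDr; exact: coef_error0.
apply: le_trans H1; rewrite /coarse_error (coarse_in sc) lee_fin frob_subC.
by apply: le_trans (coord_le_frob _ i); rewrite !mxE.
Qed.

End AlongSubsequence.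

(** Dominated convergence along the subsequence: the discount stays in [0, 1] and the loss below
    [C0]. The coarse error vanishes because the test function of the true path equals [v] wherever
    [E] is nonzero. *)
Lemma sequence_bound : int_le P integrand (tf h z0).
Proof.
split; first exact: iintegrand.
have [nk [nkk ae_sum]] := pr0_subseq total_error_pr0.
pose f k w := v * (1 - \prod_(s <- coarse) (1 - E s w)) * expR (- TR (nk k) w)
     - Num.min C0 (TD (nk k) w) - \sum_(s <- coarse) E s w * `|tf h (Z (nk k) s w) - v|.
have TR0 n w : 0 <= TR n w.
  rewrite -lee_fin -total_rateE; apply: integral_ge0 => r _; rewrite lee_fin.
  by apply: le_trans (rate_ge Kp0 kk0 eta01 _ _); exact: coq_ge0.
have TD0 n w : 0 <= TD n w.
  by rewrite -lee_fin -total_defectE; apply: integral_ge0 => r _; rewrite lee_fin le_max lexx.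
pose B := v + C0 + \sum_(s <- coarse) (C0 + v).
have fB k w : `|f k w| <= B.
  have /andP[p0 p1] := pi01 w; have /andP[x0 x1] := ex01 (TR0 (nk k) w).
  apply: le_trans (ler_normB _ _) _; apply: lerD; first apply: le_trans (ler_normB _ _) _; first apply: lerD.
  - rewrite ger0_norm ?mulr_ge0 ?subr_ge0//.
    apply: (@le_trans _ _ (v * 1 * 1)); last by rewrite !mulr1.
    by apply: ler_pM; rewrite ?mulr_ge0 ?subr_ge0// ler_wpM2l// gerBl.
  - by rewrite ger0_norm ?le_min ?C00 ?TD0// ge_min lexx.
  rewrite ger0_norm; last by apply: sumr_ge0 => s _; rewrite mulr_ge0//; have /andP[] := E01 s w.
  apply: ler_sum => s _; have /andP[e0 e1] := E01 s w; rewrite -[leRHS]mul1r; apply: ler_pM => //.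
  by apply: le_trans (ler_normB _ _) _; apply: lerD; [exact: (test_tf_le test)|rewrite ger0_norm].
have cf : {ae P, forall w, setT w -> (f k w)%:E @[k --> \oo] --> (integrand w)%:E}.
  apply: filterS ae_sum => w sm _; apply: cvg_EFin; first exact: nearW.
  rewrite -[integrand w]subr0 -[integrand w - 0]subr0; apply: cvgB; first apply: cvgB.
  - apply: cvgM; first exact: cvg_cst.
    exact: (cvg_comp _ _ (cvgN (total_rate_cvg sm)) (@continuous_expR R (- rate_integral w))).
  - apply: (@squeeze_cvgr _ _ _ _ (fun=> 0) (fun k => TD (nk k) w)).
    + by apply: nearW => k; rewrite le_min C00 TD0 ge_min lexx orbT.
    + exact: cvg_cst.
    + exact: total_defect_cvg.
  pose u k s := if s \in coarse then E s w * `|tf h (Z (nk k) s w) - v| else 0.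
  have c1 : \sum_(s <- coarse) u k s @[k --> \oo] --> \sum_(s <- coarse) (0 : R).
    apply: (@cvg_seq_sum R _ coarse (fun s k => u k s) (fun=> 0)) => s; rewrite /u.
    case: (boolP (s \in coarse)) => sc; last exact: cvg_cst.
    have [->|Es0] := eqVneq (E s w) 0; first by under eq_fun do rewrite mul0r; exact: cvg_cst.
    rewrite -(mulr0 (E s w)); apply: cvgM; first exact: cvg_cst.
    rewrite -(normr0 R) -(subrr v); apply: cvg_norm; apply: cvgB; last exact: cvg_cst.
    by rewrite -(Ev sc Es0); exact: coarse_cvg.
  have E1 : (fun k => \sum_(s <- coarse) E s w * `|tf h (Z (nk k) s w) - v|) =
      fun k => \sum_(s <- coarse) u k s.
    by apply/funext => k; rewrite big_seq big_mkcond.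
  by rewrite E1; move: c1; rewrite big1.
have mf k : measurable_fun setT (fun w => (f k w)%:E).
  by have [_ _ [/integrableP[]]] := approx (nk k).
have iB : P.-integrable setT (EFin \o cst B).
  by have := finite_measure_integrable_cst P B measurableT.
have df : {ae P, forall w k, setT w -> (`|(f k w)%:E| <= (EFin \o cst B) w)%E}.
  by apply: aeW => w k _; rewrite /= lee_fin.
have mi : measurable_fun setT (fun w => (integrand w)%:E) by have /integrableP[] := iintegrand.
have [_ _ cv] := dominated_convergence measurableT mf mi cf iB df.
have F' : (\int[P]_w (integrand w)%:E)%E \is a fin_num by exact: (integrable_fin_num measurableT iintegrand).
rewrite -lee_fin /Rintegral fineK//; apply/lee_addgt0Pr => e1 e10; rewrite -EFinD.
have <- := cvg_lim (@ereal_hausdorff R) cv.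
apply: lime_le; first by apply/cvg_ex; eexists; exact: cv.
have e2 : 0 < e1 / T0 by rewrite divr_gt0.
near=> k; have [_ _ [fi fl]] := approx (nk k).
have fin : (\int[P]_w (f k w)%:E)%E \is a fin_num by exact: (integrable_fin_num measurableT fi).
rewrite /= -(fineK fin) lee_fin; apply: le_trans fl _; rewrite lerD2l -ler_pdivlMr//.
have : (k.+1%:R^-1 : R) < e1 / T0 by near: k; exact: (near_infty_natSinv_lt (PosNum e2)).
by move=> /ltW; apply: le_trans; rewrite lef_pV2 ?posrE ?ltr0n// ler_nat ltnS.
Unshelve. all: by end_near. Qed.

End FixedSequences.

Hypothesis Fbb : forall a t, 0 <= t -> Fm F t (bb a t).
Hypothesis HI : forall a j, exists Hn : nat -> simple_process F,
  pr0 P (fun n w => \int[lebesgue_measure]_(r in `]0%R, T0]) ((sp_val (Hn n) r w - ss a j r w) ^+ 2)%:E)%E /\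
  forall t, 0 <= t -> pr0 P (fun n w =>
    `|sp_integral (Hn n) (fun t w => (W t w : 'cV[R]_d) j 0) t w - II a j t w|%:E).
Hypothesis HJ : forall a, exists Gn : nat -> simple_field F nu,
  pr0 P (fun n w => \int[lebesgue_measure]_(r in `]0%R, T0])
    \int[nu]_u ((sf_val (Gn n) r w u - cc a r w u) ^+ 2)%:E)%E /\
  forall t, 0 <= t -> pr0 P (fun n w => `|sf_integral (Gn n) N t w - JJ a t w|%:E).

(** For each approximant the grid contains its breakpoints and the coarse times. The mesh is fitted
    to the one-step estimate and to the L1 modulus, and both of these depend on the approximant. *)
Let fine_grid (K : A -> simple_process F) (H : A -> 'I_d -> simple_process F)
    (G : A -> simple_field F nu) n : exists p : R * nat * (nat -> R),
  let: (dl, m, t) := p in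
  [/\ grid T0 dl m t, forall i, (i < m)%N -> bfree_all K H G (t i) (t i.+1),
    forall i r, (i < m)%N -> t i < r <= t i.+1 ->
      int_le P (fun w => frob (Zs W N e z0 K H G r w - Zs W N e z0 K H G (t i) w)) n.+1%:R^-1 &
    [/\ measurable_fun setT (total_rate W N e z0 K H G Kp kk eta m t),
      measurable_fun setT (total_defect W N e z0 K H G h h1 h2 Kp kk eta m t) &
      int_le P (fun w => v * (1 - \prod_(s <- coarse) (1 - E s w)) *
          expR (- total_rate W N e z0 K H G Kp kk eta m t w)
        - Num.min C0 (total_defect W N e z0 K H G h h1 h2 Kp kk eta m t w)
        - \sum_(s <- coarse) E s w * `|tf h (Zs W N e z0 K H G s w) - v|)
      (tf h z0 + n.+1%:R^-1 * T0)]].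
Proof.
have n0 : 0 < n.+1%:R^-1 :> R by rewrite invr_gt0 ltr0n.
have [d1 d10 Hd1] := approximant_hitting noise e z0 K H G (test_hc test) (test_h1c test) (test_h2c test)
  (test_C01 test) (test_tf_le test) (test_tg_le test) (test_tD_le test) (test_tf_lip test)
  (test_tT_le test) (test_tT_taylor test) (test_h_ge0 test) Kp0 kk0 etac eta01 T00 n0 v0
  coarse_in coarse_uniq E01 mE.
have [C C_0 HC] := Zs_L1 noise e z0 K H G T00.
have C1 : 0 < C + 1 by rewrite ltr_wpDl.
(* Chosen so that C times the square root of [d2] is at most 1 / (n + 1). *)
pose d2 := (n.+1%:R^-1 / (C + 1)) ^+ 2.
have d20 : 0 < d2 by rewrite exprn_gt0// divr_gt0.
pose dl := Num.min d1 (Num.min 1 d2).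
have dl0 : 0 < dl by rewrite !lt_min d10 ltr01 d20.
pose ends (S : simple_process F) := map (@sp_left _ _ _ _ S) (enum 'I_(sp_size S)) ++
  map (@sp_right _ _ _ _ S) (enum 'I_(sp_size S)).
pose pts := coarse ++ flatten [seq ends (K a) ++ (flatten [seq ends (H a j) | j <- enum 'I_d]) ++ ends (G a) | a <- enum A].
have [m [t [g Hpts]]] := grid_exists pts T00 dl0.
have [t0 tT gH] := g.
have free (S : simple_process F) : {subset ends S <= pts} -> forall i, (i < m)%N -> bfree S (t i) (t i.+1).
  move=> sub i im k.
  have pt x : x \in ends S -> 0 <= x -> x <= t i \/ t i.+1 <= x.
    move=> xS x0; have [xT|Tx] := leP x T0.
      have [j jm ->] := Hpts x (sub x xS) (introT andP (conj x0 xT)).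
      have [ji|ij] := leqP j i.
        by left; apply: (grid_le g); rewrite ji (ltnW im).
      by right; apply: (grid_le g); rewrite ij jm.
    right; apply: ltW; apply: le_lt_trans Tx; rewrite -tT; apply: (grid_le g); rewrite im leqnn//.
  have [l0 lr] := sp_order k.
  split; apply: pt => //; last exact: le_trans lr.
    by rewrite mem_cat map_f ?mem_enum.
  by rewrite mem_cat orbC map_f ?mem_enum.
have sub a (x : R) : x \in ends (K a) ++ (flatten [seq ends (H a j) | j <- enum 'I_d]) ++ ends (G a) -> x \in pts.
  move=> xa; rewrite mem_cat; apply/orP; right; apply/flattenP.
  by exists (ends (K a) ++ (flatten [seq ends (H a j) | j <- enum 'I_d]) ++ ends (G a)) => //;
    apply: map_f; rewrite mem_enum.
have cells i : (i < m)%N -> bfree_all K H G (t i) (t i.+1).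
  move=> im; split=> [a|a j|a]; apply: (free _ _ i im) => x xS; apply: (sub a); rewrite mem_cat.
  - by rewrite xS.
  - apply/orP; right; rewrite mem_cat; apply/orP; left; apply/flattenP; exists (ends (H a j)) => //.
    by apply: map_f; rewrite mem_enum.
  - by apply/orP; right; rewrite mem_cat xS orbT.
exists (dl, m, t); split=> //.
- move=> i r im /andP[ir ri]; have [_ dd] := gH i im.
  have ti0 : 0 <= t i by rewrite -t0; apply: (grid_le g); rewrite leq0n ltnW.
  have rd : r - t i <= dl by apply: le_trans dd; rewrite lerB.
  have rT : r <= T0 by apply: le_trans ri _; rewrite -tT; apply: (grid_le g); rewrite im leqnn.
  have r1 : r - t i <= 1 by apply: le_trans rd _; rewrite /dl !ge_min lexx !orbT.
  apply: int_le_weak (HC _ _ ti0 ir rT r1 (bfree_all_sub ri (cells i im))).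
  apply: (@le_trans _ _ (C * (n.+1%:R^-1 / (C + 1)))).
    rewrite ler_wpM2l// -[leRHS]ger0_norm ?divr_ge0 ?(ltW n0) ?(ltW C1)// -sqrtr_sqr ler_wsqrtr//.
    by apply: le_trans rd _; rewrite /dl !ge_min lexx !orbT.
  by rewrite mulrCA ler_piMr ?(ltW n0)// ler_pdivrMr// mul1r lerDl.
apply: Hd1 => //.
- split=> // i im; have [ti td] := gH i im; split=> //.
  by apply: le_trans td _; rewrite /dl ge_min lexx.
- by move=> s sc; apply: Hpts (coarse_in sc); rewrite mem_cat sc.
Qed.

(** A form of optional stopping: when the path is stopped at the first coarse time with [E] nonzero,
    the discounted level [v] has mean at most the initial value of the test function. *)
Theorem hitting_bound : int_le P
  (fun w => v * (1 - \prod_(s <- coarse) (1 - E s w)) * expR (- rate_integral w)) (tf h z0).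
Proof.
pose K n a := simple_drift T0 (F_sigma noise) (@Fbb a) n.
have /choice[H0 HH0] : forall p : A * 'I_d, exists Hn : nat -> simple_process F,
    pr0 P (fun n w => \int[lebesgue_measure]_(r in `]0%R, T0]) ((sp_val (Hn n) r w - ss p.1 p.2 r w) ^+ 2)%:E)%E /\
    forall t, 0 <= t -> pr0 P (fun n w =>
      `|sp_integral (Hn n) (fun t w => (W t w : 'cV[R]_d) p.2 0) t w - II p.1 p.2 t w|%:E).
  by case=> a j; exact: HI.
have /choice[G0 HG0] := HJ.
pose H n a j := H0 (a, j) n; pose G n a := G0 a n.
have /choice[p Hp] : forall n, exists p : R * nat * (nat -> R), _ := fun n => fine_grid (K n) (H n) (G n) n.
apply: (@sequence_bound K H G _ _ _ _ _ (fun n => (p n).1.2) (fun n => (p n).2) (fun n => (p n).1.1)).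
- move=> a; apply: pr0_pointwise.
  + move=> n; apply: (@measurable_time_integral _ _ _ _ (fun p : R * T => `|sp_val (K n a) p.1 p.2 - bb a p.1 p.2|%:E)) => //.
    apply/measurable_EFinP; apply: measurableT_comp => //; apply: measurable_funB => //.
    exact: measurable_sp_val noise _.
  + by move=> n w; apply: integral_ge0 => r _; rewrite lee_fin.
  + by apply: aeW => w; apply: simple_drift_cvg.
- by move=> a j t t0; have [_] := HH0 (a, j); exact.
- by move=> a t t0; have [_] := HG0 a; exact.
- by move=> a j; have [] := HH0 (a, j).
- by move=> a; have [] := HG0 a.
- by move=> n; have := Hp n; case: (p n) => -[dl m] t [].
- by move=> n; have := Hp n; case: (p n) => -[dl m] t [].
- by move=> n; have := Hp n; case: (p n) => -[dl m] t [].
- by move=> n; have := Hp n; case: (p n) => -[dl m] t [].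
Qed.

End SequenceBound.

(** * The truncated Lyapunov function *)

Section QuadraticError.
Variable R : realType.

(** Lets the powers of the positive part be differentiated by one inequality, at the kink as well as
    elsewhere. *)
Lemma is_derive_quad (f : R -> R) (x c K : R) :
  (forall y, `|y - x| <= 1 -> `|f y - f x - c * (y - x)| <= K * (y - x) ^+ 2) -> is_derive x 1 f c.
Proof.
move=> H; have K0 : 0 <= K.
  have := H (x + 1); rewrite addrAC subrr add0r normr1 lexx expr1n mulr1 => /(_ isT) H1.
  by rewrite -[K]mulr1; apply: le_trans H1; exact: normr_ge0.
have cv : h^-1 *: ((f \o shift x) (h *: 1) - f x) @[h --> 0^'] --> c.
  apply/cvgrPdist_le => e e0; near=> t.
  have t0 : t != 0 by near: t; exact: nbhs_dnbhs_neq.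
  have t1 : `|t| <= 1.
    by near: t; apply: dnbhs0_le.
  have tK : `|t| <= e / (K + 1).
    by near: t; apply: dnbhs0_le; rewrite divr_gt0// ltr_wpDl.
  rewrite /= /GRing.scale/= mulr1.
  have := H (t + x); rewrite addrK => /(_ t1) Ht.
  rewrite (_ : c - _ = - (t^-1 * (f (t + x) - f x - c * t))); last by field.
  rewrite normrN normrM normfV ler_pdivrMl ?normr_gt0//.
  apply: le_trans Ht _; rewrite -[t ^+ 2]ger0_norm ?sqr_ge0// normrX expr2 mulrCA.
  rewrite ler_wpM2l//; apply: (@le_trans _ _ (K * (e / (K + 1)))); first by rewrite ler_wpM2l.
  by rewrite mulrCA ler_piMr ?(ltW e0)// ler_pdivrMr ?ltr_wpDl// mul1r lerDl.
by split; [apply/cvg_ex; exists c|apply: cvg_lim].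
Unshelve. all: by end_near. Qed.

Definition pos (x : R) : R := Num.max 0 x.

Lemma pos_ge0 x : 0 <= pos x. Proof. by rewrite le_max lexx. Qed.

Lemma pos_le x : x <= pos x. Proof. by rewrite le_max lexx orbT. Qed.

Lemma ge0_pos x : 0 <= x -> pos x = x. Proof. by move=> x0; exact/max_idPr. Qed.

Lemma le0_pos x : x <= 0 -> pos x = 0. Proof. by move=> x0; exact/max_idPl. Qed.

Lemma pos_continuous : continuous pos.
Proof.
move=> x; apply/cvgrPdist_le => e e0; near=> y.
have : `|x - y| <= e by near: y; exact: cvgr_dist_le.
by rewrite /pos !ler_norml => /andP[? ?]; case: (leP 0 x) => ?; case: (leP 0 y) => ?; apply/andP; split; lra.
Unshelve. all: by end_near. Qed.

(** The third power is the first integer power of the positive part that is twice continuously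
    differentiable. Its tangent inequality becomes the concavity of the truncation. *)
Lemma cube_pos_convex a b : pos a ^+ 3 + 3 * pos a ^+ 2 * (b - a) <= pos b ^+ 3.
Proof.
have b0 := exprn_ge0 3 (pos_ge0 b).
have [a0|a0] := leP a 0; first by rewrite (le0_pos a0) !expr0n/= mulr0 mul0r addr0.
rewrite (ge0_pos (ltW a0)); have [bn|bn] := leP b 0.
  rewrite (le0_pos bn) expr0n/=.
  rewrite (_ : _ + _ = 3 * (a ^+ 2 * b) - 2 * (a ^+ 2 * a)); last by ring.
  have := mulr_ge0 (sqr_ge0 a) (ltW a0); have := mulr_ge0_le0 (sqr_ge0 a) bn; lra.
rewrite (ge0_pos (ltW bn)) -subr_ge0 (_ : _ - _ = (b - a) ^+ 2 * (b + 2 * a)); last by ring.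
by rewrite mulr_ge0 ?sqr_ge0// addr_ge0 ?mulr_ge0 ?(ltW a0) ?(ltW bn).
Qed.

Definition C2 (O : set R) (f f1 f2 : R -> R) := forall s : R, O s ->
  [/\ is_derive s 1 f (f1 s), is_derive s 1 f1 (f2 s) & {for s, continuous f2}].

Lemma is_derive_continuous (f : R -> R) (s a : R) : is_derive s 1 f a -> {for s, continuous f}.
Proof. by move=> [fd _]; exact/differentiable_continuous/derivable1_diffP. Qed.

Lemma C2_ext O f f1 f2 g g1 g2 : f =1 g -> f1 =1 g1 -> f2 =1 g2 -> C2 O f f1 f2 -> C2 O g g1 g2.
Proof. by move=> /funext -> /funext -> /funext ->. Qed.

Lemma C2_affine (a b : R) : C2 setT (fun s => a * s + b) (fun=> a) (fun=> 0).
Proof.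
move=> s _; split; last exact: cvg_cst.
  by apply: is_derive_eq; rewrite /GRing.scale/= addr0 mulr1.
exact: is_derive_cst.
Qed.

Lemma C2_comp (O O' : set R) f f1 f2 g g1 g2 : C2 O' f f1 f2 -> C2 O g g1 g2 ->
  (forall s, O s -> O' (g s)) -> C2 O (fun s => f (g s)) (fun s => f1 (g s) * g1 s)
    (fun s => f2 (g s) * g1 s ^+ 2 + f1 (g s) * g2 s).
Proof.
move=> Cf Cg OO s Os; have [fa fb fc] := Cf _ (OO s Os); have [ga gb gc] := Cg s Os.
have cg := is_derive_continuous ga; have cg1 := is_derive_continuous gb.
have cf1 := is_derive_continuous fb.
have d1 := is_derive1_comp fb ga.
split.
- exact: (is_derive1_comp fa ga).
- have D : is_derive s 1 (fun s => f1 (g s) * g1 s) _ := is_deriveM d1 gb.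
  refine (@is_derive_eq _ _ _ _ _ _ _ _ D _); rewrite /GRing.scale/=.
  by move: (f1 _) (f2 _) (g1 _) (g2 _) => *; ring.
apply: cvgD; apply: cvgM => //.
- exact: (cvg_comp _ _ cg fc).
- by rewrite expr2; under eq_fun do rewrite expr2; exact: cvgM.
- exact: (cvg_comp _ _ cg cf1).
Qed.

Lemma C2_mul O f f1 f2 g g1 g2 : C2 O f f1 f2 -> C2 O g g1 g2 ->
  C2 O (fun s => f s * g s) (fun s => f1 s * g s + f s * g1 s)
    (fun s => f2 s * g s + 2 * (f1 s * g1 s) + f s * g2 s).
Proof.
move=> Cf Cg s Os; have [fa fb fc] := Cf s Os; have [ga gb gc] := Cg s Os.
have cf := is_derive_continuous fa; have cf1 := is_derive_continuous fb.
have cg := is_derive_continuous ga; have cg1 := is_derive_continuous gb.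
split.
- have D : is_derive s 1 (fun s => f s * g s) _ := is_deriveM fa ga.
  by refine (@is_derive_eq _ _ _ _ _ _ _ _ D _); rewrite /GRing.scale/= addrC [g s * _]mulrC.
- have D : is_derive s 1 (fun s => f1 s * g s + f s * g1 s) _ := is_deriveD (is_deriveM fb ga) (is_deriveM fa gb).
  refine (@is_derive_eq _ _ _ _ _ _ _ _ D _); rewrite /GRing.scale/=.
  by move: (f s) (f1 s) (f2 s) (g s) (g1 s) (g2 s) => *; ring.
by apply: cvgD; [apply: cvgD; [exact: cvgM|apply: cvgM; [exact: cvg_cst|exact: cvgM]]|exact: cvgM].
Qed.

Lemma C2_cube : C2 setT (fun x => pos x ^+ 3) (fun x => 3 * pos x ^+ 2) (fun x => 6 * pos x).
Proof.
move=> a _; split.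
- apply: (@is_derive_quad _ _ _ (3 * `|a| + 3)) => b ab.
  have := cube_pos_convex a b; rewrite -subr_ge0 opprD addrA => H; rewrite ger0_norm//.
  rewrite ler_norml in ab; case/andP: ab => ab1 ab2.
  have sq := sqr_ge0 (b - a).
  have [a0|a0] := leP a 0.
    rewrite (le0_pos a0) !expr0n/= mulr0 mul0r !subr0 (ler0_norm a0).
    have [b0|b0] := leP b 0; first by rewrite (le0_pos b0) expr0n/= mulr_ge0//; lra.
    rewrite (ge0_pos (ltW b0)); apply: (@le_trans _ _ (1 * (b - a) ^+ 2)); last first.
      by rewrite ler_wpM2r//; lra.
    have ba : b <= b - a by lra.
    rewrite mul1r exprS; apply: (@le_trans _ _ (1 * b ^+ 2)); first by rewrite ler_wpM2r ?sqr_ge0//; lra.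
    by rewrite mul1r lerXn2r ?nnegrE ?(ltW b0)//; lra.
  rewrite (gtr0_norm a0) (ge0_pos (ltW a0)).
  have [b0|b0] := leP b 0.
    rewrite (le0_pos b0) expr0n/= [leLHS](_ : _ = a ^+ 2 * (2 * a - 3 * b)); last by ring.
    rewrite mulrC; apply: ler_pM; rewrite ?sqr_ge0//; [lra|lra|].
    rewrite (_ : (b - a) ^+ 2 = (a - b) ^+ 2); last by ring.
    by rewrite lerXn2r ?nnegrE//; lra.
  rewrite (ge0_pos (ltW b0)) (_ : _ - _ = (b + 2 * a) * (b - a) ^+ 2); last by ring.
  by rewrite ler_wpM2r//; lra.
- apply: (@is_derive_quad _ _ _ 3) => b _.
  have sq := sqr_ge0 (b - a).
  have [a0|a0] := leP a 0.
    rewrite (le0_pos a0) expr0n/= !mulr0 mul0r !subr0.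
    have [b0|b0] := leP b 0; first by rewrite (le0_pos b0) expr0n/= mulr0 normr0 mulr_ge0.
    have n0 : 0 <= 3 * b ^+ 2 by rewrite mulr_ge0// sqr_ge0.
    rewrite (ge0_pos (ltW b0)) (ger0_norm n0) ler_wpM2l//.
    by rewrite lerXn2r ?nnegrE//; lra.
  rewrite (ge0_pos (ltW a0)).
  have [b0|b0] := leP b 0.
    rewrite (le0_pos b0) expr0n/= [X in `|X|](_ : _ = 3 * (a * (a - 2 * b))); last by ring.
    rewrite ger0_norm; last by rewrite !mulr_ge0//; lra.
    rewrite ler_pM2l// -subr_ge0 (_ : _ - _ = b ^+ 2); first exact: sqr_ge0.
    by ring.
  rewrite (ge0_pos (ltW b0)) [X in `|X|](_ : _ = 3 * (b - a) ^+ 2); last by ring.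
  by rewrite ger0_norm// mulr_ge0.
- by apply: cvgM; [exact: cvg_cst|exact: pos_continuous].
Qed.

Lemma C2_sqrt : C2 [set s | 0 < s] Num.sqrt (fun s => (2 * Num.sqrt s)^-1)
  (fun s => - (4 * Num.sqrt s ^+ 3)^-1).
Proof.
move=> s /= s0; have r0 : Num.sqrt s != 0 by rewrite gt_eqF// sqrtr_gt0.
have r20 : 2 * Num.sqrt s != 0 by rewrite mulf_neq0.
split; first exact: is_derive1_sqrt.
- have d0 := is_derive1_sqrt s0.
  have d1 : is_derive s 1 (fun y => 2 * Num.sqrt y) (2 * (2 * Num.sqrt s)^-1).
    have D : is_derive s 1 (fun y => 2 * Num.sqrt y) _ := is_deriveZ 2 d0.
    by refine (@is_derive_eq _ _ _ _ _ _ _ _ D _).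
  refine (@is_derive_eq _ _ _ _ _ _ _ _ (is_deriveV (f := fun y => 2 * Num.sqrt y) r20 d1) _); rewrite /GRing.scale/=.
  by field.
have cs : {for s, continuous (Num.sqrt : R -> R)} by exact: sqrt_continuous.
apply: cvgN; apply: cvgV; first by rewrite mulf_neq0// expf_neq0.
apply: cvgM; first exact: cvg_cst.
rewrite exprS expr2; under eq_fun do rewrite exprS expr2.
by apply: cvgM => //; exact: cvgM.
Qed.

Lemma C2_open_halflineP (V : R -> R) : C2_open_halfline V ->
  C2 [set s | 0 < s] V V^`() (V^`()^`()).
Proof.
move=> H s s0; have [d1 d2 c2] := H s s0; split; last exact: c2.
  by split; [exact: d1|rewrite derive1E].
by split; [exact: d2|rewrite [RHS]derive1E].
Qed.

End QuadraticError.

Section Truncation.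
Variables (R : realType) (M : R).
Hypothesis M0 : 0 < M.

(** A concave C^2 function, tangent to the identity at 0 and constantly M / 3 from v = M on. The
    functions [trunc1] and [trunc2] are its derivatives. *)
Definition trunc (v : R) : R := M / 3 * (1 - pos (1 - v / M) ^+ 3).
Definition trunc1 (v : R) : R := pos (1 - v / M) ^+ 2.
Definition trunc2 (v : R) : R := - (2 / M * pos (1 - v / M)).

Lemma C2_trunc : C2 setT trunc trunc1 trunc2.
Proof.
have c1 := C2_comp (@C2_cube R) (@C2_affine R (- M^-1) 1) (fun _ _ => I).
have := C2_comp (@C2_affine R (- (M / 3)) (M / 3)) c1 (fun _ _ => I).
have Mn : M != 0 by rewrite gt_eqF.
have E v : - M^-1 * v + 1 = 1 - v / M by rewrite mulNr addrC mulrC.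
apply: C2_ext => v; rewrite E /trunc/trunc1/trunc2; move: (pos _) => p; by field.
Qed.

Lemma trunc_ge0 v : 0 <= v -> 0 <= trunc v.
Proof.
move=> v0; apply: mulr_ge0; first by rewrite divr_ge0// ltW.
have vM : 0 <= v / M by rewrite divr_ge0// ltW.
rewrite subr_ge0 exprn_ile1 ?pos_ge0// /pos ge_max ler01/=; lra.
Qed.

Lemma trunc_tangent v w : trunc w <= trunc v + trunc1 v * (w - v).
Proof.
have := cube_pos_convex (1 - v / M) (1 - w / M).
rewrite /trunc /trunc1; move: (pos (1 - v / M)) (pos (1 - w / M)) => p q H.
have Mn : M != 0 by rewrite gt_eqF.
rewrite -subr_ge0 (_ : _ - _ = M / 3 * (q ^+ 3 - (p ^+ 3 + 3 * p ^+ 2 * (1 - w / M - (1 - v / M))))).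
  apply: mulr_ge0; first by rewrite divr_ge0// ltW.
  by rewrite subr_ge0.
by field.
Qed.

Lemma trunc1_ge0 v : 0 <= trunc1 v. Proof. exact: sqr_ge0. Qed.

Lemma trunc2_le0 v : trunc2 v <= 0.
Proof. by rewrite /trunc2 oppr_le0 mulr_ge0 ?pos_ge0// divr_ge0// ltW. Qed.

Lemma trunc00 : trunc 0 = 0.
Proof. by rewrite /trunc mul0r subr0 ge0_pos// expr1n subrr mulr0. Qed.

Lemma trunc_le v : trunc v <= v.
Proof.
have := trunc_tangent 0 v; rewrite trunc00 add0r subr0 /trunc1 mul0r subr0 ge0_pos//.
by rewrite expr1n mul1r.
Qed.

(** The tangent at v lies above the value 0 taken at 0. Together with [trunc1_le1] this bounds
    trunc1 v (1 + v) by 1 + trunc v, the exchange needed in the generator inequality. *)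
Lemma trunc1_le v : v * trunc1 v <= trunc v.
Proof. by have := trunc_tangent v 0; rewrite trunc00 sub0r; move: (trunc v) (trunc1 v) => a b; lra. Qed.

Lemma trunc1_le1 v : 0 <= v -> trunc1 v <= 1.
Proof.
move=> v0; have vM : 0 <= v / M by rewrite divr_ge0// ltW.
by rewrite /trunc1 exprn_ile1 ?pos_ge0// /pos ge_max ler01/=; lra.
Qed.

Lemma trunc_big v : M <= v -> [/\ trunc v = M / 3, trunc1 v = 0 & trunc2 v = 0].
Proof.
move=> Mv; have p0 : pos (1 - v / M) = 0 by apply: le0_pos; rewrite subr_le0 ler_pdivlMr// mul1r.
by rewrite /trunc /trunc1 /trunc2 p0 !expr0n/= subr0 !mulr1 mulr0 oppr0.
Qed.

End Truncation.

Section Cutoff.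
Variables (R : realType) (R0 : R).
Hypothesis R00 : 0 < R0.

Let u (s : R) : R := (s - 3 * R0) / R0.
(** A C^2 transition while s runs from 3 R0 to 4 R0: the inner cube flattens the departure from 1,
    the outer cube the arrival at 0. *)
Definition cut (s : R) : R := pos (1 - pos (u s) ^+ 3) ^+ 3.
Definition cut1 (s : R) : R := - (9 * pos (1 - pos (u s) ^+ 3) ^+ 2 * pos (u s) ^+ 2 / R0).
Definition cut2 (s : R) : R := 54 * pos (1 - pos (u s) ^+ 3) * (pos (u s) ^+ 2 / R0) ^+ 2
  - 18 * pos (1 - pos (u s) ^+ 3) ^+ 2 * pos (u s) / R0 ^+ 2.

Lemma C2_cut : C2 setT cut cut1 cut2.
Proof.
have Rn : R0 != 0 by rewrite gt_eqF.
have c1 := C2_comp (@C2_cube R) (@C2_affine R R0^-1 (- 3)) (fun _ _ => I).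
have c2 := C2_comp (@C2_affine R (- 1) 1) c1 (fun _ _ => I).
have := C2_comp (@C2_cube R) c2 (fun _ _ => I).
have E s : R0^-1 * s + - 3 = u s by rewrite /u; field.
have E2 p : - 1 * p + 1 = 1 - p :> R by rewrite mulN1r addrC.
apply: C2_ext => s; rewrite !E ?E2 /cut/cut1/cut2.
- by [].
- by move: (pos (1 - pos (u s) ^+ 3)) (pos (u s)) => q p; field.
- by move: (pos (1 - pos (u s) ^+ 3)) (pos (u s)) => q p; field.
Qed.

Lemma cut01 s : 0 <= cut s <= 1.
Proof.
rewrite exprn_ge0 ?pos_ge0//= exprn_ile1 ?pos_ge0// /pos ge_max ler01/= gerBl.
by rewrite exprn_ge0// le_max lexx.
Qed.

Lemma cut_in s : s <= 3 * R0 -> [/\ cut s = 1, cut1 s = 0 & cut2 s = 0].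
Proof.
move=> s3; have p0 : pos (u s) = 0 by apply: le0_pos; rewrite /u ler_pdivrMr// mul0r subr_le0.
have p1 : pos (1 : R) = 1 by exact: ge0_pos.
rewrite /cut /cut1 /cut2 p0; split.
- by rewrite expr0n/= subr0 p1 expr1n.
- by rewrite [0 ^+ 2]expr0n/= mulr0 mul0r oppr0.
- by rewrite [_ * 0]mulr0 [0 / _ ^+ 2]mul0r subr0 [0 ^+ 2]expr0n/= [0 / _]mul0r [0 ^+ 2]expr0n/= mulr0.
Qed.

Lemma cut_out s : 4 * R0 <= s -> [/\ cut s = 0, cut1 s = 0 & cut2 s = 0].
Proof.
move=> s3; have p0 : pos (1 - pos (u s) ^+ 3) = 0.
  apply: le0_pos; rewrite subr_le0 exprn_ege1//; apply: le_trans (pos_le _).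
  by rewrite /u ler_pdivlMr// mul1r; lra.
rewrite /cut /cut1 /cut2 p0; split.
- by rewrite expr0n.
- by rewrite expr0n/= mulr0 !mul0r oppr0.
- by rewrite [0 ^+ 2]expr0n/= !mulr0 !mul0r subr0.
Qed.

End Cutoff.

(** * The test profile as a function of the squared norm *)

Section RadialProfile.
Variables (R : realType) (V V1 V2 : R -> R) (M R0 e2 e3 : R).
Hypotheses (CV : C2 [set r | 0 < r] V V1 V2) (M0 : 0 < M) (R00 : 0 < R0).
Hypotheses (e20 : 0 < e2) (e23 : e2 < e3) (e3R : e3 <= 3 * R0).
Hypothesis V_ge0 : forall r, 0 < r -> 0 < V r.
Hypothesis V_big : forall r, 0 < r -> r ^+ 2 <= e3 -> M <= V r.

Definition rV (s : R) : R := V (Num.sqrt s).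
Definition rV1 (s : R) : R := V1 (Num.sqrt s) * (2 * Num.sqrt s)^-1.
Definition rV2 (s : R) : R := V2 (Num.sqrt s) * (2 * Num.sqrt s)^-1 ^+ 2 + V1 (Num.sqrt s) * - (4 * Num.sqrt s ^+ 3)^-1.

Let f (s : R) : R := trunc M (rV s).
Let f1 (s : R) : R := trunc1 M (rV s) * rV1 s.
Let f2 (s : R) : R := trunc2 M (rV s) * rV1 s ^+ 2 + trunc1 M (rV s) * rV2 s.
Let k (s : R) : R := 1 + f s * cut R0 s.
Let k1 (s : R) : R := f1 s * cut R0 s + f s * cut1 R0 s.
Let k2 (s : R) : R := f2 s * cut R0 s + 2 * (f1 s * cut1 R0 s) + f s * cut2 R0 s.

(** [V] carries no information at 0, so up to [e2] the constant 1 + M / 3 is put in. On ]0, e3] the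
    formula [k] already takes this value, and the overlap ]e2, e3[ makes the gluing C^2. The added 1
    matches psi(v) <= psi(1) (1 + v) and keeps the profile at least 1. *)
Definition profile (s : R) : R := if s <= e2 then 1 + M / 3 else k s.
Definition profile1 (s : R) : R := if s <= e2 then 0 else k1 s.
Definition profile2 (s : R) : R := if s <= e2 then 0 else k2 s.

Let Ck : C2 [set s | 0 < s] k k1 k2.
Proof.
have c1 : C2 [set s | 0 < s] rV rV1 rV2.
  by apply: (C2_comp CV (@C2_sqrt R)) => s /=; rewrite sqrtr_gt0.
have c2 : C2 [set s | 0 < s] f f1 f2 by apply: (C2_comp (C2_trunc M0) c1).
have c3 : C2 [set s | 0 < s] (cut R0) (cut1 R0) (cut2 R0) by move=> s _; exact: C2_cut.
have c4 := C2_mul c2 c3.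
have := C2_comp (@C2_affine R 1 1) c4 (fun _ _ => I).
by apply: C2_ext => s; rewrite ?mul1r ?mul0r ?add0r// addrC.
Qed.

Let k_small s : 0 < s -> s <= e3 -> [/\ k s = 1 + M / 3, k1 s = 0 & k2 s = 0].
Proof.
move=> s0 se; have [c0 c1 c2] := cut_in R00 (le_trans se e3R).
have [t0 t1 t2] : [/\ trunc M (rV s) = M / 3, trunc1 M (rV s) = 0 & trunc2 M (rV s) = 0].
  by apply: trunc_big => //; apply: V_big; rewrite ?sqrtr_gt0// sqr_sqrtr// ltW.
by rewrite /k /k1 /k2 /f /f1 /f2 c0 c1 c2 t0 t1 t2 !mul0r !mulr0 !mulr1 !addr0.
Qed.

Lemma C2_profile : C2 setT profile profile1 profile2.
Proof.
move=> s _; have [se|se] := ltP s e3.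
  have nearc (g : R -> R) (c : R) : (forall x, x < e3 -> g x = c) -> \near s, cst c s = g s.
    move=> H; near=> x; rewrite H//; near: x; exact: lt_nbhsl.
  have p0 x : x < e3 -> [/\ profile x = 1 + M / 3, profile1 x = 0 & profile2 x = 0].
    move=> xe; rewrite /profile /profile1 /profile2; case: (leP x e2) => // ex.
    by apply: k_small; [exact: lt_trans ex|exact: ltW].
  have [_ E1 E2] := p0 s se; rewrite E1 E2.
  split.
  - apply: (near_eq_is_derive _ (is_derive_cst (1 + M / 3) s 1)).
    by apply: nearc => x /p0[].
  - apply: (near_eq_is_derive _ (is_derive_cst 0 s 1)).
    by apply: nearc => x /p0[].
  rewrite /prop_for /continuous_at E2.
  apply/cvgrPdist_le => e e0; near=> x; have [|_ _ ->] := p0 x.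
    by near: x; exact: lt_nbhsl.
  by rewrite subrr normr0 ltW.
have s2 : e2 < s by exact: lt_le_trans se.
have s0 : 0 < s by exact: lt_trans s2.
have nearc (g g' : R -> R) : (forall x, e2 < x -> g x = g' x) -> \near s, g s = g' s.
  by move=> H; near=> x; rewrite H//; near: x; exact: lt_nbhsr.
have kE x : e2 < x -> [/\ k x = profile x, k1 x = profile1 x & k2 x = profile2 x].
  by move=> ex; rewrite /profile /profile1 /profile2 leNgt ex.
have [a1 a2 a3] := Ck s0; have [_ E1 E2] := kE s s2.
split.
- by apply: (near_eq_is_derive _ (_ : is_derive s 1 k _)); [apply: nearc => x /kE[]|rewrite -E1].
- by apply: (near_eq_is_derive _ (_ : is_derive s 1 k1 _)); [apply: nearc => x /kE[]|rewrite -E2].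
rewrite /prop_for /continuous_at -E2; move/cvgrPdist_le: a3 => a3.
apply/cvgrPdist_le => e e0; near=> x; have [|_ _ <-] := kE x.
  by near: x; exact: lt_nbhsr.
by near: x; exact: a3.
Unshelve. all: by end_near. Qed.

Lemma profile_far s : Num.max e3 (4 * R0) <= s -> [/\ profile s = 1, profile1 s = 0 & profile2 s = 0].
Proof.
rewrite ge_max => /andP[s3 s4]; have s2 : e2 < s by exact: lt_le_trans s3.
have [c0 c1 c2] := cut_out R00 s4.
by rewrite /profile /profile1 /profile2 leNgt s2/= /k /k1 /k2 c0 c1 c2 !mulr0 !addr0.
Qed.

Lemma profile_near s : 0 < s -> s <= 3 * R0 -> [/\ profile s = 1 + trunc M (rV s),
  profile1 s = trunc1 M (rV s) * rV1 s &
  profile2 s = trunc2 M (rV s) * rV1 s ^+ 2 + trunc1 M (rV s) * rV2 s].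
Proof.
move=> s0 s3; have [c0 c1 c2] := cut_in R00 s3.
have kE : [/\ k s = 1 + f s, k1 s = f1 s & k2 s = f2 s].
  by rewrite /k /k1 /k2 c0 c1 c2 !mulr0 !mulr1 !addr0.
rewrite /profile /profile1 /profile2; have [se|_] := leP s e2; last exact: kE.
have [K0 K1 K2] := kE; have [L0 L1 L2] := k_small s0 (le_trans se (ltW e23)).
by split; [exact: etrans (esym L0) K0|exact: etrans (esym L1) K1|exact: etrans (esym L2) K2].
Qed.

Lemma profile_le s : 0 < s -> 1 <= profile s <= 1 + trunc M (rV s).
Proof.
move=> s0; have t0 : 0 <= trunc M (rV s) by apply: trunc_ge0 => //; apply/ltW/V_ge0; rewrite sqrtr_gt0.
rewrite /profile; have [se|_] := leP s e2.
  have [kE _ _] := k_small s0 (le_trans se (ltW e23)); rewrite -kE /k.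
  have [-> _ _] := cut_in R00 (le_trans (le_trans se (ltW e23)) e3R).
  by rewrite mulr1 lexx lerDl t0.
have /andP[c0 c1] := cut01 R0 s; rewrite /k lerDl mulr_ge0//= lerD2l.
by rewrite ler_piMr.
Qed.

Lemma profile_small s : s <= e2 -> profile s = 1 + M / 3.
Proof. by rewrite /profile => ->. Qed.

Lemma profile_ge1 s : 1 <= profile s.
Proof.
have [s0|s0] := ltP 0 s; first by have /andP[] := profile_le s0.
by rewrite profile_small ?(le_trans s0 (ltW e20))// lerDl divr_ge0// ltW.
Qed.

End RadialProfile.

(** No integrability is assumed: positive and negative parts are compared separately, and the
    inequality holds between extended values. *)
Lemma ae_le_integral_any (R : realType) dS (S : measurableType dS) (mu : {measure set S -> \bar R})
    (f g : S -> \bar R) : measurable_fun setT f -> measurable_fun setT g ->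
  {ae mu, forall x, (f x <= g x)%E} -> (\int[mu]_x f x <= \int[mu]_x g x)%E.
Proof.
move=> mf mg fg; rewrite (integralE _ _ f) (integralE _ _ g); apply: leeB.
  apply: ae_ge0_le_integral => //; [exact: measurable_funepos|exact: measurable_funepos|].
  apply: filterS fg => x fx _; rewrite !funeposE; exact: le_max2.
apply: ae_ge0_le_integral => //; [exact: measurable_funeneg|exact: measurable_funeneg|].
by apply: filterS fg => x fx _; rewrite !funenegE; apply: le_max2 => //; rewrite leeN2.
Qed.

(** Up to 1 by monotonicity; beyond 1 because the chord from 0 to v lies below the graph at 1. *)
Lemma concave0_linear (R : realType) (psi : R -> R) : nondecreasing0 psi -> concave0 psi ->
  psi 0 = 0 -> 0 <= psi 1 -> forall v, 0 <= v -> psi v <= psi 1 * (1 + v).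
Proof.
move=> nd cc p0 p1 v v0; have [v1|v1] := leP v 1.
  apply: (@le_trans _ _ (psi 1)); first exact: nd.
  by rewrite ler_peMr// lerDl.
have vp : 0 < v by exact: lt_trans v1.
have vi : v^-1 <= 1 by rewrite invf_le1// ltW.
have vi0 : 0 <= v^-1 by rewrite invr_ge0 ltW.
have := cc (Itv01 vi0 vi) v 0.
rewrite !inE/= !in_itv/= !andbT (ltW vp) lexx => /(_ isT isT).
move=> H0; have : - psi (v^-1 * v + (1 - v^-1) * 0) <= v^-1 * (- psi v) + (1 - v^-1) * (- psi 0) := H0.
rewrite p0 mulr0 addr0 oppr0 mulr0 addr0 mulVf ?gt_eqF// mulrN lerN2 => H.
have : psi v <= psi 1 * v by rewrite -ler_pdivrMr// mulrC.
by move=> /le_trans; apply; rewrite mulrDr mulr1 lerDr.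
Qed.

(** * From the Lyapunov condition to the generator of the test profile *)

Section GeneratorBound.
Context (R : realType) (dU : measure_display) (U : measurableType dU).
Variables (nu : {sigma_finite_measure set U -> \bar R}) (d : nat).
Variables (V V1 V2 : R -> R) (M R0 e2 e3 : R).
Hypotheses (CV : C2 [set r | 0 < r] V V1 V2) (M0 : 0 < M) (R00 : 0 < R0).
Hypotheses (e20 : 0 < e2) (e23 : e2 < e3) (e3R : e3 <= 3 * R0).
Hypothesis V_gt0 : forall r, 0 < r -> 0 < V r.
Hypothesis V_big : forall r, 0 < r -> r ^+ 2 <= e3 -> M <= V r.

Let h := profile V M R0 e2.
Let h1 := profile1 V V1 M R0 e2.
Let h2 := profile2 V V1 V2 M R0 e2.

Let Ch : C2 setT h h1 h2.
Proof. exact: C2_profile CV M0 R00 e20 e23 e3R V_big. Qed.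

Lemma profile_test : exists C0, test_function d h h1 h2 C0.
Proof.
have hd (s : R) : is_derive s 1 h (h1 s) by have [] := @Ch s I.
have h1d (s : R) : is_derive s 1 h1 (h2 s) by have [] := @Ch s I.
have h2c : continuous h2 by move=> s; have [] := @Ch s I.
pose B := Num.max e3 (4 * R0).
have B0 : 0 < B by rewrite lt_max (lt_trans e20 e23).
have hB s : B <= s -> [/\ h s = 1, h1 s = 0 & h2 s = 0] by exact: (profile_far V V1 V2 M R00 e23).
have [C C1 [c1 c2 c3]] := test_bounds d hd h1d h2c B0 hB.
have [C' C'1 [c4 c5 c6]] := test_lip d hd h1d h2c B0 hB.
have mono (x a b : R) : 0 <= x -> a <= b -> a * x <= b * x by move=> x0 ab; rewrite ler_wpM2r.
have CC : C <= C + C' by lra.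
have CC' : C' <= C + C' by lra.
exists (C + C'); split=> //.
- exact: continuous_h hd.
- exact: continuous_h1 h1d.
- lra.
- by move=> y; apply: le_trans (c1 y) _.
- by move=> y z; apply: le_trans (c2 y z) _; apply: mono; rewrite ?frob_ge0.
- by move=> y z z'; apply: le_trans (c3 y z z') _; apply: mono; rewrite ?mulr_ge0 ?frob_ge0.
- by move=> y z; apply: le_trans (c4 y z) _; apply: mono; rewrite ?frob_ge0.
- by move=> y z; apply: le_trans (c5 y z) _; apply: mono; rewrite ?sqr_ge0.
- by move=> y z z'; apply: le_trans (c6 y z z') _; apply: mono; rewrite ?mulr_ge0 ?addr_ge0 ?frob_ge0.
- exact: test_taylor hd h1d h2c B0 hB.
- by move=> s; apply: le_trans (profile_ge1 V1 V2 M0 R00 e20 e23 e3R V_gt0 V_big s); exact: ler01.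
Qed.

(** [V] is arbitrary outside the positive half-line, so measurability is stated for the version that
    is constant there. *)
Let mV : measurable_fun setT (fun r : R => if 0 < r then V r else V 0).
Proof.
apply: measurable_fun_if => //.
- by apply: measurable_fun_ltr; [exact: measurable_cst|exact: measurable_id].
- rewrite setTI (_ : _ @^-1` _ = `]0, +oo[%classic); last first.
    by apply/seteqP; split=> x /=; rewrite in_itv/= andbT.
  apply: open_continuous_measurable_fun; first exact: interval_open.
  move=> x; rewrite inE/= in_itv/= andbT => x0.
  by have [dV _ _] := CV x0; exact: is_derive_continuous dV.
Qed.

Variables (y b : 'cV[R]_d) (S : 'M[R]_d) (C : U -> 'cV[R]_d) (K : R).
Let r := frob y.
Hypotheses (r0 : 0 < r) (yR : dotv y y <= 3 * R0) (sqC : sq_integrable nu C) (K0 : 0 <= K).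
Hypothesis noncollision : {ae nu, forall u, y + C u != 0}.

Let G u := V (frob (y + C u)) - V r - V1 r / r * dotv y (C u).

Hypothesis lyapunov : ((1 / 2 * (V2 r - V1 r / r) * (frob (S^T *m y) ^+ 2 / r ^+ 2)
    + V1 r / (2 * r) * (2 * dotv y b + frob S ^+ 2))%:E + \int[nu]_u (G u)%:E <= (K * (1 + V r))%:E)%E.

Let s := dotv y y.
Let sr : Num.sqrt s = r. Proof. by rewrite /s -frob_dotv sqrtr_sqr ger0_norm ?frob_ge0. Qed.
Let s0 : 0 < s. Proof. by rewrite -sqrtr_gt0 sr. Qed.
Let p := trunc1 M (V r).
Let p0 : 0 <= p. Proof. exact: trunc1_ge0. Qed.

Let hs : [/\ h s = 1 + trunc M (V r), h1 s = p * (V1 r / (2 * r)) &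
  h2 s = trunc2 M (V r) * (V1 r / (2 * r)) ^+ 2 + p * (V2 r / (4 * r ^+ 2) - V1 r / (4 * r ^+ 3))].
Proof.
have [H0 H1 H2] := profile_near V1 V2 M0 R00 e23 e3R V_big s0 yR.
rewrite /h /h1 /h2 H0 H1 H2 /rV /rV1 /rV2 sr; split=> //; congr (_ + _ * _).
have rn : r != 0 by rewrite gt_eqF.
by move: rn; move: r (V1 _) (V2 _) => x a c rn; field.
Qed.

(** The tangent inequality of the truncation, combined with profile <= 1 + trunc V at the point y +
    C u. That comparison requires the point to be nonzero, which is what [noncollision] provides. *)
Let tT_le_G : {ae nu, forall u, tT h h1 y (C u) <= p * G u}.
Proof.
apply: filterS noncollision => u yu; have [H0 H1 _] := hs.
have z0 : 0 < dotv (y + C u) (y + C u).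
  rewrite lt_neqAle dotv_ge0 andbT eq_sym; apply: contra_neq yu; exact: dotv_sqr_eq0.
have /andP[_] := profile_le V1 V2 M0 R00 e23 e3R V_gt0 V_big z0.
rewrite -/h /rV -frob_dotv sqrtr_sqr ger0_norm ?frob_ge0// frob_dotv => H2.
have := trunc_tangent M0 (V r) (V (frob (y + C u))); rewrite -/p => H3.
rewrite /tT /tf /tg -/s H0 H1 /G.
have rn : r != 0 by rewrite gt_eqF.
rewrite (_ : 2 * (p * (V1 r / (2 * r))) * dotv y (C u) = p * (V1 r / r * dotv y (C u))); last first.
  by move: rn; move: r (V1 _) (dotv _ _) => x a c rn; field.
move: H2 H3; rewrite !mulrBr; move: (h _) (trunc M (V (frob _))) (trunc M (V r)) (p * _) (p * V r) (p * (_ * _)) => a1 a2 a3 a4 a5 a6.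
by move=> H2 H3; lra.
Qed.

Let mG : measurable_fun setT G.
Proof.
have [mC _] := sqC.
have my : mvec (fun u : U => y) by move=> i; exact: measurable_cst.
apply: measurable_funB; last by apply: measurable_funM => //; exact: measurable_dotv.
apply: measurable_funB => //.
have mf : measurable_fun setT (fun u => frob (y + C u)) by apply: measurable_frob; exact: mvecD.
rewrite (_ : (fun u => _) = fun u => (fun r => if 0 < r then V r else V 0) (frob (y + C u))).
  exact: (measurableT_comp mV mf).
apply/funext => u /=; have := frob_ge0 (y + C u); rewrite le_eqVlt => /orP[/eqP <-|->//].
by rewrite ltxx.
Qed.

(** Chain rule for the truncation: the term with its second derivative is nonpositive and dropped,
    the first derivative [p] multiplies the Lyapunov inequality, and p (1 + V) <= 1 + trunc V. *)
Lemma generator_le : gen nu h h1 h2 y b (fun j => col j S) C <= K * tf h y.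
Proof.
have [C0 test] := profile_test; have [mC iC] := sqC.
have [iT _] := gen_le (test_hc test) (test_h1c test) (test_C01 test) (test_tg_le test) (test_tD_le test)
  (test_tT_le test) y b (fun j => col j S) mC iC.
have [H0 H1 H2] := hs.
have SA : \sum_j dotv (col j S) (col j S) = frob S ^+ 2.
  rewrite frob_sqr exchange_big; apply: eq_bigr => j _; apply: eq_bigr => i _.
  by rewrite !mxE expr2.
have SB : \sum_j dotv y (col j S) ^+ 2 = frob (S^T *m y) ^+ 2.
  rewrite frob_sqr; apply: eq_bigr => j _; rewrite big_ord1 mxE; congr (_ ^+ 2).
  by apply: eq_bigr => i _; rewrite !mxE mulrC.
have LY := lyapunov; set a := 1 / 2 * _ * _ + _ in LY.
have genE : gen nu h h1 h2 y b (fun j => col j S) C <= p * a + \int[nu]_u tT h h1 y (C u).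
  rewrite /gen lerD2r /tg /tD.
  rewrite (_ : \sum_j _ = 2 * h1 s * frob S ^+ 2 + 4 * h2 s * frob (S^T *m y) ^+ 2); last first.
    rewrite -SA -SB !mulr_sumr -big_split/=; apply: eq_bigr => j _.
    by rewrite -/s; move: (dotv y (col j S)) (dotv (col j S) _) (h1 s) (h2 s) => *; ring.
  rewrite -/s H1 H2 /a.
  have t2 : trunc2 M (V r) * ((V1 r / (2 * r)) ^+ 2 * frob (S^T *m y) ^+ 2) <= 0.
    by rewrite mulr_le0_ge0 ?trunc2_le0// mulr_ge0 ?sqr_ge0.
  have rn : r != 0 by rewrite gt_eqF.
  rewrite -subr_ge0 [X in 0 <= X](_ : _ = - (2 * (trunc2 M (V r) * ((V1 r / (2 * r)) ^+ 2 * frob (S^T *m y) ^+ 2)))).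
    by move: t2; lra.
  move: rn; move: r p (dotv y b) (frob S ^+ 2) (frob (S^T *m y) ^+ 2) (trunc2 _ _) (V1 r) (V2 r) => x q D A B t v1 v2 xn.
  by field.
apply: le_trans genE _.
have iT' : (\int[nu]_u (tT h h1 y (C u))%:E)%E \is a fin_num by exact: integrable_fin_num.
have mT : measurable_fun setT (fun u => tT h h1 y (C u)).
  by have /integrableP[/measurable_EFinP] := iT.
have Vr : 0 <= V r by apply: ltW; exact: V_gt0.
have fE : K * tf h y = K * (1 + trunc M (V r)) by rewrite /tf -/s H0.
(* The case p = 0 is separate because the integral of [G] need not be finite, so it cannot simply be
   multiplied by p; the remainder is then nonpositive by itself. *)
have [p00|pn] := eqVneq p 0.
  have : (\int[nu]_u (tT h h1 y (C u))%:E <= \int[nu]_u cst 0%:E u)%E.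
    apply: ae_le_integral_any => //; first exact/measurable_EFinP.
    by apply: filterS tT_le_G => u; rewrite p00 mul0r lee_fin.
  rewrite integral0 -(fineK iT') lee_fin => I0.
  rewrite p00 mul0r add0r; apply: le_trans I0 _; rewrite fE mulr_ge0// addr_ge0//.
  exact: trunc_ge0.
have pp : 0 < p by rewrite lt_neqAle eq_sym pn p0.
have I1 : ((p^-1 * \int[nu]_u tT h h1 y (C u))%:E <= \int[nu]_u (G u)%:E)%E.
  rewrite EFinM /Rintegral fineK// -integralZl//.
  apply: ae_le_integral_any.
  - by apply: measurable_funeM; exact/measurable_EFinP.
  - exact/measurable_EFinP.
  apply: filterS tT_le_G => u H; rewrite -EFinM lee_fin.
  by rewrite ler_pdivrMl.
have : ((a + p^-1 * \int[nu]_u tT h h1 y (C u))%:E <= (K * (1 + V r))%:E)%E.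
  by rewrite EFinD; apply: le_trans LY; rewrite leeD2l.
rewrite lee_fin -(ler_pM2l pp) mulrDr mulVKf// => H.
apply: le_trans H _; rewrite fE mulrCA ler_wpM2l// mulrDr mulr1; apply: lerD.
  by apply: trunc1_le1.
by rewrite mulrC; exact: trunc1_le.
Qed.

End GeneratorBound.

(** * Two solutions driven by the same noise *)

Section RegularizedPath.
Context (R : realType) (dT : measure_display) (T : measurableType dT).
Variables (P : probability T R) (F : R -> set (set T)).
Context (dU : measure_display) (U : measurableType dU).
Variables (nu : {sigma_finite_measure set U -> \bar R}) (d : nat).
Variables (W : R -> T -> Borel 'cV[R]_d)
          (N : T -> {measure set (R * U) -> \bar R}).
Hypothesis noise : driving_noise P F nu W N.

Lemma augmented_sub t : 0 <= t -> augmented_natural_filtration P W N t `<=` F t.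
Proof.
move=> t0; have [[filt mono] [_ negl _] [adW _ _ _] [_ _ _ adN _] _] := noise.
apply: sub_gen; first by have [] := filt t t0.
move=> A [[nA|]|].
- by apply: (mono 0 t) => //; exact: negl.
- move=> [s /=]; rewrite in_itv/= => /andP[s0 st] sA.
  by apply: (mono s t) => //; apply: (adW s s0); exists s.
- by move=> H; exact: adN.
Qed.

Lemma adapted_Fm (X : R -> T -> Borel 'cV[R]_d) t :
  adapted (augmented_natural_filtration P W N) X -> 0 <= t -> Fm F t (X t).
Proof.
move=> adX t0; apply/(FmP noise) => // B mB; apply: augmented_sub => //.
by apply: (adX t t0); exists t => //; exists B => //; rewrite setTI.
Qed.

Variables (X : R -> T -> Borel 'cV[R]_d) (B0 : set T).
Hypothesis FX : forall t, 0 <= t -> Fm F t (X t).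
Hypothesis FB0 : F 0 B0.
Hypothesis nB0 : P B0 = 0%E.
Hypothesis cad : forall w, ~ B0 w -> @cadlag R 'cV[R]_d (X^~ w).

(** Every path becomes right-continuous with left limits on the whole line: 0 on the exceptional
    null set, constant before time 0. Adaptedness survives because the exceptional set belongs to
    [F 0]. *)
Definition regular (t : R) (w : T) : 'cV[R]_d := if w \in B0 then 0 else X (Num.max 0 t) w.

Let mB0 : measurable B0.
Proof. by apply: (F_meas noise (lexx 0)). Qed.

Lemma regular_good t w : 0 <= t -> ~ B0 w -> regular t w = X t w.
Proof. by move=> t0 nB; rewrite /regular (memNset nB) (max_idPr t0). Qed.

Lemma regular_ae : {ae P, forall w, ~ B0 w}.
Proof. by exists B0; split => // w /= /contrapT. Qed.

Lemma regular_Fm t : 0 <= t -> Fm F t (regular t : T -> Borel 'cV[R]_d).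
Proof.
move=> t0; have [[filt mono] _ _ _ _] := noise.
have FB : F t B0 by exact: (mono 0 t).
have sF : @measurable _ (sigT_of (F t)) B0.
  by rewrite /measurable/= sigma_algebra_id//; exact: F_sigma noise _ t0.
rewrite /regular (max_idPr t0); apply: measurable_fun_if => //.
- apply: (@measurable_fun_bool _ _ _ _ true); rewrite setTI.
  by rewrite (_ : _ @^-1` _ = B0)//; apply/seteqP; split=> w /=; [exact: set_mem|exact: mem_set].
- exact: measurable_funTS (FX t0).
Qed.

Lemma regular_meas t : measurable_fun setT (regular t : T -> Borel 'cV[R]_d).
Proof.
have E : regular t = regular (Num.max 0 t).
  by apply/funext => w; rewrite /regular maxA maxxx.
rewrite E; have t0 : 0 <= Num.max 0 t by rewrite le_max lexx.
exact: (Fm_measurable noise t0 (regular_Fm t0)).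
Qed.

Lemma regular_right w t : regular s w @[s --> t^'+] --> regular t w.
Proof.
rewrite /regular; case: (boolP (w \in B0)) => wB; first exact: cvg_cst.
have /cad[rc _] : ~ B0 w by move=> /mem_set; apply/negP.
have [t0|t0] := leP 0 t.
  apply: cvg_trans (rc t t0); apply: near_eq_cvg; near=> s.
  by rewrite (max_idPr _)//; apply: le_trans t0 _; apply: ltW; near: s; exact: nbhs_right_gt.
have c0 : (X 0 w : 'cV[R]_d) @[s --> t^'+] --> (X 0 w : 'cV[R]_d) by exact: cvg_cst.
apply: cvg_trans c0; apply: near_eq_cvg; near=> s.
by rewrite (max_idPl _)//; apply: ltW; near: s; exact: nbhs_right_lt.
Unshelve. all: by end_near. Qed.

Lemma regular_left w t : cvg (regular s w @[s --> t^'-]).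
Proof.
rewrite /regular; case: (boolP (w \in B0)) => wB; first exact: is_cvg_cst.
have /cad[_ lc] : ~ B0 w by move=> /mem_set; apply/negP.
have [t0|t0] := ltP 0 t.
  have /cvg_ex[l Hl] := lc t t0; apply/cvg_ex; exists l.
  apply: cvg_trans Hl; apply: near_eq_cvg; near=> s.
  by rewrite (max_idPr _)//; apply: ltW; near: s; exact: nbhs_left_gt.
apply/cvg_ex; exists (X 0 w : 'cV[R]_d).
have c0 : (X 0 w : 'cV[R]_d) @[s --> t^'-] --> (X 0 w : 'cV[R]_d) by exact: cvg_cst.
apply: cvg_trans c0; apply: near_eq_cvg; near=> s.
by rewrite (max_idPl _)//; apply: le_trans t0; apply: ltW; near: s; exact: nbhs_left_lt.
Unshelve. all: by end_near. Qed.

Lemma regular_rcll (g : 'cV[R]_d -> R) w : continuous g -> rcll (fun t => g (regular t w)).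
Proof.
move=> cg; split=> t; first exact: (cvg_comp _ _ (@regular_right w t) (@cg (regular t w))).
have /cvg_ex[l Hl] := regular_left (w := w) (t := t).
by apply/cvg_ex; exists (g l); exact: (cvg_comp _ _ Hl (@cg l)).
Qed.

Lemma regular_comp_Fm (g : 'cV[R]_d -> R) t : continuous g -> 0 <= t -> Fm F t (fun w => g (regular t w)).
Proof.
move=> cg t0; exact: (measurableT_comp (continuous_Borel cg) (regular_Fm t0)).
Qed.

Lemma regular_joint (g : 'cV[R]_d -> R) : continuous g ->
  measurable_fun setT (fun p : R * T => g (regular p.1 p.2)).
Proof.
move=> cg; apply: (@right_continuous_joint R _ _ (fun r w => g (regular r w))).
  by move=> r; exact: (measurableT_comp (continuous_Borel cg) (regular_meas r)).
by move=> w r; have [] := regular_rcll w cg.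
Qed.

Lemma regular_field (c : 'cV[R]_d -> U -> 'cV[R]_d) (i : 'I_d) :
  measurable_fun setT ((fun p => c p.1 p.2) : (Borel 'cV[R]_d * U)%type -> Borel 'cV[R]_d) ->
  (forall u, continuous (fun x => c x u)) ->
  measurable_fun setT (fun p : (R * T) * U => c (regular p.1.1 p.1.2) p.2 i 0).
Proof.
move=> mc cc.
have mj : measurable_fun setT (fun p : R * (T * U) => c (regular p.1 p.2.1) p.2.2 i 0).
  apply: (@right_continuous_joint R _ _ (fun r (q : T * U) => c (regular r q.1) q.2 i 0)).
    move=> r.
    have m1 : measurable_fun setT ((fun q : T * U => (regular r q.1, q.2)) : (T * U)%type -> (Borel 'cV[R]_d * U)%type).
      apply/measurable_fun_pairP; split => /=.
        exact: (measurableT_comp (regular_meas r) measurable_fst).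
      exact: measurable_snd.
    exact: (measurableT_comp (@coord_Borel R d 1 i 0) (measurableT_comp mc m1)).
  move=> q r; have H := cvg_comp _ _ (@regular_right q.1 r) (@cc q.2 (regular r q.1)).
  exact: (cvg_comp _ _ H (@coord_continuous _ _ _ i 0 (c (regular r q.1) q.2))).
apply: (measurableT_comp mj (f := fun p => c (regular p.1 p.2.1) p.2.2 i 0) (g := fun p : (R * T) * U => (p.1.1, (p.1.2, p.2)))).
apply/measurable_fun_pairP; split => /=; first exact: (measurableT_comp measurable_fst measurable_fst).
apply/measurable_fun_pairP; split => /=; last exact: measurable_snd.
exact: (measurableT_comp measurable_snd measurable_fst).
Qed.

(** The left limit differs from the value only where some coordinate jumps, and each coordinate has
    countably many jumps. *)
Lemma regular_left_lim w : ~ B0 w ->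
  countable [set s | 0 < s /\ @left_lim R 'cV[R]_d (X^~ w) s <> regular s w].
Proof.
move=> nB; apply: (@sub_countable _ _ _ (\bigcup_(i in [set: 'I_d])
    [set s | ~ (regular s' w i 0 @[s' --> s^'-] --> regular s w i 0)])); last first.
  apply: bigcup_countable => // i _; apply: rcll_left_continuous.
  by apply: (regular_rcll w (g := fun x => x i 0)); exact: coord_continuous.
apply: subset_card_le => s /= [s0]; apply: contra_notP => H.
apply/colP => i.
have [_ lc] := cad nB; have /cvg_ex[l Hl] := lc s s0.
have ll : @left_lim R 'cV[R]_d (X^~ w) s = l by apply: cvg_lim.
have c1 : regular s' w i 0 @[s' --> s^'-] --> l i 0.
  apply: (cvg_trans _ (cvg_comp _ _ Hl (@coord_continuous _ _ _ i 0 l))).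
  apply: near_eq_cvg; near=> s'.
  by rewrite /= regular_good//; apply: ltW; near: s'; exact: nbhs_left_gt.
have c2 : regular s' w i 0 @[s' --> s^'-] --> regular s w i 0.
  by apply: contrapT => H'; apply: H; exists i.
by rewrite ll; apply: (cvg_unique _ c1 c2).
Unshelve. all: by end_near. Qed.

(** The exceptional set is null and the time 0 is Lebesgue-negligible, so the approximating sequence
    of the original integrand serves for the regularized one. *)
Lemma regular_ito (g : 'cV[R]_d -> R) (W1 I : R -> T -> R) (T0 : R) : continuous g -> 0 < T0 ->
  is_ito_integral P F W1 (fun s w => g (X s w)) I -> exists Hn : nat -> simple_process F,
  pr0 P (fun n w => \int[lebesgue_measure]_(r in `]0%R, T0]) ((sp_val (Hn n) r w - g (regular r w)) ^+ 2)%:E)%E /\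
  forall t, 0 <= t -> pr0 P (fun n w => `|sp_integral (Hn n) W1 t w - I t w|%:E).
Proof.
move=> cg T00 [_ _ [Hn Hc]]; exists Hn; split; last first.
  by move=> t t0; have [_ /pr0_prob] := Hc t t0; apply.
have [/pr0_prob H _] := Hc T0 (ltW T00); apply: pr0_le H.
- move=> n; apply: (@measurable_time_integral _ _ _ _ (fun p : R * T => ((sp_val (Hn n) p.1 p.2 - g (regular p.1 p.2)) ^+ 2)%:E)).
    apply/measurable_EFinP; apply: (measurableT_comp (f := fun x : R => x ^+ 2)) => //; apply: measurable_funB.
      exact: measurable_sp_val noise _.
    exact: regular_joint.
  by move=> p; rewrite lee_fin sqr_ge0.
- by move=> n w; apply: integral_ge0 => r _; rewrite lee_fin sqr_ge0.
move=> n; apply: filterS regular_ae => w nB.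
rewrite gee0_abs; last by apply: integral_ge0 => r _; rewrite lee_fin sqr_ge0.
have mf : measurable_fun setT (fun r => ((sp_val (Hn n) r w - g (regular r w)) ^+ 2)%:E).
  apply/measurable_EFinP; apply: (measurableT_comp (f := fun x : R => x ^+ 2)) => //; apply: measurable_funB.
    exact: (measurableT_comp (measurable_sp_val noise (Hn n)) (measurable_pair2 w)).
  exact: (measurableT_comp (regular_joint cg) (measurable_pair2 w)).
rewrite integral_itv_obnd_cbnd; last exact: measurable_funTS.
rewrite le_eqVlt; apply/orP; left; apply/eqP; apply: eq_integral => r.
by rewrite inE/= in_itv/= => /andP[r0 _]; rewrite regular_good.
Qed.

Lemma measurable_off_countable dS (S : measurableType dS) (f g : R -> S) (C : set R) :
  countable C -> (forall r, ~ C r -> f r = g r) -> measurable_fun setT f -> measurable_fun setT g.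
Proof.
move=> cC fg mf _ B mB; rewrite setTI.
have mC (A : set R) : A `<=` C -> measurable A.
  move=> AC; apply: countable_measurable => //; apply: sub_countable cC; exact: subset_card_le.
rewrite (_ : g @^-1` B = ((f @^-1` B) `\` C) `|` (C `&` g @^-1` B)).
  apply: measurableU; last by apply: mC => r [].
  apply: measurableD; last exact: mC.
  by rewrite -[X in measurable X]setTI; exact: mf.
apply/seteqP; split=> r /=.
  by have [Cr|nCr] := pselect (C r); [right|left; rewrite fg].
by move=> [[fB nC]|[]//]; rewrite -fg.
Qed.

(** The integrand at the left limit is exchanged for the one at the current value: along a path they
    differ at countably many times only. The same fact yields the measurability in time of the
    original integrand. *)
Lemma regular_jump (c : 'cV[R]_d -> U -> 'cV[R]_d) (i : 'I_d) (J : R -> T -> R) (T0 : R) :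
  measurable_fun setT ((fun p => c p.1 p.2) : (Borel 'cV[R]_d * U)%type -> Borel 'cV[R]_d) ->
  (forall u, continuous (fun x => c x u)) -> 0 < T0 ->
  is_compensated_integral P F nu N (fun s w u => c (@left_lim R 'cV[R]_d (X^~ w) s) u i 0) J ->
  exists Gn : nat -> simple_field F nu,
  pr0 P (fun n w => \int[lebesgue_measure]_(r in `]0%R, T0])
    \int[nu]_u ((sf_val (Gn n) r w u - c (regular r w) u i 0) ^+ 2)%:E)%E /\
  forall t, 0 <= t -> pr0 P (fun n w => `|sf_integral (Gn n) N t w - J t w|%:E).
Proof.
move=> mc cc T00 [_ _ [Hn Hc]]; exists Hn; split; last first.
  by move=> t t0; have [_ /pr0_prob] := Hc t t0; apply.
have mj n : measurable_fun setT (fun p : (R * T) * U =>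
    ((sf_val (Hn n) p.1.1 p.1.2 p.2 - c (regular p.1.1 p.1.2) p.2 i 0) ^+ 2)%:E).
  apply/measurable_EFinP; apply: (measurableT_comp (f := fun x : R => x ^+ 2)) => //; apply: measurable_funB.
    exact: measurable_sf_val noise _.
  exact: regular_field.
pose f n (p : R * T) : \bar R := (\int[nu]_u ((sf_val (Hn n) p.1 p.2 u - c (regular p.1 p.2) u i 0) ^+ 2)%:E)%E.
have f0 n p : (0 <= f n p)%E by apply: integral_ge0 => u _; rewrite lee_fin sqr_ge0.
have mf n : measurable_fun setT (f n).
  have p0 (p : (R * T) * U) : (0 <= ((sf_val (Hn n) p.1.1 p.1.2 p.2 - c (regular p.1.1 p.1.2) p.2 i 0) ^+ 2)%:E)%E.
    by rewrite lee_fin sqr_ge0.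
  exact: (@measurable_ge0_param _ _ _ nu _ _ _ (mj n) p0).
have [/pr0_prob H _] := Hc T0 (ltW T00); apply: pr0_le H.
- by move=> n; exact: (measurable_time_integral T0 (mf n) (f0 n)).
- by move=> n w; apply: integral_ge0 => r _; apply: integral_ge0 => u _; rewrite lee_fin sqr_ge0.
move=> n; apply: filterS regular_ae => w nB.
have g0 s : (0 <= \int[nu]_u ((sf_val (Hn n) s w u - c (@left_lim R 'cV[R]_d (X^~ w) s) u i 0) ^+ 2)%:E)%E.
  by apply: integral_ge0 => u _; rewrite lee_fin sqr_ge0.
rewrite gee0_abs; last by apply: integral_ge0 => r _.
have mfw : measurable_fun setT (fun r => f n (r, w)).
  exact: (measurableT_comp (mf n) (measurable_pair2 w)).
have mg : measurable_fun (`]0%R, T0]%classic : set (measurableTypeR R)) (fun s => \int[nu]_u ((sf_val (Hn n) s w u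
    - c (@left_lim R 'cV[R]_d (X^~ w) s) u i 0) ^+ 2)%:E)%E.
  pose g s := if 0 < s then (\int[nu]_u ((sf_val (Hn n) s w u
    - c (@left_lim R 'cV[R]_d (X^~ w) s) u i 0) ^+ 2)%:E)%E else f n (s, w).
  apply: (eq_measurable_fun g).
    by move=> s; rewrite inE/= in_itv/= /g => /andP[-> _].
  apply: measurable_funTS; apply: (measurable_off_countable (regular_left_lim nB) _ mfw) => s /= H.
  rewrite /g; case: ltP => // s0; apply: eq_integral => u _; do 3 congr (_ _).
  by have [->//|] := pselect (@left_lim R 'cV[R]_d (X^~ w) s = regular s w); move=> H'; case: H.
rewrite -integral_itv_obnd_cbnd//; apply: ae_ge0_le_integral => //.
- by move=> r _; apply: integral_ge0 => u _; rewrite lee_fin sqr_ge0.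
- exact: measurable_funTS.
exists [set s | 0 < s /\ @left_lim R 'cV[R]_d (X^~ w) s <> regular s w]; split.
- by apply: countable_measurable => //; exact: regular_left_lim.
- by apply: countable_lebesgue_measure0; exact: regular_left_lim.
move=> s /= H; split.
  apply: contrapT => s0; apply: H; rewrite in_itv/= => /andP[/s0//].
move=> E; apply: H => _; by rewrite E.
Qed.

End RegularizedPath.

Lemma sqr_frobB (R : realType) d (x y : 'cV[R]_d) :
  frob (x - y) ^+ 2 <= 2 * frob x ^+ 2 + 2 * frob y ^+ 2.
Proof.
have := frobD x (- y); rewrite frobN; have := frob_ge0 (x - y).
move: (frob (x - y)) (frob x) (frob y) => a u v a0 auv.
apply: (@le_trans _ _ ((u + v) ^+ 2)); first by rewrite lerXn2r// nnegrE (le_trans a0).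
by rewrite -subr_ge0 (_ : _ - _ = (u - v) ^+ 2); [exact: sqr_ge0|ring].
Qed.

Section SignedSum.
Context (R : realType) (d : nat).

(** The two solutions are treated as one sum over pairs (solution, coordinate), with plus or minus a
    basis vector as direction; approximating sequences chosen separately for each scalar integral
    then fit into one process. *)
Definition signed_basis (a : bool * 'I_d) : 'cV[R]_d := (if a.1 then 1 else -1) *: delta_mx a.2 0.

Lemma signed_comb (v : bool -> 'cV[R]_d) :
  \sum_a v a.1 a.2 0 *: signed_basis a = v true - v false.
Proof.
have E (w : 'cV[R]_d) (s : R) : \sum_i w i 0 *: (s *: delta_mx i 0) = s *: w.
  apply/colP => k; rewrite summxE (bigD1 k)//= !mxE !eqxx big1 ?addr0 ?mulr1; first by rewrite mulrC.
  by move=> i ik; rewrite !mxE eq_sym (negbTE ik) !mulr0.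
rewrite -(pair_bigA _ (fun bo i => v bo i 0 *: signed_basis (bo, i)))/= big_bool/=.
by rewrite /signed_basis/= !E scale1r scaleN1r.
Qed.

End SignedSum.

(** * The gap between the two solutions *)

Section TwoSolutions.
Context (R : realType) (dT : measure_display) (T : measurableType dT).
Variables (P : probability T R) (F : R -> set (set T)).
Context (dU : measure_display) (U : measurableType dU).
Variables (nu : {sigma_finite_measure set U -> \bar R}) (d : nat).
Variables (W : R -> T -> Borel 'cV[R]_d)
          (N : T -> {measure set (R * U) -> \bar R}).
Hypothesis noise : driving_noise P F nu W N.
Variables (b : 'cV[R]_d -> 'cV[R]_d) (sigma : 'cV[R]_d -> 'M[R]_d) (c : 'cV[R]_d -> U -> 'cV[R]_d).
Hypothesis mc : measurable_fun setT
  ((fun p => c p.1 p.2) : (Borel 'cV[R]_d * U)%type -> Borel 'cV[R]_d).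
Hypotheses (cb : continuous b) (csigma : continuous sigma) (cc : forall u, continuous (fun x => c x u)).
Hypothesis c2_fin : forall x, (\int[nu]_u (frob (c x u) ^+ 2)%:E < +oo)%E.
Hypothesis c2_cont : continuous (fun x => (\int[nu]_u (frob (c x u) ^+ 2)%:E)%E).
Variables (xs : bool -> 'cV[R]_d) (Xs : bool -> R -> T -> Borel 'cV[R]_d)
  (Is : bool -> 'I_d -> 'I_d -> R -> T -> R) (Js : bool -> 'I_d -> R -> T -> R) (B0 : set T).
Hypothesis FX : forall o t, 0 <= t -> Fm F t (Xs o t).
Hypotheses (FB0 : F 0 B0) (nB0 : P B0 = 0%E).
Hypothesis cad : forall o w, ~ B0 w -> @cadlag R 'cV[R]_d ((Xs o)^~ w).
Hypothesis itoI : forall o i j, is_ito_integral P F (fun t w => W t w j 0)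
  (fun s w => sigma (Xs o s w) i j) (Is o i j).
Hypothesis jumpJ : forall o i, is_compensated_integral P F nu N
  (fun s w u => c (@left_lim R 'cV[R]_d ((Xs o)^~ w) s) u i 0) (Js o i).
Hypothesis sde : forall o w, ~ B0 w -> forall t : R, 0 <= t -> forall i,
  Xs o t w i 0 = xs o i 0 + \int[lebesgue_measure]_(s in `[0%R, t]) (b (Xs o s w) i 0)
    + \sum_(j < d) Is o i j t w + Js o i t w.

Let Y o := regular (Xs o) B0.
Definition gap_path (t : R) (w : T) : 'cV[R]_d := Y true t w - Y false t w.
Let D := gap_path.
Let z0 := xs true - xs false.
Let e := @signed_basis R d.
Let bb (a : bool * 'I_d) t w := b (Y a.1 t w) a.2 0.
Let ss (a : bool * 'I_d) j t w := sigma (Y a.1 t w) a.2 j.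
Let gg (a : bool * 'I_d) t w u := c (Y a.1 t w) u a.2 0.
Let II (a : bool * 'I_d) := Is a.1 a.2.
Let JJ (a : bool * 'I_d) := Js a.1 a.2.

Let ccoord (g : 'cV[R]_d -> 'cV[R]_d) i : continuous g -> continuous (fun x => g x i 0).
Proof. by move=> cg x; exact: (cvg_comp _ _ (@cg x) (@coord_continuous _ _ _ i 0 (g x))). Qed.

Let csig i j : continuous (fun x => sigma x i j).
Proof. by move=> x; exact: (cvg_comp _ _ (@csigma x) (@coord_continuous _ _ _ i j (sigma x))). Qed.

Let mD i : measurable_fun setT (fun p : R * T => D p.1 p.2 i 0).
Proof.
rewrite (_ : (fun p => _) = fun p : R * T => Y true p.1 p.2 i 0 - Y false p.1 p.2 i 0); last first.
  by apply/funext => p; rewrite /D /gap_path !mxE.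
by apply: measurable_funB; apply: (regular_joint noise (@FX _) FB0 (@cad _) (g := fun x => x i 0));
  exact: coord_continuous.
Qed.

Let mbb a : measurable_fun setT (fun p : R * T => bb a p.1 p.2).
Proof. exact: (regular_joint noise (@FX a.1) FB0 (@cad a.1) (g := fun x => b x a.2 0) (@ccoord b a.2 cb)). Qed.

Let rbb a w : rcll (bb a ^~ w).
Proof. exact (regular_rcll (@cad a.1) (g := fun x => b x a.2 0) w (@ccoord b a.2 cb)). Qed.

Let Fbb a t : 0 <= t -> Fm F t (bb a t).
Proof. by move=> t0; exact: (regular_comp_Fm noise (@FX a.1) FB0 (g := fun x => b x a.2 0) (@ccoord b a.2 cb) t0). Qed.

Let mss a j : measurable_fun setT (fun p : R * T => ss a j p.1 p.2).
Proof. exact: (regular_joint noise (@FX a.1) FB0 (@cad a.1) (g := fun x => sigma x a.2 j) (@csig a.2 j)). Qed.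

Let rss a j w : rcll (ss a j ^~ w).
Proof. exact: (regular_rcll (@cad a.1) (g := fun x => sigma x a.2 j) w (@csig a.2 j)). Qed.

Let mgg a : measurable_fun setT (fun p : (R * T) * U => gg a p.1.1 p.1.2 p.2).
Proof. exact: (regular_field noise (@FX a.1) FB0 (@cad a.1) a.2 mc cc). Qed.

Let driftE r w : lin_drift e bb r w = b (Y true r w) - b (Y false r w).
Proof. exact: (signed_comb (fun o => b (Y o r w))). Qed.

Let diffE r w j : lin_diff e ss j r w = col j (sigma (Y true r w) - sigma (Y false r w)).
Proof.
rewrite /lin_diff.
have := signed_comb (fun o => col j (sigma (Y o r w))).
under eq_bigr do rewrite mxE.
by move=> ->; apply/colP => i; rewrite !mxE.
Qed.

Let jumpE r w : lin_jump e gg r w = fun u => c (Y true r w) u - c (Y false r w) u.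
Proof. by apply/funext => u; exact: (signed_comb (fun o => c (Y o r w) u)). Qed.

Let HD t : 0 <= t -> {ae P, forall w, D t w = z0 + \sum_a
  (\int[lebesgue_measure]_(s in `]0, t]) (bb a s w) + \sum_j II a j t w + JJ a t w) *: e a}.
Proof.
move=> t0; have [[_ mB] _ _ _ _] := noise.
have mB0 : measurable B0 by exact: (F_meas noise (lexx 0)).
have nB : {ae P, forall w, ~ B0 w} by exists B0; split => // w /= /contrapT.
apply: filterS nB => w nB.
pose v o : 'cV[R]_d := \col_i (\int[lebesgue_measure]_(s in `]0, t]) (b (Y o s w) i 0) +
  \sum_j Is o i j t w + Js o i t w).
rewrite (eq_bigr (fun a => v a.1 a.2 0 *: e a)); last by move=> a _; rewrite mxE.
rewrite (signed_comb v).
have X_E o : Y o t w = xs o + v o.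
  rewrite /Y (regular_good _ t0 nB); apply/colP => i; rewrite (sde o nB t0) !mxE -!addrA; congr (_ + (_ + _)).
  have mf : measurable_fun setT (fun s => b (Y o s w) i 0).
    by apply: rcll_measurable; exact: (@rbb (o, i) w).
  rewrite /Rintegral; congr fine.
  rewrite integral_itv_obnd_cbnd; last by apply: measurable_funTS; exact/measurable_EFinP.
  apply: eq_integral => s; rewrite inE/= in_itv/= => /andP[s0 _].
  by rewrite /Y (regular_good _ s0 nB).
by rewrite /D /gap_path !X_E /z0 opprD addrACA.
Qed.

Let mcx x : mvec (c x).
Proof.
move=> i; have mx : measurable_fun setT ((fun u => (x, u)) : U -> (Borel 'cV[R]_d * U)%type).
  by apply/measurable_fun_pairP; split => /=; [exact: measurable_cst|exact: measurable_id].
exact: (measurableT_comp (@coord_Borel R d 1 i 0) (measurableT_comp mc mx)).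
Qed.

Let sqc x : sq_integrable nu (c x).
Proof.
split; first exact: mcx.
apply/integrableP; split.
  apply/measurable_EFinP; apply: (measurableT_comp (f := fun x : R => x ^+ 2)) => //.
  exact: measurable_frob.
by under eq_integral do rewrite /= ger0_norm ?sqr_ge0//; exact: c2_fin.
Qed.

Let sqG r w : sq_integrable nu (lin_jump e gg r w).
Proof. by rewrite jumpE; apply: sq_integrableB. Qed.

Let cc2 : continuous (fun x => \int[nu]_u (frob (c x u) ^+ 2)).
Proof.
move=> x; rewrite /continuous_at /Rintegral.
have fin : (\int[nu]_u (frob (c x u) ^+ 2)%:E)%E \is a fin_num.
  by have [_ i] := sqc x; exact: integrable_fin_num.
have cx : (\int[nu]_u (frob (c y u) ^+ 2)%:E)%E @[y --> x] --> (fine (\int[nu]_u (frob (c x u) ^+ 2)%:E)%E)%:E.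
  by rewrite fineK//; exact: c2_cont.
exact: fine_cvg cx.
Qed.

Let coq_bounded T0 w : exists2 M, 0 <= M & forall r, 0 < r <= T0 -> lin_coq nu e bb ss gg r w <= M.
Proof.
have /choice[Mb HMb] : forall a, exists M, 0 <= M /\ forall r, 0 <= r <= T0 -> `|bb a r w| <= M.
  by move=> a; have [M M0 H] := rcll_bounded T0 (rbb a w); exists M.
have /choice[Ms HMs] : forall p : (bool * 'I_d) * 'I_d, exists M, 0 <= M /\ forall r, 0 <= r <= T0 -> `|ss p.1 p.2 r w| <= M.
  by move=> p; have [M M0 H] := rcll_bounded T0 (rss p.1 p.2 w); exists M.
have /choice[Mc HMc] : forall o : bool, exists M, 0 <= M /\ forall r, 0 <= r <= T0 ->
    `|\int[nu]_u (frob (c (Y o r w) u) ^+ 2)| <= M.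
  by move=> o; have [M M0 H] := rcll_bounded T0 (regular_rcll (@cad o) w cc2); exists M.
have sf0 := sum_frob_ge0 e.
pose K2 := #|{: bool * 'I_d}|%:R * sum_frob e ^+ 2.
have K20 : 0 <= K2 by rewrite mulr_ge0// sqr_ge0.
exists (sum_frob e * (\sum_a Mb a) + \sum_j (K2 * \sum_a Ms (a, j) ^+ 2) + 2 * (Mc true + Mc false)).
  have [m1 _] := HMc true; have [m2 _] := HMc false.
  rewrite !addr_ge0 ?mulr_ge0 ?addr_ge0//; first by apply: sumr_ge0 => a _; have [] := HMb a.
  by apply: sumr_ge0 => j _; rewrite mulr_ge0// sumr_ge0// => a _; exact: sqr_ge0.
move=> r /andP[r0 rT]; have r0T : 0 <= r <= T0 by rewrite ltW.
apply: lerD; first apply: lerD.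
- apply: le_trans (frob_comb e _) _; rewrite ler_wpM2l//; apply: ler_sum => a _.
  by have [_] := HMb a; apply.
- apply: ler_sum => j _; apply: le_trans (sqr_frob_comb e _) _; rewrite ler_wpM2l//.
  apply: ler_sum => a _; have [m0 Hm] := HMs (a, j).
  by rewrite -real_normK ?num_real// lerXn2r ?nnegrE//; exact: Hm.
rewrite jumpE; have [_ i1] := sqc (Y true r w); have [_ i2] := sqc (Y false r w).
have j1 : nu.-integrable setT (EFin \o (fun u => 2 * frob (c (Y true r w) u) ^+ 2)).
  by have := integrableZl measurableT 2 i1; apply: eq_integrable.
have j2 : nu.-integrable setT (EFin \o (fun u => 2 * frob (c (Y false r w) u) ^+ 2)).
  by have := integrableZl measurableT 2 i2; apply: eq_integrable.
have j3 : nu.-integrable setT (EFin \o (fun u => 2 * frob (c (Y true r w) u) ^+ 2 + 2 * frob (c (Y false r w) u) ^+ 2)).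
  by have := integrableD measurableT j1 j2; apply: eq_integrable.
apply: (@le_trans _ _ (\int[nu]_u (2 * frob (c (Y true r w) u) ^+ 2 + 2 * frob (c (Y false r w) u) ^+ 2))).
  have [_ i3] := sq_integrableB (sqc (Y true r w)) (sqc (Y false r w)).
  by apply: le_Rintegral => // u _; exact: sqr_frobB.
rewrite RintegralD// !RintegralZl// mulrDr; apply: lerD; rewrite ler_wpM2l//.
  by apply: le_trans (ler_norm _) _; have [_] := HMc true; apply.
by apply: le_trans (ler_norm _) _; have [_] := HMc false; apply.
Qed.

Hypothesis inj : {ae nu, forall u, injective (fun x => x + c x u)}.
Variables (psi V : R -> R).
Hypotheses (psi_nd : nondecreasing0 psi) (psi_cc : concave0 psi) (psi_ge0 : forall r : R, 0 <= r -> 0 <= psi r).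
Hypothesis psi0 : psi 0 = 0.
Hypothesis V_C2 : C2_open_halfline V.
Hypothesis V_gt0 : forall r : R, 0 < r -> 0 < V r.
Hypothesis V_infty : V r @[r --> 0^'+] --> +oo.
Hypothesis lyapunov : forall x z : 'cV[R]_d, 0 < frob (x - z) ->
  let r := frob (x - z) in
  ((psi (V r))%:E >=
    (1 / 2 * (derive1 (derive1 V) r - derive1 V r / r) *
       (frob ((sigma x - sigma z)^T *m (x - z)) ^+ 2 / r ^+ 2)
     + derive1 V r / (2 * r) *
       (2 * dotv (x - z) (b x - b z) + frob (sigma x - sigma z) ^+ 2))%:E
    + \int[nu]_u (V (frob (x - z + c x u - c z u)) - V r
        - derive1 V r / r * dotv (x - z) (c x u - c z u))%:E)%E.
Hypothesis z0n : z0 != 0.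
Variables (T0 R0 : R).
Hypotheses (T00 : 0 < T0) (R00 : 0 < R0).

(** The rate with the ramp switched off, common to all levels of truncation. *)
Definition exit_rate w := rate_integral nu e D bb ss gg T0 (psi 1) 0 (fun=> 0) w.

Let psi1 : 0 <= psi 1. Proof. exact: psi_ge0. Qed.

Lemma measurable_exit_rate : measurable_fun setT exit_rate.
Proof.
apply: (measurable_rate_integral nu e T0 mD mbb mss mgg psi1 (lexx 0)).
  exact: cst_continuous.
by move=> s; rewrite lexx ler01.
Qed.

(** A continuous ramp, 0 up to R0 and 1 from 2 R0 on. The crude bound on the generator is thus fully
    in force before the cut-off of the profile begins at 3 R0. *)
Let eta (s : R) : R := pos (1 - pos (1 - (s - R0) / R0)).

Let eta01 s : 0 <= eta s <= 1.
Proof.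
rewrite pos_ge0/= /eta; have := pos_ge0 (1 - (s - R0) / R0); move: (pos _) => p p0.
by rewrite /pos ge_max ler01/= gerBl.
Qed.

Let eta_cont : continuous eta.
Proof.
have c1 : continuous (fun s => 1 - (s - R0) / R0).
  move=> x; apply: cvgB; first exact: cvg_cst.
  by apply: cvgM; [apply: cvgB; [exact: cvg_id|exact: cvg_cst]|exact: cvg_cst].
have c2 : continuous (fun s => 1 - pos (1 - (s - R0) / R0)).
  by move=> x; apply: cvgB; [exact: cvg_cst|exact: (cvg_comp _ _ (@c1 x) (@pos_continuous R _))].
by move=> x; exact: (cvg_comp _ _ (@c2 x) (@pos_continuous R _)).
Qed.

Let eta_in s : s <= R0 -> eta s = 0.
Proof.
move=> sR; have u0 : (s - R0) / R0 <= 0 by rewrite ler_pdivrMr// mul0r subr_le0.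
by apply: le0_pos; rewrite subr_le0; apply: le_trans (pos_le _); move: u0; lra.
Qed.

Let eta_out s : 2 * R0 <= s -> eta s = 1.
Proof.
move=> sR; have u0 : 1 <= (s - R0) / R0 by rewrite ler_pdivlMr// mul1r; lra.
have p0 : pos (1 - (s - R0) / R0) = 0 by apply: le0_pos; rewrite subr_le0.
by rewrite /eta p0 subr0 ge0_pos.
Qed.

(** With M = m + 1 the profile equals 1 + (m + 1) / 3 near 0, while its initial value is at most 1 +
    V(|z0|) for every m. The radius depends on m, and so does the rate, but the latter only off the
    ball. *)
Lemma level_bound (m : nat) : exists (e2 : R) (Q : T -> R), [/\ 0 < e2, measurable_fun setT Q,
  forall w, (forall r, 0 < r <= T0 -> dotv (D r w) (D r w) <= R0) -> Q w = exit_rate w &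
  forall coarse : seq R, uniq coarse -> (forall s, s \in coarse -> 0 <= s <= T0) ->
   int_le P (fun w => (1 + m.+1%:R / 3) * (1 - \prod_(s <- coarse) (1 - (dotv (D s w) (D s w) <= e2)%R%:R))
     * expR (- Q w)) (1 + V (frob z0))].
Proof.
have M0 : 0 < m.+1%:R :> R by rewrite ltr0n.
have CV := C2_open_halflineP V_C2.
(* [e3] is a squared radius within which [V] is at least m + 1; it exists as [V] tends to infinity
   at 0, and the minimum with 3 R0 keeps it where the cut-off is 1. *)
have [e3 [e30 e3R V_big]] : exists e3 : R, [/\ 0 < e3, e3 <= 3 * R0 &
    forall r : R, 0 < r -> r ^+ 2 <= e3 -> m.+1%:R <= V r].
  have /cvgryPge/(_ m.+1%:R)[dl /= dl0 Hdl] := V_infty.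
  exists (Num.min (3 * R0) ((dl / 2) ^+ 2)); split.
  - by rewrite lt_min mulr_gt0// exprn_gt0// divr_gt0.
  - by rewrite ge_min lexx.
  move=> r r0; rewrite le_min => /andP[_ H]; apply: Hdl => //=.
  rewrite sub0r normrN gtr0_norm//.
  have : r <= dl / 2 by move: (ler_wsqrtr H); rewrite !sqrtr_sqr !gtr0_norm ?divr_gt0.
  by move: dl0; lra.
have e20 : 0 < e3 / 2 by rewrite divr_gt0.
have e23 : e3 / 2 < e3 by lra.
have [C0 test] := profile_test d CV M0 R00 e20 e23 e3R V_gt0 V_big.
have C01 := test_C01 test; have C00 : 0 <= C0 by exact: le_trans C01.
pose h := profile V m.+1%:R R0 (e3 / 2).
pose h1 := profile1 V V^`() m.+1%:R R0 (e3 / 2).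
pose h2 := profile2 V V^`() V^`()^`() m.+1%:R R0 (e3 / 2).
have h_ge1 s : 1 <= h s by exact: (profile_ge1 V^`() V^`()^`() M0 R00 e20 e23 e3R V_gt0 V_big).
pose Q := rate_integral nu e D bb ss gg T0 (psi 1) C0 eta.
exists (e3 / 2), Q; split=> //.
- exact: (measurable_rate_integral nu e T0 mD mbb mss mgg psi1 C00 eta_cont eta01).
- move=> w H; rewrite /Q /exit_rate /rate_integral; apply: eq_Rintegral => r; rewrite inE/= in_itv/= => r0.
  by rewrite /rate (eta_in (H r r0)) !mulr0.
move=> coarse uc inT.
have super r w : 0 < r <= T0 ->
    gen nu h h1 h2 (D r w) (lin_drift e bb r w) (lin_diff e ss ^~ r ^~ w) (lin_jump e gg r w)
    <= rate (psi 1) C0 eta (D r w) (lin_coq nu e bb ss gg r w) * tf h (D r w).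
  move=> _; set y := D r w; set q := lin_coq nu e bb ss gg r w.
  have q0 : 0 <= q by exact: coq_ge0.
  have [mG iG] := sqG r w.
  have rate0 : 0 <= rate (psi 1) C0 eta y q.
    by apply: le_trans (rate_ge psi1 C00 eta01 y q0).
  have tf1 : 1 <= tf h y by exact: h_ge1.
  have tf0 : 0 <= tf h y by exact: le_trans tf1.
  (* At a zero gap the two positions agree, so all differences of coefficients vanish and so does
     the generator. *)
  have [y00|yn] := eqVneq y 0.
    have YY : Y true r w = Y false r w by apply/eqP; rewrite -subr_eq0; apply/eqP.
    have -> : gen nu h h1 h2 y (lin_drift e bb r w) (lin_diff e ss ^~ r ^~ w) (lin_jump e gg r w) = 0.
      rewrite /gen driftE jumpE YY subrr big1 => [|j _]; last first.
        rewrite diffE YY subrr (_ : col j 0 = 0); last by apply/colP => i; rewrite !mxE.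
        by rewrite /tD !dotv0r !mulr0 addr0.
      under eq_Rintegral do rewrite subrr /tT addr0 subrr /tg dotv0r mulr0 subrr.
      by rewrite /tg dotv0r mulr0 mul0r !add0r /Rintegral integral0.
    exact: mulr_ge0.
  have s0 : 0 < dotv y y.
    by rewrite lt_neqAle dotv_ge0 andbT eq_sym; apply: contra_neq yn; exact: dotv_sqr_eq0.
  have r0 : 0 < frob y by rewrite lt_neqAle frob_ge0 andbT eq_sym; apply: contra_neq yn; exact: frob_eq0.
  (* Far out the rate contains [C0] times q, which dominates the generator because the test function
     is at least 1. *)
  have [sR|sR] := leP (2 * R0) (dotv y y).
    have [_ G1] := gen_le (test_hc test) (test_h1c test) C01 (test_tg_le test) (test_tD_le test)
      (test_tT_le test) y (lin_drift e bb r w) (lin_diff e ss ^~ r ^~ w) mG iG.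
    apply: le_trans (ler_norm _) _; apply: le_trans G1 _.
    apply: (@le_trans _ _ (rate (psi 1) C0 eta y q)); last by rewrite ler_peMr.
    rewrite -[coq _ _ _ _]/q /rate; have := eta_out sR; move: (eta _) => et ->.
    have -> : q * (1 + C0 * 1) = q + C0 * q by ring.
    by rewrite addrA lerDr addr_ge0.
  apply: (@le_trans _ _ (psi 1 * tf h y)); last first.
    rewrite ler_wpM2r// /rate lerDl mulr_ge0// addr_ge0// mulr_ge0//.
    by have /andP[] := eta01 (dotv y y).
  have nc : {ae nu, forall u, y + lin_jump e gg r w u != 0}.
    apply: filterS inj => u iu; rewrite jumpE; apply/eqP => H.
    have : Y true r w + c (Y true r w) u = Y false r w + c (Y false r w) u.
      apply/eqP; rewrite -subr_eq0 opprD addrACA; apply/eqP; exact: H.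
    by move=> /iu YY; move/eqP: yn; apply; rewrite /y /D /gap_path YY subrr.
  have LY := lyapunov r0.
  rewrite (_ : (lin_diff e ss ^~ r) ^~ w = fun j => col j (sigma (Y true r w) - sigma (Y false r w))); last first.
    by apply/funext => j; exact: diffE.
  apply: (generator_le CV M0 R00 e20 e23 e3R V_gt0 V_big r0 _ (conj mG iG) psi1 nc); first lra.
  apply: (@le_trans _ _ (psi (V (frob y)))%:E).
    apply: le_trans LY; rewrite driftE jumpE; apply: leeD; first exact: lexx.
    rewrite le_eqVlt; apply/orP; left; apply/eqP; apply: eq_integral => u _.
    by rewrite /y /D /gap_path addrA.
  rewrite lee_fin; apply: (concave0_linear psi_nd psi_cc psi0 psi1).
  by apply: ltW; exact: V_gt0.
pose E s w : R := (dotv (D s w) (D s w) <= e3 / 2)%R%:R.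
have E01 s w : 0 <= E s w <= 1 by rewrite /E ler0n lern1; case: (_ <= _).
have mE s : s \in coarse -> Fm F s (E s).
  move=> sc; have /andP[sc0 _] := inT s sc.
  have FY o i : Fm F s (fun w => Y o s w i 0).
    by apply: (regular_comp_Fm noise (@FX o) FB0 (g := fun x => x i 0)) => //; exact: coord_continuous.
  have FD i : Fm F s (fun w => D s w i 0).
    rewrite (_ : (fun w => _) = fun w => Y true s w i 0 - Y false s w i 0); last first.
      by apply/funext => w; rewrite /D /gap_path !mxE.
    by apply: measurable_funB; exact: FY.
  have Fd : Fm F s (fun w => dotv (D s w) (D s w)) by apply: measurable_dotv.
  have Fb : measurable_fun setT ((fun w => dotv (D s w) (D s w) <= e3 / 2) : sigT_of (F s) -> bool).
    by apply: measurable_fun_ler => //; exact: measurable_cst.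
  rewrite (_ : E s = fun w => if dotv (D s w) (D s w) <= e3 / 2 then 1 else 0); last first.
    by apply/funext => w; rewrite /E; case: (_ <= _).
  by apply: measurable_fun_ifT => //; exact: measurable_cst.
have Ev s w : s \in coarse -> E s w != 0 -> tf h (D s w) = 1 + m.+1%:R / 3.
  move=> _; rewrite /E; case: leP => [H _|_ /eqP//].
  exact: profile_small.
have v0 : 0 <= 1 + m.+1%:R / 3 :> R by rewrite addr_ge0// divr_ge0.
have := hitting_bound noise T00 mD mbb rbb mss mgg HD sqG (coq_bounded T0) test psi1 C00 eta_cont eta01
  super v0 inT uc E01 mE Ev Fbb.
move=> HB; apply: int_le_weak (HB _ _).
- have z00 : 0 < dotv z0 z0.
    by rewrite lt_neqAle dotv_ge0 andbT eq_sym; apply: contra_neq z0n; exact: dotv_sqr_eq0.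
  have /andP[_] := profile_le V^`() V^`()^`() M0 R00 e23 e3R V_gt0 V_big z00.
  move=> /le_trans; apply; rewrite lerD2l; apply: le_trans (trunc_le M0 _) _.
  by rewrite /rV -frob_dotv sqrtr_sqr ger0_norm ?frob_ge0.
- move=> a j; exact: (regular_ito noise (@FX a.1) FB0 nB0 (@cad a.1) (@csig a.2 j) T00 (itoI a.1 a.2 j)).
- move=> a; exact: (regular_jump noise (@FX a.1) FB0 nB0 (@cad a.1) mc cc T00 (jumpJ a.1 a.2)).
Qed.

Let mdot s : measurable_fun setT (fun w => dotv (D s w) (D s w)).
Proof.
have md : mvec (D s) by move=> i; exact: (measurableT_comp (mD i) (measurable_pair1 s)).
exact: measurable_dotv.
Qed.

Let dot_right w t : dotv (D s w) (D s w) @[s --> t^'+] --> dotv (D t w) (D t w).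
Proof.
have cD i : D s w i 0 @[s --> t^'+] --> D t w i 0.
  have cY o : Y o s w i 0 @[s --> t^'+] --> Y o t w i 0.
    by have [] := regular_rcll (@cad o) (g := fun x => x i 0) w (@coord_continuous _ _ _ i 0).
  rewrite /D /gap_path !mxE; under eq_fun do rewrite !mxE.
  exact: cvgB.
by rewrite /dotv; apply: cvg_big => [|i _]; [exact: add_continuous|exact: cvgM].
Qed.

(** The coarse times: finite sets, increasing in k, that exhaust the rationals of [0, T0] in the
    order of their codes. *)
Let rationals k : seq R := undup [seq s <- pmap (fun j : nat => omap (ratr : rat -> R) (unpickle j)) (iota 0 k) | 0 <= s <= T0].

Let rationals_le k k' s : (k <= k')%N -> s \in rationals k -> s \in rationals k'.
Proof.
move=> kk'; rewrite !mem_undup !mem_filter !mem_pmap => /andP[-> /mapP[j]] /=.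
rewrite !mem_iota !add0n/= => jk ->; apply: map_f.
by rewrite mem_iota/= add0n (leq_trans jk).
Qed.

Let rationals_mem (q : rat) : 0 <= (ratr q : R) <= T0 -> ratr q \in rationals (pickle q).+1.
Proof.
move=> q0; rewrite mem_undup mem_filter q0 andTb mem_pmap; apply/mapP; exists (pickle q).
  by rewrite mem_iota leq0n add0n ltnSn.
by rewrite pickleK.
Qed.

Let miss (e2 : R) k w : R := \prod_(s <- rationals k) (1 - (dotv (D s w) (D s w) <= e2)%R%:R).

Let missP e2 k w : miss e2 k w = 0 <-> exists2 s, s \in rationals k & dotv (D s w) (D s w) <= e2.
Proof.
rewrite /miss; split.
  move=> /eqP; rewrite prodf_seq_eq0 => /hasP[s sk /=]; case: leP => [? _|_]; first by exists s.
  by rewrite subr0 oner_eq0.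
move=> [s sk H]; apply/eqP; rewrite prodf_seq_eq0; apply/hasP; exists s => //=.
by rewrite H subrr.
Qed.

Let mmiss e2 k : measurable_fun setT (miss e2 k).
Proof.
apply: measurable_prod => s _; apply: measurable_funB => //.
rewrite (_ : (fun w => _) = fun w => if dotv (D s w) (D s w) <= e2 then 1 else 0 : R); last first.
  by apply/funext => w; case: (_ <= _).
by apply: measurable_fun_ifT => //; apply: measurable_fun_ler => //; exact: measurable_cst.
Qed.

(** Let the coarse times exhaust the rationals first: paths with rate integral at most n that come
    near 0 have probability at most C n / (1 + (m + 1) / 3). Then m tends to infinity, and a
    countable union over n ends the argument. The strict t < T0 leaves room for rational times after
    t. *)
Lemma collision_null : P.-negligible [set w | (exists2 t, 0 <= t < T0 & D t w = 0) /\
  forall r, 0 < r <= T0 -> dotv (D r w) (D r w) <= R0].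
Proof.
have /choice[p Hp] : forall m : nat, exists p : R * (T -> R), [/\ 0 < p.1, measurable_fun setT p.2,
  forall w, (forall r, 0 < r <= T0 -> dotv (D r w) (D r w) <= R0) -> p.2 w = exit_rate w &
  forall coarse : seq R, uniq coarse -> (forall s, s \in coarse -> 0 <= s <= T0) ->
   int_le P (fun w => (1 + m.+1%:R / 3) * (1 - \prod_(s <- coarse) (1 - (dotv (D s w) (D s w) <= p.1)%R%:R))
     * expR (- p.2 w)) (1 + V (frob z0))].
  by move=> m; have [e2 [Q H]] := level_bound m; exists (e2, Q).
(* On this event a coarse time sees the gap near 0, the rate integral of level m is the common one,
   and the discount is at least exp(- n); the integrand of [level_bound] is then at least the
   constant [vv] below. *)
pose S m (n k : nat) := [set w | miss (p m).1 k w = 0] `&` [set w | (p m).2 w = exit_rate w]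
  `&` [set w | exit_rate w <= n%:R].
have mS m n k : measurable (S m n k).
  have [_ mQ _ _] := Hp m; apply: measurableI; first apply: measurableI.
  - rewrite (_ : [set w | _] = miss (p m).1 k @^-1` [set 0])//.
    by rewrite -[X in measurable X]setTI; exact: mmiss.
  - rewrite (_ : [set w | _] = (fun w => (p m).2 w - exit_rate w) @^-1` [set 0]).
      rewrite -[X in measurable X]setTI.
      by apply: (measurable_funB mQ measurable_exit_rate measurableT).
    apply/seteqP; split=> w /= H; first by rewrite H subrr.
    by apply/eqP; rewrite -subr_eq0 H.
  - rewrite (_ : [set w | _] = exit_rate @^-1` `]-oo, n%:R]).
      by rewrite -[X in measurable X]setTI; exact: measurable_exit_rate.
    by apply/seteqP; split=> w /=; rewrite in_itv.
(* The exponential undoes the discount, and the other factor bounds the initial value of the test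
   function. *)
pose C (n : nat) : R := expR n%:R * (1 + V (frob z0)).
have C0 n : 0 <= C n.
  rewrite mulr_ge0 ?expR_ge0// addr_ge0// ltW// V_gt0// lt_neqAle frob_ge0 andbT eq_sym.
  by apply: contra_neq z0n; exact: frob_eq0.
have v0 (m : nat) : 0 < 1 + m.+1%:R / 3 :> R by rewrite ltr_pwDl// divr_ge0.
have PS m n k : (P (S m n k) <= (C n / (1 + m.+1%:R / 3))%:E)%E.
  have [_ mQ _ HB] := Hp m.
  have uk : uniq (rationals k) by exact: undup_uniq.
  have ik s : s \in rationals k -> 0 <= s <= T0 by rewrite mem_undup mem_filter => /andP[].
  have HI := HB _ uk ik.
  have pn : P (S m n k) \is a fin_num by exact: fin_num_measure.
  pose vv : R := (1 + m.+1%:R / 3) * expR (- n%:R).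
  have vv0 : 0 < vv by rewrite mulr_gt0// expR_gt0.
  have iS : P.-integrable setT (EFin \o (\1_(S m n k) : T -> R)).
    apply: (@bounded_integrable _ _ _ _ _ 1); first exact: measurable_indic.
    by move=> w; rewrite indicE ger0_norm ?ler0n// lern1; case: (_ \in _).
  have [_] : int_le P (fun w => vv * \1_(S m n k) w) (1 + V (frob z0)).
    apply: int_le_mono HI.
    - by apply: measurable_funM => //; exact: measurable_indic.
    - by move=> w; rewrite mulr_ge0 ?(ltW vv0)// indicE ler0n.
    apply: aeW => w; rewrite indicE.
    have [|_] := boolP (w \in S m n k); last first.
      rewrite mulr0 !mulr_ge0 ?(ltW (v0 m)) ?expR_ge0// subr_ge0.
      elim: (rationals k) => [|s l ih]; first by rewrite big_nil.
      rewrite big_cons; apply: le_trans ih; rewrite ler_piMl//.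
      by apply: prodr_ge0 => s' _; rewrite subr_ge0 lern1; case: (_ <= _).
    rewrite inE /S => -[[m0 QE] en]; rewrite /= in m0 QE en.
    rewrite mulr1 -/(miss (p m).1 k w) m0 subr0 mulr1 QE /vv.
    by rewrite ler_wpM2l ?(ltW (v0 m))// ler_expR lerN2.
  rewrite RintegralZl// /Rintegral integral_indic// setIT => H.
  rewrite -(fineK pn) lee_fin ler_pdivlMr// mulrC /C -ler_pdivrMl ?expR_gt0//.
  by apply: le_trans H; rewrite /vv -expRN mulrA [_ * expR _]mulrC.
pose Wn n := \bigcap_m \bigcup_k S m n k.
have mU m n : measurable (\bigcup_k S m n k) by apply: bigcupT_measurable.
have mW n : measurable (Wn n) by apply: bigcapT_measurable.
have PU m n : (P (\bigcup_k S m n k) <= (C n / (1 + m.+1%:R / 3))%:E)%E.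
  have nd : nondecreasing_seq (S m n).
    move=> k k' kk'; apply/subsetPset => w [[/missP[s sk Hs] QE] en].
    by split; [split; [apply/missP; exists s => //; exact: (rationals_le kk' sk)|exact: QE]|exact: en].
  have cv := nondecreasing_cvg_mu (mS m n) (mU m n) nd.
  have <- := cvg_lim (@ereal_hausdorff R) (cv R P).
  by apply: lime_le; [apply/cvg_ex; eexists; exact: (cv R P)|apply: nearW => k; exact: PS].
have PW n : P (Wn n) = 0%E.
  apply/eqP; rewrite eq_le measure_ge0 andbT; apply/lee_addgt0Pr => e0 e00; rewrite add0e.
  (* This makes (m + 1) / 3 exceed C n / e0. *)
  pose m := Num.truncn (3 * C n / e0).
  apply: (@le_trans _ _ (P (\bigcup_k S m n k))).
    by apply: le_measure; rewrite ?inE// => w; apply.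
  apply: le_trans (PU m n) _; rewrite lee_fin ler_pdivrMr//.
  have : 3 * C n / e0 < m.+1%:R by exact: truncnS_gt.
  rewrite ltr_pdivrMr// => /ltW H; rewrite mulrDr mulr1.
  apply: (@le_trans _ _ (e0 * (m.+1%:R / 3))); last by rewrite lerDr ltW.
  by rewrite mulrA ler_pdivlMr// [leLHS]mulrC [e0 * _]mulrC.
have NW : P.-negligible (\bigcup_n Wn n).
  by apply: negligible_bigcup => n; apply/negligibleP => //; exact: PW.
apply: negligibleS NW.
move=> w [[t /andP[t0 tT] Dt] bnd]; exists (Num.truncn (exit_rate w)).+1 => // m _.
have [e20 _ QE _] := Hp m.
have dt0 : dotv (D t w) (D t w) = 0 by rewrite Dt dotv0l.
(* Right-continuity at the collision time keeps the squared gap below the radius of level m for a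
   short while, and a rational time before [T0] falls into that while. *)
have /cvgrPdist_le/(_ _ e20) := @dot_right w t; rewrite dt0 => -[dl /= dl0 Hdl].
have tm : t < Num.min (t + dl) T0 by rewrite lt_min tT ltrDl dl0.
have [q] := rat_in_itvoo tm; rewrite in_itv/= lt_min => /andP[tq /andP[qd qT]].
exists (pickle q).+1 => //; split; first split.
- apply/missP; exists (ratr q).
    by apply: rationals_mem; rewrite (le_trans t0 (ltW tq)) ltW.
  have := Hdl (ratr q); rewrite /= => H.
  have : `|0 - dotv (D (ratr q) w) (D (ratr q) w)| <= (p m).1.
    by apply: H => //; rewrite distrC ger0_norm ?subr_ge0 ?(ltW tq)// ltrBlDl.
  by rewrite sub0r normrN ger0_norm// dotv_ge0.
- exact: QE.
- by apply: ltW; exact: truncnS_gt.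
Qed.

End TwoSolutions.

Theorem theorem3p1
  (R : realType) (d : nat) (hd : (2 <= d)%N)
  (dU : measure_display) (U : measurableType dU)
  (nu : {sigma_finite_measure set U -> \bar R})
  (b : 'cV[R]_d -> 'cV[R]_d)
  (sigma : 'cV[R]_d -> 'M[R]_d)
  (c : 'cV[R]_d -> U -> 'cV[R]_d)
  (b_meas : measurable_fun setT (b : Borel 'cV[R]_d -> Borel 'cV[R]_d))
  (sigma_meas : measurable_fun setT (sigma : Borel 'cV[R]_d -> Borel 'M[R]_d))
  (c_meas : measurable_fun setT
     ((fun p => c p.1 p.2) : (Borel 'cV[R]_d * U)%type -> Borel 'cV[R]_d))
  (b_cont : continuous b)
  (sigma_cont : continuous sigma)
  (c_cont : forall u, continuous (fun x => c x u))
  (c2_fin : forall x, (\int[nu]_u (frob (c x u) ^+ 2)%:E < +oo)%E)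
  (c2_cont : continuous (fun x => (\int[nu]_u (frob (c x u) ^+ 2)%:E)%E))
  (dT : measure_display) (T : measurableType dT) (P : probability T R)
  (F : R -> set (set T))
  (W : R -> T -> Borel 'cV[R]_d)
  (N : T -> {measure set (R * U) -> \bar R})
  (noise : driving_noise P F nu W N)
  (* (1) *)
  (H1 : exists (kappa : R) (zeta : R -> R),
    [/\ 0 < kappa, nondecreasing0 zeta, C1_halfline zeta
      & (forall r : R, 0 <= r -> 1 <= zeta r)] /\
    (\int[lebesgue_measure]_(r in `[0%R, +oo[)
        ((r * zeta r + 1)^-1)%:E = +oo)%E /\
    forall x : 'cV[R]_d,
      ((2 * dotv x (b x) + frob (sigma x) ^+ 2)%:E
        + \int[nu]_u (frob (c x u) ^+ 2)%:E
       <= (kappa * (frob x ^+ 2 * zeta (frob x ^+ 2) + 1))%:E)%E)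
  (* (2a) or (2b) *)
  (H2 :
    (exists (delta0 : R) (rho : R -> R),
      [/\ 0 < delta0, nondecreasing0 rho, concave0 rho
        & (forall r : R, 0 <= r -> 0 <= rho r)] /\
      (forall r : R, 0 < r -> 0 < rho r) /\
      inv_integral0_infty rho /\
      (forall M : R, 0 < M -> exists2 kappaM : R, 0 < kappaM &
        forall x z : 'cV[R]_d,
          Num.max (frob x) (frob z) <= M -> frob (x - z) <= delta0 ->
          2 * dotv (z - x) (b z - b x) + frob (sigma z - sigma x) ^+ 2
            <= kappaM * frob (z - x) * rho (frob (z - x)) /\
          (\int[nu]_u (frob (c z u - c x u))%:E
            <= (kappaM * rho (frob (z - x)))%:E)%E) /\
      (\int[nu]_u (frob (c 0 u))%:E < +oo)%E)
    \/
    (exists (delta0 : R) (varrho : R -> R),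
      [/\ 0 < delta0, nondecreasing0 varrho, concave0 varrho
        & (forall r : R, 0 <= r -> 0 <= varrho r)] /\
      (forall r : R, 0 < r ->
        0 < varrho r /\ varrho r <= (1 + r) ^+ 2 * varrho (r / (1 + r))) /\
      inv_integral0_infty varrho /\
      (forall M : R, 0 < M -> exists2 kappaM : R, 0 < kappaM &
        forall x z : 'cV[R]_d,
          Num.max (frob x) (frob z) <= M -> frob (x - z) <= delta0 ->
          ((2 * dotv (x - z) (b x - b z) + frob (sigma x - sigma z) ^+ 2)%:E
            + \int[nu]_u (frob (c x u - c z u) ^+ 2)%:E
           <= (kappaM * varrho (frob (x - z) ^+ 2))%:E)%E)))
  (* (3) *)
  (H3 : {ae nu, forall u, injective (fun x => x + c x u)})
  (* (4) *)
  (H4 : exists psi V : R -> R,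
    [/\ nondecreasing0 psi, concave0 psi, (forall r : R, 0 <= r -> 0 <= psi r)
      & (forall r : R, 0 <= r -> (psi r = 0 <-> r = 0))] /\
    [/\ C2_open_halfline V, (forall r : R, 0 < r -> 0 < V r),
        (exists2 e : R, 0 < e &
          forall r s : R, 0 < r -> r <= s -> s < e -> V s <= V r)
      & V r @[r --> 0^'+] --> +oo] /\
    forall x z : 'cV[R]_d, 0 < frob (x - z) ->
      let r := frob (x - z) in
      ((psi (V r))%:E >=
        (1 / 2 * (derive1 (derive1 V) r - derive1 V r / r) *
           (frob ((sigma x - sigma z)^T *m (x - z)) ^+ 2 / r ^+ 2)
         + derive1 V r / (2 * r) *
           (2 * dotv (x - z) (b x - b z) + frob (sigma x - sigma z) ^+ 2))%:E
        + \int[nu]_u (V (frob (x - z + c x u - c z u)) - V r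
            - derive1 V r / r * dotv (x - z) (c x u - c z u))%:E)%E)
  (x' x : 'cV[R]_d) (hx : x' <> x)
  (X' X : R -> T -> Borel 'cV[R]_d)
  (hX' : strong_solution P F nu W N b sigma c x' X')
  (hX : strong_solution P F nu W N b sigma c x X) :
  let E := [set w | forall t : R, 0 <= t -> X' t w <> X t w] in
  measurable E /\ P E = 1%E.
Proof.
have [psi [V [[psi_nd psi_cc psi_ge0 psi_0] [[V_C2 V_gt0 _ V_infty] lyapunov]]]] := H4.
have psi0 : psi 0 = 0 by apply/psi_0.
have [filt [complete negF _] _ _ _] := noise.
have [adX' cad' [I' [J' [ito' jump' sde']]]] := hX'.
have [adX cad [I [J [ito jump sde]]]] := hX.
(* The almost sure path properties of both solutions are gathered in one null set, which belongs to
   [F 0] by the usual hypotheses. *)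
have [B0 [mB0 nB0 good]] := filterI (filterI cad' cad) (filterI sde' sde).
have nX w : ~ B0 w -> ((@cadlag R 'cV[R]_d (X'^~ w) /\ @cadlag R 'cV[R]_d (X^~ w)) /\
    ((forall t : R, 0 <= t -> forall i, X' t w i 0 = x' i 0
        + \int[lebesgue_measure]_(s in `[0%R, t]) (b (X' s w) i 0)
        + \sum_(j < d) I' i j t w + J' i t w) /\
     (forall t : R, 0 <= t -> forall i, X t w i 0 = x i 0
        + \int[lebesgue_measure]_(s in `[0%R, t]) (b (X s w) i 0)
        + \sum_(j < d) I i j t w + J i t w))).
  by move=> nB; apply: contrapT => nw; apply: nB; apply: good.
have NB0 : P.-negligible B0 by exists B0; split.
have FB0 : F 0 B0 by exact: negF.
pose Xs o := if o then X' else X.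
pose xs o := if o then x' else x.
pose Is o := if o then I' else I.
pose Js o := if o then J' else J.
have FX o t : 0 <= t -> Fm F t (Xs o t).
  by case: o => t0; [exact: (adapted_Fm noise adX')|exact: (adapted_Fm noise adX)].
have cads o w : ~ B0 w -> @cadlag R 'cV[R]_d ((Xs o)^~ w).
  by case: o => nB; have [[ca' ca] _] := nX w nB; [exact: ca'|exact: ca].
have itos o i j : is_ito_integral P F (fun t w => W t w j 0)
    (fun s w => sigma (Xs o s w) i j) (Is o i j).
  by case: o; [exact: ito'|exact: ito].
have jumps o i : is_compensated_integral P F nu N
    (fun s w u => c (@left_lim R 'cV[R]_d ((Xs o)^~ w) s) u i 0) (Js o i).
  by case: o; [exact: jump'|exact: jump].
have sdes o w : ~ B0 w -> forall t : R, 0 <= t -> forall i,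
    Xs o t w i 0 = xs o i 0 + \int[lebesgue_measure]_(s in `[0%R, t]) (b (Xs o s w) i 0)
      + \sum_(j < d) Is o i j t w + Js o i t w.
  by case: o => nB; have [_ [sd' sd]] := nX w nB; [exact: sd'|exact: sd].
have z0n : xs true - xs false != 0 by rewrite subr_eq0; apply/eqP.
(* The horizon n + 1 and the squared radius m + 1 run over the positive integers. *)
have null (n m : nat) := collision_null noise c_meas b_cont sigma_cont c_cont c2_fin c2_cont FX FB0
  nB0 cads itos jumps sdes H3 psi_nd psi_cc psi_ge0 psi0 V_C2 V_gt0 V_infty lyapunov z0n
  (ltr0Sn R n) (ltr0Sn R m).
move=> E.
have nE : P.-negligible (~` E).
  have NU := negligible_bigcup (fun n => negligible_bigcup (null n)).
  apply: negligibleS (negligibleU NB0 NU) => w nEw.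
  have [Bw|nB] := pselect (B0 w); first by left.
  right; have [t t0 XX] : exists2 t : R, 0 <= t & X' t w = X t w.
    apply: contrapT => H; apply: nEw => t t0 XX; apply: H; exists t => //.
  have Dt : gap_path Xs B0 t w = 0.
    by rewrite /gap_path !regular_good//= XX subrr.
  exists (Num.truncn t) => //.
  set n := Num.truncn t.
  (* Paths are bounded on [0, n + 1], so some integer squared radius contains the gap up to the
     horizon. *)
  have bd i o := rcll_bounded n.+1%:R
    (regular_rcll (cads o) w (@coord_continuous R d 1 i 0)).
  have /choice[M HM] : forall a : 'I_d * bool, exists M : R, forall r, 0 <= r <= n.+1%:R ->
      `|regular (Xs a.2) B0 r w a.1 0| <= M.
    by move=> [i o]; have [M _ HM] := bd i o; exists M.
  pose K := \sum_i (M (i, true) + M (i, false)) ^+ 2.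
  exists (Num.truncn K) => //; split.
    by exists t => //; rewrite t0/=; exact: truncnS_gt.
  move=> r /andP[/ltW r0 rn]; apply: (@le_trans _ _ K); last by apply: ltW; exact: truncnS_gt.
  apply: ler_sum => i _; rewrite -expr2 -[leLHS]real_normK ?num_real// !mxE.
  apply: lerXn2r; rewrite ?nnegrE ?normr_ge0//.
    by rewrite addr_ge0// (le_trans (normr_ge0 _) (HM (i, _) r _))// r0.
  apply: le_trans (ler_normB _ _) _; apply: lerD; first by apply: (HM (i, true)); rewrite r0.
  by apply: (HM (i, false)); rewrite r0.
(* [E] involves uncountably many times; its measurability comes from completeness, its complement
   being negligible. *)
have mE : measurable E by rewrite -(setCK E); apply: measurableC; exact: complete.
split=> //.
have PE : P (~` E) = 0%E by apply/negligibleP => //; exact: measurableC.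
by rewrite -[E in LHS]setCK (probability_setC _ (measurableC mE)) PE sube0.
Qed.
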